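(* Let $U\subseteq\mathbb{R}^m$ be a finite set of input values, let $p:\widetilde{\mathcal{U}}_{pc}\to\mathbb{R}^r$ be a response map on an admissible set of inputs $\widetilde{\mathcal{U}}_{pc}$, having an extension to negative times, and let $\Sigma=(X,f,h,x_0)$ be a semi-algebraically reachable local Nash realization of $p$. Let $\epsilon>0$ be arbitrary. Then the following procedure is correct: by following its steps one transforms $\Sigma$ to a system $\Sigma_V$ (given in Step 6) which is a semi-algebraically reachable and semi-algebraically observable local Nash realization of $p_u$, where $u\in\widetilde{\mathcal{U}}_{pc}\cap\widetilde{\mathcal{U}}_{pc}(\Sigma)$ can be chosen such that $T_u<\epsilon$. Step 1. Choose a transcendence basis $\varphi_1,\dots,\varphi_d$ of $A_{obs}(\Sigma)$ and denote $\Phi=(\varphi_1,\dots,\varphi_d)$. Step 2. Find non-zero polynomials $Q_{\alpha,i},P_j\in\mathbb{R}[T,T_1,\dots,T_d]$ with the smallest possible degree such that $Q_{\alpha,i}(f_\alpha\varphi_i(x),\Phi(x))=0$ and $P_j(h_j(x),\Phi(x))=0$ for all $x\in X$, $i=1,\dots,d$, $\alpha\in U$, $j=1,\dots,r$. Step 3. Find $u\in\widetilde{\mathcal{U}}_{pc}(\Sigma)\cap\widetilde{\mathcal{U}}_{pc}$ such that $T_u<\epsilon$ and such that $\frac{d}{dT}Q_{\alpha,i}(f_\alpha\varphi_i,\Phi)$ and $\frac{d}{dT}P_j(h_j,\Phi)$ do not vanish on an open neighborhood of $\overline{x}:=x_\Sigma(T_u;x_0,u)$. Step 4. By the implicit function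 theorem, find (1) open connected semi-algebraic subsets $W_{\alpha,i}\subseteq\mathbb{R}$, $V_{\alpha,i}\subseteq\mathbb{R}^d$ and a Nash map $\psi_{\alpha,i}:V_{\alpha,i}\to W_{\alpha,i}$ such that $f_\alpha\varphi_i(\overline{x})\in W_{\alpha,i}$, $\Phi(\overline{x})\in V_{\alpha,i}$ and $\psi_{\alpha,i}(\Phi(\overline{x}))=f_\alpha\varphi_i(\overline{x})$, and for all $(f_\alpha\varphi_i(x),\Phi(x))\in W_{\alpha,i}\times V_{\alpha,i}$: $Q_{\alpha,i}(f_\alpha\varphi_i(x),\Phi(x))=0\iff f_\alpha\varphi_i(x)=\psi_{\alpha,i}(\Phi(x))$; (2) open connected semi-algebraic subsets $W_j\subseteq\mathbb{R}$, $V_j\subseteq\mathbb{R}^d$ and a Nash map $\psi_j:V_j\to W_j$ such that $h_j(\overline{x})\in W_j$, $\Phi(\overline{x})\in V_j$ and $\psi_j(\Phi(\overline{x}))=h_j(\overline{x})$, and for all $(h_j(x),\Phi(x))\in W_j\times V_j$: $P_j(h_j(x),\Phi(x))=0\iff h_j(x)=\psi_j(\Phi(x))$. Step 5. Define $V:=\bigcap_{i=1,\dots,d;\ \alpha\in U;\ j=1,\dots,r}V_{\alpha,i}\cap V_j$. Step 6. Take $\Sigma_V=(V,f^V,h^V,x_0^V)$, where $x_0^V=\Phi(\overline{x})$, $f^V=\{f^V_\alpha\mid\alpha\in U\}$ is such that $f^V_\alpha(x)=(\psi_{\alpha,1}(x),\dots,\psi_{\alpha,d}(x))$ for all $\alpha\in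 U$, $x\in V$, and $h^V(\Phi(x))=h(x)$.
   Context: **Inputs.** $\mathcal{U}_{pc}$ is the set of piecewise-constant inputs $u=(\alpha_1,t_1)\cdots(\alpha_k,t_k)$ with values $\alpha_i\in U$ and durations $t_i\in[0,\infty)$, defined on $[0,T_u]$, $T_u=\sum_i t_i$; $uv$ is concatenation. A nonempty subset $\widetilde{\mathcal{U}}_{pc}\subseteq\mathcal{U}_{pc}$ is an admissible set of inputs if: (i) for all $u\in\widetilde{\mathcal{U}}_{pc}$, $t\in[0,T_u]$, the restriction $u_{[0,t]}\in\widetilde{\mathcal{U}}_{pc}$; (ii) for all $u\in\widetilde{\mathcal{U}}_{pc}$, $\alpha\in U$ there is $t>0$ with $u(\alpha,t)\in\widetilde{\mathcal{U}}_{pc}$; (iii) for all $u=(\alpha_1,t_1)\cdots(\alpha_k,t_k)\in\widetilde{\mathcal{U}}_{pc}$ there is $\delta>0$ such that $(\alpha_1,\bar t_1)\cdots(\alpha_k,\bar t_k)\in\widetilde{\mathcal{U}}_{pc}$ for all $\bar t_i\in[0,t_i+\delta]$. **Response maps.** A map $p:\widetilde{\mathcal{U}}_{pc}\to\mathbb{R}^r$ is a response map if for all $k>0$, $\alpha_1,\dots,\alpha_k\in U$, the map $(t_1,\dots,t_k)\mapsto p((\alpha_1,t_1)\cdots(\alpha_k,t_k))$ is (componentwise) analytic on the set of those $(t_1,\dots,t_k)\in[0,\infty)^k$ with $(\alpha_1,t_1)\cdots(\alpha_k,t_k)\in\widetilde{\mathcal{U}}_{pc}$. For $u\in\widetilde{\mathcal{U}}_{pc}$,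 let $\widetilde{\mathcal{U}}_{pc}^u=\{v\in\widetilde{\mathcal{U}}_{pc}\mid uv\in\widetilde{\mathcal{U}}_{pc}\}$ and $p_u:\widetilde{\mathcal{U}}_{pc}^u\to\mathbb{R}^r$, $p_u(v)=p(uv)$; this is again a response map. **Extension to negative times.** $\mathcal{U}_{pc}^-$ is the set of generalized inputs $(\alpha_1,t_1)\cdots(\alpha_k,t_k)$ with $\alpha_i\in U$, $t_i\in\mathbb{R}$. Let $I(0,a)=[0,a]$ if $a\ge0$ and $[a,0]$ if $a<0$. A nonempty $\overline{\mathcal{U}}_{pc}\subseteq\mathcal{U}_{pc}^-$ is an admissible set of generalized inputs if: (i) for $u=(\alpha_1,t_1)\cdots(\alpha_k,t_k)\in\overline{\mathcal{U}}_{pc}$, each $i$ and $t\in I(0,t_i)$, $(\alpha_1,t_1)\cdots(\alpha_{i-1},t_{i-1})(\alpha_i,t)\in\overline{\mathcal{U}}_{pc}$; (ii) for $u\in\overline{\mathcal{U}}_{pc}$, $\alpha\in U$ there is $\delta>0$ with $u(\alpha,t)\in\overline{\mathcal{U}}_{pc}$ for all $t\in(-\delta,\delta)$; (iii) for $u=(\alpha_1,t_1)\cdots(\alpha_k,t_k)\in\overline{\mathcal{U}}_{pc}$ there is $\delta>0$ with $(\alpha_1,\bar t_1)\cdots(\alpha_k,\bar t_k)\in\overline{\mathcal{U}}_{pc}$ for all $\bar t_i\in I(0,\mathrm{sgn}(t_i)(|t_i|+\delta))$. A map $\bar p:\overline{\mathcal{U}}_{pc}\to\mathbb{R}^r$ is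 a generalized response map if each component is analytic in $(t_1,\dots,t_k)$ for each fixed $\alpha_1,\dots,\alpha_k$ (on the set of tuples in $\mathbb{R}^k$ giving elements of $\overline{\mathcal{U}}_{pc}$) and satisfies $\bar p(u(\alpha,0)v)=\bar p(uv)$ and $\bar p(u(\alpha,t_1)(\alpha,t_2)v)=\bar p(u(\alpha,t_1+t_2)v)$ whenever these generalized inputs lie in $\overline{\mathcal{U}}_{pc}$. A response map $p:\widetilde{\mathcal{U}}_{pc}\to\mathbb{R}^r$ has an extension to negative times if there are an admissible set of generalized inputs $\overline{\mathcal{U}}_{pc}\supseteq\widetilde{\mathcal{U}}_{pc}$ and a generalized response map $\bar p:\overline{\mathcal{U}}_{pc}\to\mathbb{R}^r$ with $\bar p|_{\widetilde{\mathcal{U}}_{pc}}=p$. **Nash systems.** A Nash function on an open semi-algebraic $X\subseteq\mathbb{R}^n$ is an analytic semi-algebraic function $X\to\mathbb{R}$; $\mathcal{N}(X)$ is the ring of these; an $\mathbb{R}^k$-valued map is Nash if its components are. A Nash system $\Sigma=(X,f,h,x_0)$ with input space $U$ and output space $\mathbb{R}^r$ consists of an open connected semi-algebraic $X\subseteq\mathbb{R}^n$, $f:X\times U\to\mathbb{R}^n$ with $f_\alpha=f(\cdot,\alpha)$ Nash for every $\alpha\in U$, a Nash map $h=(h_1,\dots,h_r):X\to\mathbb{R}^r$, and an initial state $x_0\in X$; the dynamics is $\dot x(t)=f(x(t),u(t))$, $x(0)=x_0$. $\widetilde{\mathcal{U}}_{pc}(\Sigma)$ is the largest admissible set of inputs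 $u\in\mathcal{U}_{pc}$ for which there is a unique trajectory $x_\Sigma(\cdot;x_0,u):[0,T_u]\to X$ of $\Sigma$. $\Sigma$ is a local (Nash) realization of a response map $p:\widetilde{\mathcal{U}}_{pc}\to\mathbb{R}^r$ if $p(u)=h(x_\Sigma(T_u;x_0,u))$ for all $u\in\widetilde{\mathcal{U}}_{pc}\cap\widetilde{\mathcal{U}}_{pc}(\Sigma)$. **Reachability and observability.** $\mathcal{R}(x_0)=\{x_\Sigma(T_u;x_0,u)\mid u\in\widetilde{\mathcal{U}}_{pc}(\Sigma)\}$. $\Sigma$ is semi-algebraically reachable if every $g\in\mathcal{N}(X)$ vanishing on $\mathcal{R}(x_0)$ is zero. For $g\in\mathcal{N}(X)$, $f_\alpha g$ denotes the Lie derivative of $g$ along the vector field $f_\alpha$. $A_{obs}(\Sigma)$ is the smallest subalgebra of $\mathcal{N}(X)$ containing the components of $h$ and closed under Lie derivatives along $f_\alpha$, $\alpha\in U$. For an integral domain $A$ over $\mathbb{R}$, $\operatorname{trdeg}A$ is the transcendence degree over $\mathbb{R}$ of its fraction field. $\Sigma$ is semi-algebraically observable if $\operatorname{trdeg}A_{obs}(\Sigma)=\operatorname{trdeg}\mathcal{N}(X)$. Here $\frac{d}{dT}Q(g,\Phi)$ means the partial derivative of the polynomial $Q$ with respect to $T$, evaluated at $(T,T_1,\dots,T_d)=(g,\varphi_1,\dots,\varphi_d)$. In Steps 3 and 4 the indices range over $i=1,\dots,d$, $\alpha\in U$, $j=1,\dots,r$.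
   Formalization: Step 4 is shown to admit choices with V of Step 5 connected, and the claim on Σ_V is made for every such choice (it fails when V is disconnected); h^V is (ψ_1,…,ψ_r) and h^V(Φ(x))=h(x) is claimed only for x near x̄, since Φ need not be injective. *)

(* Defs.v *)
From HB Require Import structures.
From mathcomp Require Import all_boot all_order all_algebra.
From mathcomp Require Import all_classical all_reals all_analysis.
(* The notations of [mpoly] clash with those of MathComp-Analysis: below,
   [mpoly d R] is the ring R[X_0, ..., X_(d-1)], [meval v P] the value of P at
   v : 'I_d -> R, [mderiv i P] the partial derivative of P in X_i, and
   [mmap f v P] the value at v of P with its coefficients mapped by f. *)
From mathcomp Require Import -(notations) mpoly.

Set Implicit Arguments.
Unset Strict Implicit.
Unset Printing Implicit Defensive.

Import Order.TTheory GRing.Theory Num.Theory.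
Import numFieldNormedType.Exports.

Local Open Scope classical_set_scope.
Local Open Scope ring_scope.

Section NashFunctions.
Context {R : realType}.

(* Analyticity on an arbitrary, possibly not open, set S: around every point of
   S there is an absolutely convergent power series that represents g on the
   part of S lying in its polydisc ([ball] is the ball of the sup norm). Since
   the series converges absolutely, it may be summed over increasing cubes of
   multi-indices. *)
Definition analytic_on n (S : set 'rV[R]_n) (g : 'rV[R]_n -> R) : Prop :=
  forall a, S a -> exists2 rho : R, 0 < rho &
  exists c : {ffun 'I_n -> nat} -> R,
    (forall x, ball a rho x ->
       summable [set: {ffun 'I_n -> nat}]
         (fun nu => (c nu * \prod_(i < n) (x 0 i - a 0 i) ^+ nu i)%:E)) /\
    (forall x, S x -> ball a rho x ->
       (fun N => \sum_(nu : {ffun 'I_n -> 'I_N})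
          c [ffun i => nat_of_ord (nu i)] *
          \prod_(i < n) (x 0 i - a 0 i) ^+ nu i) @ \oo --> g x).

Inductive semialgebraic n : set 'rV[R]_n -> Prop :=
| semialgebraic_gt0 (P : mpoly n R) :
    semialgebraic [set x : 'rV[R]_n | 0 < meval (x 0) P]
| semialgebraic_setU A B :
    semialgebraic A -> semialgebraic B -> semialgebraic (A `|` B)
| semialgebraic_setC A : semialgebraic A -> semialgebraic (~` A).

Definition semialgebraic_fun n (X : set 'rV[R]_n) (g : 'rV[R]_n -> R) : Prop :=
  semialgebraic [set z : 'rV[R]_(n + 1) |
                 X (lsubmx z) /\ rsubmx z 0 0 = g (lsubmx z)].

(* Functions on X are total functions of which only the values on X matter;
   equality in the ring of Nash functions on X is [eq_on X]. *)
Definition eq_on n (X : set 'rV[R]_n) (g1 g2 : 'rV[R]_n -> R) : Prop :=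
  forall x, X x -> g1 x = g2 x.

Definition nash_fun n (X : set 'rV[R]_n) : set ('rV[R]_n -> R) :=
  [set g | analytic_on X g /\ semialgebraic_fun X g].

Definition nash_map n k (X : set 'rV[R]_n) (g : 'rV[R]_n -> 'rV[R]_k) : Prop :=
  forall i, nash_fun X (fun x => g x 0 i).

Definition nash_subalgebra n (X : set 'rV[R]_n) (A : set ('rV[R]_n -> R)) :=
  [/\ A `<=` nash_fun X,
      (forall g1 g2, A g1 -> eq_on X g1 g2 -> A g2),
      (forall c : R, A (fun=> c)),
      (forall g1 g2, A g1 -> A g2 -> A (fun x => g1 x + g2 x)) &
      (forall g1 g2, A g1 -> A g2 -> A (fun x => g1 x * g2 x))].

Definition lie n (F : 'rV[R]_n -> 'rV[R]_n) (g : 'rV[R]_n -> R) :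
    'rV[R]_n -> R :=
  fun x => 'D_(F x) g x.

End NashFunctions.

Section TranscendenceDegree.
Context {R : realType}.

Definition fcons T d (y : T) (v : 'I_d -> T) : 'I_d.+1 -> T :=
  fun i => oapp v y (unlift ord0 i).

Definition alg_indep (K : fieldType) (emb : R -> K) d (y : 'I_d -> K) : Prop :=
  forall P : mpoly d R, mmap emb y P = 0 -> P = 0.

(* A maximal algebraically independent family. *)
Definition field_trans_basis (K : fieldType) (emb : R -> K) d
    (y : 'I_d -> K) : Prop :=
  alg_indep emb y /\ forall z, ~ alg_indep emb (fcons z y).

(* iota exhibits K as the fraction field of the domain A of functions on X. *)
Definition fraction_field_of n (X : set 'rV[R]_n) (A : set ('rV[R]_n -> R))
    (K : fieldType) (iota : ('rV[R]_n -> R) -> K) : Prop :=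
  [/\ iota (fun=> 1) = 1,
      (forall g1 g2, A g1 -> A g2 ->
         iota (fun x => g1 x + g2 x) = iota g1 + iota g2),
      (forall g1 g2, A g1 -> A g2 ->
         iota (fun x => g1 x * g2 x) = iota g1 * iota g2),
      (forall g1 g2, A g1 -> A g2 -> (iota g1 = iota g2 <-> eq_on X g1 g2)) &
      (forall y, exists g1 g2,
         [/\ A g1, A g2, iota g2 != 0 & y = iota g1 / iota g2])].

Definition has_trdeg n (X : set 'rV[R]_n) (A : set ('rV[R]_n -> R)) d : Prop :=
  exists (K : fieldType) (iota : ('rV[R]_n -> R) -> K),
    fraction_field_of X A iota /\
    exists y : 'I_d -> K, field_trans_basis (fun c => iota (fun=> c)) y.

Definition trans_basis n (X : set 'rV[R]_n) (A : set ('rV[R]_n -> R)) d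
    (phi : 'I_d -> 'rV[R]_n -> R) : Prop :=
  (forall i, A (phi i)) /\
  exists (K : fieldType) (iota : ('rV[R]_n -> R) -> K),
    fraction_field_of X A iota /\
    field_trans_basis (fun c => iota (fun=> c)) (fun i => iota (phi i)).

End TranscendenceDegree.

Section Inputs.
Context {R : realType} {m : nat}.

(* (alpha_1, t_1) ... (alpha_k, t_k); uv is u ++ v. *)
Definition input := seq ('rV[R]_m * R).

Definition word k (al : 'I_k -> 'rV[R]_m) (t : 'rV[R]_k) : input :=
  [seq (al i, t 0 i) | i <- enum 'I_k].

Definition duration (u : input) : R := \sum_(at_ <- u) at_.2.

Definition pc_inputs (U : set 'rV[R]_m) : set input :=
  [set u | forall a t, (a, t) \in u -> U a /\ 0 <= t].

Definition generalized_inputs (U : set 'rV[R]_m) : set input :=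
  [set u | forall a t, (a, t) \in u -> U a].

(* The piecewise-constant function of t >= 0 denoted by u; the value is None
   from the time duration u on. *)
Fixpoint input_at (u : input) (t : R) : option 'rV[R]_m :=
  if u is (a, s) :: u' then (if t < s then Some a else input_at u' (t - s))
  else None.

(* An input is a function of time, so that two words denoting the same function
   are the same input: sets of inputs are saturated for, and maps on inputs are
   compatible with, [same_input]. *)
Definition same_input (u v : input) : Prop :=
  forall t, 0 <= t -> input_at u t = input_at v t.

Fixpoint restrict (u : input) (t : R) : input :=
  if u is (a, s) :: u' then
    (if t <= s then [:: (a, t)] else (a, s) :: restrict u' (t - s))
  else [::].

Definition admissible (U : set 'rV[R]_m) (Ut : set input) : Prop :=
  [/\ Ut !=set0, Ut `<=` pc_inputs U,
      (forall u v, Ut u -> pc_inputs U v -> same_input u v -> Ut v) &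
  [/\ forall u t, Ut u -> 0 <= t <= duration u -> Ut (restrict u t),
      forall u a, Ut u -> U a -> exists2 t, 0 < t & Ut (rcons u (a, t)) &
      forall k (al : 'I_k -> 'rV[R]_m) (t : 'rV[R]_k), Ut (word al t) ->
        exists2 delta, 0 < delta &
          forall t' : 'rV[R]_k, (forall i, 0 <= t' 0 i <= t 0 i + delta) ->
            Ut (word al t')]].

Definition response_map r (U : set 'rV[R]_m) (Ut : set input)
    (p : input -> 'rV[R]_r) : Prop :=
  [/\ admissible U Ut,
      (forall u v, Ut u -> Ut v -> same_input u v -> p u = p v) &
      forall k (al : 'I_k -> 'rV[R]_m) (j : 'I_r),
        (0 < k)%N -> (forall i, U (al i)) ->
        analytic_on [set t : 'rV[R]_k | Ut (word al t)]
          (fun t => p (word al t) 0 j)].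

Definition shifted_inputs (Ut : set input) (u : input) : set input :=
  [set v | Ut v /\ Ut (u ++ v)].

Definition shifted_map r (p : input -> 'rV[R]_r) (u : input) :
    input -> 'rV[R]_r :=
  fun v => p (u ++ v).

Definition I0 (a : R) : set R :=
  if 0 <= a then `[0, a]%classic else `[a, 0]%classic.

(* Generalized inputs are genuinely words; the identifications are imposed on
   [generalized_response_map] instead. *)
Definition admissible_generalized (U : set 'rV[R]_m) (Ub : set input) : Prop :=
  [/\ Ub !=set0, Ub `<=` generalized_inputs U &
  [/\ forall v a t w s, Ub (v ++ (a, t) :: w) -> I0 t s -> Ub (rcons v (a, s)),
      forall u a, Ub u -> U a -> exists2 delta, 0 < delta &
        forall t, - delta < t < delta -> Ub (rcons u (a, t)) &
      forall k (al : 'I_k -> 'rV[R]_m) (t : 'rV[R]_k), Ub (word al t) ->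
        exists2 delta, 0 < delta &
          forall t' : 'rV[R]_k,
            (forall i, I0 (Num.sg (t 0 i) * (`|t 0 i| + delta)) (t' 0 i)) ->
            Ub (word al t')]].

Definition generalized_response_map r (U : set 'rV[R]_m) (Ub : set input)
    (pb : input -> 'rV[R]_r) : Prop :=
  [/\ forall k (al : 'I_k -> 'rV[R]_m) (j : 'I_r), (forall i, U (al i)) ->
        analytic_on [set t : 'rV[R]_k | Ub (word al t)]
          (fun t => pb (word al t) 0 j),
      forall u a v, Ub (u ++ (a, 0) :: v) -> Ub (u ++ v) ->
        pb (u ++ (a, 0) :: v) = pb (u ++ v) &
      forall u a t1 t2 v,
        Ub (u ++ (a, t1) :: (a, t2) :: v) -> Ub (u ++ (a, t1 + t2) :: v) ->
        pb (u ++ (a, t1) :: (a, t2) :: v) = pb (u ++ (a, t1 + t2) :: v)].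

Definition has_negative_extension r (U : set 'rV[R]_m) (Ut : set input)
    (p : input -> 'rV[R]_r) : Prop :=
  exists (Ub : set input) (pb : input -> 'rV[R]_r),
    [/\ admissible_generalized U Ub, Ut `<=` Ub,
        generalized_response_map U Ub pb & forall u, Ut u -> pb u = p u].

End Inputs.
Arguments input : clear implicits.

Section Systems.
Context {R : realType}.

Record system (n m r : nat) := System {
  st_space : set 'rV[R]_n ;
  dyn : 'rV[R]_m -> 'rV[R]_n -> 'rV[R]_n ;
  out : 'rV[R]_n -> 'rV[R]_r ;
  init : 'rV[R]_n }.

Context {n m r : nat}.
Implicit Types (S : system n m r) (U : set 'rV[R]_m) (u : input R m).

Definition nash_system U S : Prop :=
  [/\ open (st_space S), connected (st_space S), semialgebraic (st_space S) &
  [/\ forall a, U a -> nash_map (st_space S) (dyn S a),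
      nash_map (st_space S) (out S) & st_space S (init S)]].

Definition trajectory S u (x : R -> 'rV[R]_n) : Prop :=
  [/\ x 0 = init S,
      {within `[0, duration u], continuous x},
      (forall t, 0 <= t <= duration u -> st_space S (x t)) &
      forall v a s w, u = v ++ (a, s) :: w ->
        forall t : R, duration v < t < duration v + s ->
          is_derive t (1 : R) x (dyn S a (x t))].

Definition has_unique_trajectory S u : Prop :=
  exists2 x, trajectory S u x &
    forall y, trajectory S u y ->
      forall t, 0 <= t <= duration u -> y t = x t.

(* The largest admissible set of inputs with a unique trajectory, namely the
   union of all of them: the conditions defining admissibility are stable under
   unions. *)
Definition system_inputs U S : set (input R m) :=
  [set u | exists A, [/\ admissible U A, A `<=` has_unique_trajectory S & A u]].

(* x_S(T_u; x_0, u); meaningful for u with a unique trajectory. *)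
Definition final_state S u : 'rV[R]_n := get (trajectory S u) (duration u).

Definition reachable U S : set 'rV[R]_n :=
  [set final_state S u | u in system_inputs U S].

Definition sa_reachable U S : Prop :=
  forall g, nash_fun (st_space S) g -> (forall x, reachable U S x -> g x = 0) ->
    eq_on (st_space S) g (fun=> 0).

Definition A_obs U S : set ('rV[R]_n -> R) :=
  smallest
    (fun A => nash_subalgebra (st_space S) A /\
       forall a g, U a -> A g -> A (lie (dyn S a) g))
    [set g | exists j, g = fun x => out S x 0 j].

Definition sa_observable U S : Prop :=
  exists d, has_trdeg (st_space S) (A_obs U S) d /\
            has_trdeg (st_space S) (nash_fun (st_space S)) d.

Definition local_nash_realization U (Ut : set (input R m))
    (p : input R m -> 'rV[R]_r) S : Prop :=
  [/\ response_map U Ut p, nash_system U S &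
      forall u, Ut u -> system_inputs U S u -> p u = out S (final_state S u)].

End Systems.
Arguments system : clear implicits.

Section Procedure.
Context {R : realType} {n m r d : nat}.
Implicit Types (S : system R n m r) (U : set 'rV[R]_m) (phi : 'I_d -> 'rV[R]_n -> R).

(* Q(g(x), phi_1(x), ..., phi_d(x)): the variable T has index ord0. *)
Definition eval_rel (Q : mpoly d.+1 R) (g : 'rV[R]_n -> R) phi
    (x : 'rV[R]_n) : R :=
  meval (fcons (g x) (fun i => phi i x)) Q.

Definition relation_on (X : set 'rV[R]_n) (g : 'rV[R]_n -> R) phi
    (Q : mpoly d.+1 R) : Prop :=
  Q != 0 /\ forall x, X x -> eval_rel Q g phi x = 0.

(* [msize] is the total degree plus one. *)
Definition minimal_relation (X : set 'rV[R]_n) (g : 'rV[R]_n -> R) phi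
    (Q : mpoly d.+1 R) : Prop :=
  relation_on X g phi Q /\
  forall Q', relation_on X g phi Q' -> (msize Q <= msize Q')%N.

Definition Phi phi (x : 'rV[R]_n) : 'rV[R]_d := \row_i phi i x.

Definition out_comp S (j : 'I_r) : 'rV[R]_n -> R := fun x => out S x 0 j.

Definition step1 U S phi : Prop := trans_basis (st_space S) (A_obs U S) phi.

Definition step2 U S phi (Q : 'rV[R]_m -> 'I_d -> mpoly d.+1 R)
    (P : 'I_r -> mpoly d.+1 R) : Prop :=
  (forall a i, U a ->
     minimal_relation (st_space S) (lie (dyn S a) (phi i)) phi (Q a i)) /\
  (forall j, minimal_relation (st_space S) (out_comp S j) phi (P j)).

Definition step3 U (Ut : set (input R m)) S phi (eps : R)
    (Q : 'rV[R]_m -> 'I_d -> mpoly d.+1 R) (P : 'I_r -> mpoly d.+1 R)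
    (u : input R m) : Prop :=
  [/\ system_inputs U S u, Ut u, duration u < eps,
      (forall a i, U a -> \forall x \near final_state S u,
         eval_rel (mderiv ord0 (Q a i)) (lie (dyn S a) (phi i)) phi x != 0) &
      (forall j, \forall x \near final_state S u,
         eval_rel (mderiv ord0 (P j)) (out_comp S j) phi x != 0)].

Record implicit_fun := ImplicitFun {
  imW : set R ;
  imV : set 'rV[R]_d ;
  impsi : 'rV[R]_d -> R }.

Definition solves_relation (X : set 'rV[R]_n) (g : 'rV[R]_n -> R) phi
    (Q : mpoly d.+1 R) (xbar : 'rV[R]_n) (I : implicit_fun) : Prop :=
  [/\ [/\ open (imW I), connected (imW I) &
          semialgebraic [set z : 'rV[R]_1 | imW I (z 0 0)]],
      [/\ open (imV I), connected (imV I) & semialgebraic (imV I)],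
      nash_fun (imV I) (impsi I) /\ (forall y, imV I y -> imW I (impsi I y)),
      [/\ imW I (g xbar), imV I (Phi phi xbar) &
          impsi I (Phi phi xbar) = g xbar] &
      forall x, X x -> imW I (g x) -> imV I (Phi phi x) ->
        (eval_rel Q g phi x = 0 <-> g x = impsi I (Phi phi x))].

Definition step4 U S phi (Q : 'rV[R]_m -> 'I_d -> mpoly d.+1 R)
    (P : 'I_r -> mpoly d.+1 R) (xbar : 'rV[R]_n)
    (If : 'rV[R]_m -> 'I_d -> implicit_fun) (Ih : 'I_r -> implicit_fun) : Prop :=
  (forall a i, U a ->
     solves_relation (st_space S) (lie (dyn S a) (phi i)) phi (Q a i) xbar
       (If a i)) /\
  (forall j,
     solves_relation (st_space S) (out_comp S j) phi (P j) xbar (Ih j)).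

Definition step5 U (If : 'rV[R]_m -> 'I_d -> implicit_fun)
    (Ih : 'I_r -> implicit_fun) : set 'rV[R]_d :=
  (\bigcap_(a in U) \bigcap_i imV (If a i)) `&` \bigcap_j imV (Ih j).

(* The identity h^V(Phi(x)) = h(x) determines h^V near Phi(xbar), where it is
   (psi_1, ..., psi_r). *)
Definition step6 U phi (If : 'rV[R]_m -> 'I_d -> implicit_fun)
    (Ih : 'I_r -> implicit_fun) (xbar : 'rV[R]_n) : system R d m r :=
  {| st_space := step5 U If Ih ;
     dyn := fun a y => \row_i impsi (If a i) y ;
     out := fun y => \row_j impsi (Ih j) y ;
     init := Phi phi xbar |}.

End Procedure.
Arguments implicit_fun : clear implicits.

(* Main.v *)
(* Near the state xbar reached by a short input, Phi carries the trajectories of S to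
   trajectories of the reduced system, because there f_alpha phi_i and h_j are the
   Nash functions psi of Phi. Analyticity is used through bounds M C^k k! on the
   iterated partial derivatives of order k: they are stable under Lie derivatives,
   and a response all of whose iterated Lie derivatives vanish at one state vanishes
   along every trajectory through it, so identities known for short inputs only
   extend to all inputs.

   Reachability: if g vanishes at the states reached by the reduced system and
   B(g, y) = 0 is a minimal relation, then the observable B(0, Phi) of S is flat at
   xbar, hence vanishes at all states reached by S, hence on X. As Phi is
   algebraically independent, T divides B, and minimality of B forces g = 0.

   Observability: phi_1, ..., phi_d agree near xbar with observables of the reduced
   system composed with Phi, so the latter are d independent functions of d
   variables. Nash functions on a subset of R^d have transcendence degree d since
   d + 1 of them would otherwise map a d-dimensional cube onto a set with interior. *)

(* Trajectories of the reduced system are never constructed by solving an equation: they are images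
   under Phi of trajectories of S, or they are provided by membership in [system_inputs]. The
   obstacle is an input v that is long. The reduced system may follow v while S has no trajectory
   under uv, or one that leaves the neighbourhood of xbar where Phi conjugates the dynamics, so the
   value of p at uv cannot be compared with the output directly. Both are analytic in the durations,
   though only on a closed box that has the zero durations as a corner. Their mixed derivatives at
   this corner are iterated Lie derivatives at xbar and at Phi(xbar), which the conjugation
   identifies. Derivative bounds are preferred to power series because flows and implicit functions
   are hard to expand, whereas their derivatives are again Lie derivatives or polynomials in known
   functions. Semi-algebraicity of sums, derivatives, roots and images is obtained by writing a
   first-order formula and eliminating its quantifiers. *)
Require Import Defs.
From HB Require Import structures.
From mathcomp Require Import all_boot all_order all_algebra.
From mathcomp Require Import all_classical all_reals all_analysis.
From mathcomp Require Import -(notations) mpoly.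
From mathcomp Require Import lra zify.
From mathcomp Require qe_rcf ordered_qelim.
Set Implicit Arguments.
Unset Strict Implicit.
Unset Printing Implicit Defensive.
Import Order.TTheory GRing.Theory Num.Theory.
Import numFieldNormedType.Exports.
Local Open Scope classical_set_scope.
Local Open Scope ring_scope.

(** * Definable and semi-algebraic sets *)

Module ord := ordered_qelim.ord.

Section Definable.
Context {R : realType}.
Implicit Types (e : nat -> R) (s : seq R).

Definition upd e i (t : R) : nat -> R := fun j => if j == i then t else e j.

(** Terms may contain inverses (see [polytermV]); they are removed together with the quantifiers.
    Only environments [nth 0 s] are tested, those with finitely many nonzero entries. *)
Definition polyterm (T : (nat -> R) -> R) : Prop :=
  exists t : GRing.term R, forall s, GRing.eval s t = T (nth 0 s).

Definition definable (P : (nat -> R) -> Prop) : Prop :=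
  exists f : ord.formula R, forall s, ord.holds s f <-> P (nth 0 s).

Lemma polyterm_var i : polyterm (fun e => e i).
Proof. by exists (GRing.Var R i). Qed.

Lemma polyterm_cst c : polyterm (fun=> c).
Proof. by exists (GRing.Const c). Qed.

Lemma polytermD T1 T2 : polyterm T1 -> polyterm T2 ->
  polyterm (fun e => T1 e + T2 e).
Proof. by move=> [t1 h1] [t2 h2]; exists (GRing.Add t1 t2) => s /=; rewrite h1 h2. Qed.

Lemma polytermN T1 : polyterm T1 -> polyterm (fun e => - T1 e).
Proof. by move=> [t1 h1]; exists (GRing.Opp t1) => s /=; rewrite h1. Qed.

Lemma polytermB T1 T2 : polyterm T1 -> polyterm T2 ->
  polyterm (fun e => T1 e - T2 e).
Proof. by move=> h1 h2; apply: polytermD => //; apply: polytermN. Qed.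

Lemma polytermM T1 T2 : polyterm T1 -> polyterm T2 ->
  polyterm (fun e => T1 e * T2 e).
Proof. by move=> [t1 h1] [t2 h2]; exists (GRing.Mul t1 t2) => s /=; rewrite h1 h2. Qed.

Lemma polytermX T1 k : polyterm T1 -> polyterm (fun e => T1 e ^+ k).
Proof. by move=> [t1 h1]; exists (GRing.Exp t1 k) => s /=; rewrite h1. Qed.

Lemma polyterm_sum I (r : seq I) (F : I -> (nat -> R) -> R) :
  (forall i, polyterm (F i)) -> polyterm (fun e => \sum_(i <- r) F i e).
Proof.
move=> h; elim: r => [|i r [t ht]].
  by exists (GRing.Const 0) => s; rewrite big_nil.
by have [ti hi] := h i; exists (GRing.Add ti t) => s /=; rewrite big_cons hi ht.
Qed.

Lemma polyterm_prod I (r : seq I) (F : I -> (nat -> R) -> R) :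
  (forall i, polyterm (F i)) -> polyterm (fun e => \prod_(i <- r) F i e).
Proof.
move=> h; elim: r => [|i r [t ht]].
  by exists (GRing.Const 1) => s; rewrite big_nil.
by have [ti hi] := h i; exists (GRing.Mul ti t) => s /=; rewrite big_cons hi ht.
Qed.

Lemma polyterm_meval n (P : mpoly n R) (T : 'I_n -> (nat -> R) -> R) :
  (forall i, polyterm (T i)) -> polyterm (fun e => meval (fun i => T i e) P).
Proof.
move=> h; under [X in polyterm X]eq_fun do rewrite mevalE.
apply: polyterm_sum => m; apply: polytermM; first exact: polyterm_cst.
by apply: polyterm_prod => i; apply: polytermX.
Qed.

Lemma definable_ext P Q : (forall e, P e <-> Q e) -> definable P -> definable Q.
Proof. by move=> h [f hf]; exists f => s; rewrite hf. Qed.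

Lemma definable_lt T1 T2 : polyterm T1 -> polyterm T2 ->
  definable (fun e => T1 e < T2 e).
Proof. by move=> [t1 h1] [t2 h2]; exists (ord.Lt t1 t2) => s /=; rewrite h1 h2. Qed.

Lemma definable_le T1 T2 : polyterm T1 -> polyterm T2 ->
  definable (fun e => T1 e <= T2 e).
Proof. by move=> [t1 h1] [t2 h2]; exists (ord.Le t1 t2) => s /=; rewrite h1 h2. Qed.

Lemma definable_eq T1 T2 : polyterm T1 -> polyterm T2 ->
  definable (fun e => T1 e = T2 e).
Proof. by move=> [t1 h1] [t2 h2]; exists (ord.Equal t1 t2) => s /=; rewrite h1 h2. Qed.

Lemma definable_and P Q : definable P -> definable Q ->
  definable (fun e => P e /\ Q e).
Proof. by move=> [f hf] [g hg]; exists (ord.And f g) => s /=; rewrite hf hg. Qed.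

Lemma definable_or P Q : definable P -> definable Q ->
  definable (fun e => P e \/ Q e).
Proof. by move=> [f hf] [g hg]; exists (ord.Or f g) => s /=; rewrite hf hg. Qed.

Lemma definable_imp P Q : definable P -> definable Q ->
  definable (fun e => P e -> Q e).
Proof. by move=> [f hf] [g hg]; exists (ord.Implies f g) => s /=; rewrite hf hg. Qed.

Lemma definable_not P : definable P -> definable (fun e => ~ P e).
Proof. by move=> [f hf]; exists (ord.Not f) => s /=; rewrite hf. Qed.

Lemma definable_true : definable (fun=> True).
Proof. by exists (ord.Bool true). Qed.

Lemma nth_set_nth_upd s i t : nth 0 (set_nth 0 s i t) = upd (nth 0 s) i t.
Proof. by apply/funext => j; rewrite nth_set_nth. Qed.

Lemma definable_ex P i : definable P -> definable (fun e => exists t, P (upd e i t)).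
Proof.
move=> [f hf]; exists (ord.Exists i f) => s /=.
by split=> [[t /hf]|[t h]]; exists t; rewrite ?hf -?nth_set_nth_upd // nth_set_nth_upd.
Qed.

Lemma definable_all P i : definable P -> definable (fun e => forall t, P (upd e i t)).
Proof.
move=> [f hf]; exists (ord.Forall i f) => s /=.
by split=> h t; have := h t; rewrite ?hf nth_set_nth_upd.
Qed.

Lemma definable_forall_fin (I : finType) (P : I -> (nat -> R) -> Prop) :
  (forall i, definable (P i)) -> definable (fun e => forall i, P i e).
Proof.
move=> h; suff H : forall r : seq I, definable (fun e => forall i, i \in r -> P i e).
  by apply: definable_ext (H (enum I)) => e; split=> he i => [|_]; apply: he; rewrite ?mem_enum.
elim=> [|i r IH]; first by apply: definable_ext definable_true => e; split.
apply: definable_ext (definable_and (h i) IH) => e; split.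
  by move=> [hi hr] j; rewrite inE => /orP[/eqP->//|/hr].
by move=> he; split=> [|j jr]; apply: he; rewrite inE ?eqxx // jr orbT.
Qed.

Lemma definable_semialgebraic n (S : set 'rV[R]_n) (T : 'I_n -> (nat -> R) -> R) :
  semialgebraic S -> (forall i, polyterm (T i)) ->
  definable (fun e => S (\row_i T i e)).
Proof.
move=> hS hT; elim: hS => [P|A B _ hA _ hB|A _ hA] /=.
- have := definable_lt (polyterm_cst 0) (polyterm_meval P hT).
  apply: definable_ext => e; rewrite (_ : meval (fun i => T i e) P = meval ((\row_i T i e) 0) P) //.
  by apply: meval_eq => i; rewrite mxE.
- exact: definable_or.
- exact: definable_not.
Qed.

Definition row_env n (x : 'rV[R]_n) : seq R := [seq x 0 i | i <- enum 'I_n].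

Lemma nth_row_env n (x : 'rV[R]_n) (i : 'I_n) : nth 0 (row_env x) i = x 0 i.
Proof.
by rewrite /row_env (nth_map i) ?size_enum_ord // nth_ord_enum.
Qed.

Lemma nth_row_env_ge n (x : 'rV[R]_n) k : (n <= k)%N -> nth 0 (row_env x) k = 0.
Proof. by move=> h; rewrite nth_default // size_map size_enum_ord. Qed.

Lemma rterm_mpoly n (t : GRing.term R) : GRing.rterm t ->
  exists P : mpoly n R, forall x : 'rV[R]_n, GRing.eval (row_env x) t = meval (x 0) P.
Proof.
elim: t => //=.
- move=> k _; case: (ltnP k n) => [kn|nk].
    exists (mpolyX R (mnm1 (Ordinal kn))) => x.
    by rewrite mevalXU -nth_row_env.
  (* Variables beyond the length of the environment take the default value 0. *)
  by exists 0 => x; rewrite meval0 nth_row_env_ge.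
- by move=> c _; exists (mpolyC n c) => x; rewrite mevalC.
- by move=> k _; exists (mpolyC n k%:R) => x; rewrite mevalC.
- by move=> t1 h1 t2 h2 /andP[/h1[P1 e1] /h2[P2 e2]]; exists (P1 + P2) => x; rewrite mevalD e1 e2.
- by move=> t1 h1 /h1[P1 e1]; exists (- P1) => x; rewrite mevalN e1.
- by move=> t1 h1 k /h1[P1 e1]; exists (P1 *+ k) => x; rewrite mevalMn e1.
- by move=> t1 h1 t2 h2 /andP[/h1[P1 e1] /h2[P2 e2]]; exists (P1 * P2) => x; rewrite mevalM e1 e2.
- by move=> t1 h1 k /h1[P1 e1]; exists (P1 ^+ k) => x; rewrite rmorphXn e1.
Qed.

Lemma semialgebraic_ext n (A B : set 'rV[R]_n) : (forall x, A x <-> B x) ->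
  semialgebraic A -> semialgebraic B.
Proof. by move=> h; rewrite (_ : A = B) //; apply/seteqP; split=> x /h. Qed.

Lemma semialgebraic_setT n : semialgebraic [set: 'rV[R]_n].
Proof.
apply: semialgebraic_ext (semialgebraic_gt0 (1 : mpoly n R)) => x.
by split=> // _ /=; rewrite meval1.
Qed.

Lemma semialgebraic_setI n (A B : set 'rV[R]_n) : semialgebraic A -> semialgebraic B ->
  semialgebraic (A `&` B).
Proof.
move=> hA hB; have := semialgebraic_setC (semialgebraic_setU (semialgebraic_setC hA) (semialgebraic_setC hB)).
by rewrite setCU !setCK.
Qed.

Lemma semialgebraic_qf n (f : ord.formula R) : ord.qf_form f && ord.rformula f ->
  semialgebraic [set x : 'rV[R]_n | ord.qf_eval (row_env x) f].
Proof.
elim: f => //=.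
- case=> _; first by apply: semialgebraic_ext (semialgebraic_setT n) => x.
  by apply: semialgebraic_ext (semialgebraic_setC (semialgebraic_setT n)) => x /=; split=> [[]|].
- move=> t1 t2 /andP[/(rterm_mpoly n)[P1 e1] /(rterm_mpoly n)[P2 e2]].
  apply: semialgebraic_ext (semialgebraic_setC (semialgebraic_setU
    (semialgebraic_gt0 (P1 - P2)) (semialgebraic_gt0 (P2 - P1)))) => x /=.
  rewrite e1 e2 !mevalB !subr_gt0 eq_le; split=> [/not_orP[/negP + /negP]|].
    by rewrite -!leNgt => -> ->.
  by case/andP=> h1 h2 []; rewrite ltNge ?h1 ?h2.
- move=> t1 t2 /andP[/(rterm_mpoly n)[P1 e1] /(rterm_mpoly n)[P2 e2]].
  by apply: semialgebraic_ext (semialgebraic_gt0 (P2 - P1)) => x /=; rewrite e1 e2 mevalB subr_gt0.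
- move=> t1 t2 /andP[/(rterm_mpoly n)[P1 e1] /(rterm_mpoly n)[P2 e2]].
  apply: semialgebraic_ext (semialgebraic_setC (semialgebraic_gt0 (P1 - P2))) => x /=.
  by rewrite e1 e2 mevalB subr_gt0 leNgt; split=> /negP.
- move=> f1 h1 f2 h2 /andP[/andP[q1 q2] /andP[r1 r2]].
  have := semialgebraic_setI (h1 _) (h2 _); rewrite q1 q2 r1 r2 => /(_ isT isT).
  by apply: semialgebraic_ext => x /=; split=> [[-> ->]|/andP].
- move=> f1 h1 f2 h2 /andP[/andP[q1 q2] /andP[r1 r2]].
  have := semialgebraic_setU (h1 _) (h2 _); rewrite q1 q2 r1 r2 => /(_ isT isT).
  by apply: semialgebraic_ext => x /=; split=> [[->//|->]|/orP]; rewrite ?orbT.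
- move=> f1 h1 f2 h2 /andP[/andP[q1 q2] /andP[r1 r2]].
  have := semialgebraic_setU (semialgebraic_setC (h1 _)) (h2 _); rewrite q1 q2 r1 r2 => /(_ isT isT).
  apply: semialgebraic_ext => x /=; split=> [[/negP/negbTE->//|->]|]; first by rewrite implybT.
  by case: (ord.qf_eval _ f1) => /= h; [right|left].
- move=> f1 h1 /h1 /semialgebraic_setC; apply: semialgebraic_ext => x /=; split=> /negP //.
Qed.

(** Tarski-Seidenberg: [to_rform] removes inverses, quantifier elimination over a real closed field
    removes quantifiers, and what remains is a boolean combination of polynomial conditions. *)
Lemma definable_row_env n P : definable P ->
  semialgebraic [set x : 'rV[R]_n | P (nth 0 (row_env x))].
Proof.
move=> [f hf].
pose w := fun i bc => qe_rcf.qfr_to_formula (@qe_rcf.wproj R i bc).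
pose f' := ord.quantifier_elim w (ord.to_rform f).
have wf := @ord.quantifier_elim_wf R w (@qe_rcf.wf_QE_wproj R) _ (ord.to_rform_rformula f).
apply: semialgebraic_ext (semialgebraic_qf n wf) => x /=.
rewrite -hf -ord.to_rformP.
symmetry; apply: rwP (@ord.quantifier_elim_rformP R w (@qe_rcf.wf_QE_wproj R) (@qe_rcf.valid_QE_wproj R) _ _ (ord.to_rform_rformula f)).
Qed.

Lemma semialgebraic_definable n (S : set 'rV[R]_n) :
  definable (fun e => S (\row_(i < n) e i)) -> semialgebraic S.
Proof.
move=> /(definable_row_env n); apply: semialgebraic_ext => x /=.
rewrite (_ : \row_i _ = x) //.
by apply/rowP => i; rewrite mxE nth_row_env.
Qed.

Lemma semialgebraic_fun_definable n (X : set 'rV[R]_n) g :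
  definable (fun e => X (\row_(i < n) e i) /\ e n = g (\row_(i < n) e i)) ->
  semialgebraic_fun X g.
Proof.
move=> h; apply: semialgebraic_definable; apply: definable_ext h => e /=.
have -> : lsubmx (\row_(i < n + 1) e i) = \row_(i < n) e i by apply/rowP => i; rewrite !mxE.
by rewrite !mxE /= addn0.
Qed.

(** The value of g enters a formula as an existentially quantified variable j pinned down by the
    graph of g, which is why the arguments T must not depend on j. *)
Lemma definable_app n (X : set 'rV[R]_n) g (T : 'I_n -> (nat -> R) -> R) j P :
  semialgebraic_fun X g -> (forall i, polyterm (T i)) ->
  (forall e t i, T i (upd e j t) = T i e) -> definable P ->
  definable (fun e => X (\row_i T i e) /\ P (upd e j (g (\row_i T i e)))).
Proof.
move=> hg hT Tj hP.
pose T' (k : 'I_(n + 1)) : (nat -> R) -> R := match fintype.split k with inl i => T i | inr _ => fun e => e j end.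
have hT' k : polyterm (T' k).
  by rewrite /T'; case: (fintype.split k) => a //; exact: polyterm_var.
have TE e t : \row_k T' k (upd e j t) = row_mx (\row_i T i e) (\row_(_ < 1) t).
  apply/rowP => k; rewrite !mxE /T'; case: (fintype.split k) => a; rewrite !mxE ?Tj //.
  by rewrite /upd eqxx.
apply: definable_ext (definable_ex j (definable_and (definable_semialgebraic hg hT') hP)) => e /=.
split=> [[t]|[hX h]].
  by rewrite TE row_mxKl row_mxKr mxE => -[[hX ->] h].
by exists (g (\row_i T i e)); rewrite TE row_mxKl row_mxKr mxE.
Qed.

Let row_upd n e j t : (n <= j)%N -> \row_(i < n) upd e j t i = \row_(i < n) e i.
Proof.
move=> nj; apply/rowP => i; rewrite !mxE /upd; case: eqP => // ij.
by have := ltn_ord i; rewrite ij ltnNge nj.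
Qed.

Lemma semialgebraic_fun_cst n (X : set 'rV[R]_n) c : semialgebraic X ->
  semialgebraic_fun X (fun=> c).
Proof.
move=> hX; apply: semialgebraic_fun_definable; apply: definable_and.
  by apply: definable_semialgebraic => // i; apply: polyterm_var.
by apply: definable_eq; [apply: polyterm_var|apply: polyterm_cst].
Qed.

Lemma semialgebraic_fun_meval n (X : set 'rV[R]_n) (P : mpoly n R) : semialgebraic X ->
  semialgebraic_fun X (fun x => meval (x 0) P).
Proof.
move=> hX; apply: semialgebraic_fun_definable; apply: definable_and.
  by apply: definable_semialgebraic => // i; apply: polyterm_var.
apply: definable_eq; first exact: polyterm_var.
have := @polyterm_meval n P (fun i e => e i) (fun i => polyterm_var i).
rewrite (_ : (fun e => meval (fun i : 'I_n => e i) P) =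
  (fun e : nat -> R => meval ((\row_(i < n) e i) 0) P)) //.
by apply/funext => e; apply: meval_eq => i; rewrite mxE.
Qed.

Lemma semialgebraic_fun_op n (X : set 'rV[R]_n) (op : R -> R -> R) g1 g2 :
  (forall T1 T2, polyterm T1 -> polyterm T2 -> polyterm (fun e => op (T1 e) (T2 e))) ->
  semialgebraic_fun X g1 -> semialgebraic_fun X g2 ->
  semialgebraic_fun X (fun x => op (g1 x) (g2 x)).
Proof.
move=> hop h1 h2; apply: semialgebraic_fun_definable.
have V (i : 'I_n) : polyterm (fun e => e i) by apply: polyterm_var.
have lt_upd e j t (i : 'I_n) : (n <= j)%N -> upd e j t i = e i.
  by move=> nj; have := congr1 (fun z : 'rV_n => z 0 i) (row_upd e t nj); rewrite !mxE.
(* Variable n holds the claimed value, n + 1 and n + 2 those of g1 and g2. *)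
have d0 : definable (fun e => e n = op (e n.+1) (e n.+2)).
  by apply: definable_eq; [|apply: hop]; apply: polyterm_var.
have d2 := definable_app h2 V (fun e t i => lt_upd e n.+2 t i (leqW (leqnSn n))) d0.
have d1 := definable_app h1 V (fun e t i => lt_upd e n.+1 t i (leqnSn n)) d2.
apply: definable_ext d1 => e /=; rewrite row_upd //.
rewrite /upd !eqxx; have [-> -> ->] : [/\ (n == n.+2) = false, (n == n.+1) = false &
   (n.+1 == n.+2) = false] by split; lia.
by tauto.
Qed.

Lemma semialgebraic_funD n (X : set 'rV[R]_n) g1 g2 :
  semialgebraic_fun X g1 -> semialgebraic_fun X g2 ->
  semialgebraic_fun X (fun x => g1 x + g2 x).
Proof. by apply: semialgebraic_fun_op => *; apply: polytermD. Qed.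

Lemma semialgebraic_funM n (X : set 'rV[R]_n) g1 g2 :
  semialgebraic_fun X g1 -> semialgebraic_fun X g2 ->
  semialgebraic_fun X (fun x => g1 x * g2 x).
Proof. by apply: semialgebraic_fun_op => *; apply: polytermM. Qed.

Lemma semialgebraic_fun_eq_on n (X : set 'rV[R]_n) g1 g2 : eq_on X g1 g2 ->
  semialgebraic_fun X g1 -> semialgebraic_fun X g2.
Proof.
move=> h; apply: semialgebraic_ext => x /=.
by split=> -[hX ->]; rewrite h.
Qed.

Lemma semialgebraic_fun_sub n (X Y : set 'rV[R]_n) g : semialgebraic Y -> Y `<=` X ->
  semialgebraic_fun X g -> semialgebraic_fun Y g.
Proof.
move=> hY YX h; apply: semialgebraic_definable.
have V (i : 'I_(n + 1)) : polyterm (fun e : nat -> R => e i) by apply: polyterm_var.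
have V' (i : 'I_n) : polyterm (fun e : nat -> R => e i) by apply: polyterm_var.
apply: definable_ext (definable_and (definable_semialgebraic hY V') (definable_semialgebraic h V)) => e /=.
have -> : lsubmx (\row_(i < n + 1) e i) = \row_(i < n) e i by apply/rowP => i; rewrite !mxE.
by split=> [[? []]|[? ?]]; split=> //; split=> //; apply: YX.
Qed.

Lemma semialgebraic_fun_deriv n (X : set 'rV[R]_n) g (l : 'I_n) : open X ->
  (forall x, X x -> derivable g x (delta_mx 0 l)) -> semialgebraic_fun X g ->
  semialgebraic_fun X (fun x => 'D_(delta_mx 0 l) g x).
Proof.
move=> oX dg hg; apply: semialgebraic_fun_definable.
pose v : 'rV[R]_n := delta_mx 0 l.
(* The epsilon-delta form of y being the right-hand derivative, with the division by h cleared. The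
   negated conjunction expresses an implication in the shape that [definable_app] produces. *)
pose Q x y := forall eps : R, 0 < eps -> exists del, 0 < del /\ forall h, 0 < h -> h < del ->
  ~ (X (x + h *: v) /\ (X x /\ ~ (g (x + h *: v) - g x - y * h <= eps * h /\
     - (eps * h) <= g (x + h *: v) - g x - y * h))).
have HQ x : X x -> forall y, y = 'D_v g x <-> Q x y.
  move=> Xx; have dx := dg x Xx; have {}dx : (fun h : R => h^-1 *: (g (h *: v + x) - g x)) @ 0^' --> 'D_v g x by [].
  have near_h eps : 0 < eps -> exists2 del : R, 0 < del & forall h, 0 < h -> h < del ->
      X (x + h *: v) /\ `|g (x + h *: v) - g x - 'D_v g x * h| <= eps * h.
    move=> e0; move/cvgrPdist_le : dx => /(_ _ e0).
    move=> -[d1 /= d10 H1].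
    have Xn : \forall h \near (0 : R), X (x + h *: v).
      have : (fun h : R => x + h *: v) @ (0 : R) --> x + 0 *: v.
        by apply: cvgD; [exact: cvg_cst|apply: cvgZr_tmp; exact: cvg_id].
      by rewrite scale0r addr0; apply; apply: open_nbhs_nbhs; split.
    case: Xn => d2 /= d20 H2.
    exists (Num.min d1 d2); first by rewrite lt_min d10 d20.
    move=> h h0; rewrite lt_min => /andP[hd1 hd2]; split.
      by apply: H2 => /=; rewrite sub0r normrN gtr0_norm.
    have := H1 h; rewrite /= sub0r normrN gtr0_norm // => /(_ hd1 (lt0r_neq0 h0)).
    rewrite [h *: v + x]addrC ler_norml => /andP[a1 a2].
    have e1 : h^-1 * (g (x + h *: v) - g x) * h = g (x + h *: v) - g x.
      by rewrite mulrAC mulVf ?mul1r ?lt0r_neq0.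
    move: (ler_wpM2r (ltW h0) a1) (ler_wpM2r (ltW h0) a2).
    by rewrite !mulrBl e1 ler_norml => b1 b2; apply/andP; split; lra.
  move=> y; split=> [->|hQ].
    move=> eps e0; have [del d0 H] := near_h _ e0; exists del; split=> // h h0 hd.
    by move=> [_ [_]]; apply; have [_] := H h h0 hd; rewrite ler_norml => /andP[].
  apply/eqP; rewrite -subr_eq0 -normr_eq0 eq_le normr_ge0 andbT.
  apply/ler_addgt0Pl => eps e0; rewrite addr0.
  have e20 : 0 < eps / 2 by rewrite divr_gt0.
  have [d1 d10 H1] := near_h _ e20; have [d2 [d20 H2]] := hQ _ e20.
  pose h := Num.min d1 d2 / 2.
  have m0 : 0 < Num.min d1 d2 by rewrite lt_min d10 d20.
  have h0 : 0 < h by rewrite divr_gt0.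
  have : h < Num.min d1 d2 by rewrite ltr_pdivrMr // ltr_pMr // ltr1n.
  rewrite lt_min => /andP[hd1 hd2].
  have [Xh] := H1 h h0 hd1; rewrite ler_norml => /andP[a1 a2].
  have := H2 h h0 hd2 => H.
  have [b1 b2] : g (x + h *: v) - g x - y * h <= eps / 2 * h /\
     - (eps / 2 * h) <= g (x + h *: v) - g x - y * h.
    by apply: contrapT => C; apply: H.
  rewrite -(ler_pM2r h0) -{1}(gtr0_norm h0) -normrM mulrBl ler_norml.
  by apply/andP; split; lra.
have V (i : 'I_n) : polyterm (fun e : nat -> R => e i) by apply: polyterm_var.
have lt_upd e j t (i : 'I_n) : (n <= j)%N -> upd e j t i = e i.
  by move=> nj; have := congr1 (fun z : 'rV_n => z 0 i) (row_upd e t nj); rewrite !mxE.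
pose T (i : 'I_n) (e : nat -> R) := e i + e n.+3 * v 0 i.
have hT i : polyterm (T i).
  by apply: polytermD => //; apply: polytermM; [apply: polyterm_var|apply: polyterm_cst].
(* Layout of the variables: below n the point x, then y, eps, del, h, g(x + h v) and g(x). *)
have d0 : definable (fun e => ~ (e n.+4 - e n.+4.+1 - e n * e n.+3 <= e n.+1 * e n.+3 /\
     - (e n.+1 * e n.+3) <= e n.+4 - e n.+4.+1 - e n * e n.+3)).
  apply: definable_not; apply: definable_and; apply: definable_le;
  by repeat (apply: polytermB || apply: polytermN || apply: polytermM || apply: polyterm_var).
have d1 := definable_app hg V (fun e t i => lt_upd e n.+4.+1 t i (leqW (leqW (leqW (leqW (leqnSn n)))))) d0.
have Tu e t i : T i (upd e n.+4 t) = T i e.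
  rewrite /T lt_upd; last by lia.
  by rewrite /upd (_ : (n.+3 == n.+4) = false) //; lia.
have d2 := definable_not (definable_app hg hT Tu d1).
have d3 := definable_imp (definable_lt (polyterm_cst 0) (polyterm_var n.+3))
             (definable_imp (definable_lt (polyterm_var n.+3) (polyterm_var n.+2)) d2).
have d4 := definable_and (definable_lt (polyterm_cst 0) (polyterm_var n.+2)) (definable_all n.+3 d3).
have d5 := definable_all n.+1 (definable_imp (definable_lt (polyterm_cst 0) (polyterm_var n.+1)) (definable_ex n.+2 d4)).
have sX : semialgebraic X.
  apply: semialgebraic_definable.
  have dt := definable_app hg V (fun e t i => lt_upd e n.+1 t i (leqnSn n)) definable_true.
  by apply: definable_ext dt => e; split=> [[]|].
apply: definable_ext (definable_and (definable_semialgebraic sX V) d5) => e /=.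
set x := \row_i e i.
have us e' k t : upd e' k t k = t by rewrite /upd eqxx.
have F eps del t : let e3 := upd (upd (upd e n.+1 eps) n.+2 del) n.+3 t in
   [/\ \row_i T i e3 = x + t *: v, forall w, \row_(i < n) upd e3 n.+4 w i = x,
       e3 n.+2 = del, e3 n.+3 = t &
     forall w w', let e5 := upd (upd e3 n.+4 w) n.+4.+1 w' in
       [/\ e5 n.+4 = w, e5 n.+4.+1 = w', e5 n = e n, e5 n.+3 = t & e5 n.+1 = eps]].
  have ud e' j k t' : (k == j) = false -> upd e' j t' k = e' k by rewrite /upd => ->.
  split.
  - apply/rowP => i; rewrite !mxE /T us mxE; have := ltn_ord i => ni.
    by rewrite !ud //; lia.
  - move=> w; apply/rowP => i; rewrite !mxE; have := ltn_ord i => ni.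
    by rewrite !ud //; lia.
  - by rewrite ud ?us //; lia.
  - by rewrite us.
  - move=> w w' e5; rewrite /e5; split; rewrite ?us //.
    + by rewrite ud ?us //; lia.
    + by rewrite !ud //; lia.
    + by rewrite ud 1?ud ?us //; lia.
    + by rewrite 4?ud ?us //; lia.
split=> [[Xx h]|[Xx /(HQ _ Xx _) hQ]]; split=> //.
  apply/(HQ _ Xx _) => eps e0.
  have := h eps; rewrite us => /(_ e0) [del].
  rewrite us => -[d0' {}h]; exists del; split=> // t t0 td.
  have := h t; have /= [-> f2 -> -> f5] := F eps del t.
  rewrite f2; set e5 := upd _ _ _; rewrite /e5.
  by have /= [-> -> -> -> ->] := f5 (g (x + t *: v)) (g x); apply.
move=> eps; rewrite us => e0.
have [del [d0' h]] := hQ _ e0; exists del; split; first by rewrite us.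
move=> t; have /= [-> f2 -> -> f5] := F eps del t.
rewrite f2; set e5 := upd _ _ _; rewrite /e5.
by have /= [-> -> -> -> ->] := f5 (g (x + t *: v)) (g x); apply: h.
Qed.

End Definable.

(** * Bounds on iterated partial and Lie derivatives *)

Section DifferentialEstimate.
Context {R : realType} {V W : normedModType R}.

Lemma littleo_differentiable (f : V -> W) (df : {linear V -> W}) x : continuous df ->
  (forall eps : R, 0 < eps ->
     \forall h \near (0 : V), `|f (h + x) - f x - df h| <= eps * `|h|) ->
  differentiable f x /\ 'd f x = df :> (V -> W).
Proof.
move=> cdf H.
have E : f \o shift x = cst (f x) + df +o_ (0 : V) id.
  apply/eqaddoP => eps /H; apply: filterS => h.
  by rewrite /= !fctE /= opprD addrA.
have D := diff_unique cdf E; split=> //.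
by apply/diff_locallyP; rewrite D.
Qed.

Lemma differentiable_littleo (f : V -> W) x : differentiable f x -> forall eps : R, 0 < eps ->
  \forall h \near (0 : V), `|f (h + x) - f x - 'd f x h| <= eps * `|h|.
Proof.
move=> /diff_locallyP[_ /eqaddoP E] eps /E; apply: filterS => h.
by rewrite /= !fctE /= opprD addrA.
Qed.

Lemma near_eq_differentiable (f g : V -> W) x : (\forall y \near x, f y = g y) ->
  differentiable f x -> differentiable g x.
Proof.
move=> nr df.
suff [] : differentiable g x /\ 'd g x = 'd f x :> (V -> W) by [].
apply: littleo_differentiable => [|eps e0]; first exact: diff_continuous.
have nr2 : \forall y \near (0 : V), f (y + x) = g (y + x).
  have : (fun y => y + x) @ (0 : V) --> 0 + x by apply: cvgD => //; exact: cvg_cst.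
  by rewrite add0r => /(_ _ nr).
have fg : f x = g x by apply: nbhs_singleton nr.
apply: filterS2 nr2 (differentiable_littleo df e0) => h.
by rewrite fg => ->.
Qed.

End DifferentialEstimate.

Section Calculus.
Context {R : realType} {n : nat}.
Implicit Types (g : 'rV[R]_n -> R) (x v : 'rV[R]_n) (B : set 'rV[R]_n).

Lemma coord_le_norm x i : `|x 0 i| <= `|x|.
Proof.
rewrite [leRHS]/Num.norm/= mx_normrE.
by apply: (le_bigmax _ (fun i : 'I_1 * 'I_n => `|x i.1 i.2|) (0, i)).
Qed.

Lemma norm_le_coord x (c : R) : 0 <= c -> (forall i, `|x 0 i| <= c) -> `|x| <= c.
Proof.
move=> c0 h; rewrite [leLHS]/Num.norm/= mx_normrE.
by apply/bigmax_leP; split=> // -[i j] _; rewrite (ord1 i) /=.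
Qed.

Lemma norm_lt_coord x (c : R) : 0 < c -> (forall i, `|x 0 i| < c) -> `|x| < c.
Proof.
move=> c0 h; rewrite [ltLHS]/Num.norm/= mx_normrE.
by apply/bigmax_ltP; split=> // -[i j] _; rewrite (ord1 i) /=.
Qed.

Lemma in_ball x y (r : R) : ball x r y <-> `|x - y| < r.
Proof. by rewrite mx_norm_ball. Qed.

Lemma derive_partial g x v : differentiable g x ->
  'D_v g x = \sum_i v 0 i * 'D_('e_i) g x.
Proof.
move=> dg; rewrite deriveE // {1}(row_sum_delta v) linear_sum /=.
by apply: eq_bigr => i _; rewrite linearZ /= deriveE.
Qed.

Lemma derive_along (x : R -> 'rV[R]_n) g (t : R) v : differentiable g (x t) ->
  is_derive t (1 : R) x v -> is_derive t (1 : R) (g \o x) ('D_v g (x t)).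
Proof.
move=> dg dx; have d1 : differentiable x t.
  by apply/derivable1_diffP; case: dx.
have dc : differentiable (g \o x) t by apply: differentiable_comp.
apply: DeriveDef; first by apply/derivable1_diffP.
have -> : 'D_1 (g \o x) t = 'd (g \o x) t 1 by apply: deriveE.
rewrite diff_comp //=; have <- : 'D_1 x t = 'd x t 1 by apply: deriveE.
by case: dx => _ ->; rewrite deriveE.
Qed.

Definition dlin (l : 'I_n -> R) (h : 'rV[R]_n) : R := \sum_i h 0 i * l i.

Lemma dlin_is_linear l : linear (dlin l).
Proof.
move=> a u v; rewrite /dlin scaler_sumr -big_split /=; apply: eq_bigr => i _.
by rewrite !mxE mulrDl -mulrA.
Qed.
HB.instance Definition _ l := GRing.isLinear.Build R 'rV[R]_n R _ (dlin l) (dlin_is_linear l).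

Lemma dlin_le l h : `|dlin l h| <= (\sum_i `|l i|) * `|h|.
Proof.
rewrite mulr_suml (le_trans (ler_norm_sum _ _ _)) //; apply: ler_sum => i _.
by rewrite normrM mulrC ler_wpM2l // coord_le_norm.
Qed.

Lemma dlin_continuous l : continuous (dlin l).
Proof.
apply: bounded_linear_continuous; apply/linear_boundedP.
have H : \forall M \near +oo, \sum_i `|l i| <= M.
  by apply: nbhs_pinfty_ge; rewrite num_real.
by apply: filterS H => M lM h; apply: le_trans (dlin_le l h) _; apply: ler_wpM2r.
Qed.

(** A quadratic error is what both limits of polynomials and implicit functions deliver: such bounds
    survive limits and come from second-order expansions. *)
Lemma tangent_differentiable g x l (K del : R) : 0 < del ->
  (forall h, `|h| < del -> `|g (x + h) - g x - dlin l h| <= K * `|h| ^+ 2) ->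
  differentiable g x /\ forall v, 'D_v g x = dlin l v.
Proof.
move=> del0 H.
have [] := @littleo_differentiable _ _ _ g (dlin l) x (@dlin_continuous l).
  move=> eps eps0.
  pose r := Num.min del (eps / (`|K| + 1)).
  have K1 : 0 < `|K| + 1 by rewrite ltr_wpDl.
  have r0 : 0 < r by rewrite lt_min del0 divr_gt0.
  near=> h.
  have hr : `|h| < r.
    near: h; apply/nbhs_ballP; exists r => // y; rewrite mx_norm_ball /ball_ /= sub0r normrN //.
  move: hr; rewrite lt_min => /andP[hd he].
  have := H h hd; rewrite [x + h]addrC => /le_trans; apply.
  rewrite expr2 mulrA ler_wpM2r //.
  apply: le_trans (_ : (`|K| + 1) * `|h| <= _).
    by rewrite ler_wpM2r // (le_trans (ler_norm K)) // lerDl.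
  by rewrite mulrC -ler_pdivlMr // ltW.
by move=> dg D; split=> // v; rewrite deriveE // D.
Unshelve. all: by end_near.
Qed.

Definition pd (i : 'I_n) g : 'rV[R]_n -> R := fun x => 'D_('e_i) g x.

Definition pds (w : seq 'I_n) g : 'rV[R]_n -> R := foldr pd g w.

Lemma pds_rcons w i g : pds (rcons w i) g = pds w (pd i g).
Proof. by rewrite /pds foldr_rcons. Qed.

Lemma near_open B (P : 'rV[R]_n -> Prop) x : open B -> B x ->
  (forall y, B y -> P y) -> \forall y \near x, P y.
Proof. by move=> oB Bx h; apply: filterS h _; apply: open_nbhs_nbhs. Qed.

Lemma derive_eq_on B g1 g2 v : open B -> eq_on B g1 g2 ->
  eq_on B (fun x => 'D_v g1 x) (fun x => 'D_v g2 x).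
Proof.
move=> oB h x Bx; have [->|v0] := eqVneq v 0; first by rewrite !derive0.
by apply: near_eq_derive => //; apply: near_open oB Bx _.
Qed.

Lemma lie_eq_on B F g1 g2 : open B -> eq_on B g1 g2 ->
  eq_on B (lie F g1) (lie F g2).
Proof. by move=> oB h x Bx; apply: derive_eq_on h x Bx. Qed.

Lemma pds_eq_on B w g1 g2 : open B -> eq_on B g1 g2 -> eq_on B (pds w g1) (pds w g2).
Proof. by move=> oB h; elim: w => //= i w IH; apply: derive_eq_on. Qed.

Lemma differentiable_eq_on B g1 g2 x : open B -> eq_on B g1 g2 -> B x ->
  differentiable g1 x -> differentiable g2 x.
Proof.
move=> oB h Bx; apply: near_eq_differentiable; exact: near_open oB Bx _.
Qed.

(** The cut-off k allows induction on the order: the bound for g up to order k + 1 is that for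
    [pd i g] up to order k with the majorant shifted by one. *)
Definition majk k B (b : nat -> R) g : Prop := forall w x, (size w <= k)%N -> B x ->
  differentiable (pds w g) x /\ `|pds w g x| <= b (size w).

Definition maj B (b : nat -> R) g : Prop := forall k, majk k B b g.

Lemma maj0 B b g x : maj B b g -> B x -> differentiable g x /\ `|g x| <= b 0%N.
Proof. by move=> /(_ 0%N) m /(m [::]); apply. Qed.

Lemma maj_pds B b g w x : maj B b g -> B x ->
  differentiable (pds w g) x /\ `|pds w g x| <= b (size w).
Proof. by move=> /(_ (size w)) m Bx; apply: m. Qed.

Lemma majk_eq_on k B b g1 g2 : open B -> eq_on B g1 g2 -> majk k B b g1 -> majk k B b g2.
Proof.
move=> oB h m w x wk Bx; have [d l] := m w x wk Bx.
rewrite -(pds_eq_on w oB h Bx); split=> //.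
exact: differentiable_eq_on (pds_eq_on w oB h) Bx d.
Qed.

Lemma maj_eq_on B b g1 g2 : open B -> eq_on B g1 g2 -> maj B b g1 -> maj B b g2.
Proof. by move=> oB h m k; apply: majk_eq_on h (m k). Qed.

Lemma maj_le B b b' g : (forall k, b k <= b' k) -> maj B b g -> maj B b' g.
Proof. by move=> h m k w x wk Bx; have [d l] := m k w x wk Bx; split=> //; apply: le_trans l _. Qed.

Lemma maj_sub B B' b g : B' `<=` B -> maj B b g -> maj B' b g.
Proof. by move=> h m k w x wk /h; apply: m. Qed.

Lemma maj_pd B b g i : maj B b g -> maj B (fun k => b k.+1) (pd i g).
Proof.
move=> m k w x wk Bx; rewrite -pds_rcons.
by have := m k.+1 (rcons w i) x; rewrite size_rcons; apply.
Qed.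

Lemma majk_step k B b g : (forall x, B x -> differentiable g x /\ `|g x| <= b 0%N) ->
  (forall i, majk k B (fun j => b j.+1) (pd i g)) -> majk k.+1 B b g.
Proof.
move=> h0 h w; case/lastP: w => [|w i] x wk Bx; first exact: h0.
by rewrite pds_rcons size_rcons; apply: h => //; rewrite size_rcons in wk.
Qed.

Lemma majk0 B b g : (forall x, B x -> differentiable g x /\ `|g x| <= b 0%N) -> majk 0 B b g.
Proof. by move=> h [|//] x _; apply: h. Qed.

Lemma majkD k B b1 b2 g1 g2 : open B -> majk k B b1 g1 -> majk k B b2 g2 ->
  majk k B (fun j => b1 j + b2 j) (fun x => g1 x + g2 x).
Proof.
move=> oB; elim: k b1 b2 g1 g2 => [|k IH] b1 b2 g1 g2 m1 m2.
  apply: majk0 => x Bx; have [d1 l1] := m1 [::] x isT Bx; have [d2 l2] := m2 [::] x isT Bx.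
  by split; [apply: differentiableD|apply: le_trans (ler_normD _ _) (lerD l1 l2)].
apply: majk_step => [x Bx|i].
  have [d1 l1] := m1 [::] x isT Bx; have [d2 l2] := m2 [::] x isT Bx.
  by split; [apply: differentiableD|apply: le_trans (ler_normD _ _) (lerD l1 l2)].
have E : eq_on B (fun y => pd i g1 y + pd i g2 y) (pd i (fun y => g1 y + g2 y)).
  move=> y By; have [d1 _] := m1 [::] y isT By; have [d2 _] := m2 [::] y isT By.
  by rewrite /pd deriveD //; apply: diff_derivable.
have sh b g : majk k.+1 B b g -> majk k B (fun j => b j.+1) (pd i g).
  by move=> m w x wk Bx; have := m (rcons w i) x; rewrite pds_rcons size_rcons; apply.
exact: majk_eq_on oB E (IH _ _ _ _ (sh _ _ m1) (sh _ _ m2)).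
Qed.

Lemma majD B b1 b2 g1 g2 : open B -> maj B b1 g1 -> maj B b2 g2 ->
  maj B (fun k => b1 k + b2 k) (fun x => g1 x + g2 x).
Proof. by move=> oB m1 m2 k; apply: majkD. Qed.

(** The binomial convolution, sum over j of C(k, j) b1(j) b2(k - j), in the recursive form that the
    Leibniz rule yields. *)
Fixpoint conv (b1 b2 : nat -> R) k : R :=
  if k is k'.+1 then conv (fun j => b1 j.+1) b2 k' + conv b1 (fun j => b2 j.+1) k'
  else b1 0%N * b2 0%N.

Lemma conv_ext b1 b1' b2 b2' k : b1 =1 b1' -> b2 =1 b2' -> conv b1 b2 k = conv b1' b2' k.
Proof.
by elim: k b1 b1' b2 b2' => [|k IH] b1 b1' b2 b2' h1 h2 /=; rewrite ?h1 ?h2 //;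
  congr (_ + _); apply: IH => // j.
Qed.

Lemma majkM k B b1 b2 g1 g2 : open B -> majk k B b1 g1 -> majk k B b2 g2 ->
  majk k B (conv b1 b2) (fun x => g1 x * g2 x).
Proof.
move=> oB; elim: k b1 b2 g1 g2 => [|k IH] b1 b2 g1 g2 m1 m2.
  apply: majk0 => x Bx; have [d1 l1] := m1 [::] x isT Bx; have [d2 l2] := m2 [::] x isT Bx.
  by split; [apply: differentiableM|rewrite normrM ler_pM].
apply: majk_step => [x Bx|i].
  have [d1 l1] := m1 [::] x isT Bx; have [d2 l2] := m2 [::] x isT Bx.
  by split; [apply: differentiableM|rewrite normrM ler_pM].
have E : eq_on B (fun y => pd i g1 y * g2 y + g1 y * pd i g2 y) (pd i (fun y => g1 y * g2 y)).
  move=> y By; have [d1 _] := m1 [::] y isT By; have [d2 _] := m2 [::] y isT By.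
  rewrite /pd deriveM; [|exact: diff_derivable..].
  by rewrite -![_ *: _]/(_ * _) addrC [g2 y * _]mulrC.
have sh b g : majk k.+1 B b g -> majk k B (fun j => b j.+1) (pd i g).
  by move=> m w x wk Bx; have := m (rcons w i) x; rewrite pds_rcons size_rcons; apply.
have wk b g : majk k.+1 B b g -> majk k B b g.
  by move=> m w x wk Bx; apply: m => //; apply: leqW.
exact: majk_eq_on oB E (majkD oB (IH _ _ _ _ (sh _ _ m1) (wk _ _ m2)) (IH _ _ _ _ (wk _ _ m1) (sh _ _ m2))).
Qed.

Lemma majM B b1 b2 g1 g2 : open B -> maj B b1 g1 -> maj B b2 g2 ->
  maj B (conv b1 b2) (fun x => g1 x * g2 x).
Proof. by move=> oB m1 m2 k; apply: majkM. Qed.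

Lemma majk_cst k B b c : `|c| <= b 0%N -> (forall j, 0 <= b j) -> majk k B b (fun=> c).
Proof.
elim: k b c => [|k IH] b c cb b0; [apply: majk0|apply: majk_step] => [x Bx|x Bx|i];
  do ?by split=> //; apply: differentiable_cst.
have -> : pd i (fun=> c) = (fun=> 0) by apply/funext => x; rewrite /pd derive_cst.
by apply: IH => //; rewrite normr0.
Qed.

Lemma maj_cst B b c : `|c| <= b 0%N -> (forall j, 0 <= b j) -> maj B b (fun=> c).
Proof. by move=> *; move=> k; apply: majk_cst. Qed.

Lemma derive_coord x v i : 'D_v (fun y : 'rV[R]_n => y 0 i) x = v 0 i.
Proof.
have dx := @derivable_id _ _ x v.
by have := derive_mx dx; rewrite derive_id => /matrixP/(_ 0 i); rewrite mxE.
Qed.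

Lemma maj_coord B b i : (forall x, B x -> `|x 0 i| <= b 0%N) -> 1 <= b 1%N ->
  (forall j, 0 <= b j) -> maj B b (fun x => x 0 i).
Proof.
move=> h0 h1 hb k; have h x : B x -> differentiable (fun x : 'rV[R]_n => x 0 i) x /\ `|x 0 i| <= b 0%N.
  by move=> Bx; split; [apply: differentiable_coord|apply: h0].
case: k => [|k]; [exact: majk0|apply: majk_step => // j].
have -> : pd j (fun x => x 0 i) = fun=> ('e_j : 'rV[R]_n) 0 i by apply/funext => x; rewrite /pd derive_coord.
apply: majk_cst => //; rewrite mxE eqxx /=; case: (i == j) => //=; rewrite ?normr0 ?normr1 //.
Qed.

Lemma maj_sum B b I (r : seq I) (g : I -> 'rV[R]_n -> R) : open B ->
  (forall i, maj B b (g i)) ->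
  maj B (fun k => (size r)%:R * b k) (fun x => \sum_(i <- r) g i x).
Proof.
move=> oB h; elim: r => [|i r IH].
  rewrite (_ : (fun x => _) = fun=> 0); last by apply/funext => x; rewrite big_nil.
  by apply: maj_cst => [|j]; rewrite ?normr0 mul0r.
rewrite (_ : (fun x => _) = fun x => g i x + \sum_(j <- r) g j x); last by apply/funext => x; rewrite big_cons.
by apply: maj_le (majD oB (h i) IH) => k /=; rewrite -natr1 mulrDl mul1r addrC.
Qed.

(* Rising factorials: the derivatives at 0 of the majorant (1 - s)^-p. *)
Fixpoint rf (p k : nat) : nat := if k is k'.+1 then (p * rf p.+1 k')%N else 1%N.

Lemma rf_fact p k : (rf p.+1 k * p`! = (p + k)`!)%N.
Proof.
elim: k p => [|k IH] p; first by rewrite mul1n addn0.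
rewrite /= -/(rf p.+2 k) mulnAC -factS mulnC IH addSnnS //.
Qed.

Lemma rf1 k : rf 1 k = k`!.
Proof. by have := rf_fact 0 k; rewrite muln1 add0n. Qed.

(** The identity (1 - C s)^-p (1 - C s)^-q = (1 - C s)^-(p + q), read off on derivatives at s =
    0. *)
Lemma conv_rf A1 A2 C p q k :
  conv (fun j => A1 * C ^+ j * (rf p j)%:R) (fun j => A2 * C ^+ j * (rf q j)%:R) k =
  A1 * A2 * C ^+ k * (rf (p + q) k)%:R.
Proof.
elim: k A1 A2 p q => [|k IH] A1 A2 p q /=; first by rewrite !expr0 !mulr1.
have E A p' j : A * C ^+ j.+1 * (p' * rf p'.+1 j)%:R = (A * C * p'%:R) * C ^+ j * (rf p'.+1 j)%:R.
  rewrite exprS natrM; lra.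
rewrite (conv_ext _ (E A1 p) (frefl _)) (conv_ext _ (frefl _) (E A2 q)) !IH.
rewrite addSn addnS exprS natrM natrD; lra.
Qed.

(** The majorant is the sequence of derivatives at s = 0 of M / (1 - C s). *)
Definition gmaj B (M C : R) g : Prop := maj B (fun k => M * C ^+ k * (k`!)%:R) g.

Lemma lie_sum B b (F : 'rV[R]_n -> 'rV[R]_n) g : maj B b g ->
  eq_on B (fun x => \sum_i F x 0 i * pd i g x) (lie F g).
Proof. by move=> m x Bx; rewrite /lie derive_partial //; case: (maj0 m Bx). Qed.

(** In terms of the majorant (1 - C s)^-p, a partial derivative raises the exponent by one and
    brings out C p, the factor [F x 0 i] raises it once more, and the sum over the coordinates costs
    a factor n. *)
Lemma maj_lie B Mf C Mg p (F : 'rV[R]_n -> 'rV[R]_n) g : open B -> (forall i, gmaj B Mf C (fun x => F x 0 i)) ->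
  maj B (fun k => Mg * C ^+ k * (rf p k)%:R) g ->
  maj B (fun k => n%:R * Mf * C * p%:R * Mg * C ^+ k * (rf p.+2 k)%:R) (lie F g).
Proof.
move=> oB hF hg; apply: (maj_eq_on oB (lie_sum F hg)).
have h i : maj B (fun k => Mf * (Mg * C * p%:R) * C ^+ k * (rf p.+2 k)%:R) (fun x => F x 0 i * pd i g x).
  have hF' : maj B (fun k => Mf * C ^+ k * (rf 1 k)%:R) (fun x => F x 0 i).
    by apply: maj_le (hF i) => k; rewrite rf1.
  have hg' : maj B (fun k => (Mg * C * p%:R) * C ^+ k * (rf p.+1 k)%:R) (pd i g).
    apply: maj_le (maj_pd i hg) => k /=; rewrite exprS natrM.
    by rewrite le_eqVlt; apply/orP; left; apply/eqP; lra.
  by apply: maj_le (majM oB hF' hg') => k; rewrite conv_rf add1n.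
apply: maj_le (maj_sum (index_enum 'I_n) oB h) => k /=.
have -> : size (index_enum 'I_n) = n by rewrite /index_enum -enumT size_enum_ord.
by rewrite le_eqVlt; apply/orP; left; apply/eqP; lra.
Qed.

Definition lies (Fs : seq ('rV[R]_n -> 'rV[R]_n)) g : 'rV[R]_n -> R := foldr (@lie R n) g Fs.

(* The majorants of the k-th iterated Lie derivative are the Taylor coefficients
   of a multiple of (1 - C s)^-(2k+1). *)
Lemma maj_lies B Mf C Mg (Fam : set ('rV[R]_n -> 'rV[R]_n)) g : open B -> 0 <= C -> 0 <= Mf -> 0 <= Mg ->
  (forall F, Fam F -> forall i, gmaj B Mf C (fun x => F x 0 i)) -> gmaj B Mg C g ->
  forall Fs, (forall F, List.In F Fs -> Fam F) ->
  maj B (fun k => Mg * (2 * n%:R * Mf * C) ^+ size Fs * ((size Fs)`!)%:R * C ^+ k * (rf (size Fs).*2.+1 k)%:R)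
    (lies Fs g).
Proof.
move=> oB C0 Mf0 Mg0 hF hg; elim=> [|F Fs IH] h /=.
  by apply: maj_le hg => k; rewrite expr0 !mulr1 rf1.
have {}IH := IH (fun F' hF' => h F' (or_intror hF')).
have := maj_lie oB (hF F (h F (or_introl erefl))) IH.
apply: maj_le => k; rewrite doubleS; apply: ler_wpM2r => //; apply: ler_wpM2r; first exact: exprn_ge0.
set s := size Fs; rewrite exprS factS natrM.
have D0 : 0 <= 2 * n%:R * Mf * C by rewrite !mulr_ge0.
(* The exponent 2s + 1 brought out by one more Lie derivative is bounded by 2 (s + 1): this is the
   origin of the factor 2 and of the factorial in the bound. *)
have E : (s.*2.+1)%:R <= 2 * (s.+1)%:R :> R by rewrite -natrM ler_nat; lia.
set D := 2 * n%:R * Mf * C in D0 *.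
have Z0 : 0 <= n%:R * Mf * C * (Mg * D ^+ s * s`!%:R) by rewrite !mulr_ge0 // exprn_ge0.
have := ler_wpM2l Z0 E; rewrite /D; set DD := (_ ^+ s); lra.
Qed.

Lemma lies_bound B Mf C Mg (Fam : set ('rV[R]_n -> 'rV[R]_n)) g : open B -> 0 <= C -> 0 <= Mf -> 0 <= Mg ->
  (forall F, Fam F -> forall i, gmaj B Mf C (fun x => F x 0 i)) -> gmaj B Mg C g ->
  forall Fs, (forall F, List.In F Fs -> Fam F) -> forall x, B x ->
  differentiable (lies Fs g) x /\
  `|lies Fs g x| <= Mg * (2 * n%:R * Mf * C) ^+ size Fs * ((size Fs)`!)%:R.
Proof.
move=> oB C0 Mf0 Mg0 hF hg Fs h x Bx.
by have [d] := maj0 (maj_lies oB C0 Mf0 Mg0 hF hg h) Bx; rewrite expr0 !mulr1.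
Qed.

End Calculus.

(** * Quasi-analyticity on an interval *)

(** P and its negation both spread over the trace of each neighbourhood on A, so the points of A
    where P holds are relatively open and relatively closed. *)
Lemma connected_locally_constant (T : topologicalType) (A : set T) (P : T -> Prop) :
  connected A ->
  (forall x, A x -> exists2 U, nbhs x U & forall y z, A y -> A z -> U y -> U z -> P y -> P z) ->
  forall x0 x, A x0 -> A x -> P x0 -> P x.
Proof.
move=> cA loc x0 x Ax0 Ax Px0.
have E : A `&` P = A; last by have : A x by []; rewrite -E => -[].
apply: cA.
- by exists x0.
- exists (interior [set z | A z -> P z]); first exact: open_interior.
  apply/seteqP; split=> [y [Ay Py]|y [Ay iy]]; split=> //; last exact: (interior_subset iy).
  have [U nU h] := loc y Ay; apply: filterS (nU) => z Uz Az.
  by apply: h Py => //; apply: nbhs_singleton.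
- exists (~` interior [set z | A z -> ~ P z]); first by apply: open_closedC; exact: open_interior.
  apply/seteqP; split=> [y [Ay Py]|y [Ay iy]]; split=> //.
    by move=> /interior_subset /(_ Ay).
  apply: contrapT => nP; apply: iy.
  have [U nU h] := loc y Ay; apply: filterS (nU) => z Uz Az Pz; apply: nP.
  by apply: h Pz => //; apply: nbhs_singleton.
Qed.

Lemma within_continuousP (R : realType) (V : normedModType R) (A : set R) (f : R -> V) :
  {within A, continuous f} <-> (forall x, A x -> forall eps : R, 0 < eps ->
    exists2 del : R, 0 < del & forall y, A y -> `|x - y| < del -> `|f x - f y| < eps).
Proof.
split=> [/subspace_continuousP h x Ax eps e0|h].
  have /cvgrPdist_lt/(_ _ e0) := h x Ax.
  rewrite near_withinE => -[del /= d0 hd]; exists del => // y Ay xy.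
  exact: hd.
apply/subspace_continuousP => x Ax; apply/cvgrPdist_lt => eps e0.
rewrite near_withinE; have [del d0 hd] := h x Ax _ e0.
by exists del => // y /= xy Ay; apply: hd.
Qed.

Lemma le0_geometric (R : realType) (y K q : R) : 0 <= q < 1 ->
  (forall N, y <= K * q ^+ N) -> y <= 0.
Proof.
move=> /andP[q0 q1] h; apply/ler_addgt0Pl => del d0; rewrite addr0.
have : (fun N => K * q ^+ N) @ \oo --> K * 0.
  by apply: cvgM; [exact: cvg_cst|apply: cvg_expr; rewrite ger0_norm].
rewrite mulr0 => /cvgrPdist_le /(_ _ d0) [N _ /(_ N (leqnn N))] /=.
by rewrite sub0r normrN => /(le_trans (ler_norm _)); exact: le_trans (h N).
Qed.

Section Taylor.
Context {R : realType}.
Implicit Types (f : R -> R) (phi : nat -> R -> R).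

(** Derivatives inside and mere continuity at the endpoints: this is all that a trajectory offers at
    a switching time, and it suffices for the mean value theorem. *)
Definition cder (a b : R) f f' : Prop := {within `[a, b], continuous f} /\
  forall t : R, a < t < b -> is_derive t (1 : R) f (f' t).

Lemma cder_eq a b f g f' g' : (forall t, a <= t <= b -> f t = g t) ->
  (forall t, a < t < b -> f' t = g' t) -> cder a b f f' -> cder a b g g'.
Proof.
move=> h h' [cf df]; split.
  move/within_continuousP : cf => cf; apply/within_continuousP => x xab eps e0.
  have [del d0 hd] := cf x xab _ e0; exists del => // y yab xy.
  by rewrite -!h; [exact: hd|move: yab; rewrite /= in_itv..|move: xab; rewrite /= in_itv].
move=> t tab; rewrite -h' //; have dt := df t tab.
apply: (@near_eq_is_derive _ _ _ f) => //.
have : t \in `]a, b[ by rewrite in_itv.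
move=> /near_in_itvoo; apply: filterS => y; rewrite in_itv /= => /andP[y1 y2].
by apply: h; rewrite !ltW.
Qed.

Lemma cder_sub a b c d f f' : a <= c -> d <= b -> cder a b f f' -> cder c d f f'.
Proof.
move=> ac db [cf df]; split.
  apply: continuous_subspaceW cf; move=> x /=; rewrite !in_itv /= => /andP[h1 h2].
  by apply/andP; split; [apply: le_trans h1|apply: le_trans db].
by move=> t /andP[h1 h2]; apply: df; rewrite (le_lt_trans ac h1) (lt_le_trans h2 db).
Qed.

Lemma cderT a b f f' : (forall t : R, is_derive t (1 : R) f (f' t)) -> cder a b f f'.
Proof.
move=> h; split=> //; apply: continuous_subspaceT => x.
by apply: differentiable_continuous; apply/derivable1_diffP; case: (h x).
Qed.

Lemma cderD a b f g f' g' : cder a b f f' -> cder a b g g' ->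
  cder a b (fun t => f t + g t) (fun t => f' t + g' t).
Proof.
move=> [cf df] [cg dg]; split; first by move=> x; apply: continuousD; [exact: cf|exact: cg].
by move=> t tab; have := df t tab; have := dg t tab => d1 d2; apply: is_deriveD.
Qed.

Lemma cderN a b f f' : cder a b f f' -> cder a b (fun t => - f t) (fun t => - f' t).
Proof.
move=> [cf df]; split; first by move=> x; apply: continuousN; exact: cf.
by move=> t tab; have := df t tab => d1; apply: is_deriveN.
Qed.

Lemma is_derive_pow k (x c : R) : is_derive x (1 : R) (fun t : R => c * t ^+ k) (c * (k%:R * x ^+ k.-1)).
Proof.
have h : is_derive x (1 : R) (fun t : R => t ^+ k) (k%:R * x ^+ k.-1).
  apply: DeriveDef; first exact: exprn_derivable.
  by rewrite exp_derive /= -![_ *: _]/(_ * _) mulr1.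
exact: (@is_deriveZ _ _ _ _ c _ _ _ h).
Qed.

Lemma cder_pow a b c k : cder a b (fun t => c * t ^+ k.+1 / (k.+1)`!%:R)
  (fun t => c * t ^+ k / k`!%:R).
Proof.
apply: cderT => t; rewrite (_ : (fun t => _) = fun t => (c / (k.+1)`!%:R) * t ^+ k.+1); last first.
  by apply/funext => s; rewrite mulrAC.
apply: is_derive_eq (is_derive_pow _ _ _) _ => /=.
rewrite factS natrM invfM.
have k0 : (k.+1)%:R != 0 :> R by rewrite pnatr_eq0.
have : (k.+1)%:R^-1 * (k.+1)%:R = 1 :> R by rewrite mulVf.
set u := _^-1; set v := (k.+1)%:R; set w := (k`!)%:R^-1; set z := t ^+ k => E.
have -> : c * (u * w) * (v * z) = c * z * w * (u * v) by lra.
by rewrite E mulr1.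
Qed.

Lemma cder_mono a b f f' : cder a b f f' -> (forall t, a < t < b -> 0 <= f' t) ->
  forall s t, a <= s -> s <= t -> t <= b -> f s <= f t.
Proof.
move=> [cf df] f0 s t as_ st tb.
apply: (@ger0_derive1_le_cc _ f a b) => //.
- by move=> x; rewrite in_itv /= => /df [].
- by move=> x; rewrite in_itv /= => xab; rewrite derive1E; case: (df x xab) => _ ->; apply: f0.
- by rewrite in_itv /= as_ (le_trans st tb).
- by rewrite in_itv /= tb (le_trans as_ st).
Qed.

(** Integration of a bound by monotonicity: M t^(k+1) / (k+1)! minus f, and plus f, have nonnegative
    derivatives and vanish at 0. *)
Lemma cder_bound (T : R) f f' (M : R) k : cder 0 T f f' -> f 0 = 0 ->
  (forall t, 0 < t < T -> `|f' t| <= M * t ^+ k / k`!%:R) ->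
  forall t, 0 <= t <= T -> `|f t| <= M * t ^+ k.+1 / (k.+1)`!%:R.
Proof.
move=> cf f0 hb t /andP[t0 tT].
suff H g g' : cder 0 T g g' -> g 0 = 0 -> (forall t, 0 < t < T -> g' t <= M * t ^+ k / k`!%:R) ->
    g t <= M * t ^+ k.+1 / (k.+1)`!%:R.
  rewrite ler_norml lerNl; apply/andP; split.
    apply: H (cderN cf) _ _ => [|s /hb]; first by rewrite f0 oppr0.
    by rewrite ler_norml lerNl => /andP[].
  by apply: H cf _ _ => // s /hb; rewrite ler_norml => /andP[].
move=> cg g0 hg.
have := cder_mono (cderD (cder_pow 0 T M k) (cderN cg)) _ (lexx 0) t0 tT.
rewrite expr0n /= g0 mulr0 mul0r oppr0 addr0 subr_ge0; apply.
by move=> s /hg; rewrite subr_ge0.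
Qed.

(** The remainder of order N + 1 of [phi 0] vanishes at 0 and has the remainder of order N of
    [phi 1] as its derivative, so the bound is integrated N times. *)
Lemma taylor_bound phi (T : R) N (M : R) : (forall j, (j < N)%N -> cder 0 T (phi j) (phi j.+1)) ->
  (forall t, 0 <= t <= T -> `|phi N t| <= M) ->
  forall t, 0 <= t <= T ->
    `|phi 0%N t - \sum_(j < N) phi j 0 * t ^+ j / j`!%:R| <= M * t ^+ N / N`!%:R.
Proof.
elim: N phi => [|N IH] phi h hb t tT.
  by rewrite big_ord0 subr0 expr0 mulr1 divr1 hb.
have {}IH := IH (fun j => phi j.+1) (fun j jN => h j.+1 jN) hb.
pose f t := phi 0%N t - \sum_(j < N.+1) phi j 0 * t ^+ j / j`!%:R.
pose f' t := phi 1%N t - \sum_(j < N) phi j.+1 0 * t ^+ j / j`!%:R.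
have cf : cder 0 T f f'.
  apply: cderD; [exact: h|apply: cderN].
  have cs K : cder 0 T (fun t => \sum_(j < K) phi j.+1 0 * t ^+ j.+1 / j.+1`!%:R)
     (fun t => \sum_(j < K) phi j.+1 0 * t ^+ j / j`!%:R).
    elim: K => [|K IHK].
      have c0 : cder 0 T (fun=> 0) (fun=> 0) by apply: cderT => t'; apply: is_derive_cst.
      by apply: cder_eq c0 => t' _; rewrite big_ord0.
    by apply: cder_eq (cderD IHK (cder_pow 0 T (phi K.+1 0) K)) => t' _; rewrite big_ord_recr.
  have cc : cder 0 T (fun=> phi 0%N 0) (fun=> 0) by apply: cderT => t'; apply: is_derive_cst.
  apply: cder_eq (cderD cc (cs N)) => t' _; last by rewrite add0r.
  by rewrite big_ord_recl /= expr0 mulr1 divr1.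
apply: (cder_bound cf) => //.
- by rewrite /f big_ord_recl big1 ?addr0 /= ?expr0 ?mulr1 ?divr1 ?subrr // => j _; rewrite exprS mul0r mulr0 mul0r.
- by move=> s /andP[s0 sT]; apply: IH; rewrite !ltW.
Qed.

Lemma cder_affine (a b c e : R) f f' : (e = 1 \/ e = - 1) -> cder a b f f' ->
  forall a' b' : R, (forall t, a' <= t <= b' -> a <= c + e * t <= b) ->
  (forall t, a' < t < b' -> a < c + e * t < b) ->
  cder a' b' (fun t => f (c + e * t)) (fun t => e * f' (c + e * t)).
Proof.
move=> ee [cf df] a' b' h1 h2; have ne : `|e| = 1 by case: ee => ->; rewrite ?normrN normr1.
split.
  move/within_continuousP : cf => cf; apply/within_continuousP => x.
  rewrite /= in_itv /= => /h1 xab eps e0.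
  have [|del d0 hd] := cf (c + e * x) _ _ e0; first by rewrite /= in_itv.
  exists del => // y; rewrite /= in_itv /= => /h1 yab xy.
  apply: hd; first by rewrite /= in_itv.
  by rewrite opprD addrACA subrr add0r -mulrBr normrM ne mul1r.
move=> t /h2 tab; have dt := df _ tab.
have da : is_derive t (1 : R) (fun s : R => c + e * s) e.
  have := is_derive_pow 1 t e; rewrite expr0 !mulr1 => d1.
  have d2 : is_derive t (1 : R) (fun=> c) 0 by apply: is_derive_cst.
  by have := is_deriveD d2 d1; rewrite add0r.
by have := @is_derive1_comp _ f (fun s => c + e * s) _ _ _ dt da; rewrite mulrC.
Qed.

(** The expansion at 0 is moved to the base point s by r -> s + e r, where e = -1 reverses time when
    t lies before s. *)
Lemma taylor_vanish phi (a b s : R) N (M : R) : a <= s <= b -> (forall j, cder a b (phi j) (phi j.+1)) ->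
  (forall j, phi j s = 0) -> forall t, a <= t <= b ->
  (forall r, Num.min s t <= r <= Num.max s t -> `|phi N r| <= M) ->
  `|phi 0%N t| <= M * `|t - s| ^+ N / N`!%:R.
Proof.
move=> /andP[as_ sb] h h0 t /andP[at_ tb] hM.
pose e : R := if s <= t then 1 else -1.
have ee : e = 1 \/ e = -1 by rewrite /e; case: ifP; [left|right].
pose psi j r := e ^+ j * phi j (s + e * r).
have e2 : e * e = 1 by case: ee => ->; lra.
have ets : e * `|t - s| = t - s.
  rewrite /e; case: ifPn => st; first by rewrite mul1r ger0_norm ?subr_ge0.
  by rewrite mulN1r ltr0_norm ?opprK // subr_lt0 ltNge.
have mx r : 0 <= r <= `|t - s| -> Num.min s t <= s + e * r <= Num.max s t.
  rewrite /e minEle maxEle; case: ifPn => st /andP[r0].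
    by rewrite ger0_norm ?subr_ge0 // => rl; apply/andP; split; lra.
  rewrite ltr0_norm; last by rewrite subr_lt0 ltNge.
  by move=> rl; apply/andP; split; lra.
have sub r : Num.min s t <= r <= Num.max s t -> a <= r <= b.
  move=> /andP[r1 r2]; apply/andP; split.
    by apply: le_trans r1; rewrite le_min as_ at_.
  by apply: le_trans r2 _; rewrite ge_max sb tb.
have sub' r : 0 < r < `|t - s| -> a < s + e * r < b.
  rewrite /e; case: ifPn => st /andP[r0].
    by rewrite ger0_norm ?subr_ge0 // => rl; apply/andP; split; lra.
  rewrite ltr0_norm; last by rewrite subr_lt0 ltNge.
  by move=> rl; apply/andP; split; lra.
have cpsi j : cder 0 `|t - s| (psi j) (psi j.+1).
  have c1 := cder_affine ee (h j) (fun r hr => sub _ (mx r hr)) sub'.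
  have c0 : forall f f', cder 0 `|t - s| f f' -> cder 0 `|t - s| (fun r => e ^+ j * f r) (fun r => e ^+ j * f' r).
    move=> f f' cf; have : e ^+ j = 1 \/ e ^+ j = -1.
      by elim: (j) => [|i [] IH]; rewrite ?expr0; [left| |] => //; case: ee => ee;
        rewrite exprS IH ee; (try by left; lra); right; lra.
    case=> ->; first by apply: cder_eq cf => r _; rewrite mul1r.
    by apply: cder_eq (cderN cf) => r _; rewrite mulN1r.
  by apply: cder_eq (c0 _ _ c1) => r _ //; rewrite /psi exprSr mulrA.
have := taylor_bound (N := N) (M := M) (fun j _ => cpsi j) _ (t := `|t - s|) _.
have -> : \sum_(j < N) psi j 0 * `|t - s| ^+ j / j`!%:R = 0.
  by rewrite big1 // => j _; rewrite /psi mulr0 addr0 h0 mulr0 !mul0r.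
rewrite subr0 {2}/psi expr0 mul1r ets [s + (t - s)]addrC subrK; apply.
  move=> r hr; rewrite /psi normrM normrX.
  have -> : `|e| = 1 by case: ee => ->; rewrite ?normrN normr1.
  by rewrite expr1n mul1r; apply: hM; apply: mx.
by rewrite normr_ge0 lexx.
Qed.

Lemma fact_add_le i j : ((i + j)`! <= 2 ^ (i + j) * (i`! * j`!))%N.
Proof.
have := bin_fact (leq_addr j i); rewrite addKn => <-.
rewrite leq_mul2r; apply/orP; right.
have := expnDn 1 1 (i + j); rewrite addn1 => ->.
have ij : (i < (i + j).+1)%N by rewrite ltnS leq_addr.
rewrite (bigD1 (Ordinal ij)) //= !exp1n !muln1.
exact: leq_addr.
Qed.

(** If all derivatives vanish at y, Taylor's bound of order N at z is M C^(j+N) (j+N)!/N! |z - y|^N,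
    which tends to 0 for z close to y. Flatness is therefore a locally constant property on the
    interval. *)
Lemma quasianalytic phi (a b t0 : R) : a <= t0 <= b -> (forall j, cder a b (phi j) (phi j.+1)) ->
  (forall t, a <= t <= b -> exists eps M C : R, 0 < eps /\
     forall s j, a <= s <= b -> `|s - t| < eps -> `|phi j s| <= M * C ^+ j * j`!%:R) ->
  (forall j, phi j t0 = 0) -> forall j t, a <= t <= b -> phi j t = 0.
Proof.
move=> t0ab h hb h0 j t tab; move: j.
apply: (@connected_locally_constant _ `[a, b]%classic (fun t => forall j, phi j t = 0)) h0;
  rewrite ?/= ?in_itv //; first exact: segment_connected.
move=> x xab; have [eps [M [C [e0 H]]]] := hb x xab.
pose C' := `|C| + 1; have C'0 : 0 < C' by rewrite ltr_wpDl.
(* Two points of the ball are less than 1/(4C') apart; with (j+N)! <= 2^(j+N) j! N! the bound is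
   then geometric of ratio 2C'/(4C') = 1/2. *)
pose r := Num.min eps (8 * C')^-1; have r0 : 0 < r by rewrite lt_min e0 invr_gt0 mulr_gt0.
exists (ball x r); first exact: nbhsx_ballx.
move=> y z; rewrite /= !in_itv /= => yab zab xy xz hy j.
have H' s i : a <= s <= b -> `|s - x| < r -> `|phi i s| <= `|M| * C' ^+ i * i`!%:R.
  move=> sab; rewrite lt_min => /andP[/(H s i sab)/le_trans + _]; apply.
  apply: ler_wpM2r => //; apply: le_trans (ler_norm _) _; rewrite normrM; apply: ler_wpM2l => //.
  rewrite normrX; apply: lerXn2r; rewrite ?nnegrE ?(ltW C'0) //.
  by rewrite /C' lerDl.
have yz : `|z - y| < (4 * C')^-1.
  have -> : z - y = (x - y) - (x - z) by lra.
  apply: le_lt_trans (ler_normB _ _) _.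
  have : (4 * C')^-1 = (8 * C')^-1 + (8 * C')^-1.
    have n0 : C' != 0 by rewrite gt_eqF.
    rewrite !invfM -mulrDl; congr (_ * _); lra.
  by move=> ->; apply: ltrD; [move: xy|move: xz]; rewrite /ball /= lt_min => /andP[].
apply/eqP; rewrite -normr_le0; apply/ler_addgt0Pl => del d0; rewrite addr0.
pose K := `|M| * (2 * C') ^+ j * j`!%:R.
have main N : `|phi j z| <= K * 2^-1 ^+ N.
  have := @taylor_vanish (fun i => phi (j + i)%N) a b y N (`|M| * C' ^+ (j + N) * (j + N)`!%:R) yab
    (fun i => _) (fun i => hy _) z zab _.
  rewrite addn0 => /(_ _ _)/le_trans; apply.
  - by move=> i; rewrite addnS; apply: h.
  - move=> s /andP[s1 s2]; apply: H'.
      move: yab zab => /andP[ya yb] /andP[za zb]; apply/andP; split.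
        by apply: le_trans s1; rewrite le_min ya za.
      by apply: le_trans s2 _; rewrite ge_max yb zb.
    move: xy xz; rewrite /ball /= !ltr_norml => /andP[u1 u2] /andP[v1 v2].
    move: s1 s2; rewrite minEle maxEle; case: ifP => _ s1 s2; apply/andP; split; lra.
  have F : (j + N)`!%:R <= 2 ^+ (j + N) * (j`!%:R * N`!%:R) :> R.
    by rewrite -natrX -!natrM ler_nat fact_add_le.
  have N0 : 0 < N`!%:R :> R by rewrite ltr0n fact_gt0.
  rewrite ler_pdivrMr //.
  have zy : `|z - y| ^+ N <= ((4 * C')^-1) ^+ N.
    apply: lerXn2r; rewrite ?nnegrE //; last exact: ltW.
    by rewrite invr_ge0 mulr_ge0 // ltW.
  have C'1 : 0 <= C' by apply: ltW.
  have D0 : 0 <= (4 * C')^-1 by rewrite invr_ge0 mulr_ge0.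
  apply: le_trans (_ : `|M| * C' ^+ (j + N) * (2 ^+ (j + N) * (j`!%:R * N`!%:R)) * ((4 * C')^-1) ^+ N <= _).
    apply: ler_pM => //; rewrite ?mulr_ge0 ?exprn_ge0 //.
    by apply: ler_wpM2l => //; rewrite mulr_ge0 // exprn_ge0.
  rewrite /K exprMn !exprD.
  have E : C' ^+ N * 2 ^+ N * ((4 * C')^-1) ^+ N = 2^-1 ^+ N.
    rewrite -!exprMn; congr (_ ^+ _); rewrite invfM.
    have : C' * C'^-1 = 1 by rewrite mulfV ?gt_eqF.
    set u := C'^-1 => Eu; have -> : C' * 2 * (4^-1 * u) = 2 * 4^-1 * (C' * u) by lra.
    rewrite Eu; lra.
  rewrite -E le_eqVlt; apply/orP; left; apply/eqP; lra.
apply: le_trans (_ : 0 <= _); last exact: ltW.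
by apply: (le0_geometric _ main); rewrite invr_ge0 ler0n /= invf_lt1 ?ltr1n.
Qed.

End Taylor.

(** * Power series and Taylor series *)

Section PolynomialDerivatives.
Context {R : realType} {n : nat}.
Implicit Types (P : mpoly n R) (x : 'rV[R]_n) (m : multinom n) (w : seq 'I_n).

Lemma meval_chain k (c : 'I_k -> 'rV[R]_n -> R) (P : mpoly k R) x : (forall j, differentiable (c j) x) ->
  differentiable (fun y => meval (fun j => c j y) P) x /\
  forall v, 'D_v (fun y => meval (fun j => c j y) P) x = \sum_j meval (fun j => c j x) (mderiv j P) * 'D_v (c j) x.
Proof.
move=> dc; pose e (P : mpoly k R) := (fun y : 'rV[R]_n => meval (fun j => c j y) P).
pose ok (P : mpoly k R) := differentiable (e P) x /\
  forall v, 'D_v (e P) x = \sum_j meval (fun j => c j x) (mderiv j P) * 'D_v (c j) x.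
suff H : ok P by apply: H.
have okC a : ok (mpolyC k a).
  rewrite /ok (_ : e _ = fun=> a); last by apply/funext => z; rewrite /e mevalC.
  split=> [|v]; first exact: differentiable_cst.
  by rewrite derive_cst big1 // => j _; rewrite mderivC meval0 mul0r.
have okX i : ok (mpolyX R (mnm1 i)).
  rewrite /ok (_ : e _ = c i); last by apply/funext => z; rewrite /e mevalXU.
  split=> // v; rewrite (bigD1 i) //= big1 ?addr0.
    rewrite mderivX mevalZ mnm1E eqxx (_ : mnm_sub _ _ = mnm0); last by apply/mnmP => l; rewrite mnmBE mnm0E subnn.
    by rewrite mpolyX0 meval1 mulr1 mul1r.
  by move=> j ji; rewrite mderivX mevalZ mnm1E eq_sym (negbTE ji) !mul0r.
have okD (P1 P2 : mpoly k R) : ok P1 -> ok P2 -> ok (P1 + P2).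
  move=> [d1 e1] [d2 e2]; rewrite /ok (_ : e _ = e P1 + e P2); last by apply/funext => z; rewrite /e mevalD.
  split=> [|v]; first exact: differentiableD.
  rewrite deriveD ?e1 ?e2; [|exact: diff_derivable..].
  by rewrite -big_split /=; apply: eq_bigr => j _; rewrite mderivD mevalD mulrDl.
have okM (P1 P2 : mpoly k R) : ok P1 -> ok P2 -> ok (P1 * P2).
  move=> [d1 e1] [d2 e2]; rewrite /ok (_ : e _ = e P1 * e P2); last by apply/funext => z; rewrite /e mevalM.
  split=> [|v]; first exact: differentiableM.
  rewrite deriveM ?e1 ?e2; [|exact: diff_derivable..].
  rewrite -![_ *: _]/(_ * _) !mulr_sumr -big_split /=; apply: eq_bigr => j _.
  rewrite mderivM mevalD !mevalM; set a := meval _ P1; set b := meval _ P2.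
  rewrite -[e P1 x]/a -[e P2 x]/b; set u := meval _ _; set w := meval _ _; set t := derive _ _ _; lra.
rewrite (mpolyE P); apply: big_ind => //; first by have := okC 0; rewrite mpolyC0.
move=> m _; rewrite -mul_mpolyC; apply: (okM) => //; rewrite mpolyXE_id.
apply: big_ind => //; first by have := okC 1; rewrite mpolyC1.
move=> i _; elim: (m i) => [|l IH]; first by rewrite expr0 -mpolyC1.
by rewrite exprS; apply: okM.
Qed.

Lemma meval_partial P x : differentiable (fun y : 'rV[R]_n => meval (y 0) P) x /\
  forall i, 'D_('e_i) (fun y : 'rV[R]_n => meval (y 0) P) x = meval (x 0) (mderiv i P).
Proof.
have [d e] := @meval_chain n (fun j y => y 0 j) P x (fun j => differentiable_coord x 0 j).
split=> // i; rewrite e (bigD1 i) //= big1 => [|j ji]; rewrite derive_coord mxE eqxx /=.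
  by rewrite eqxx mulr1 addr0.
by rewrite (negbTE ji) mulr0.
Qed.

Definition mderivs w P : mpoly n R := foldr (fun i => mderiv i) P w.

Lemma mderivs_rcons w i P : mderivs (rcons w i) P = mderivs w (mderiv i P).
Proof. by rewrite /mderivs foldr_rcons. Qed.

Lemma mderivs_is_linear w : linear (mderivs w).
Proof. by elim: w => //= i w IH a P Q; rewrite /mderivs /= -/(mderivs w _) IH linearP. Qed.
HB.instance Definition _ w := GRing.isLinear.Build R (mpoly n R) (mpoly n R) _ (mderivs w) (mderivs_is_linear w).

Lemma pds_meval w P : pds w (fun y : 'rV[R]_n => meval (y 0) P) = fun y => meval (y 0) (mderivs w P).
Proof.
by elim: w => //= i w ->; apply/funext => x; rewrite /pd; case: (meval_partial (mderivs w P) x).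
Qed.

Lemma mderivs_mono_bound w m x (s : R) : 0 <= s -> (forall i, `|x 0 i| <= s) ->
  `|meval (x 0) (mderivs w (mpolyX R m))| <= (mdeg m ^_ size w)%:R * s ^+ (mdeg m - size w).
Proof.
move=> s0 xs; elim/last_ind: w m => [|w i IH] m.
  rewrite /= ffactn0 mul1r subn0 mevalX normr_prod mdegE -prodrXr.
  by apply: ler_prod => i _; rewrite normr_ge0 normrX lerXn2r ?nnegrE.
rewrite mderivs_rcons mderivX linearZ mevalZ size_rcons normrM normr_nat.
have [->|mi] := eqVneq (m i) 0%N.
  by rewrite mul0r mulr_ge0 // exprn_ge0.
have E : (mdeg m = (mdeg (mnm_sub m (mnm1 i))).+1)%N.
  rewrite !mdegE (bigD1 i) // [in RHS](bigD1 i) //= mnmBE mnm1E eqxx subn1 -addSn prednK ?lt0n //.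
  congr (_ + _)%N; apply: eq_bigr => k ki; by rewrite mnmBE mnm1E eq_sym (negbTE ki) subn0.
have mE : (m i)%:R <= (mdeg m)%:R :> R by rewrite ler_nat mdegE (bigD1 i) //=; exact: leq_addr.
apply: le_trans (ler_pM (ler0n _ _) (normr_ge0 _) mE (IH _)) _.
by rewrite E ffactnS /= subSS natrM -mulrA.
Qed.

(** A single term of the binomial expansion of (s + del)^M: enlarging the radius by del pays for k
    derivatives of a monomial, at the price k!/del^k. *)
Lemma ffact_le_exp M k (s del : R) : 0 <= s -> 0 < del ->
  (M ^_ k)%:R * s ^+ (M - k) <= k`!%:R * del^-1 ^+ k * (s + del) ^+ M.
Proof.
move=> s0 d0; have d1 := ltW d0.
have [kM|Mk] := leqP k M; last first.
  rewrite ffact_small // mul0r !mulr_ge0 // exprn_ge0 ?invr_ge0 ?addr_ge0 //.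
have kM' : (k < M.+1)%N by rewrite ltnS.
have : s ^+ (M - k) * del ^+ k *+ 'C(M, k) <= (s + del) ^+ M.
  rewrite exprDn (bigD1 (Ordinal kM')) //= lerDl sumr_ge0 // => i _.
  by rewrite mulrn_wge0 // mulr_ge0 // exprn_ge0.
rewrite -bin_ffact natrM -[X in X <= _]mulr_natr => h.
have dk : del ^+ k * del^-1 ^+ k = 1 by rewrite -exprMn mulfV ?gt_eqF // expr1n.
have z0 : 0 <= k`!%:R * del^-1 ^+ k by rewrite mulr_ge0 // exprn_ge0 // invr_ge0.
have := ler_wpM2l z0 h; apply: le_trans.
set a := s ^+ _; set b := del ^+ k in dk *; set c := del^-1 ^+ k in dk *.
have -> : k`!%:R * c * (a * b * 'C(M, k)%:R) = 'C(M, k)%:R * k`!%:R * a * (b * c) by lra.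
by rewrite dk mulr1.
Qed.

Lemma mderivs_mono_le w m x (s del : R) : 0 <= s -> 0 < del -> (forall i, `|x 0 i| <= s) ->
  `|meval (x 0) (mderivs w (mpolyX R m))| <= (size w)`!%:R * del^-1 ^+ size w * (s + del) ^+ mdeg m.
Proof.
by move=> s0 d0 xs; apply: le_trans (mderivs_mono_bound w m s0 xs) (ffact_le_exp _ _ s0 d0).
Qed.

Lemma is_derive_line x (h : 'rV[R]_n) (t : R) : is_derive t (1 : R) (fun s : R => x + s *: h) h.
Proof.
have d1 : is_derive t (1 : R) (fun s : R => s *: h) h.
  have dc (i : 'I_n) : is_derive t (1 : R) (fun s : R => (s *: h) 0 i) (h 0 i).
    have := is_derive_pow 1 t (h 0 i); rewrite expr0 !mulr1; congr (is_derive _ _ _ _).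
    by apply/funext => s; rewrite mxE expr1 mulrC.
  have dm : derivable (fun s : R => s *: h) t 1.
    by apply/derivable_mxP => i j; rewrite (ord1 i); case: (dc j).
  apply: DeriveDef => //; rewrite derive_mx //; apply/rowP => i; rewrite mxE.
  by case: (dc i).
have d2 : is_derive t (1 : R) (fun=> x) 0 by apply: is_derive_cst.
by have := is_deriveD d2 d1; rewrite add0r.
Qed.

Lemma cder_line (g : 'rV[R]_n -> R) x h (a b : R) : (forall t, a <= t <= b -> differentiable g (x + t *: h)) ->
  cder a b (fun t => g (x + t *: h)) (fun t => 'D_h g (x + t *: h)).
Proof.
move=> dg.
have D t : a <= t <= b -> is_derive t (1 : R) (fun s => g (x + s *: h)) ('D_h g (x + t *: h)).
  by move=> tab; have := derive_along (dg t tab) (is_derive_line x h t).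
split=> [|t /andP[t1 t2]]; last by apply: D; rewrite !ltW.
apply: continuous_in_subspaceT => t; rewrite inE /= in_itv /= => tab.
by apply: differentiable_continuous; apply/derivable1_diffP; case: (D t tab).
Qed.

Fixpoint words (j : nat) : seq (seq 'I_n) :=
  if j is j'.+1 then [seq i :: w | i <- enum 'I_n, w <- words j'] else [:: [::]].

Lemma size_words j w : w \in words j -> size w = j.
Proof.
elim: j w => [|j IH] w; first by rewrite inE => /eqP ->.
by move=> /allpairsP[[i u] /= [_ /IH us ->]] /=; rewrite us.
Qed.

Lemma big_words (F : seq 'I_n -> R) j :
  \sum_(w <- words j.+1) F w = \sum_i \sum_(w <- words j) F (i :: w).
Proof. by rewrite /= big_allpairs_dep /= big_enum. Qed.

Definition hpow (h : 'rV[R]_n) w : R := \prod_(i <- w) h 0 i.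

Lemma hpow_words_le h j : \sum_(w <- words j) `|hpow h w| <= (n%:R * `|h|) ^+ j.
Proof.
elim: j => [|j IH]; first by rewrite /= big_seq1 /hpow big_nil normr1 expr0.
rewrite big_words exprS -mulrA; apply: le_trans (_ : \sum_(i < n) `|h| * (n%:R * `|h|) ^+ j <= _).
  apply: ler_sum => i _; apply: le_trans (_ : `|h 0 i| * \sum_(w <- words j) `|hpow h w| <= _).
    by rewrite mulr_sumr; apply: ler_sum => w _; rewrite /hpow big_cons normrM.
  by apply: ler_pM => //; [apply: sumr_ge0|apply: coord_le_norm].
rewrite sumr_const card_ord; set z := _ * _ ^+ _.
by rewrite -[z *+ n]mulr_natl.
Qed.

(** The j-th power of the operator that differentiates in the direction h, expanded over words. *)
Definition dpow j (g : 'rV[R]_n -> R) h : 'rV[R]_n -> R :=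
  fun x => \sum_(w <- words j) hpow h w * pds w g x.

Lemma dpow_derive j g h x : (forall w, size w = j -> differentiable (pds w g) x) ->
  differentiable (dpow j g h) x /\ 'D_h (dpow j g h) x = dpow j.+1 g h x.
Proof.
move=> dg; have {}dg w : w \in words j -> differentiable (pds w g) x.
  by move=> /size_words/dg.
have H (r : seq (seq 'I_n)) : {subset r <= words j} ->
   differentiable (fun y => \sum_(w <- r) hpow h w * pds w g y) x /\
   'D_h (fun y => \sum_(w <- r) hpow h w * pds w g y) x = \sum_(w <- r) \sum_i h 0 i * (hpow h w * pds (i :: w) g x).
  elim: r => [|w r IH] sr.
    rewrite big_nil (_ : (fun y => _) = fun=> 0); last by apply/funext => y; rewrite big_nil.
    by split; [apply: differentiable_cst|rewrite derive_cst].
  have [d1 e1] := IH (fun u ur => sr u (mem_behead (s := w :: r) ur)).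
  have dw : differentiable (pds w g) x by apply: dg; apply: sr; rewrite inE eqxx.
  rewrite (_ : (fun y => _) = (hpow h w \*: pds w g) + (fun y => \sum_(w <- r) hpow h w * pds w g y));
    last by apply/funext => y; rewrite big_cons.
  split; first by apply: differentiableD => //; apply: differentiableZ.
  rewrite deriveD; [|by apply: diff_derivable; apply: differentiableZ|exact: diff_derivable].
  rewrite e1 deriveZ; last exact: diff_derivable.
  rewrite big_cons; congr (_ + _).
  rewrite derive_partial // -[_ *: _]/(_ * _) mulr_sumr; apply: eq_bigr => i _ /=.
  by rewrite mulrCA.
have [d e] := H (words j) (fun _ => id); split=> //.
rewrite /dpow e big_words exchange_big /=; apply: eq_bigr => i _; apply: eq_bigr => w _.
by rewrite /hpow big_cons mulrA.
Qed.

(** One-variable Taylor bound for t -> g(x + t h) on [0, 1]; the factor (n |h|)^N bounds the sum of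
    the |h^w| over the n^N words of length N. *)
Lemma taylor_line (g : 'rV[R]_n -> R) x h N (K : R) : 0 <= K ->
  (forall t, 0 <= t <= 1 -> forall w, (size w < N)%N -> differentiable (pds w g) (x + t *: h)) ->
  (forall t, 0 <= t <= 1 -> forall w, size w = N -> `|pds w g (x + t *: h)| <= K) ->
  `|g (x + h) - \sum_(j < N) dpow j g h x / j`!%:R| <= (n%:R * `|h|) ^+ N * K / N`!%:R.
Proof.
move=> K0 dg hK; pose phi j t := dpow j g h (x + t *: h).
have c j : (j < N)%N -> cder 0 1 (phi j) (phi j.+1).
  move=> jN; have hd t : 0 <= t <= 1 -> differentiable (dpow j g h) (x + t *: h) /\
       'D_h (dpow j g h) (x + t *: h) = dpow j.+1 g h (x + t *: h).
    by move=> tab; apply: dpow_derive => w sw; apply: dg => //; rewrite sw.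
  apply: cder_eq (cder_line (fun t tab => (hd t tab).1)) => t // /andP[t0 t1].
  by have [] := hd t; rewrite ?ltW.
have := taylor_bound c (M := (n%:R * `|h|) ^+ N * K) _ (t := 1); rewrite expr1n mulr1 /phi.
have -> : dpow 0 g h (x + 1 *: h) = g (x + h).
  by rewrite /dpow /= big_seq1 /hpow big_nil mul1r scale1r.
have -> : \sum_(j < N) dpow j g h (x + 0 *: h) * 1 ^+ j / j`!%:R = \sum_(j < N) dpow j g h x / j`!%:R.
  by apply: eq_bigr => j _; rewrite scale0r addr0 expr1n mulr1.
apply; last by rewrite ler01 lexx.
move=> t tab; apply: le_trans (ler_norm_sum _ _ _) _.
apply: le_trans (_ : \sum_(w <- words N) `|hpow h w| * K <= _).
  rewrite big_seq [leRHS]big_seq; apply: ler_sum => w /size_words sw; rewrite normrM.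
  by apply: ler_wpM2l => //; apply: hK.
rewrite -mulr_suml; apply: ler_wpM2r => //; exact: hpow_words_le.
Qed.

Lemma second_order_bound (g : 'rV[R]_n -> R) x h (K : R) : 0 <= K ->
  (forall t, 0 <= t <= 1 -> forall w, (size w < 2)%N -> differentiable (pds w g) (x + t *: h)) ->
  (forall t, 0 <= t <= 1 -> forall w, size w = 2%N -> `|pds w g (x + t *: h)| <= K) ->
  `|g (x + h) - g x - dlin (fun i => pd i g x) h| <= n%:R ^+ 2 * K / 2 * `|h| ^+ 2.
Proof.
move=> K0 dg hK; have := taylor_line K0 dg hK.
rewrite !big_ord_recr big_ord0 /= add0r.
have -> : dpow 0 g h x = g x by rewrite /dpow /= big_seq1 /hpow big_nil mul1r.
have -> : dpow 1 g h x = dlin (fun i => pd i g x) h.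
  rewrite /dpow big_words; apply: eq_bigr => i _.
  by rewrite big_seq1 /hpow big_cons big_nil mulr1.
rewrite !divr1 opprD addrA exprMn; rewrite (_ : 2`! = 2)%N //.
move/le_trans; apply; rewrite le_eqVlt; apply/orP; left; apply/eqP; lra.
Qed.

End PolynomialDerivatives.

(** * From power series to bounds on derivatives *)

Section PowerSeries.
Context {R : realType} {n : nat}.
Implicit Types (mu : {ffun 'I_n -> nat}) (x : 'rV[R]_n) (w : seq 'I_n).

(** Its sums are the partial sums in [analytic_on], but with indices of one type for all N, so that
    cubes of different sides can be compared. *)
Definition cube N : seq {ffun 'I_n -> nat} :=
  map (fun nu : {ffun 'I_n -> 'I_N} => [ffun i => nat_of_ord (nu i)]) (enum {: {ffun 'I_n -> 'I_N}}).

Lemma mem_cube N mu : (mu \in cube N) = [forall i, (mu i < N)%N].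
Proof.
apply/mapP/forallP => [[nu _ ->] i|h]; first by rewrite ffunE.
exists [ffun i => Ordinal (h i)]; first by rewrite mem_enum.
by apply/ffunP => i; rewrite !ffunE.
Qed.

Lemma uniq_cube N : uniq (cube N).
Proof.
rewrite map_inj_uniq ?enum_uniq // => nu1 nu2 /ffunP h.
by apply/ffunP => i; apply: val_inj; have := h i; rewrite !ffunE.
Qed.

Lemma big_cube N (F : {ffun 'I_n -> nat} -> R) :
  \sum_(mu <- cube N) F mu = \sum_(nu : {ffun 'I_n -> 'I_N}) F [ffun i => nat_of_ord (nu i)].
Proof. by rewrite big_map big_enum. Qed.

Lemma cube_sub N M : (N <= M)%N -> {subset cube N <= cube M}.
Proof.
by move=> NM mu; rewrite !mem_cube => /forallP h; apply/forallP => i; apply: leq_trans NM.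
Qed.

Lemma big_cube_split N M (F : {ffun 'I_n -> nat} -> R) : (N <= M)%N ->
  \sum_(mu <- cube M) F mu = \sum_(mu <- cube N) F mu +
    \sum_(mu <- [seq mu <- cube M | mu \notin cube N]) F mu.
Proof.
move=> NM; rewrite -big_cat; apply: perm_big; rewrite perm_sym.
apply: perm_trans (permEl (perm_filterC (mem (cube N)) (cube M))).
apply: perm_cat => //; apply: uniq_perm; rewrite ?filter_uniq ?uniq_cube //.
by move=> mu; rewrite mem_filter /=; case: (boolP (mu \in cube N)) => //= /(cube_sub NM) ->.
Qed.

Lemma big_seq_cube_le (r : seq {ffun 'I_n -> nat}) : uniq r ->
  exists N, forall F : {ffun 'I_n -> nat} -> R, (forall mu, 0 <= F mu) ->
  \sum_(mu <- r) F mu <= \sum_(mu <- cube N) F mu.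
Proof.
move=> ur; exists (\max_(mu <- r) \max_i (mu i)).+1 => F F0.
set N := _.+1; have sr : {subset r <= cube N}.
  move=> mu mur; rewrite mem_cube; apply/forallP => i; rewrite ltnS.
  apply: leq_trans (leq_bigmax i) _.
  exact: (@leq_bigmax_seq _ r xpredT (fun mu : {ffun 'I_n -> nat} => \max_i (mu i))%N mu).
have -> : \sum_(mu <- r) F mu = \sum_(mu <- [seq mu <- cube N | mu \in r]) F mu.
  apply: perm_big; apply: uniq_perm; rewrite ?filter_uniq ?uniq_cube //.
  by move=> mu; rewrite mem_filter; case: (boolP (mu \in r)) => // /sr ->.
rewrite big_filter big_mkcond /=; apply: ler_sum => mu _; case: ifP => // _; exact: F0.
Qed.

Lemma cvgn_cauchy (u : nat -> R) :
  (forall eps, 0 < eps -> exists N, forall M, (N <= M)%N -> `|u M - u N| <= eps) -> cvgn u.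
Proof.
move=> h; apply/cauchy_cvgP/cauchy_exP => eps e0.
have e2 : 0 < eps / 2 by rewrite divr_gt0.
have [N hN] := h _ e2; exists (u N); exists N => // M /= NM.
rewrite /ball /= distrC; apply: le_lt_trans (hN M NM) _.
by rewrite ltr_pdivrMr // ltr_pMr // ltr1n.
Qed.

Lemma nondecreasing_cauchy (u : nat -> R) (U : R) : (forall N M, (N <= M)%N -> u N <= u M) ->
  (forall N, u N <= U) -> forall eps, 0 < eps -> exists N, forall M, (N <= M)%N -> u M - u N <= eps.
Proof.
move=> hu hU eps e0.
have cu : cvgn u by apply: nondecreasing_is_cvgn => //; exists U => _ [N _ <-].
move/cvgrPdist_le : (cu) => /(_ _ e0) [N _ hN]; exists N => M NM.
have := hN N (leqnn N); rewrite /= ler_norml => /andP[_]; apply: le_trans.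
by apply: lerB => //; apply: nondecreasing_cvgn_le.
Qed.

Lemma norm_cvg_le (u : nat -> R) a (C : R) : u @ \oo --> a -> (forall N, `|u N| <= C) -> `|a| <= C.
Proof.
move=> cu h; apply/ler_addgt0Pr => eps e0.
move/cvgrPdist_le : cu => /(_ _ e0) [N _ /(_ N (leqnn N))] /= hN.
have -> : a = u N + (a - u N) by lra.
by apply: le_trans (ler_normD _ _) _; apply: lerD.
Qed.

Lemma cvg_bigsum (I : Type) (r : seq I) (u : I -> nat -> R) (a : I -> R) :
  (forall i, u i @ \oo --> a i) -> (fun N => \sum_(i <- r) u i N) @ \oo --> \sum_(i <- r) a i.
Proof.
move=> h; elim: r => [|i r IH].
  by rewrite big_nil (_ : (fun N => _) = fun=> 0); [exact: cvg_cst|apply/funext => N; rewrite big_nil].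
rewrite big_cons (_ : (fun N => _) = fun N => u i N + \sum_(j <- r) u j N); first exact: cvgD.
by apply/funext => N; rewrite big_cons.
Qed.

Definition mn mu : multinom n := Multinom [tuple mu i | i < n].

Lemma mnE mu i : mn mu i = mu i. Proof. by rewrite /mn multinomE tnth_mktuple. Qed.

Lemma meval_mn v mu : meval v (mpolyX R (mn mu)) = \prod_i v i ^+ mu i.
Proof. by rewrite mevalX; apply: eq_bigr => i _; rewrite mnE. Qed.

Section Bounded.
Variables (c : {ffun 'I_n -> nat} -> R) (s U : R).
Hypothesis s0 : 0 < s.
Hypothesis hU : forall N, \sum_(mu <- cube N) `|c mu| * (s + s) ^+ mdeg (mn mu) <= U.

Definition psum N : mpoly n R := \sum_(mu <- cube N) c mu *: mpolyX R (mn mu).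

Let K k : R := k`!%:R * s^-1 ^+ k.

Let K0 k : 0 <= K k.
Proof. by rewrite /K mulr_ge0 // exprn_ge0 // invr_ge0 ltW. Qed.

Let term_le w mu x : (forall i, `|x 0 i| <= s) ->
  `|c mu * meval (x 0) (mderivs w (mpolyX R (mn mu)))| <= K (size w) * (`|c mu| * (s + s) ^+ mdeg (mn mu)).
Proof.
move=> xs; rewrite normrM mulrCA; apply: ler_wpM2l => //.
exact: mderivs_mono_le (ltW s0) s0 xs.
Qed.

Let psumE w N x : meval (x 0) (mderivs w (psum N)) =
  \sum_(mu <- cube N) c mu * meval (x 0) (mderivs w (mpolyX R (mn mu))).
Proof.
rewrite /psum linear_sum raddf_sum; apply: eq_bigr => mu _.
by rewrite -mevalZ /= linearZ.
Qed.

(** Absolute boundedness at radius 2s controls the derivatives at radius s, uniformly in N: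
    [mderivs_mono_le] with [del] equal to s. *)
Lemma psum_bound w N x : (forall i, `|x 0 i| <= s) ->
  `|meval (x 0) (mderivs w (psum N))| <= K (size w) * U.
Proof.
move=> xs; rewrite psumE; apply: le_trans (ler_norm_sum _ _ _) _.
apply: le_trans (ler_wpM2l (K0 _) (hU N)); rewrite mulr_sumr.
by apply: ler_sum => mu _; apply: term_le.
Qed.

Lemma psum_cvg w x : (forall i, `|x 0 i| <= s) ->
  cvgn (fun N => meval (x 0) (mderivs w (psum N))).
Proof.
move=> xs; apply: cvgn_cauchy => eps e0.
pose u N := \sum_(mu <- cube N) `|c mu| * (s + s) ^+ mdeg (mn mu).
have t0 mu : 0 <= `|c mu| * (s + s) ^+ mdeg (mn mu).
  by rewrite mulr_ge0 // exprn_ge0 // addr_ge0 ?ltW.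
have u_nd N M : (N <= M)%N -> u N <= u M.
  by move=> NM; rewrite /u (big_cube_split _ NM) lerDl sumr_ge0.
have k1 : 0 < K (size w) + 1 by rewrite ltr_wpDl.
have ek : 0 < eps / (K (size w) + 1) by rewrite divr_gt0.
have [N hN] := nondecreasing_cauchy u_nd hU ek; exists N => M NM.
rewrite !psumE (big_cube_split _ NM) addrAC subrr add0r.
apply: le_trans (ler_norm_sum _ _ _) _.
have := hN M NM; rewrite /u (big_cube_split _ NM) addrAC subrr add0r => h.
apply: le_trans (_ : K (size w) * (eps / (K (size w) + 1)) <= _).
  apply: le_trans (ler_wpM2l (K0 _) h); rewrite mulr_sumr.
  by apply: ler_sum => mu _; apply: term_le.
rewrite mulrCA ger_pMr // ler_pdivrMr // mul1r lerDl //.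
Qed.

(** Termwise differentiation: the second-order bounds for the partial sums are uniform in N, hence
    pass to the limit and show that the limits of the partial derivatives are the partial
    derivatives of the limit. Induction on the word does the same at every order. *)
Lemma power_series_gmaj (g : 'rV[R]_n -> R) :
  (forall x, `|x| < s -> meval (x 0) (psum N) @[N --> \oo] --> g x) ->
  gmaj (ball 0 s) U s^-1 g.
Proof.
move=> hg.
have inb x : ball 0 s x -> `|x| < s by move=> /in_ball; rewrite sub0r normrN.
have inc x : `|x| < s -> forall i, `|x 0 i| <= s.
  by move=> xs i; apply: le_trans (coord_le_norm x i) (ltW xs).
pose q w N := mderivs w (psum N).
have U0 : 0 <= U by have := hU 0; apply: le_trans; apply: sumr_ge0 => mu _;
  rewrite mulr_ge0 // exprn_ge0 // addr_ge0 ?ltW.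
have step (G : 'rV[R]_n -> R) w : (forall x, `|x| < s -> meval (x 0) (q w N) @[N --> \oo] --> G x) ->
   forall x, `|x| < s -> differentiable G x /\ forall i, meval (x 0) (q (i :: w) N) @[N --> \oo] --> pd i G x.
  move=> hG x xs.
  pose l i := limn (fun N => meval (x 0) (q (i :: w) N)).
  have hl i : meval (x 0) (q (i :: w) N) @[N --> \oo] --> l i by apply: psum_cvg (inc x xs).
  have r0 : 0 < s - `|x| by rewrite subr_gt0.
  have main h : `|h| < s - `|x| -> `|G (x + h) - G x - dlin l h| <= (n%:R ^+ 2 * (K (size w).+2 * U) / 2) * `|h| ^+ 2.
    move=> hr; have xh t : 0 <= t <= 1 -> `|x + t *: h| < s.
      move=> /andP[t0 t1]; apply: le_lt_trans (ler_normD _ _) _.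
      rewrite -ltrBrDl; apply: le_lt_trans hr; rewrite normrZ ger0_norm //.
      by rewrite ler_piMl.
    have cu : meval ((x + h) 0) (q w N) - meval (x 0) (q w N) -
         dlin (fun i => meval (x 0) (q (i :: w) N)) h @[N --> \oo] --> G (x + h) - G x - dlin l h.
      apply: cvgB; first apply: cvgB.
      - by apply: hG; have := xh 1; rewrite scale1r ler01 lexx; apply.
      - exact: hG.
      - apply: (cvg_bigsum (u := fun i N => h 0 i * meval (x 0) (q (i :: w) N))) => i.
        by apply: cvgM; [exact: cvg_cst|exact: hl].
    apply: (norm_cvg_le cu) => N.
    have := @second_order_bound _ _ (fun y : 'rV[R]_n => meval (y 0) (q w N)) x h (K (size w).+2 * U).
    rewrite /dlin; under eq_bigr do rewrite /pd (meval_partial (q w N) x).2.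
    apply; first by rewrite mulr_ge0.
      by move=> t tab u _; rewrite pds_meval; case: (meval_partial (mderivs u (q w N)) (x + t *: h)).
    move=> t tab u su; rewrite pds_meval /q.
    have -> : mderivs u (mderivs w (psum N)) = mderivs (u ++ w) (psum N) by rewrite /mderivs foldr_cat.
    rewrite (_ : (size w).+2 = size (u ++ w)); last by rewrite size_cat su.
    by apply: psum_bound; apply: inc; apply: xh.
  have [dG eG] := tangent_differentiable r0 main; split=> // i.
  rewrite /pd eG /dlin (bigD1 i) //= big1 ?addr0 ?mxE ?eqxx ?mul1r; first exact: hl.
  by move=> j ji; rewrite mxE eqxx /= (negbTE ji) mul0r.
have key w : forall x, `|x| < s -> meval (x 0) (q w N) @[N --> \oo] --> pds w g x.
  by elim: w => [//|i w IH] x xs; have [_] := step _ _ IH x xs; apply.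
move=> k w x _ /inb xs; split; first by have [] := step _ _ (key w) x xs.
apply: (norm_cvg_le (key w x xs)) => N.
apply: le_trans (psum_bound w N (inc x xs)) _.
rewrite /K le_eqVlt; apply/orP; left; apply/eqP; lra.
Qed.

End Bounded.

Lemma summable_bounded (a : {ffun 'I_n -> nat} -> R) :
  summable [set: {ffun 'I_n -> nat}] (fun mu => (a mu)%:E) <->
  exists U, forall N, \sum_(mu <- cube N) `|a mu| <= U.
Proof.
split=> [sm|[U hU]].
  have fn : (esum [set: {ffun 'I_n -> nat}] (fun mu => `|(a mu)%:E|)%E) \is a fin_num.
    by rewrite ge0_fin_numE //; apply: esum_ge0 => *; apply: abse_ge0.
  exists (fine (esum [set: {ffun 'I_n -> nat}] (fun mu => `|(a mu)%:E|)%E)) => N.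
  rewrite -lee_fin fineK // -sumEFin.
  apply: esum_ge; exists [set` cube N]; first by split=> //; apply: finite_seq.
  by rewrite fsbig_seq ?uniq_cube //=.
rewrite /summable; apply: le_lt_trans (ltry U).
apply: ge_ereal_sup => _ [F [finF _] <-].
rewrite fsbig_finite //= sumEFin lee_fin.
have [N hN] := big_seq_cube_le (finmap.fset_uniq (fset_set F)).
exact: le_trans (hN _ (fun mu => normr_ge0 _)) (hU N).
Qed.

Lemma maj_translate (B : set 'rV[R]_n) b (g : 'rV[R]_n -> R) a :
  maj B b g -> maj [set x | B (x - a)] b (fun x => g (x - a)).
Proof.
move=> m k w x wk Bx; have [d l] := m k w (x - a) wk Bx.
have E : forall w, pds w (fun x => g (x - a)) = fun x => pds w g (x - a).
  elim=> //= i u ->; apply/funext => y; rewrite /pd /derive.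
  rewrite (_ : (fun z => pds u g (z - a)) \o shift y = pds u g \o shift (y - a)) //.
  by apply/funext => h /=; rewrite addrA.
rewrite E; split=> //.
apply: differentiable_comp => //; apply: differentiableB => //.
Qed.

(** The sum of the series lives on a full ball even when X is not open; this extension G carries the
    bounds, and g equals G on X only. *)
Lemma analytic_on_local (X : set 'rV[R]_n) (g : 'rV[R]_n -> R) a : analytic_on X g -> X a ->
  exists rho M C : R, [/\ 0 < rho, 0 <= M, 0 <= C & exists G, gmaj (ball a rho) M C G /\
    forall x, X x -> ball a rho x -> g x = G x].
Proof.
move=> ag Xa; have [rho rho0 [c [sm cv]]] := ag a Xa.
(* With this s the point a + (2s, ..., 2s) lies in the polydisc, and absolute summability there is
   boundedness at radius 2s. *)
pose s := rho / 4; have s0 : 0 < s by rewrite divr_gt0.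
pose x1 := a + const_mx (s + s).
have bx1 : ball a rho x1.
  apply/in_ball; rewrite opprD addrA subrr sub0r normrN.
  apply: le_lt_trans (_ : s + s < rho); last by rewrite /s; lra.
  have s2 : 0 <= s + s by rewrite addr_ge0 // ltW.
  by apply: norm_le_coord => [//|i]; rewrite mxE ger0_norm.
have [U hU] := (summable_bounded _).1 (sm x1 bx1).
have hU' N : \sum_(mu <- cube N) `|c mu| * (s + s) ^+ mdeg (mn mu) <= U.
  apply: le_trans (hU N); rewrite le_eqVlt; apply/orP; left; apply/eqP.
  apply: eq_bigr => mu _; rewrite normrM; congr (_ * _).
  rewrite normr_prod mdegE -prodrXr; apply: eq_bigr => i _.
  by rewrite mnE !mxE addrAC subrr add0r normrX ger0_norm // addr_ge0 // ltW.
pose G0 (x : 'rV[R]_n) := limn (fun N => meval (x 0) (psum c N)).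
have cG0 (x : 'rV[R]_n) : `|x| < s -> meval (x 0) (psum c N) @[N --> \oo] --> G0 x.
  move=> xs; have := @psum_cvg c s U s0 hU' [::] x; apply=> i.
  exact: le_trans (coord_le_norm x i) (ltW xs).
have mG := power_series_gmaj s0 hU' cG0.
exists s, U, s^-1; split=> //.
- by apply: le_trans (hU' 0); apply: sumr_ge0 => mu _; rewrite mulr_ge0 // exprn_ge0 // addr_ge0 ?ltW.
- by rewrite invr_ge0 ltW.
exists (fun x => G0 (x - a)); split.
  rewrite /gmaj; apply: (@maj_sub R n [set x | ball 0 s (x - a)]); last exact: maj_translate.
  by move=> x /in_ball xs /=; apply/in_ball; rewrite sub0r opprB.
move=> x Xx /in_ball xs; have xs' : `|x - a| < s by rewrite distrC.
have h1 := cG0 (x - a) xs'.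
have h2 := cv x Xx; apply: cvg_unique h1; first exact: norm_hausdorff.
have xrho : ball a rho x by apply/in_ball; apply: lt_le_trans xs _; rewrite /s; lra.
have E N : \sum_(nu : {ffun 'I_n -> 'I_N}) c [ffun i => nat_of_ord (nu i)] *
    \prod_(i < n) (x 0 i - a 0 i) ^+ nu i = meval ((x - a) 0) (psum c N).
  rewrite /psum raddf_sum /= big_cube.
  apply: eq_bigr => nu _; rewrite mevalZ meval_mn; congr (_ * _).
  by apply: eq_bigr => i _; rewrite ffunE !mxE.
by have := h2 xrho; rewrite (funext E).
Qed.

End PowerSeries.

(** * From bounds on derivatives to power series *)

Section TaylorSeries.
Context {R : realType} {n : nat}.
Implicit Types (mu : {ffun 'I_n -> nat}) (x h : 'rV[R]_n) (w : seq 'I_n).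

Definition content w : {ffun 'I_n -> nat} := [ffun i => count_mem i w].

Lemma hpow_content h w : hpow h w = \prod_i h 0 i ^+ content w i.
Proof.
elim: w => [|i w IH].
  by rewrite /hpow big_nil big1 // => i _; rewrite ffunE.
rewrite /hpow big_cons -/(hpow h w) IH (bigD1 i) //= [in RHS](bigD1 i) //= mulrA.
congr (_ * _); first by rewrite !ffunE /= eqxx exprS.
by apply: eq_bigr => j ji; rewrite !ffunE /= eq_sym (negbTE ji).
Qed.

Lemma sum_content w : (\sum_i content w i = size w)%N.
Proof.
elim: w => [|i w IH]; first by rewrite big1 // => i _; rewrite ffunE.
rewrite (bigD1 i) //= -IH [in RHS](bigD1 i) //= -addSn; congr (_ + _)%N.
  by rewrite !ffunE /= eqxx.
by apply: eq_bigr => j ji; rewrite !ffunE /= eq_sym (negbTE ji).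
Qed.

(** Every word contributes to exactly one multi-index, its content, so a sum over the cube regroups
    into a sum over word lengths. *)
Lemma big_cube_words (F : seq 'I_n -> R) N J :
  (forall mu, mu \in cube N -> (\sum_i mu i < J)%N) ->
  \sum_(mu <- cube N) \sum_(w <- words (\sum_i mu i)%N | content w == mu) F w =
  \sum_(j < J) \sum_(w <- words j) (content w \in cube N)%:R * F w.
Proof.
move=> hJ.
have -> : \sum_(mu <- cube N) \sum_(w <- words (\sum_i mu i)%N | content w == mu) F w =
  \sum_(mu <- cube N) \sum_(j < J) \sum_(w <- words j) (content w == mu)%:R * F w.
  rewrite big_seq [RHS]big_seq; apply: eq_bigr => mu /hJ muJ.
  rewrite (bigD1 (Ordinal muJ)) //= [X in _ + X]big1 ?addr0.
    by rewrite big_mkcond; apply: eq_bigr => w _; case: eqP; rewrite ?mul1r ?mul0r.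
  move=> j jJ; rewrite big_seq big1 // => w /size_words sw.
  case: eqP => [cw|]; last by rewrite mul0r.
  move: jJ; rewrite -val_eqE /= -cw sum_content sw eqxx //.
rewrite exchange_big /=; apply: eq_bigr => j _; rewrite exchange_big /=; apply: eq_bigr => w _.
rewrite -mulr_suml; congr (_ * _).
case: (boolP (content w \in cube N)) => [cN|cN].
  rewrite (bigD1_seq (content w)) ?uniq_cube //= eqxx big1 ?addr0 // => mu.
  by rewrite eq_sym => /negbTE ->.
by rewrite big_seq big1 // => mu muN; case: eqP => // E; move: cN; rewrite E muN.
Qed.

Lemma geometric_le (t : R) J : 0 <= t <= 2^-1 -> \sum_(j < J) t ^+ j <= 2.
Proof.
move=> /andP[t0 t2]; suff : \sum_(j < J) t ^+ j + 2 * t ^+ J <= 2.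
  by apply: le_trans; rewrite lerDl mulr_ge0 // exprn_ge0.
elim: J => [|J IH]; first by rewrite big_ord0 expr0; lra.
rewrite big_ord_recr /= exprS; apply: le_trans IH.
have := ler_wpM2r (exprn_ge0 J t0) t2; lra.
Qed.

(** Near a, the words of length j contribute at most M (n |h| C)^j, a geometric series. The cube of
    side N contains the contents of all words shorter than N, so its sum is the Taylor polynomial
    plus part of the tail. *)
Lemma gmaj_analytic (X : set 'rV[R]_n) (g : 'rV[R]_n -> R) :
  (forall a, X a -> exists rho M C : R, 0 < rho /\ gmaj (ball a rho) M C g) -> analytic_on X g.
Proof.
move=> hg a Xa; have [rho [M0 [C0 [rho0 gm0]]]] := hg a Xa.
pose M := `|M0|; pose C := `|C0| + 1.
have C1 : 0 < C by rewrite ltr_wpDl.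
have gm : gmaj (ball a rho) M C g.
  apply: maj_le gm0 => k; apply: ler_wpM2r => //; apply: le_trans (ler_norm _) _.
  rewrite normrM; apply: ler_wpM2l => //; rewrite normrX; apply: lerXn2r; rewrite ?nnegrE //; first exact: ltW.
  by rewrite /C lerDl.
have M1 : 0 <= M by apply: normr_ge0.
(* For |h| < 1/D the ratio n |h| C is at most 1/2; the added 1 keeps D positive when n = 0. *)
pose D := 2 * (n%:R * C + 1).
have D1 : 0 < D by rewrite mulr_gt0 // ltr_wpDl // mulr_ge0 // ltW.
pose r := Num.min rho D^-1.
have r0 : 0 < r by rewrite lt_min rho0 invr_gt0.
(* The usual Taylor coefficient: there are |mu|!/mu! words of content mu, so dividing their sum by
   |mu|! amounts to dividing one derivative by mu!. *)
pose cf mu := (\sum_(w <- words (\sum_i mu i)%N | content w == mu) pds w g a) / ((\sum_i mu i)`!)%:R.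
exists r => //; exists cf.
pose A h w := pds w g a / (size w)`!%:R * hpow h w.
have cfE h mu : cf mu * \prod_i h 0 i ^+ mu i = \sum_(w <- words (\sum_i mu i)%N | content w == mu) A h w.
  rewrite /cf mulr_suml mulr_suml big_seq_cond [RHS]big_seq_cond; apply: eq_bigr => w /andP[/size_words sw /eqP <-].
  by rewrite /A hpow_content sum_content.
pose th h := n%:R * `|h| * C.
have thP h : `|h| < r -> 0 <= th h <= 2^-1.
  rewrite lt_min => /andP[_ hD]; rewrite /th mulr_ge0 ?mulr_ge0 ?(ltW C1) //=.
  have : `|h| * D <= 1 by rewrite -ler_pdivlMr // mul1r ltW.
  rewrite /D; have := normr_ge0 h; lra.
have ba : ball a rho a by apply/in_ball; rewrite subrr normr0.
have Ale h j : \sum_(w <- words j) `|A h w| <= M * th h ^+ j.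
  have -> : M * th h ^+ j = M * C ^+ j * (n%:R * `|h|) ^+ j by rewrite /th exprMn; lra.
  apply: le_trans (_ : \sum_(w <- words j) M * C ^+ j * `|hpow h w| <= _).
    rewrite big_seq [leRHS]big_seq; apply: ler_sum => w /size_words sw.
    rewrite /A normrM; apply: ler_wpM2r => //; rewrite normrM normfV normr_nat ler_pdivrMr ?ltr0n ?fact_gt0 //.
    by have [_] := maj_pds w gm ba; rewrite sw.
  rewrite -mulr_sumr; apply: ler_wpM2l; last exact: hpow_words_le.
  by rewrite mulr_ge0 // exprn_ge0 // ltW.
(* Lengths in the cube are at most n N; the extra summand N lets the range be split into lengths
   below N and the tail. *)
have Jok N : forall mu, mu \in cube N -> (\sum_i mu i < N + (n * N).+1)%N.
  move=> mu; rewrite mem_cube => /forallP hmu; rewrite addnS ltnS; apply: leq_trans (leq_addl _ _).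
  have : (\sum_i mu i <= \sum_(i < n) N)%N by apply: leq_sum => i _; apply: ltnW.
  by rewrite sum_nat_const card_ord.
have sumA h N J : `|h| < r -> `|\sum_(j < J) \sum_(w <- words (N + j)) (content w \in cube N)%:R * A h w| <= 2 * M * th h ^+ N.
  move=> hr; have /andP[t0 t2] := thP h hr.
  apply: le_trans (ler_norm_sum _ _ _) _; apply: le_trans (_ : \sum_(j < J) M * th h ^+ (N + j) <= _).
    apply: ler_sum => j _; apply: le_trans (ler_norm_sum _ _ _) _; apply: le_trans (Ale h (N + j)%N).
    apply: ler_sum => w _; rewrite normrM; apply: ler_piMl => //; case: (_ \in _); rewrite ?normr1 ?normr0 //.
  rewrite -mulr_sumr [2 * M]mulrC -mulrA; apply: ler_wpM2l => //.
  under eq_bigr do rewrite exprD.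
  rewrite -mulr_sumr mulrC; apply: ler_wpM2r; [exact: exprn_ge0|apply: geometric_le; exact: thP].
have sub_h x : ball a r x -> `|x - a| < r by move=> /in_ball; rewrite distrC.
have prodE x mu : \prod_i (x 0 i - a 0 i) ^+ mu i = \prod_i (x - a) 0 i ^+ mu i.
  by apply: eq_bigr => i _; rewrite !mxE.
split=> [x /sub_h xr|x Xx /sub_h xr].
  apply/summable_bounded; exists (2 * M) => N; set h := x - a in xr.
  apply: le_trans (_ : \sum_(mu <- cube N) \sum_(w <- words (\sum_i mu i)%N | content w == mu) `|A h w| <= _).
    by apply: ler_sum => mu _; rewrite prodE cfE ler_norm_sum.
  rewrite (big_cube_words _ (Jok N)).
  apply: le_trans (_ : \sum_(j < N + (n * N).+1) M * th h ^+ j <= _).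
    apply: ler_sum => j _; apply: le_trans (Ale h j); apply: ler_sum => w _; apply: ler_piMl => //.
    by case: (_ \in _).
  by rewrite -mulr_sumr mulrC; apply: ler_wpM2r => //; apply: geometric_le; apply: thP.
set h := x - a in xr; have xE : x = a + h by rewrite addrC subrK.
have /andP[t0 t2] := thP h xr.
have hrho : `|h| < rho by move: xr; rewrite lt_min => /andP[].
have main N : `|g x - \sum_(nu : {ffun 'I_n -> 'I_N}) cf [ffun i => nat_of_ord (nu i)] *
    \prod_(i < n) (x 0 i - a 0 i) ^+ nu i| <= 3 * M * 2^-1 ^+ N.
  have -> : \sum_(nu : {ffun 'I_n -> 'I_N}) cf [ffun i => nat_of_ord (nu i)] *
    \prod_(i < n) (x 0 i - a 0 i) ^+ nu i = \sum_(mu <- cube N) cf mu * \prod_i h 0 i ^+ mu i.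
    rewrite big_cube; apply: eq_bigr => nu _; congr (_ * _).
    by apply: eq_bigr => i _; rewrite ffunE !mxE.
  under eq_bigr do rewrite cfE.
  rewrite (big_cube_words _ (Jok N)) big_split_ord /= opprD addrA.
  apply: le_trans (ler_normB _ _) _.
  have -> : \sum_(j < N) \sum_(w <- words j) (content w \in cube N)%:R * A h w = \sum_(j < N) dpow j g h a / j`!%:R.
    apply: eq_bigr => j _; rewrite /dpow mulr_suml big_seq [RHS]big_seq; apply: eq_bigr => w /size_words sw.
    have -> : content w \in cube N.
      rewrite mem_cube; apply/forallP => i; rewrite ffunE; apply: leq_ltn_trans (count_size _ _) _.
      by rewrite sw.
    rewrite mul1r /A sw mulrC mulrA //.
  have h1 := @taylor_line _ _ g a h N (M * C ^+ N * N`!%:R).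
  have seg t : 0 <= t <= 1 -> ball a rho (a + t *: h).
    move=> /andP[u0 u1]; apply/in_ball; rewrite opprD addrA subrr sub0r normrN normrZ ger0_norm //.
    by apply: le_lt_trans hrho; rewrite ler_piMl.
  have {}h1 : `|g (a + h) - \sum_(j < N) dpow j g h a / j`!%:R| <= M * th h ^+ N.
    apply: le_trans (h1 _ _ _) _.
    - by rewrite !mulr_ge0 // exprn_ge0 // ltW.
    - by move=> t tab w _; have [] := maj_pds w gm (seg t tab).
    - by move=> t tab w sw; have [_] := maj_pds w gm (seg t tab); rewrite sw.
    rewrite /th !exprMn; have f0 : N`!%:R != 0 :> R by rewrite pnatr_eq0 -lt0n fact_gt0.
    rewrite [_ * (_ * N`!%:R)]mulrA mulfK // le_eqVlt; apply/orP; left; apply/eqP; lra.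
  have h2 := sumA h N (n * N).+1 xr.
  have tN : th h ^+ N <= 2^-1 ^+ N by apply: lerXn2r; rewrite ?nnegrE // invr_ge0.
  have := ler_wpM2l M1 tN; rewrite xE => h3.
  apply: le_trans (lerD h1 h2) _; lra.
apply/cvgrPdist_le => eps e0.
have : (fun N => 3 * M * 2^-1 ^+ N) @ \oo --> 3 * M * 0.
  by apply: cvgM; [exact: cvg_cst|apply: cvg_expr; rewrite ger0_norm ?invr_ge0 // invf_lt1 // ltr1n].
rewrite mulr0 => /cvgrPdist_le /(_ _ e0) [N _ hN]; exists N => // k Nk.
apply: le_trans (main k) _; apply: le_trans (hN k Nk) => /=.
by rewrite sub0r normrN ler_norm.
Qed.

Definition locally_maj (X : set 'rV[R]_n) (g : 'rV[R]_n -> R) : Prop :=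
  forall a, X a -> exists rho M C : R, [/\ 0 < rho, 0 <= M, 0 <= C, ball a rho `<=` X & gmaj (ball a rho) M C g].

Lemma open_ball_sub (X : set 'rV[R]_n) a : open X -> X a -> exists2 rho : R, 0 < rho & ball a rho `<=` X.
Proof.
move=> oX Xa; have : nbhs a X by apply: open_nbhs_nbhs.
by move=> /nbhs_ballP[rho rho0 h]; exists rho.
Qed.

Lemma ball_open_rV a (rho : R) : open (ball (a : 'rV[R]_n) rho).
Proof. exact: ball_open. Qed.

(** [locally_maj] is the working form of analyticity on open sets, stable under products,
    derivatives and composition by estimates alone. *)
Lemma analytic_locally_maj (X : set 'rV[R]_n) g : open X -> analytic_on X g <-> locally_maj X g.
Proof.
move=> oX; split=> [ag a Xa|h]; last first.
  by apply: gmaj_analytic => a /h[rho [M [C [? ? ? ? ?]]]]; exists rho, M, C.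
have [rho [M [C [rho0 M0 C0 [G [mG gG]]]]]] := analytic_on_local ag Xa.
have [rho' rho'0 bX] := open_ball_sub oX Xa.
have b1 : ball a (Num.min rho rho') `<=` ball a rho.
  by move=> x /in_ball; rewrite lt_min => /andP[? _]; apply/in_ball.
have b2 : ball a (Num.min rho rho') `<=` X.
  by move=> x /in_ball; rewrite lt_min => /andP[_ ?]; apply: bX; apply/in_ball.
exists (Num.min rho rho'), M, C; split=> //; first by rewrite lt_min rho0.
apply: maj_eq_on (maj_sub b1 mG); first exact: ball_open_rV.
by move=> x bx; rewrite gG //; [apply: b2|apply: b1].
Qed.

End TaylorSeries.

(** * Trajectories of analytic vector fields *)

Section LocallyMajorized.
Context {R : realType} {n : nat}.
Implicit Types (g : 'rV[R]_n -> R) (x : 'rV[R]_n) (B X : set 'rV[R]_n).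

Lemma gmaj_le B (M C M' C' : R) g : 0 <= M -> 0 <= C -> M <= M' -> C <= C' ->
  gmaj B M C g -> gmaj B M' C' g.
Proof.
move=> M0 C0 MM CC; apply: maj_le => k; apply: ler_wpM2r => //.
by apply: ler_pM => //; [exact: exprn_ge0|apply: lerXn2r; rewrite ?nnegrE // (le_trans C0)].
Qed.

Lemma gmajD B (M1 M2 C : R) g1 g2 : open B -> gmaj B M1 C g1 -> gmaj B M2 C g2 ->
  gmaj B (M1 + M2) C (fun x => g1 x + g2 x).
Proof.
move=> oB h1 h2; apply: maj_le (majD oB h1 h2) => k /=.
rewrite le_eqVlt; apply/orP; left; apply/eqP; lra.
Qed.

Lemma rf2_le k : (rf 2 k <= 2 ^ k * k`!)%N.
Proof.
have := rf_fact 1 k; rewrite muln1 add1n factS => ->.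
by rewrite leq_mul2r; apply/orP; right; apply: ltn_expl.
Qed.

(** The product has the majorant M1 M2 / (1 - C s)^2; the factor k + 1 in its coefficients is
    absorbed by doubling C. *)
Lemma gmajM B (M1 M2 C : R) g1 g2 : open B -> 0 <= M1 -> 0 <= M2 -> 0 <= C ->
  gmaj B M1 C g1 -> gmaj B M2 C g2 -> gmaj B (M1 * M2) (2 * C) (fun x => g1 x * g2 x).
Proof.
move=> oB m1 m2 c0 h1 h2; apply: maj_le (majM oB h1 h2) => k.
have E (M : R) j : M * C ^+ j * j`!%:R = M * C ^+ j * (rf 1 j)%:R by rewrite rf1.
rewrite (conv_ext _ (E M1) (E M2)) conv_rf exprMn.
have : (rf 2 k)%:R <= 2 ^+ k * k`!%:R :> R by rewrite -natrX -natrM ler_nat rf2_le.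
move=> h; have z : 0 <= M1 * M2 * C ^+ k by rewrite !mulr_ge0 // exprn_ge0.
apply: le_trans (ler_wpM2l z h) _.
rewrite le_eqVlt; apply/orP; left; apply/eqP; lra.
Qed.

Lemma gmaj_pd B (M C : R) g i : 0 <= M -> 0 <= C -> gmaj B M C g -> gmaj B (M * C) (2 * C) (pd i g).
Proof.
move=> M0 C0 h; apply: maj_le (maj_pd i h) => k /=.
have h2 : (k.+1)`!%:R <= 2 ^+ k * k`!%:R :> R.
  by rewrite -natrX -natrM ler_nat factS leq_mul2r; apply/orP; right; apply: ltn_expl.
rewrite exprS exprMn.
have z : 0 <= M * (C * C ^+ k) by rewrite !mulr_ge0 // exprn_ge0.
have := ler_wpM2l z h2; lra.
Qed.

Lemma ball_minl x (r s : R) : ball x (Num.min r s) `<=` ball x r.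
Proof. by move=> y /in_ball; rewrite lt_min => /andP[? _]; apply/in_ball. Qed.

Lemma ball_minr x (r s : R) : ball x (Num.min r s) `<=` ball x s.
Proof. by move=> y /in_ball; rewrite lt_min => /andP[_ ?]; apply/in_ball. Qed.

Lemma locally_maj2 X g1 g2 : locally_maj X g1 -> locally_maj X g2 -> forall a, X a ->
  exists rho M C : R, [/\ 0 < rho, 0 <= M, 0 <= C, ball a rho `<=` X & gmaj (ball a rho) M C g1 /\ gmaj (ball a rho) M C g2].
Proof.
move=> h1 h2 a Xa; have [r1 [M1 [C1 [? ? ? s1 g1m]]]] := h1 a Xa.
have [r2 [M2 [C2 [? ? ? s2 g2m]]]] := h2 a Xa.
exists (Num.min r1 r2), (M1 + M2), (C1 + C2); split; rewrite ?lt_min ?addr_ge0 //.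
- by apply/andP.
- by apply: subset_trans s1; apply: ball_minl.
split; [move: g1m => /(maj_sub (@ball_minl a r1 r2))|move: g2m => /(maj_sub (@ball_minr a r1 r2))];
  by apply: gmaj_le; rewrite // ?lerDl ?lerDr.
Qed.

Lemma locally_majD X g1 g2 : locally_maj X g1 -> locally_maj X g2 -> locally_maj X (fun x => g1 x + g2 x).
Proof.
move=> h1 h2 a Xa; have [r [M [C [r0 M0 C0 s [m1 m2]]]]] := locally_maj2 h1 h2 Xa.
exists r, (M + M), C; split=> //; first by rewrite addr_ge0.
have oB : open (ball a r) by exact: ball_open_rV.
by apply: gmajD oB m1 m2.
Qed.

Lemma locally_majM X g1 g2 : locally_maj X g1 -> locally_maj X g2 -> locally_maj X (fun x => g1 x * g2 x).
Proof.
move=> h1 h2 a Xa; have [r [M [C [r0 M0 C0 s [m1 m2]]]]] := locally_maj2 h1 h2 Xa.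
exists r, (M * M), (2 * C); split=> //; rewrite ?mulr_ge0 //.
have oB : open (ball a r) by exact: ball_open_rV.
by apply: gmajM oB _ _ _ m1 m2.
Qed.

Lemma locally_maj_pd X g i : locally_maj X g -> locally_maj X (pd i g).
Proof.
move=> h a Xa; have [r [M [C [r0 M0 C0 s m]]]] := h a Xa.
by exists r, (M * C), (2 * C); split; rewrite ?mulr_ge0 //; apply: gmaj_pd.
Qed.

Lemma locally_maj_cst X c : open X -> locally_maj X (fun=> c).
Proof.
move=> oX a Xa; have [r r0 s] := open_ball_sub oX Xa.
exists r, `|c|, 1; split=> //; apply: maj_cst => [|j]; first by rewrite expr0 !mulr1.
by rewrite expr1n mulr1 mulr_ge0.
Qed.

Lemma locally_maj_coord X i : open X -> locally_maj X (fun x => x 0 i).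
Proof.
move=> oX a Xa; have [r r0 s] := open_ball_sub oX Xa.
exists r, (`|a| + r + 1), 1; split=> //.
  by rewrite !addr_ge0 // ltW.
apply: maj_coord => [x /in_ball xr||j].
- rewrite expr0 !mulr1; apply: le_trans (coord_le_norm x i) _.
  have -> : x = a - (a - x) by rewrite opprB addrC subrK.
  apply: le_trans (ler_normB _ _) _; rewrite -addrA lerD2l; apply: le_trans (ltW xr) _.
  by rewrite lerDl.
- by rewrite expr1 !mulr1 lerDr addr_ge0 // ltW.
- by rewrite expr1n mulr1 mulr_ge0 // !addr_ge0 // ltW.
Qed.

Lemma locally_maj_eq_on X g1 g2 : eq_on X g1 g2 -> locally_maj X g1 -> locally_maj X g2.
Proof.
move=> e h a Xa; have [r [M [C [r0 M0 C0 s m]]]] := h a Xa.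
exists r, M, C; split=> //; apply: maj_eq_on m; first exact: ball_open_rV.
by move=> x /s; apply: e.
Qed.

Lemma locally_maj_sum X (I : Type) (r : seq I) (g : I -> 'rV[R]_n -> R) : open X ->
  (forall i, locally_maj X (g i)) -> locally_maj X (fun x => \sum_(i <- r) g i x).
Proof.
move=> oX h; elim: r => [|i r IH].
  by rewrite (_ : (fun x => _) = fun=> 0); [exact: locally_maj_cst|apply/funext => x; rewrite big_nil].
rewrite (_ : (fun x => _) = fun x => g i x + \sum_(j <- r) g j x); first exact: locally_majD.
by apply/funext => x; rewrite big_cons.
Qed.

Lemma locally_maj_meval X k (c : 'I_k -> 'rV[R]_n -> R) (P : mpoly k R) : open X ->
  (forall j, locally_maj X (c j)) -> locally_maj X (fun x => meval (fun j => c j x) P).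
Proof.
move=> oX hc; rewrite (_ : (fun x => _) = fun x => \sum_(m <- msupp P) mcoeff m P * \prod_i c i x ^+ m i);
  last by apply/funext => x; rewrite mevalE.
apply: locally_maj_sum => // m; apply: locally_majM; first exact: locally_maj_cst.
have hX i l : locally_maj X (fun x => c i x ^+ l).
  elim: l => [|l IH]; first by under eq_fun do rewrite expr0; exact: locally_maj_cst.
  by under eq_fun do rewrite exprS; apply: locally_majM.
elim: (index_enum _) => [|i r IH].
  by under eq_fun do rewrite big_nil; exact: locally_maj_cst.
by under eq_fun do rewrite big_cons; apply: locally_majM.
Qed.

Lemma locally_maj_differentiable X g x : locally_maj X g -> X x -> differentiable g x.
Proof.
move=> h Xx; have [r [M [C [r0 M0 C0 s m]]]] := h x Xx.
by case: (maj0 m _ : differentiable g x /\ _) => //; apply/in_ball; rewrite subrr normr0.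
Qed.

Lemma lie_partial X (F : 'rV[R]_n -> 'rV[R]_n) g : locally_maj X g ->
  eq_on X (fun x => \sum_i F x 0 i * pd i g x) (lie F g).
Proof.
by move=> h x Xx; rewrite /lie derive_partial //; apply: locally_maj_differentiable h Xx.
Qed.

Definition analytic_field X (F : 'rV[R]_n -> 'rV[R]_n) : Prop :=
  forall i, locally_maj X (fun x => F x 0 i).

Lemma locally_maj_lie X F g : open X -> analytic_field X F -> locally_maj X g -> locally_maj X (lie F g).
Proof.
move=> oX hF hg; apply: locally_maj_eq_on (lie_partial F hg) _.
by apply: locally_maj_sum => // i; apply: locally_majM => //; apply: locally_maj_pd.
Qed.

Lemma locally_maj_lies X Fs g : open X -> (forall F, List.In F Fs -> analytic_field X F) ->
  locally_maj X g -> locally_maj X (lies Fs g).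
Proof.
move=> oX + hg; elim: Fs => //= F Fs IH h; apply: locally_maj_lie => //.
  by apply: h; left.
by apply: IH => F' hF'; apply: h; right.
Qed.

Lemma locally_maj_common X (I : finType) (g : I -> 'rV[R]_n -> R) a : open X ->
  (forall i, locally_maj X (g i)) -> X a ->
  exists rho M C : R, [/\ 0 < rho, 0 <= M, 0 <= C, ball a rho `<=` X &
    forall i, gmaj (ball a rho) M C (g i)].
Proof.
move=> oX hg Xa.
suff [rho [M [C [h1 h2 h3 h4 h5]]]] : exists rho M C : R, [/\ 0 < rho, 0 <= M, 0 <= C, ball a rho `<=` X &
    forall i, i \in enum I -> gmaj (ball a rho) M C (g i)].
  by exists rho, M, C; split=> // i; apply: h5; rewrite mem_enum.
elim: (enum I) => [|j r [rho [M [C [h1 h2 h3 h4 h5]]]]].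
  by have [r r0 s] := open_ball_sub oX Xa; exists r, 0, 0.
have [r2 [M2 [C2 [k1 k2 k3 k4 k5]]]] := hg j a Xa.
exists (Num.min rho r2), (M + M2), (C + C2); split; rewrite ?lt_min ?addr_ge0 //.
- by apply/andP.
- by apply: subset_trans h4; apply: ball_minl.
move=> i; rewrite inE => /orP[/eqP->|/h5 {}h5].
  by move: k5 => /(maj_sub (@ball_minr a rho r2)); apply: gmaj_le; rewrite // lerDr.
by move: h5 => /(maj_sub (@ball_minl a rho r2)); apply: gmaj_le; rewrite // lerDl.
Qed.

Lemma lies_locally_bounded X F g a : open X -> analytic_field X F -> locally_maj X g -> X a ->
  exists rho M C : R, 0 < rho /\ forall x j, ball a rho x ->
    `|lies (nseq j F) g x| <= M * C ^+ j * j`!%:R.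
Proof.
move=> oX hF hg Xa; have [r1 [M1 [C1 [p1 p2 p3 p4 p5]]]] := locally_maj_common oX hF Xa.
have [r2 [M2 [C2 [q1 q2 q3 q4 q5]]]] := hg a Xa.
pose B := ball a (Num.min r1 r2); pose C := C1 + C2.
have oB : open B by exact: ball_open_rV.
have C0 : 0 <= C by rewrite addr_ge0.
have hF' F' : [set F'' | F'' = F] F' -> forall i, gmaj B M1 C (fun x => F' x 0 i).
  move=> -> i; move: (p5 i) => /(maj_sub (@ball_minl a r1 r2)).
  by apply: gmaj_le; rewrite // /C lerDl.
have hg' : gmaj B M2 C g.
  move: q5 => /(maj_sub (@ball_minr a r1 r2)).
  by apply: gmaj_le; rewrite // /C lerDr.
exists (Num.min r1 r2), M2, (2 * n%:R * M1 * C); split; first by rewrite lt_min p1.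
move=> x j Bx.
have := @lies_bound _ _ B M1 C M2 _ g oB C0 p2 q2 hF' hg' (nseq j F) _ x Bx.
rewrite size_nseq => -[] // F'; elim: j => //= j IH [->|/IH] //.
Qed.

End LocallyMajorized.

(** * Functions along flow lines and the identity theorem *)

Section Flows.
Context {R : realType} {n : nat}.
Implicit Types (g : 'rV[R]_n -> R) (X : set 'rV[R]_n) (F : 'rV[R]_n -> 'rV[R]_n).

Definition flow_on X F (x : R -> 'rV[R]_n) (a b : R) : Prop :=
  [/\ {within `[a, b], continuous x}, (forall t, a <= t <= b -> X (x t)) &
      forall t : R, a < t < b -> is_derive t (1 : R) x (F (x t))].

Lemma flow_sub X F (x : R -> 'rV[R]_n) (a b c d : R) : a <= c -> d <= b -> flow_on X F x a b -> flow_on X F x c d.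
Proof.
move=> ac db [cx Xx dx]; split.
- apply: continuous_subspaceW cx => t /=; rewrite !in_itv /= => /andP[h1 h2].
  by rewrite (le_trans ac h1) (le_trans h2 db).
- by move=> t /andP[h1 h2]; apply: Xx; rewrite (le_trans ac h1) (le_trans h2 db).
- by move=> t /andP[h1 h2]; apply: dx; rewrite (le_lt_trans ac h1) (lt_le_trans h2 db).
Qed.

Lemma flow_cder X F (x : R -> 'rV[R]_n) (a b : R) g : flow_on X F x a b ->
  (forall y, X y -> differentiable g y) ->
  cder a b (fun t => g (x t)) (fun t => lie F g (x t)).
Proof.
move=> [cx Xx dx] dg; split.
  apply/within_continuousP => s sab eps e0; rewrite /= in_itv /= in sab.
  have cg : {for x s, continuous g} by apply: differentiable_continuous; apply: dg; apply: Xx.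
  move/cvgrPdist_lt : cg => /(_ _ e0) /nbhs_ballP[del /= d0 hd].
  move/within_continuousP : cx => cx.
  have [|del2 d20 hd2] := cx s _ _ d0; first by rewrite /= in_itv.
  exists del2 => // r rab sr; apply: hd; apply/in_ball; exact: hd2.
move=> t tab; have ta : a <= t <= b by case/andP: tab => *; rewrite !ltW.
exact: (derive_along (dg _ (Xx t ta)) (dx t tab)).
Qed.

Lemma flow_cder_lies X F (x : R -> 'rV[R]_n) (a b : R) g j : open X -> analytic_field X F -> locally_maj X g ->
  flow_on X F x a b ->
  cder a b (fun t => lies (nseq j F) g (x t)) (fun t => lies (nseq j.+1 F) g (x t)).
Proof.
move=> oX hF hg fx; apply: (flow_cder (g := lies (nseq j F) g) fx) => y Xy.
apply: (locally_maj_differentiable _ Xy); apply: locally_maj_lies => // F'.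
by elim: j => //= j IH [<-|/IH].
Qed.

(** Along the flow the iterated Lie derivatives of g are the successive time derivatives and obey
    factorial bounds, so their difference with phi is quasi-analytic and flat at t0. *)
Lemma flow_agree X F (x : R -> 'rV[R]_n) (a b t0 : R) g (phi : nat -> R -> R) : open X -> analytic_field X F ->
  locally_maj X g -> flow_on X F x a b -> a <= t0 <= b ->
  (forall j, cder a b (phi j) (phi j.+1)) ->
  (forall t, a <= t <= b -> exists eps M C : R, 0 < eps /\
     forall s j, a <= s <= b -> `|s - t| < eps -> `|phi j s| <= M * C ^+ j * j`!%:R) ->
  (forall j, phi j t0 = lies (nseq j F) g (x t0)) ->
  forall j t, a <= t <= b -> phi j t = lies (nseq j F) g (x t).
Proof.
move=> oX hF hg fx t0ab cphi bphi h0 j t tab.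
pose psi j t := phi j t - lies (nseq j F) g (x t).
apply/eqP; rewrite -subr_eq0; apply/eqP.
apply: (@quasianalytic _ psi a b t0) => //.
- by move=> i; apply: cderD => //; apply: cderN; apply: flow_cder_lies oX hF hg fx.
- move=> s sab; have [e1 [M1 [C1 [p1 p2]]]] := bphi s sab.
  have [cx Xx _] := fx.
  have [r [M2 [C2 [r0 q]]]] := lies_locally_bounded oX hF hg (Xx s sab).
  move/within_continuousP : cx => cx.
  have [|e2 e20 he2] := cx s _ _ r0; first by rewrite /= in_itv.
  exists (Num.min e1 e2), (`|M1| + `|M2|), (`|C1| + `|C2|); rewrite lt_min p1; split=> // u i uab.
  rewrite lt_min => /andP[u1 u2].
  apply: le_trans (ler_normB _ _) _.
  rewrite -mulrA mulrDl; apply: lerD.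
    apply: le_trans (p2 u i uab u1) _; rewrite -mulrA; apply: le_trans (ler_norm _) _.
    rewrite normrM; apply: ler_wpM2l => //; rewrite normrM normrX normr_nat; apply: ler_wpM2r => //.
    by apply: lerXn2r; rewrite ?nnegrE ?addr_ge0 // lerDl.
  have Bu : ball (x s) r (x u).
    by apply/in_ball; apply: he2; rewrite ?/= ?in_itv // distrC.
  apply: le_trans (q _ i Bu) _; rewrite -mulrA; apply: le_trans (ler_norm _) _.
  rewrite normrM; apply: ler_wpM2l => //; rewrite normrM normrX normr_nat; apply: ler_wpM2r => //.
  by apply: lerXn2r; rewrite ?nnegrE ?addr_ge0 // lerDr.
- by move=> i; rewrite /psi h0 subrr.
Qed.

Lemma flow_vanish X F (x : R -> 'rV[R]_n) (a b t0 : R) g : open X -> analytic_field X F ->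
  locally_maj X g -> flow_on X F x a b -> a <= t0 <= b ->
  (forall j, lies (nseq j F) g (x t0) = 0) -> forall t, a <= t <= b -> g (x t) = 0.
Proof.
move=> oX hF hg fx t0ab h0 t tab.
rewrite -[g]/(lies (nseq 0 F) g); symmetry.
apply: (flow_agree (phi := fun _ _ => 0) oX hF hg fx t0ab) => //.
- by move=> j; apply: cderT => s; apply: is_derive_cst.
- by move=> s sab; exists 1, 0, 0; split=> // u j _ _; rewrite normr0 !mul0r.
Qed.

(** The time derivatives of a coordinate along either flow are its Lie derivatives, equal at the
    common state; quasi-analyticity propagates this in both time directions. *)
Lemma flow_unique X F (x y : R -> 'rV[R]_n) (a b t0 : R) : open X -> analytic_field X F ->
  flow_on X F x a b -> flow_on X F y a b -> a <= t0 <= b -> x t0 = y t0 ->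
  forall t, a <= t <= b -> x t = y t.
Proof.
move=> oX hF fx fy t0ab e t tab; apply/rowP => i.
have hg := locally_maj_coord i oX.
have := @flow_agree X F y a b t0 (fun z => z 0 i) (fun j t => lies (nseq j F) (fun z : 'rV[R]_n => z 0 i) (x t)) oX hF hg fy t0ab.
move=> /(_ _ _ _ 0%N t tab); apply.
- by move=> j; apply: flow_cder_lies oX hF hg fx.
- move=> s sab; have [cx Xx _] := fx.
  have [r [M2 [C2 [r0 q]]]] := lies_locally_bounded oX hF hg (Xx s sab).
  move/within_continuousP : cx => cx.
  have [|e2 e20 he2] := cx s _ _ r0; first by rewrite /= in_itv.
  exists e2, M2, C2; split=> // u j uab us; apply: q; apply/in_ball.
  by apply: he2; rewrite ?/= ?in_itv // distrC.
- by move=> j; rewrite e.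
Qed.

Lemma lies_eq_on X Fs g1 g2 : open X -> eq_on X g1 g2 -> eq_on X (lies Fs g1) (lies Fs g2).
Proof. by move=> oX e; elim: Fs => //= F Fs IH; apply: lie_eq_on. Qed.

Lemma lies_cst0 Fs : lies Fs (fun=> 0 : R) = (fun=> 0) :> ('rV[R]_n -> R).
Proof. by elim: Fs => //= F Fs ->; apply/funext => x; rewrite /lie derive_cst. Qed.

(** A segment is a flow line of a constant field, so inside a ball [flow_vanish] carries the
    vanishing near b to any other point; connectedness links the balls. *)
Lemma identity_theorem X g : open X -> connected X -> locally_maj X g ->
  forall a, X a -> (\forall y \near a, g y = 0) -> eq_on X g (fun=> 0).
Proof.
move=> oX cX hg a Xa ga x Xx.
suff : (fun y => \forall z \near y, g z = 0) x by apply: nbhs_singleton.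
apply: (@connected_locally_constant _ X (fun u => \forall z \near u, g z = 0) cX _ a x Xa Xx ga) => y Xy.
have [r r0 s] := open_ball_sub oX Xy.
exists (ball y r); first exact: nbhsx_ballx.
move=> b c Xb Xc yb yc gb.
suff H z : ball y r z -> g z = 0.
  have : nbhs c (ball y r) by apply: open_nbhs_nbhs; split; [exact: ball_open_rV|].
  by apply: filterS.
move=> yz; pose F : 'rV[R]_n -> 'rV[R]_n := fun=> z - b.
pose p (t : R) := b + t *: (z - b).
have fp : flow_on X F p 0 1.
  split.
  - apply: continuous_subspaceT => t; apply: differentiable_continuous.
    by apply/derivable1_diffP; case: (is_derive_line b (z - b) t).
  - move=> t /andP[t0 t1]; apply: s; apply/in_ball.
    have -> : y - p t = (1 - t) *: (y - b) + t *: (y - z).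
      by rewrite /p; apply/rowP => i; rewrite !mxE; lra.
    move: yb yz => /in_ball yb /in_ball yz.
    apply: le_lt_trans (ler_normD _ _) _; rewrite !normrZ !ger0_norm ?subr_ge0 //.
    have [->|t0'] := eqVneq t 0; first by rewrite subr0 mul1r mul0r addr0.
    have tp : 0 < t by rewrite lt_def t0' t0.
    have := ler_wpM2l (_ : 0 <= 1 - t) (ltW yb); rewrite subr_ge0 => /(_ t1).
    have := ltr_pM2l tp `|y - z| r; rewrite yz => h; have {}h : t * `|y - z| < t * r by rewrite h.
    lra.
  - by move=> t _; apply: is_derive_line.
have aF : analytic_field X F by move=> i; apply: locally_maj_cst.
have <- : p 1 = z by rewrite /p scale1r addrC subrK.
apply: (flow_vanish oX aF hg fp (t0 := 0)); rewrite ?lexx ?ler01 // => j.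
rewrite /p scale0r addr0.
have [B oB Bb] : exists2 B : set 'rV[R]_n, open B /\ B b & eq_on B g (fun=> 0).
  exists (interior [set z | g z = 0]) => [|u /interior_subset //].
  by split; [exact: open_interior|].
by rewrite (lies_eq_on (nseq j F) oB.1 Bb oB.2) lies_cst0.
Qed.

Lemma analytic_domain X g1 g2 : open X -> connected X -> locally_maj X g1 -> locally_maj X g2 ->
  eq_on X (fun x => g1 x * g2 x) (fun=> 0) -> eq_on X g1 (fun=> 0) \/ eq_on X g2 (fun=> 0).
Proof.
move=> oX cX h1 h2 e.
have [|ne] := pselect (eq_on X g1 (fun=> 0)); first by left.
right; have [a Xa ga] : exists2 a, X a & g1 a != 0.
  apply: contrapT => C; apply: ne => x Xx; apply: contrapT => /eqP gx.
  by apply: C; exists x.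
apply: (identity_theorem oX cX h2 Xa).
have cg : {for a, continuous g1}.
  by apply: differentiable_continuous; apply: locally_maj_differentiable h1 Xa.
have n1 : \forall y \near a, g1 y != 0.
  exact: (@cvgr_neq0 _ _ _ _ _ g1 (g1 a) cg ga).
have n2 : \forall y \near a, X y by apply: open_nbhs_nbhs.
apply: filterS2 n1 n2 => y gy Xy; have /eqP := e y Xy.
by rewrite mulf_eq0 (negbTE gy) => /eqP.
Qed.

End Flows.

(** * Composition with maps that solve an analytic differential system *)

Section Composition.
Context {R : realType} {n k : nat}.
Implicit Types (c : 'I_k -> 'rV[R]_n -> R) (g : 'rV[R]_k -> R).

Lemma row_differentiable c x : (forall j, differentiable (c j) x) ->
  differentiable (fun y => \row_j c j y) x /\
  forall v, 'D_v (fun y => \row_j c j y) x = \row_j 'D_v (c j) x.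
Proof.
move=> dc; have d : differentiable (fun y => \row_j c j y) x.
  rewrite (_ : (fun y => _) = \sum_j (fun y => c j y *: ('e_j : 'rV[R]_k))).
    by apply: differentiable_sum => j; apply: differentiableZl.
  apply/funext => y; rewrite fct_sumE {1}(row_sum_delta (\row_j c j y)).
  by apply: eq_bigr => j _; rewrite mxE.
split=> // v; rewrite derive_mx; last exact: diff_derivable.
apply/rowP => j; rewrite !mxE; congr ('D_v _ x).
by apply/funext => y; rewrite mxE.
Qed.

Lemma derive_comp c g x : (forall j, differentiable (c j) x) -> differentiable g (\row_j c j x) ->
  differentiable (fun y => g (\row_j c j y)) x /\
  forall v, 'D_v (fun y => g (\row_j c j y)) x = 'D_(\row_j 'D_v (c j) x) g (\row_j c j x).
Proof.
move=> dc dg; have [d e] := row_differentiable dc.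
have dd : differentiable (g \o (fun y => \row_j c j y)) x by apply: differentiable_comp.
split=> // v; rewrite -e -[fun y => g _]/(g \o (fun y => \row_j c j y)) deriveE // diff_comp //=.
by rewrite -!deriveE.
Qed.

(* If the partial derivatives of a map are analytic functions of its values, the
   iterated partial derivatives of g along it are Lie derivatives of g. *)
Lemma locally_maj_comp (V : set 'rV[R]_n) (X : set 'rV[R]_k) c (E : 'I_n -> 'rV[R]_k -> 'rV[R]_k) g :
  open V -> open X -> (forall i, analytic_field X (E i)) -> locally_maj X g ->
  (forall y, V y -> X (\row_j c j y) /\ forall j, differentiable (c j) y /\
     forall i, 'D_('e_i) (c j) y = E i (\row_j c j y) 0 j) ->
  locally_maj V (fun y => g (\row_j c j y)).
Proof.
move=> oV oX hE hg hc.
have hl w : locally_maj X (lies [seq E i | i <- w] g).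
  apply: locally_maj_lies => // F /List.in_map_iff[i [<- _]]; exact: hE.
have dl w y : V y -> differentiable (fun y => lies [seq E i | i <- w] g (\row_j c j y)) y /\
   forall i, 'D_('e_i) (fun y => lies [seq E i | i <- w] g (\row_j c j y)) y = lies [seq E i | i <- i :: w] g (\row_j c j y).
  move=> Vy; have [Xy h] := hc y Vy.
  have [d e] := @derive_comp c (lies [seq E i | i <- w] g) y (fun j => (h j).1) (locally_maj_differentiable (hl w) Xy).
  split=> // i; rewrite e /= /lie; congr ('D_ _ _ _).
  by apply/rowP => j; rewrite mxE (h j).2.
have P w : eq_on V (pds w (fun y => g (\row_j c j y))) (fun y => lies [seq E i | i <- w] g (\row_j c j y)).
  elim: w => [|i w IH] y Vy //=.
  by rewrite /pd (derive_eq_on 'e_i oV IH Vy) (dl w y Vy).2.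
move=> a Va; have [Xa ha] := hc a Va.
have [r1 [M1 [C1 [p1 p2 p3 p4 p5]]]] :=
  @locally_maj_common R k X ('I_n * 'I_k)%type (fun ij x => E ij.1 x 0 ij.2) _ oX (fun ij => hE ij.1 ij.2) Xa.
have [r2 [M2 [C2 [q1 q2 q3 q4 q5]]]] := hg _ Xa.
pose B := ball (\row_j c j a) (Num.min r1 r2); pose C := C1 + C2.
have oB : open B by exact: ball_open_rV.
have C0 : 0 <= C by rewrite addr_ge0.
have hF' F' : range E F' -> forall i, gmaj B M1 C (fun x => F' x 0 i).
  move=> [i _ <-] j; move: (p5 (i, j)) => /(maj_sub (@ball_minl _ _ _ r1 r2)).
  by apply: gmaj_le; rewrite // /C lerDl.
have hg' : gmaj B M2 C g.
  move: q5 => /(maj_sub (@ball_minr _ _ _ r1 r2)).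
  by apply: gmaj_le; rewrite // /C lerDr.
have [dr _] := row_differentiable (fun j => (ha j).1).
have ce := differentiable_continuous dr.
have oB' : nbhs a [set y | B (\row_j c j y)].
  by apply: ce; apply: nbhsx_ballx; rewrite lt_min p1.
have [r3 r30 h3] := open_ball_sub oV Va.
move/nbhs_ballP : oB' => [r4 /= r40 h4].
exists (Num.min r3 r4), M2, (2 * k%:R * M1 * C); split=> //.
- by rewrite lt_min r30.
- by rewrite !mulr_ge0.
- by apply: subset_trans h3; apply: ball_minl.
move=> j w y _ wB; have Vy : V y by apply: h3; apply: ball_minl wB.
have By : B (\row_j c j y) by apply: h4; apply: ball_minr wB.
split.
  apply: (differentiable_eq_on oV _ Vy (dl w y Vy).1).
  by move=> z Vz; rewrite P.
rewrite (P w y Vy); have := @lies_bound _ _ B M1 C M2 _ g oB C0 p2 q2 hF' hg' [seq E i | i <- w] _ _ By.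
rewrite size_map => -[] // F'; by move=> /List.in_map_iff[i [<- _]]; exists i.
Qed.

End Composition.

(** * The Nash implicit function theorem *)

Section ImplicitFunction.
Context {R : realType} {d : nat}.
Implicit Types (y h : 'rV[R]_d) (z : R).

Definition pt z y : 'rV[R]_d.+1 := \row_k fcons z (y 0) k.

Lemma fcons0 T k (a : T) (v : 'I_k -> T) : fcons a v ord0 = a.
Proof. by rewrite /fcons unlift_none. Qed.

Lemma fconsS T k (a : T) (v : 'I_k -> T) i : fcons a v (lift ord0 i) = v i.
Proof. by rewrite /fcons liftK. Qed.

Lemma meval_pt z y (P : mpoly d.+1 R) : meval (pt z y 0) P = meval (fcons z (y 0)) P.
Proof. by apply: meval_eq => k; rewrite mxE. Qed.

Lemma pt_norm_le z y (c : R) : 0 <= c -> `|z| <= c -> `|y| <= c -> `|pt z y| <= c.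
Proof.
move=> c0 zc yc; apply: norm_le_coord => // k; rewrite mxE.
case: (unliftP ord0 k) => [i ->|->]; rewrite ?fconsS ?fcons0 //.
exact: le_trans (coord_le_norm y i) yc.
Qed.

Lemma ptB z y z' y' : pt z' y' - pt z y = pt (z' - z) (y' - y).
Proof.
apply/rowP => k; rewrite !mxE.
by case: (unliftP ord0 k) => [i ->|->]; rewrite ?fconsS ?fcons0 ?mxE.
Qed.

Lemma mpoly_bounded n (P : mpoly n R) (s : R) : exists2 K : R, 0 <= K &
  forall v : 'I_n -> R, (forall i, `|v i| <= s) -> `|meval v P| <= K.
Proof.
exists (\sum_(m <- msupp P) `|mcoeff m P| * \prod_i `|s| ^+ m i).
  by apply: sumr_ge0 => m _; rewrite mulr_ge0 // prodr_ge0 // => i _; rewrite exprn_ge0.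
move=> v vs; rewrite mevalE; apply: le_trans (ler_norm_sum _ _ _) _.
apply: ler_sum => m _; rewrite normrM; apply: ler_wpM2l => //.
rewrite normr_prod; apply: ler_prod => i _; rewrite normr_ge0 normrX lerXn2r ?nnegrE //.
exact: le_trans (vs i) (ler_norm s).
Qed.

Lemma continuous_meval n (P : mpoly n R) : continuous (fun x : 'rV[R]_n => meval (x 0) P).
Proof. by move=> x; apply: differentiable_continuous; case: (meval_partial P x). Qed.

Lemma cder_meval_pt (Q : mpoly d.+1 R) y (a b : R) :
  cder a b (fun z => meval (fcons z (y 0)) Q) (fun z => meval (fcons z (y 0)) (mderiv ord0 Q)).
Proof.
have := @cder_line R d.+1 (fun x => meval (x 0) Q) (pt 0 y) 'e_ord0 a b
   (fun t _ => (meval_partial Q _).1).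
have E t : pt 0 y + t *: 'e_ord0 = pt t y.
  apply/rowP => k; rewrite !mxE eqxx /=.
  case: (unliftP ord0 k) => [i ->|->]; first by rewrite !fconsS [_ == _]negbTE ?mulr0 ?addr0 // eq_sym neq_lift.
  by rewrite !fcons0 eqxx add0r mulr1.
apply: cder_eq => t _; rewrite E ?meval_pt //.
by rewrite (meval_partial Q _).2 meval_pt.
Qed.

Lemma meval_incr (Q : mpoly d.+1 R) y (m z z' : R) :
  (forall t, z <= t <= z' -> m <= meval (fcons t (y 0)) (mderiv ord0 Q)) -> z <= z' ->
  m * (z' - z) <= meval (fcons z' (y 0)) Q - meval (fcons z (y 0)) Q.
Proof.
move=> h zz; have c1 : cder z z' (fun t => (- m) * t ^+ 1) (fun=> - m).
  by apply: cderT => t; have := is_derive_pow 1 t (- m); rewrite expr0 !mulr1.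
have := cder_mono (cderD (cder_meval_pt Q y z z') c1) _ (lexx z) zz (lexx z').
rewrite !expr1 => H; suff : meval (fcons z (y 0)) Q + - m * z <= meval (fcons z' (y 0)) Q + - m * z' by lra.
by apply: H => t /andP[t1 t2]; have := h t; rewrite (ltW t1) (ltW t2) => /(_ isT); lra.
Qed.

Section Positive.
Variables (Q : mpoly d.+1 R) (y0 : 'rV[R]_d) (z0 : R).
Let Q1 := mderiv ord0 Q.
Hypothesis Q0 : meval (fcons z0 (y0 0)) Q = 0.
Hypothesis Q1_gt0 : 0 < meval (fcons z0 (y0 0)) Q1.

(** On a product neighbourhood the T-derivative stays above m, half its value at the centre. Hence
    Q(., y0) changes sign between z0 - w and z0 + w, and by continuity so does Q(., y) for y near
    y0. *)
Lemma implicit_setup : exists w r m : R, [/\ 0 < w, 0 < r, 0 < m,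
  (forall z y, `|z - z0| <= w -> `|y - y0| < r -> m <= meval (fcons z (y 0)) Q1) &
  forall y, `|y - y0| < r -> meval (fcons (z0 - w) (y 0)) Q < 0 < meval (fcons (z0 + w) (y 0)) Q].
Proof.
have m1 : 0 < meval (fcons z0 (y0 0)) Q1 / 2 by rewrite divr_gt0.
set m0 := meval (fcons z0 (y0 0)) Q1 in m1 *.
have /cvgrPdist_lt /(_ _ m1) /nbhs_ballP[rho /= rho0 hr] := @continuous_meval _ Q1 (pt z0 y0).
pose w := rho / 2; have w0 : 0 < w by rewrite divr_gt0.
have wr : w < rho by rewrite /w; lra.
have Q1m z y : `|z - z0| <= w -> `|y - y0| <= w -> m0 / 2 <= meval (fcons z (y 0)) Q1.
  move=> zw yw; have := hr (pt z y); rewrite !meval_pt -/m0 => h.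
  have /h : ball (pt z0 y0) rho (pt z y).
    apply/in_ball; rewrite ptB; apply: le_lt_trans wr; apply: pt_norm_le; rewrite ?(ltW w0) // distrC //.
  by rewrite ltr_norml => /andP[_]; lra.
have y00 : `|y0 - y0| <= w by rewrite subrr normr0 ltW.
have mw : 0 < m0 / 2 * w by rewrite mulr_gt0.
have up : 0 < meval (fcons (z0 + w) (y0 0)) Q.
  have := @meval_incr Q y0 (m0 / 2) z0 (z0 + w); rewrite Q0 => H.
  have {}H : m0 / 2 * (z0 + w - z0) <= meval (fcons (z0 + w) (y0 0)) Q - 0.
    apply: H; last lra.
    by move=> t /andP[t1 t2]; apply: Q1m => //; rewrite ler_norml; apply/andP; split; lra.
  have e : z0 + w - z0 = w by lra.
  rewrite e in H; lra.
have dn : meval (fcons (z0 - w) (y0 0)) Q < 0.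
  have := @meval_incr Q y0 (m0 / 2) (z0 - w) z0; rewrite Q0 => H.
  have {}H : m0 / 2 * (z0 - (z0 - w)) <= 0 - meval (fcons (z0 - w) (y0 0)) Q.
    apply: H; last lra.
    by move=> t /andP[t1 t2]; apply: Q1m => //; rewrite ler_norml; apply/andP; split; lra.
  have e : z0 - (z0 - w) = w by lra.
  rewrite e in H; lra.
have cy z (c : R) : 0 < c -> exists2 r : R, 0 < r & forall y, `|y - y0| < r -> `|meval (fcons z (y0 0)) Q - meval (fcons z (y 0)) Q| < c.
  move=> c0; have /cvgrPdist_lt /(_ _ c0) /nbhs_ballP[r /= r0 h] := @continuous_meval _ Q (pt z y0).
  exists r => // y yr; have := h (pt z y); rewrite !meval_pt; apply.
  apply/in_ball; rewrite ptB subrr; apply: le_lt_trans yr; apply: pt_norm_le; rewrite ?normr0 // distrC //.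
have [r1 r10 h1] := cy (z0 + w) _ up.
have dn' : 0 < - meval (fcons (z0 - w) (y0 0)) Q by rewrite oppr_gt0.
have [r2 r20 h2] := cy (z0 - w) _ dn'.
exists w, (Num.min w (Num.min r1 r2)), (m0 / 2); split => //.
- by rewrite !lt_min w0 r10.
- by move=> z y zw; rewrite lt_min => /andP[/ltW yw _]; apply: Q1m.
move=> y; rewrite !lt_min => /and3P[_ /h1 + /h2].
by rewrite !ltr_norml => /andP[a1 a2] /andP[b1 b2]; apply/andP; split; lra.
Qed.

Variables (w r m : R).
Hypotheses (w0 : 0 < w) (r0 : 0 < r) (m0 : 0 < m).
Hypothesis Q1m : forall z y, `|z - z0| <= w -> `|y - y0| < r -> m <= meval (fcons z (y 0)) Q1.
Hypothesis Qsgn : forall y, `|y - y0| < r -> meval (fcons (z0 - w) (y 0)) Q < 0 < meval (fcons (z0 + w) (y 0)) Q.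

Definition implicit_root y : R := get [set z | `|z - z0| < w /\ meval (fcons z (y 0)) Q = 0].

Let psi := implicit_root.

(** Growth of Q in T at rate at least m: it yields uniqueness of the root, and in [psi_tangent] the
    Lipschitz bound for it. *)
Lemma root_unique z z' y : `|y - y0| < r -> `|z - z0| <= w -> `|z' - z0| <= w ->
  m * `|z' - z| <= `|meval (fcons z' (y 0)) Q - meval (fcons z (y 0)) Q|.
Proof.
move=> yr; wlog zz : z z' / z <= z' => [H zw zw'|zw zw'].
  have [zz|/ltW zz] := leP z z'; first exact: H.
  by rewrite distrC [leRHS]distrC; apply: H.
rewrite ger0_norm ?subr_ge0 //; apply: le_trans (ler_norm _).
apply: meval_incr => // t /andP[t1 t2]; apply: Q1m => //.
by move: zw zw'; rewrite !ler_norml => /andP[? ?] /andP[? ?]; apply/andP; split; lra.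
Qed.

Lemma psiP y : `|y - y0| < r -> `|psi y - z0| < w /\ meval (fcons (psi y) (y 0)) Q = 0.
Proof.
move=> yr; suff [z hz] : exists z, [set z | `|z - z0| < w /\ meval (fcons z (y 0)) Q = 0] z.
  exact: (@getPex _ [set z | `|z - z0| < w /\ meval (fcons z (y 0)) Q = 0] (ex_intro _ z hz)).
have /andP[dn up] := Qsgn yr.
have ww : z0 - w <= z0 + w by have := w0; lra.
have [|||z] := @IVT R (fun z => meval (fcons z (y 0)) Q) (z0 - w) (z0 + w) 0.
- exact: ww.
- by have [] := cder_meval_pt Q y (z0 - w) (z0 + w).
- by rewrite ge_min le_max (ltW dn) (ltW up) orbT.
rewrite in_itv /= => /andP[z1 z2] Qz; exists z; split=> //.
have n1 : z != z0 - w by apply: contraTneq dn => <-; rewrite Qz ltxx.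
have n2 : z != z0 + w by apply: contraTneq up => <-; rewrite Qz ltxx.
have {}z1 : z0 - w < z by rewrite lt_def n1.
have {}z2 : z < z0 + w by rewrite lt_neqAle n2.
by rewrite ltr_norml; apply/andP; split; lra.
Qed.

Lemma psi_unique z y : `|y - y0| < r -> `|z - z0| < w -> meval (fcons z (y 0)) Q = 0 -> z = psi y.
Proof.
move=> yr zw Qz; have [pw Qp] := psiP yr.
have := root_unique yr (ltW pw) (ltW zw); rewrite Qz Qp subrr normr0.
rewrite pmulr_rle0 // normr_le0 subr_eq0 => /eqP //.
Qed.

(** First psi is Lipschitz. Then Q is expanded to second order from (psi(y), y) to (psi(y + h), y +
    h): both ends are zeros of Q, so the linear part is O(|h|^2), and dividing by the T-derivative
    isolates the increment of psi. *)
Lemma psi_tangent y : `|y - y0| < r -> differentiable psi y /\ forall v,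
  'D_v psi y = \sum_i v 0 i * - (meval (fcons (psi y) (y 0)) (mderiv (lift ord0 i) Q) / meval (fcons (psi y) (y 0)) Q1).
Proof.
(* A bound for all coordinates in the product neighbourhood, where the first and second derivatives
   of the polynomial Q are therefore uniformly bounded. *)
move=> yr; pose s := `|y0| + r + `|z0| + w.
have [r0' w0'] := (ltW r0, ltW w0).
have s0 : 0 <= s by rewrite !addr_ge0.
have inbox z y' : `|z - z0| <= w -> `|y' - y0| < r -> forall k, `|pt z y' 0 k| <= s.
  move=> zw yr' k; apply: le_trans (coord_le_norm _ k) _; apply: pt_norm_le => //.
    have -> : z = z0 + (z - z0) by lra.
    apply: le_trans (ler_normD _ _) _; rewrite /s; have := normr_ge0 y0; lra.
  have -> : y' = y0 + (y' - y0) by rewrite addrC subrK.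
  apply: le_trans (ler_normD _ _) _; rewrite /s; have := normr_ge0 z0; lra.
have [K2 K20 hK2] : exists2 K : R, 0 <= K & forall i j (v : 'I_d.+1 -> R), (forall k, `|v k| <= s) ->
    `|meval v (mderiv i (mderiv j Q))| <= K.
  have h i j := mpoly_bounded (mderiv i (mderiv j Q)) s.
  exists (\sum_i \sum_j s2val (cid2 (h i j))).
    by apply: sumr_ge0 => i _; apply: sumr_ge0 => j _; case: (cid2 (h i j)).
  move=> i j v vs; rewrite (bigD1 i) //= (bigD1 j) //=; case: (cid2 (h i j)) => K /= K0 /(_ v vs) le.
  apply: le_trans le _; rewrite -addrA lerDl addr_ge0 //; apply: sumr_ge0 => ? _.
    by case: (cid2 (h i _)).
  by apply: sumr_ge0 => ? _; case: (cid2 (h _ _)).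
have [K1 K10 hK1] : exists2 K : R, 0 <= K & forall i (v : 'I_d.+1 -> R), (forall k, `|v k| <= s) ->
    `|meval v (mderiv i Q)| <= K.
  have h i := mpoly_bounded (mderiv i Q) s.
  exists (\sum_i s2val (cid2 (h i))); first by apply: sumr_ge0 => i _; case: (cid2 (h i)).
  move=> i v vs; rewrite (bigD1 i) //=; case: (cid2 (h i)) => K /= K0 /(_ v vs) le.
  apply: le_trans le _; rewrite lerDl; apply: sumr_ge0 => ? _; by case: (cid2 (h _)).
have rho0 : 0 < r - `|y - y0| by rewrite subr_gt0.
have [pw Qp] := psiP yr; set z := psi y in pw Qp *.
have yh h : `|h| < r - `|y - y0| -> `|y + h - y0| < r.
  by move=> hr; rewrite addrAC; apply: le_lt_trans (ler_normD _ _) _; lra.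
have box h (k t : R) : `|h| < r - `|y - y0| -> `|z + k - z0| < w -> 0 <= t <= 1 ->
    forall j, `|(pt z y + t *: pt k h) 0 j| <= s.
  move=> hr kw /andP[t0 t1].
  have -> : pt z y + t *: pt k h = pt (z + t * k) (y + t *: h).
    apply/rowP => j; rewrite !mxE.
    by case: (unliftP ord0 j) => [i ->|->]; rewrite ?fconsS ?fcons0 ?mxE.
  apply: inbox.
    have -> : z + t * k - z0 = (1 - t) * (z - z0) + t * (z + k - z0) by lra.
    apply: le_trans (ler_normD _ _) _; rewrite !normrM (ger0_norm t0) (_ : `|1 - t| = 1 - t); last by rewrite ger0_norm // subr_ge0.
    have := ler_wpM2l t0 (ltW kw); have := ler_wpM2l (_ : 0 <= 1 - t) (ltW pw); rewrite subr_ge0 => /(_ t1); lra.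
  apply: yh; apply: le_lt_trans hr; rewrite normrZ ger0_norm //; exact: ler_piMl.
have lip h : `|h| < r - `|y - y0| -> `|psi (y + h) - z| <= d.+1%:R * K1 / m * `|h|.
  move=> hr; have [pw' Qp'] := psiP (yh h hr); set z' := psi (y + h) in pw' Qp' *.
  have := root_unique (yh h hr) (ltW pw) (ltW pw'); rewrite Qp' sub0r normrN => A.
  have B := @taylor_line R d.+1 (fun x => meval (x 0) Q) (pt z y) (pt 0 h) 1 K1 K10.
  have pz : pt z y + pt 0 h = pt z (y + h).
    apply/rowP => j; rewrite !mxE.
    by case: (unliftP ord0 j) => [i ->|->]; rewrite ?fconsS ?fcons0 ?mxE ?addr0.
  have {}B : `|meval (fcons z ((y + h) 0)) Q| <= d.+1%:R * `|h| * K1.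
    apply: le_trans (_ : d.+1%:R * `|pt 0 h| * K1 <= _); last first.
      by apply: ler_wpM2r => //; apply: ler_wpM2l => //; apply: pt_norm_le; rewrite ?normr0.
    have := B _ _; rewrite big_ord_recl big_ord0 addr0 expr1 !divr1 /dpow /= big_seq1 /hpow big_nil mul1r.
    rewrite -[pds [::] _ _]/(meval (pt z y 0) Q) pz !meval_pt Qp subr0; apply.
      by move=> t tab [|//] _; case: (meval_partial Q (pt z y + t *: pt 0 h)).
    move=> t tab [|i [|//]] //= _; rewrite /pd (meval_partial Q _).2; apply: hK1.
    by apply: box => //; rewrite addr0.
  have -> : d.+1%:R * K1 / m * `|h| = d.+1%:R * `|h| * K1 / m by lra.
  by rewrite ler_pdivlMr // mulrC; apply: le_trans A B.
pose L := d.+1%:R * K1 / m; have L0 : 0 <= L by rewrite !mulr_ge0 // invr_ge0 ltW.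
have pw1 : m <= meval (fcons z (y 0)) Q1 by apply: Q1m => //; apply: ltW.
have q0 : 0 < meval (fcons z (y 0)) Q1 by apply: lt_le_trans pw1.
apply: (@tangent_differentiable _ _ psi y _ (d.+1%:R ^+ 2 * K2 / 2 * (L + 1) ^+ 2 / m) _ rho0) => h hr.
have [pw' Qp'] := psiP (yh h hr); set z' := psi (y + h) in pw' Qp' *.
pose k := z' - z; have z'E : z' = z + k by rewrite /k; lra.
have kL : `|k| <= L * `|h| by apply: lip.
have C := @second_order_bound R d.+1 (fun x => meval (x 0) Q) (pt z y) (pt k h) K2 K20.
have pz : pt z y + pt k h = pt z' (y + h).
  apply/rowP => j; rewrite !mxE z'E.
  by case: (unliftP ord0 j) => [i ->|->]; rewrite ?fconsS ?fcons0 ?mxE.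
have kw : `|z + k - z0| < w by rewrite -z'E.
have {}C : `|dlin (fun i => meval (fcons z (y 0)) (mderiv i Q)) (pt k h)| <= d.+1%:R ^+ 2 * K2 / 2 * (L + 1) ^+ 2 * `|h| ^+ 2.
  apply: le_trans (_ : d.+1%:R ^+ 2 * K2 / 2 * `|pt k h| ^+ 2 <= _).
    rewrite /dlin; have := C _ _; rewrite pz !meval_pt Qp Qp' subrr sub0r normrN /dlin.
    under eq_bigr do rewrite /pd (meval_partial Q _).2 meval_pt.
    apply.
      by move=> t tab u _; rewrite pds_meval; case: (meval_partial (mderivs u Q) (pt z y + t *: pt k h)).
    move=> t tab [|i [|j [|//]]] //= _; rewrite -[pd i _]/(pds [:: i; j] (fun x : 'rV_d.+1 => meval (x 0) Q)) pds_meval /=.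
    by apply: hK2; apply: box.
  rewrite -[leRHS]mulrA; apply: ler_wpM2l; first by rewrite !mulr_ge0 // ?exprn_ge0 // invr_ge0.
  rewrite -exprMn; apply: lerXn2r; rewrite ?nnegrE ?mulr_ge0 ?addr_ge0 //.
  have Lh : 0 <= L * `|h| by rewrite mulr_ge0.
  have hh : 0 <= `|h| by [].
  apply: pt_norm_le; rewrite ?mulr_ge0 ?addr_ge0 // mulrDl mul1r.
    by apply: le_trans kL _; rewrite lerDl.
  by rewrite lerDr.
move: C; rewrite /dlin big_ord_recl mxE fcons0.
under eq_bigr do rewrite mxE fconsS.
rewrite -/Q1; set q := meval (fcons z (y 0)) Q1 in q0 pw1 *; set S := \sum_(i < d) _ => C.
have -> : \sum_i h 0 i * - (meval (fcons z (y 0)) (mderiv (lift ord0 i) Q) / q) = - (S / q).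
  rewrite /S mulr_suml -sumrN; apply: eq_bigr => i _; lra.
rewrite -/k opprK.
have -> : k + S / q = (k * q + S) / q by rewrite mulrDl mulfK ?gt_eqF.
rewrite normrM normfV (gtr0_norm q0) ler_pdivrMr //; apply: le_trans C _.
set E := _ * (L + 1) ^+ 2; have E0 : 0 <= E * `|h| ^+ 2.
  by rewrite !mulr_ge0 // ?exprn_ge0 ?addr_ge0 // invr_ge0.
have -> : E / m * `|h| ^+ 2 * q = (E * `|h| ^+ 2) * (q / m) by lra.
by rewrite ler_peMr // ler_pdivlMr // mul1r.
Qed.

Let aug y : 'I_d.+2 -> R := fcons (meval (fcons (psi y) (y 0)) Q1)^-1 (fcons (psi y) (y 0)).

Let low (x : 'rV[R]_d.+2) : 'I_d.+1 -> R := fun j => x 0 (lift ord0 j).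

Let dpsi i (x : 'rV[R]_d.+2) : R := - (meval (low x) (mderiv (lift ord0 i) Q) * x 0 ord0).

(** With q the T-derivative of Q along the root, the first entry is the derivative of 1/q, namely
    -q^-2 times the total derivative of q in y_i; including 1/q among the functions turns all
    divisions into products. *)
Let daug i (x : 'rV[R]_d.+2) : 'rV[R]_d.+2 := \row_j
  fcons (- (x 0 ord0 * x 0 ord0) * (meval (low x) (mderiv (lift ord0 i) Q1) + meval (low x) (mderiv ord0 Q1) * dpsi i x))
    (fcons (dpsi i x) (fun l => (l == i)%:R)) j.

(* The partial derivatives of (1 / Q_T(psi, y), psi, y) are polynomials in these functions. *)
Lemma psi_locally_maj : locally_maj (ball y0 r) psi.
Proof.
have oB : open (ball y0 r) by exact: ball_open_rV.
have oT : open [set: 'rV[R]_d.+2] by exact: openT.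
have co j : locally_maj [set: 'rV[R]_d.+2] (fun x => x 0 j) by exact: locally_maj_coord.
have mlow P : locally_maj setT (fun x => meval (low x) P) by apply: (locally_maj_meval P oT) => j; exact: co.
have mN (f : 'rV[R]_d.+2 -> R) : locally_maj setT f -> locally_maj setT (fun x => - f x).
  move=> h; apply: locally_maj_eq_on (locally_majM (locally_maj_cst (-1) oT) h) => x _; exact: mulN1r.
have mF i : locally_maj setT (dpsi i) by apply: mN; apply: locally_majM.
have mE i : analytic_field setT (daug i).
  have ext f1 f2 : f1 =1 f2 -> locally_maj [set: 'rV[R]_d.+2] f1 -> locally_maj setT f2 by move=> /funext ->.
  move=> j; case: (unliftP ord0 j) => [l ->|->]; last first.
    apply: (ext _ _ (fun x => esym _)) => [x|]; first by rewrite mxE fcons0.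
    apply: locally_majM; first by apply: mN; apply: locally_majM.
    by apply: locally_majD => //; apply: locally_majM.
  case: (unliftP ord0 l) => [l' ->|->].
    by apply: (ext (fun=> (l' == i)%:R)) => [x|]; [rewrite mxE !fconsS|exact: locally_maj_cst].
  by apply: (ext (dpsi i)) => [x|] //; rewrite mxE fconsS fcons0.
have := @locally_maj_comp R d d.+2 (ball y0 r) setT (fun j y => aug y j) daug (fun x => x 0 (lift ord0 ord0)) oB oT mE (co _).
move=> H; apply: (locally_maj_eq_on _ (H _)).
  by move=> y _; rewrite mxE /aug fconsS fcons0.
move=> y /in_ball; rewrite distrC => yr; split=> //.
have [dp ep] := psi_tangent yr.
have [pw Qp] := psiP yr.
have pm : 0 < meval (fcons (psi y) (y 0)) Q1 by apply: lt_le_trans m0 (Q1m _ yr); exact: ltW.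
have lE : low (\row_j aug y j) = fcons (psi y) (y 0).
  by apply/funext => j; rewrite /low mxE /aug fconsS.
have qE : (\row_j aug y j) 0 ord0 = (meval (fcons (psi y) (y 0)) Q1)^-1 by rewrite mxE /aug fcons0.
have epi i : 'D_('e_i) psi y = dpsi i (\row_j aug y j).
  rewrite ep (bigD1 i) //= big1 ?addr0 => [|j ji]; last by rewrite mxE eqxx /= (negbTE ji) mul0r.
  by rewrite mxE !eqxx mul1r /dpsi lE qE.
have dc1 j : differentiable (fun y => fcons (psi y) (y 0) j) y /\
   forall i, 'D_('e_i) (fun y => fcons (psi y) (y 0) j) y = fcons (dpsi i (\row_j aug y j)) (fun l => (l == i)%:R) j.
  case: (unliftP ord0 j) => [l ->|->].
    rewrite (_ : (fun y => _) = fun y => y 0 l); last by apply/funext => y'; rewrite fconsS.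
    by split=> [|i]; [exact: differentiable_coord|rewrite derive_coord mxE eqxx fconsS].
  rewrite (_ : (fun y => _) = psi); last by apply/funext => y'; rewrite fcons0.
  by split=> // i; rewrite epi fcons0.
have [d2 e2] := @meval_chain R d d.+1 (fun j y => fcons (psi y) (y 0) j) Q1 y (fun j => (dc1 j).1).
move=> j; case: (unliftP ord0 j) => [l ->|->].
  rewrite (_ : (fun y => _) = fun y => fcons (psi y) (y 0) l); last by apply/funext => y'; rewrite /aug fconsS.
  by split=> [|i]; [exact: (dc1 l).1|rewrite (dc1 l).2 mxE fconsS].
rewrite (_ : (fun y => _) = fun y => (meval (fun j => fcons (psi y) (y 0) j) Q1)^-1); last by apply/funext => y'; rewrite /aug fcons0.
have nz : meval (fcons (psi y) (y 0)) Q1 != 0 by rewrite gt_eqF.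
split=> [|i]; first exact: differentiableV.
rewrite deriveV //; last exact: diff_derivable.
rewrite e2 mxE fcons0 big_ord_recl (dc1 _).2 fcons0 (bigD1 i) //= (dc1 _).2 fconsS eqxx mulr1 big1 => [|l li]; last first.
  by rewrite (dc1 _).2 fconsS (negbTE li) mulr0.
rewrite addr0 qE lE -![_ *: _]/(_ * _) -exprVn expr2; congr (_ * _); exact: addrC.
Qed.

(** By uniqueness of the root, the graph of psi is cut out by Q = 0 and the inequalities of the
    box. *)
Lemma psi_semialgebraic : semialgebraic_fun (ball y0 r) psi.
Proof.
apply: semialgebraic_fun_definable.
have V (i : nat) : polyterm (fun e : nat -> R => e i) by exact: polyterm_var.
apply: (@definable_ext R (fun e => (0 < r /\ forall i : 'I_d, - r < e i - y0 0 i /\ e i - y0 0 i < r) /\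
   ((- w < e d - z0 /\ e d - z0 < w) /\ meval (fun j => fcons (e d) (fun i : 'I_d => e i) j) Q = 0))).
  move=> e; set y := \row_(i < d) e i.
  have bE : (0 < r /\ forall i : 'I_d, - r < e i - y0 0 i /\ e i - y0 0 i < r) <-> ball y0 r y.
    rewrite in_ball; split=> [[_ h]|h].
      by apply: norm_lt_coord => // i; rewrite !mxE distrC ltr_norml; have [-> ->] := h i.
    split=> // i; have := le_lt_trans (coord_le_norm _ i) h; rewrite !mxE distrC ltr_norml.
    by move=> /andP[].
  have mE : meval (fun j => fcons (e d) (fun i : 'I_d => e i) j) Q = meval (fcons (e d) (y 0)) Q.
    apply: meval_eq => j; case: (unliftP ord0 j) => [l ->|->]; by rewrite ?fconsS ?fcons0 ?mxE.
  rewrite mE; split=> [[/bE b [[h1 h2] h3]]|[/bE b h]].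
    split=> //; move/in_ball : b; rewrite distrC => b.
    by apply: (psi_unique b _ h3); rewrite ltr_norml h1.
  split=> //; move/in_ball : (bE.1 b); rewrite distrC => /psiP[].
  by rewrite h ltr_norml => /andP[].
apply: definable_and.
  apply: definable_and; first by apply: definable_lt; exact: polyterm_cst.
  apply: definable_forall_fin => i; apply: definable_and; apply: definable_lt; do ?exact: polyterm_cst;
    by apply: polytermB => //; exact: polyterm_cst.
apply: definable_and; last first.
  apply: definable_eq; last exact: polyterm_cst.
  apply: polyterm_meval => j; case: (unliftP ord0 j) => [l ->|->].
    by under [X in polyterm X]eq_fun do rewrite fconsS.
  by under [X in polyterm X]eq_fun do rewrite fcons0.
apply: definable_and; apply: definable_lt; do ?exact: polyterm_cst;
    by apply: polytermB => //; exact: polyterm_cst.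
Qed.

End Positive.

End ImplicitFunction.

Section ImplicitNash.
Context {R : realType} {d : nat}.

Lemma implicit_function (Q : mpoly d.+1 R) (z0 : R) (y0 : 'rV[R]_d) :
  meval (fcons z0 (y0 0)) Q = 0 -> meval (fcons z0 (y0 0)) (mderiv ord0 Q) != 0 ->
  exists (w r : R) (psi : 'rV[R]_d -> R), [/\ 0 < w, 0 < r, nash_fun (ball y0 r) psi, psi y0 = z0 &
    forall y, ball y0 r y -> [/\ ball z0 w (psi y), meval (fcons (psi y) (y 0)) Q = 0 &
      forall z, ball z0 w z -> meval (fcons z (y 0)) Q = 0 -> z = psi y]].
Proof.
move=> Q0; wlog : Q Q0 / 0 < meval (fcons z0 (y0 0)) (mderiv ord0 Q) => [H nz|Qp _].
  have [pos|neg|/esym/eqP] := ltgtP 0 (meval (fcons z0 (y0 0)) (mderiv ord0 Q)); last by rewrite (negbTE nz).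
    exact: H Q0 pos nz.
  have [|||w [r [psi [h1 h2 h3 h4 h5]]]] := H (- Q).
  - by rewrite mevalN Q0 oppr0.
  - by rewrite mderivN mevalN oppr_gt0.
  - by rewrite mderivN mevalN oppr_eq0.
  exists w, r, psi; split=> // y yr; have [k1 k2 k3] := h5 y yr; split=> //.
    by apply/eqP; rewrite -oppr_eq0 -mevalN k2.
  by move=> z zw Qz; apply: k3 => //; rewrite mevalN Qz oppr0.
have [w [r [m [w0 r0 m0 Q1m Qs]]]] := implicit_setup Q0 Qp.
have oB : open (ball y0 r) by exact: ball_open_rV.
have P y (yr : `|y - y0| < r) := psiP w0 Qs yr.
have un y z (yr : `|y - y0| < r) := psi_unique w0 m0 Q1m Qs (z := z) yr.
exists w, r, (implicit_root Q z0 w); split=> //.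
- split; first by apply/(analytic_locally_maj _ oB); apply: psi_locally_maj Q1m Qs.
  exact: psi_semialgebraic Q1m Qs.
- by apply/esym/un; rewrite ?subrr ?normr0.
move=> y /in_ball; rewrite distrC => yr; have [p1 p2] := P y yr; split=> //.
  by rewrite /ball /= distrC.
by move=> z; rewrite /ball /= distrC => zw; apply: un.
Qed.

Lemma semialgebraic_ball (a : 'rV[R]_d) (r : R) : semialgebraic (ball a r).
Proof.
have [r0|r0] := ltP 0 r; last first.
  apply: semialgebraic_ext (semialgebraic_setC (semialgebraic_setT d)) => x.
  split=> [[] //|/in_ball h] _; have := le_lt_trans (normr_ge0 _) h; lra.
apply: semialgebraic_definable.
apply: (@definable_ext R (fun e => forall i : 'I_d, - r < a 0 i - e i /\ a 0 i - e i < r)).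
  move=> e; rewrite in_ball; split=> [h|h i].
    by apply: norm_lt_coord => // i; rewrite !mxE ltr_norml; have [-> ->] := h i.
  by have := le_lt_trans (coord_le_norm _ i) h; rewrite !mxE ltr_norml => /andP[].
have V (i : nat) : polyterm (fun e : nat -> R => e i) by exact: polyterm_var.
apply: definable_forall_fin => i; apply: definable_and; apply: definable_lt; do ?exact: polyterm_cst;
  by apply: polytermB => //; exact: polyterm_cst.
Qed.

(** Connectedness is lost under intersection, convexity is not: choosing balls in Step 4 makes the
    intersection of Step 5 connected. *)
Definition convex_set (A : set 'rV[R]_d) : Prop :=
  forall x y (t : R), A x -> A y -> 0 <= t <= 1 -> A (x + t *: (y - x)).

Lemma convex_ball (a : 'rV[R]_d) (r : R) : convex_set (ball a r).
Proof.
move=> x y t /in_ball xr /in_ball yr /andP[t0 t1]; apply/in_ball.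
have -> : a - (x + t *: (y - x)) = (1 - t) *: (a - x) + t *: (a - y).
  by apply/rowP => i; rewrite !mxE; lra.
apply: le_lt_trans (ler_normD _ _) _; rewrite !normrZ (ger0_norm t0) (_ : `|1 - t| = 1 - t); last by rewrite ger0_norm // subr_ge0.
have [->|tn] := eqVneq t 0; first by rewrite mul0r addr0 subr0 mul1r.
have tp : 0 < t by rewrite lt_def tn.
have := ler_wpM2l (_ : 0 <= 1 - t) (ltW xr); rewrite subr_ge0 => /(_ t1).
have := yr; rewrite -(ltr_pM2l tp); lra.
Qed.

Lemma convex_connected (A : set 'rV[R]_d) : convex_set A -> connected A.
Proof.
move=> cA; have [[x Ax]|A0] := pselect (A !=set0); last first.
  by rewrite (_ : A = set0); [exact: connected0|apply/seteqP; split=> // x Ax; apply: A0; exists x].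
rewrite (_ : A = \bigcup_(y in A) [set x + t *: (y - x) | t in `[0, 1]%classic]).
  apply: bigcup_connected.
    by exists x => y _; exists 0; rewrite ?scale0r ?addr0 //= in_itv /= lexx ler01.
  move=> y _; apply: connected_continuous_connected; first exact: segment_connected.
  apply: continuous_subspaceT => t; apply: differentiable_continuous.
  by apply/derivable1_diffP; case: (is_derive_line x (y - x) t).
apply/seteqP; split=> [y Ay|z [y Ay [t /= + <-]]].
  by exists y => //; exists 1; rewrite ?scale1r ?(addrC x) ?subrK //= in_itv /= lexx ler01.
by rewrite in_itv /= => t01; apply: cA.
Qed.

End ImplicitNash.

Lemma eval_rel_Phi (R : realType) (n d : nat) (Q : mpoly d.+1 R) (g : 'rV[R]_n -> R) phi x :
  eval_rel Q g phi x = meval (fcons (g x) (Phi phi x 0)) Q.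
Proof.
by apply: meval_eq => k; case: (unliftP ord0 k) => [l ->|->]; rewrite ?fconsS ?fcons0 ?mxE.
Qed.

Lemma solves_relation_exists (R : realType) (n d : nat) (X : set 'rV[R]_n) (g : 'rV[R]_n -> R)
    (phi : 'I_d -> 'rV[R]_n -> R) (Q : mpoly d.+1 R) xbar :
  X xbar -> relation_on X g phi Q -> eval_rel (mderiv ord0 Q) g phi xbar != 0 ->
  exists I : implicit_fun R d, solves_relation X g phi Q xbar I /\ convex_set (imV I).
Proof.
move=> Xx [_ /(_ _ Xx)]; rewrite !eval_rel_Phi => Q0 Q1.
have [w [r [psi [w0 r0 npsi psi0 h]]]] := implicit_function Q0 Q1.
have bx : ball (Phi phi xbar) r (Phi phi xbar) by exact: ballxx.
exists (ImplicitFun (ball (g xbar) w) (ball (Phi phi xbar) r) psi).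
split; last exact: convex_ball.
split => /=.
- split; first exact: ball_open.
  + apply/connected_intervalP => x y; rewrite /ball /= !ltr_norml => /andP[x1 x2] /andP[y1 y2] z /andP[xz zy].
    by rewrite ltr_norml; apply/andP; split; lra.
  + apply: semialgebraic_definable; apply: (@definable_ext R (fun e => - w < g xbar - e 0%N /\ g xbar - e 0%N < w)).
      by move=> e; rewrite /ball /= mxE ltr_norml; split=> [[-> ->]|/andP[]].
    have V (i : nat) : polyterm (fun e : nat -> R => e i) by exact: polyterm_var.
    by apply: definable_and; apply: definable_lt; do ?exact: polyterm_cst;
      apply: polytermB => //; exact: polyterm_cst.
- split; [exact: ball_open_rV|by apply: convex_connected; exact: convex_ball|exact: semialgebraic_ball].
- by split=> // y /h[].
- by split=> //; exact: ballxx.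
move=> x _ gw /h[p1 p2 p3]; rewrite eval_rel_Phi; split=> [|->] //.
exact: p3.
Qed.

(** * Algebras of Nash functions and observables *)

Section NashAlgebra.
Context {R : realType}.

Lemma meval_closed (T : Type) k (A : set (T -> R)) (c : 'I_k -> T -> R) (P : mpoly k R) :
  (forall a, A (fun=> a)) -> (forall g1 g2, A g1 -> A g2 -> A (fun x => g1 x + g2 x)) ->
  (forall g1 g2, A g1 -> A g2 -> A (fun x => g1 x * g2 x)) -> (forall j, A (c j)) ->
  A (fun x => meval (fun j => c j x) P).
Proof.
move=> Ac AD AM hc; rewrite (_ : (fun x => _) = fun x => \sum_(m <- msupp P) mcoeff m P * \prod_i c i x ^+ m i);
  last by apply/funext => x; rewrite mevalE.
have hX i l : A (fun x => c i x ^+ l).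
  elim: l => [|l IH]; first by under eq_fun do rewrite expr0; exact: Ac.
  by under eq_fun do rewrite exprS; apply: AM.
have hP (m : multinom k) : A (fun x => \prod_i c i x ^+ m i).
  elim: (index_enum _) => [|i r IH].
    by under eq_fun do rewrite big_nil; exact: Ac.
  by under eq_fun do rewrite big_cons; apply: AM.
elim: (msupp P : seq _) => [|m r IH].
  by under eq_fun do rewrite big_nil; exact: Ac.
by under eq_fun do rewrite big_cons; apply: AD => //; apply: AM.
Qed.

Variables (n : nat) (X : set 'rV[R]_n).
Hypotheses (oX : open X) (sX : semialgebraic X).
Implicit Types (g : 'rV[R]_n -> R) (F : 'rV[R]_n -> 'rV[R]_n).

Lemma nash_locally_maj g : nash_fun X g <-> locally_maj X g /\ semialgebraic_fun X g.
Proof. by split=> -[h1 h2]; split=> //; apply/(analytic_locally_maj g oX). Qed.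

Lemma nash_cst c : nash_fun X (fun=> c).
Proof.
by apply/nash_locally_maj; split; [exact: locally_maj_cst|exact: semialgebraic_fun_cst].
Qed.

Lemma nashD g1 g2 : nash_fun X g1 -> nash_fun X g2 -> nash_fun X (fun x => g1 x + g2 x).
Proof.
move=> /nash_locally_maj[h1 h2] /nash_locally_maj[k1 k2]; apply/nash_locally_maj.
by split; [exact: locally_majD|exact: semialgebraic_funD].
Qed.

Lemma nashM g1 g2 : nash_fun X g1 -> nash_fun X g2 -> nash_fun X (fun x => g1 x * g2 x).
Proof.
move=> /nash_locally_maj[h1 h2] /nash_locally_maj[k1 k2]; apply/nash_locally_maj.
by split; [exact: locally_majM|exact: semialgebraic_funM].
Qed.

Lemma nash_eq_on g1 g2 : nash_fun X g1 -> eq_on X g1 g2 -> nash_fun X g2.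
Proof.
move=> /nash_locally_maj[h1 h2] e; apply/nash_locally_maj.
by split; [exact: locally_maj_eq_on h1|exact: semialgebraic_fun_eq_on h2].
Qed.

Lemma nash_fun_subalgebra : nash_subalgebra X (nash_fun X).
Proof.
by split=> //; [exact: nash_eq_on|exact: nash_cst|exact: nashD|exact: nashM].
Qed.

Lemma nash_coord i : nash_fun X (fun x => x 0 i).
Proof.
apply/nash_locally_maj; split; first exact: locally_maj_coord.
apply: semialgebraic_fun_eq_on (semialgebraic_fun_meval (mpolyX R (mnm1 i)) sX) => x _.
by rewrite mevalXU.
Qed.

Lemma nash_sum (I : Type) (r : seq I) (g : I -> 'rV[R]_n -> R) :
  (forall i, nash_fun X (g i)) -> nash_fun X (fun x => \sum_(i <- r) g i x).
Proof.
move=> h; elim: r => [|i r IH].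
  by under eq_fun do rewrite big_nil; exact: nash_cst.
by under eq_fun do rewrite big_cons; apply: nashD.
Qed.

Lemma nash_map_analytic F : nash_map X F -> analytic_field X F.
Proof. by move=> h i; have /nash_locally_maj[] := h i. Qed.

Lemma nash_lie F g : nash_map X F -> nash_fun X g -> nash_fun X (lie F g).
Proof.
move=> hF hg; have [mg sg] := (nash_locally_maj g).1 hg.
apply: nash_eq_on (lie_partial F mg); apply: nash_sum => i; apply: nashM => //.
apply/nash_locally_maj; split; first exact: locally_maj_pd.
apply: semialgebraic_fun_deriv => // x Xx.
by apply: diff_derivable; exact: locally_maj_differentiable mg Xx.
Qed.

Lemma nash_fun_sub (Y : set 'rV[R]_n) g : open Y -> semialgebraic Y -> Y `<=` X -> nash_fun X g -> nash_fun Y g.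
Proof.
move=> oY sY YX ng; have [mg sg] := (nash_locally_maj g).1 ng.
split; last exact: semialgebraic_fun_sub sg.
apply/(analytic_locally_maj g oY) => a Ya; have [r [M [C [r0 M0 C0 _ mB]]]] := mg a (YX _ Ya).
have [r' r'0 sub] := open_ball_sub oY Ya.
exists (Num.min r r'), M, C; split; rewrite ?lt_min ?r0 //.
  by apply: subset_trans sub; exact: ball_minr.
by apply: maj_sub mB; exact: ball_minl.
Qed.

End NashAlgebra.

Section ObservationAlgebra.
Context {R : realType} {n m r : nat}.
Variables (U : set 'rV[R]_m) (S : system R n m r).
Hypothesis nS : nash_system U S.
Let X := st_space S.

(** The ring of all Nash functions is itself one of the algebras that are intersected, which keeps
    [A_obs] inside it; the other properties pass to intersections. *)
Lemma A_obs_closed : nash_subalgebra X (A_obs U S) /\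
  forall a g, U a -> A_obs U S g -> A_obs U S (lie (dyn S a) g).
Proof.
have [oX cX sX [nf nh _]] := nS.
have nN : (fun A => nash_subalgebra X A /\ forall a g, U a -> A g -> A (lie (dyn S a) g)) (nash_fun X) /\
   [set g | exists j, g = fun x => out S x 0 j] `<=` nash_fun X.
  split; last by move=> g [j ->]; exact: nh.
  split; first exact: nash_fun_subalgebra.
  by move=> a g Ua ng; apply: nash_lie => //; exact: nf.
split; last by move=> a g Ua Ag B hB; have [[_ h] _] := hB; apply: (h) => //; exact: Ag.
split.
- by move=> g Ag; apply: Ag.
- by move=> g1 g2 Ag e B hB; have [[[_ h _ _ _] _] _] := hB; apply: (h) e; exact: Ag.
- by move=> c B [[[_ _ h _ _] _] _]; exact: h.
- by move=> g1 g2 A1 A2 B hB; have [[[_ _ _ h _] _] _] := hB; apply: (h); [exact: A1|exact: A2].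
- by move=> g1 g2 A1 A2 B hB; have [[[_ _ _ _ h] _] _] := hB; apply: (h); [exact: A1|exact: A2].
Qed.

Lemma A_obs_out j : A_obs U S (out_comp S j).
Proof. by move=> B [_ h]; apply: h; exists j. Qed.

Lemma A_obs_lie a g : U a -> A_obs U S g -> A_obs U S (lie (dyn S a) g).
Proof. exact: A_obs_closed.2. Qed.

Lemma A_obs_nash g : A_obs U S g -> nash_fun X g.
Proof. by case: A_obs_closed => -[h _ _ _ _] _; apply: h. Qed.

End ObservationAlgebra.

(** * Algebraic dependence of Nash functions *)

Section VanishingPolynomials.
Context {R : realType}.

Lemma msize_deriv_le n (P : mpoly n R) i : (msize (mderiv i P) <= (msize P).-1)%N.
Proof.
rewrite msizeE; apply/bigmax_leqP_seq => m; rewrite mcoeff_msupp mcoeff_deriv => h _.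
have : (mnm_add m (mnm1 i)) \in msupp P.
  by rewrite mcoeff_msupp; apply: contraNneq h => ->; rewrite mul0rn.
move=> /msize_mdeg_lt; rewrite mdegD mdeg1 addn1 => h2.
by case: (msize P) h2.
Qed.

(** Induction on the degree: the partial derivatives also vanish on the ball, hence are zero, and P
    is a constant. *)
Lemma mpoly_vanish n (P : mpoly n R) (a : 'rV[R]_n) (rho : R) : 0 < rho ->
  (forall x, ball a rho x -> meval (x 0) P = 0) -> P = 0.
Proof.
move=> r0; move: {2}(msize P) (leqnn (msize P)) => k.
elim: k P => [|k IH] P Pk h; first by apply/eqP; rewrite -msize_poly_eq0 -leqn0.
have dP i : mderiv i P = 0.
  apply: IH => [|x Bx].
    by apply: leq_trans (msize_deriv_le P i) _; case: (msize P) Pk.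
  rewrite -(meval_partial P x).2.
  have oB : open (ball a rho) by exact: ball_open_rV.
  by rewrite (@derive_eq_on R n _ _ (fun=> 0) 'e_i oB h x Bx) derive_cst.
have PC : P = mpolyC n (mcoeff mnm0 P).
  apply/mpolyP => m; rewrite mcoeffC; have [->|m0] := eqVneq mnm0 m; first by rewrite mulr1.
  rewrite mulr0; have [i mi] : exists i, m i != 0%N.
    apply: contrapT => H; case/eqP: m0; apply/mnmP => i; rewrite mnm0E.
    by apply/esym/eqP; apply: contrapT => /negP mi; apply: H; exists i.
  have := mcoeff_deriv i (mnm_sub m (mnm1 i)) P; rewrite dP mcoeff0.
  have -> : mnm_add (mnm_sub m (mnm1 i)) (mnm1 i) = m.
    apply/mnmP => j; rewrite mnmDE mnmBE mnm1E.
    by case: eqVneq => [<-|_] /=; rewrite ?subnK ?lt0n ?subn0 ?addn0.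
  by move=> /esym/eqP; rewrite mulrn_eq0 /= => /eqP.
have := h a (ballxx _ r0); rewrite PC mevalC => ->.
by rewrite mpolyC0.
Qed.

Lemma mpoly_eval0 n (P : mpoly n R) : (forall v, meval v P = 0) -> P = 0.
Proof. by move=> h; apply: (@mpoly_vanish n P 0 1) => // x _; exact: h. Qed.

(** Where the product of the polynomials describing A is nonzero, their signs are locally constant
    and decide membership. *)
Lemma semialgebraic_locally_constant n (A : set 'rV[R]_n) : semialgebraic A ->
  exists2 P : mpoly n R, P != 0 & forall x : 'rV[R]_n, meval (x 0) P != 0 ->
    exists2 rho : R, 0 < rho & ball x rho `<=` A \/ ball x rho `<=` ~` A.
Proof.
elim=> [P|B C _ [P P0 hP] _ [Q Q0 hQ]|B _ [P P0 hP]]; last first.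
- by exists P => // x /hP[rho r0 [h|h]]; exists rho; rewrite ?setCK //; [right|left].
- exists (P * Q); first by rewrite mulf_neq0.
  move=> x; rewrite mevalM mulf_eq0 negb_or => /andP[/hP[r1 r10 h1] /hQ[r2 r20 h2]].
  exists (Num.min r1 r2); first by rewrite lt_min r10.
  have s1 := @ball_minl R n x r1 r2; have s2 := @ball_minr R n x r1 r2.
  case: h1 => h1; first by left=> y /s1/h1; left.
  case: h2 => h2; first by left=> y /s2/h2; right.
  by right=> y By [/(h1 _ (s1 _ By))|/(h2 _ (s2 _ By))].
have [->|P0] := eqVneq P 0.
  (* The zero polynomial describes the empty set and would spoil the product, so 1 replaces it. *)
  exists 1; first exact: oner_neq0.
  by move=> x _; exists 1 => //; right=> y _ /=; rewrite meval0 ltxx.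
exists P => // x Px; have [pos|neg|/esym/eqP] := ltgtP 0 (meval (x 0) P); last by rewrite (negbTE Px).
  have /cvgrPdist_lt /(_ _ pos) /nbhs_ballP[r /= r0 h] := @continuous_meval _ _ P x.
  exists r => //; left=> y /h; rewrite /= ltr_norml => /andP[_]; lra.
have /cvgrPdist_lt /(_ (- meval (x 0) P)) := @continuous_meval _ _ P x.
rewrite oppr_gt0 => /(_ neg) /nbhs_ballP[r /= r0 h].
exists r => //; right=> y /h; rewrite /= ltr_norml => /andP[+ _] => h1 h2; lra.
Qed.

Definition upds (e : nat -> R) k (s : seq R) : nat -> R :=
  fun j => if (k <= j < k + size s)%N then nth 0 s (j - k) else e j.

Lemma definable_exs P k n : definable P ->
  definable (fun e => exists s, size s = n /\ P (upds e k s)).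
Proof.
move=> hP; elim: n k => [|n IH] k.
  apply: definable_ext hP => e; have E : upds e k [::] = e.
    by apply/funext => j; rewrite /upds addn0 leqNgt andNb.
  by split=> [Pe|[s [/size0nil -> ]]]; [exists [::]; rewrite E|rewrite E].
apply: definable_ext (definable_ex k (IH k.+1)) => e.
have E t s : upds (upd e k t) k.+1 s = upds e k (t :: s).
  apply/funext => j; rewrite /upds /upd /= addnS addSn.
  have [jk|kj|->] := ltngtP j k; rewrite ?andbT ?andbF //=.
    by rewrite ltnS; case: ifP => // _; rewrite -(subnSK kj).
  by rewrite /= ltnS leq_addr subnn.
split=> [[t [s [sn Ps]]]|[[|t s] [//= [sn] Ps]]].
  by exists (t :: s); rewrite -E /= sn.
by exists t, s; rewrite E.
Qed.

End VanishingPolynomials.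

(* A Lipschitz image of an n-dimensional cube cannot contain an (n+1)-dimensional
   one, by counting separated points; if the image is semi-algebraic it is
   therefore contained in the zero set of a nonzero polynomial. *)
Section Dependence.
Context {R : realType} {n : nat}.
Variables (a : 'rV[R]_n) (rho L : R) (g : 'I_n.+1 -> 'rV[R]_n -> R).
Hypotheses (rho0 : 0 < rho) (L0 : 0 <= L).
Hypothesis gL : forall j x y, ball a rho x -> ball a rho y -> `|g j x - g j y| <= L * `|x - y|.
Hypothesis gs : forall j, semialgebraic_fun (ball a rho) (g j).

Lemma image_semialgebraic :
  semialgebraic [set z : 'rV[R]_n.+1 | exists2 x, ball a rho x & forall j, z 0 j = g j x].
Proof.
apply: semialgebraic_definable.
pose G j := [set z : 'rV[R]_(n + 1) | ball a rho (lsubmx z) /\ rsubmx z 0 0 = g j (lsubmx z)].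
(* Variables 0 to n hold the point z of the target; the n variables after them hold its preimage
   x. *)
pose T (j : 'I_n.+1) (i : 'I_(n + 1)) (e : nat -> R) : R := if (i < n)%N then e (n.+1 + i)%N else e j.
have hT j i : polyterm (T j i).
  by rewrite /T; case: (ltnP i n) => _; exact: polyterm_var.
have h : definable (fun e => forall j, G j (\row_i T j i e)).
  by apply: definable_forall_fin => j; apply: definable_semialgebraic (gs j) (hT j).
apply: definable_ext (definable_exs n.+1 n h) => e /=.
have key s : size s = n -> forall j, G j (\row_i T j i (upds e n.+1 s)) <->
    ball a rho (\row_i s`_i) /\ e j = g j (\row_i s`_i).
  move=> sn j; rewrite /G /=.
  have -> : lsubmx (\row_i T j i (upds e n.+1 s)) = \row_(i < n) s`_i :> 'rV[R]_n.
    apply/rowP => i; rewrite !mxE /T /= ltn_ord /upds sn leq_addr ltn_add2l ltn_ord /=.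
    by rewrite addKn.
  have -> : rsubmx (\row_i T j i (upds e n.+1 s)) 0 0 = e j.
    by rewrite !mxE /T /= addn0 ltnn /upds leqNgt ltn_ord.
  by [].
split=> [[s [sn hs]]|[x ax hx]].
  exists (\row_i s`_i); first by have /key := hs ord0; rewrite sn => -[].
  by move=> j; rewrite mxE; have /key := hs j; rewrite sn => -[].
exists (row_env x); have sn : size (row_env x) = n by rewrite size_map size_enum_ord.
split=> // j; apply/key => //; have -> : \row_i (row_env x)`_i = x.
  by apply/rowP => i; rewrite mxE nth_row_env.
by split=> //; have := hx j; rewrite mxE.
Qed.

Lemma image_no_interior (z : 'I_n.+1 -> R) (eps : R) : 0 < eps ->
  ~ (forall y : 'I_n.+1 -> R, (forall j, `|y j - z j| < eps) -> exists2 x, ball a rho x & forall j, y j = g j x).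
Proof.
move=> e0 h.
(* The target contains N^(n+1) grid points at mutual distance at least eps/(2N), the source is cut
   into M^n = K^n N^n cells. As N > K^n, two preimages share a cell of side 2 rho/M; as K > 8 L
   rho/eps, their images are then too close. *)
pose K := (Num.truncn (8 * L * rho / eps)).+1; pose N := (K ^ n).+1; pose M := (K * N)%N.
have K1 : 8 * L * rho / eps < K%:R by exact: truncnS_gt.
have N0 : 0 < N%:R :> R by rewrite ltr0n.
have K0 : 0 < K%:R :> R by rewrite ltr0n.
have M0 : (0 < M)%N by rewrite muln_gt0.
pose y (nu : {ffun 'I_n.+1 -> 'I_N}) j : R := z j + eps / 2 * ((nu j)%:R / N%:R).
have hy nu : exists2 x, ball a rho x & forall j, y nu j = g j x.
  apply: h => j; rewrite /y addrAC subrr add0r.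
  have q0 : 0 <= (nu j)%:R / N%:R :> R by rewrite divr_ge0.
  have q1 : (nu j)%:R / N%:R <= 1 :> R by rewrite ler_pdivrMr // mul1r ler_nat ltnW.
  rewrite ger0_norm ?mulr_ge0 ?divr_ge0 // ?ltW //.
  have := ler_wpM2l (ltW (divr_gt0 e0 (ltr0Sn R 1))) q1; lra.
pose x nu := s2val (cid2 (hy nu)).
have bx nu : ball a rho (x nu) by rewrite /x; case: (cid2 (hy nu)).
have gx nu j : y nu j = g j (x nu) by rewrite /x; case: (cid2 (hy nu)).
pose c nu i : R := (x nu 0 i - a 0 i + rho) / (2 * rho) * M%:R.
have rr : 0 < 2 * rho by rewrite mulr_gt0.
have c0 nu i : 0 <= c nu i < M%:R.
  have /in_ball bb := bx nu; have := le_lt_trans (coord_le_norm _ i) bb; rewrite !mxE ltr_norml => /andP[b1 b2].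
  have p : 0 <= (x nu 0 i - a 0 i + rho) / (2 * rho) < 1.
    by rewrite divr_ge0 ?(ltW rr) ?ltr_pdivrMr ?mul1r //=; lra.
  have M0' : 0 < M%:R :> R by rewrite ltr0n.
  by move/andP: p => [p1 p2]; rewrite /c mulr_ge0 ?(ltW M0') //= -[ltRHS]mul1r ltr_pM2r.
have ct nu i : (Num.truncn (c nu i) < M)%N.
  by have /andP[c1 c2] := c0 nu i; rewrite truncn_lt_nat.
pose cell nu : {ffun 'I_n -> 'I_M} := [ffun i => Ordinal (ct nu i)].
have /injectivePn[nu [nu' nn ce]] : ~~ injectiveb cell.
  apply/injectiveP => ci; have := leq_card _ ci; rewrite !card_ffun !card_ord leqNgt.
  by rewrite /M expnMn expnS ltn_pmul2r ?expn_gt0 // /N ltnS leqnn.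
have [j nj] : exists j, nu j != nu' j.
  apply: contrapT => H; case/eqP: nn; apply/ffunP => j.
  by apply/eqP; apply: contrapT => /negP nj; apply: H; exists j.
have xx : `|x nu - x nu'| <= 2 * rho / M%:R.
  apply: norm_le_coord => [|i]; first by rewrite divr_ge0 // ltW.
  have M0' : 0 < M%:R :> R by rewrite ltr0n.
  have /ffunP/(_ i) := ce; rewrite !ffunE => -[tt].
  have /andP[c1 _] := c0 nu i; have /andP[c1' _] := c0 nu' i.
  have /andP[t1 t2] := truncn_itv c1; have /andP[t1' t2'] := truncn_itv c1'.
  rewrite tt in t1 t2; have cc : `|c nu i - c nu' i| <= 1.
    by rewrite ler_norml; apply/andP; split; move: t1 t2 t1' t2'; rewrite -!natr1; lra.
  have E : x nu 0 i - x nu' 0 i = (c nu i - c nu' i) * (2 * rho / M%:R).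
    rewrite /c -mulrBl -mulrBl -[RHS]mulrA [M%:R * _]mulrCA mulfV ?gt_eqF // mulr1 -[RHS]mulrA mulVf ?gt_eqF // mulr1; lra.
  rewrite !mxE E normrM [leRHS](_ : _ = 1 * (2 * rho / M%:R)) ?mul1r //.
  have q0 : 0 <= 2 * rho / M%:R by rewrite divr_ge0 // ltW.
  by rewrite (ger0_norm q0) -[leRHS]mul1r ler_wpM2r.
have := gL j (bx nu) (bx nu'); rewrite -!gx => A.
have B : eps / 2 / N%:R <= `|y nu j - y nu' j|.
  rewrite /y [X in `|X|](_ : _ = eps / 2 / N%:R * ((nu j)%:R - (nu' j)%:R)); last lra.
  have e2 : 0 < eps / 2 / N%:R by rewrite !divr_gt0.
  rewrite normrM (gtr0_norm e2) ler_peMr // ?(ltW e2) //.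
  wlog lt : nu nu' {nn ce nj xx A} / (nu' j < nu j)%N => [H|]; last first.
    by rewrite -natrB ?(ltnW lt) // normr_nat ler1n subn_gt0.
  have [?|?|/val_inj/eqP] := ltngtP (nu j) (nu' j); [by rewrite distrC; apply: H|exact: H|by rewrite (negbTE nj)].
have C : eps / 2 / N%:R <= L * (2 * rho / M%:R).
  by apply: le_trans B _; apply: le_trans A _; apply: ler_wpM2l.
move: C; rewrite /M natrM invfM.
rewrite (_ : L * _ = (L * 2 * rho / K%:R) / N%:R); last lra.
rewrite ler_pM2r ?invr_gt0 // ler_pdivlMr //.
move: K1; rewrite ltr_pdivrMr //; have : 0 < K%:R * eps by rewrite mulr_gt0.
have : 0 <= L * rho by rewrite mulr_ge0 // ltW.
lra.
Qed.

Lemma lipschitz_semialgebraic_dependent : exists2 P : mpoly n.+1 R, P != 0 &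
  forall x, ball a rho x -> meval (fun j => g j x) P = 0.
Proof.
have [P P0 hP] := semialgebraic_locally_constant image_semialgebraic.
exists P => // x bx; apply/eqP; apply: contrapT => /negP Px.
have Ez : (fun j => g j x) = (\row_j g j x : 'rV[R]_n.+1) 0 by apply/funext => j; rewrite mxE.
rewrite Ez in Px; have [r r0 [h|h]] := hP _ Px.
  apply: (@image_no_interior (fun j => g j x) r r0) => y hy.
  have [|x' bx' hx'] := h (\row_j y j).
    by apply/in_ball; apply: norm_lt_coord => // j; rewrite !mxE distrC.
  by exists x' => // j; rewrite -hx' mxE.
by case: (h _ (ballxx _ r0)); exists x => // j; rewrite mxE.
Qed.

End Dependence.

(** * Fraction fields and transcendence bases *)

Lemma fraction_quotient (D : idomainType) (y : {fraction D}) :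
  exists a b : D, b != 0 /\ y = FracField.tofrac a / FracField.tofrac b.
Proof.
elim/quotW: y => x; exists (frac x).1, (frac x).2; have d0 := denom_ratioP x.
have d0' : FracField.tofrac (frac x).2 != 0 by rewrite tofrac_eq0.
split=> //; apply: (mulIf d0'); rewrite divfK //.
rewrite /FracField.tofrac; unlock.
rewrite -[LHS]FracField.pi_mul; apply/eqP; rewrite FracField.equivf_def.
by rewrite /FracField.mulf !numden_Ratio ?oner_neq0 ?mulr1 ?mul1r ?mulf_neq0 // mulrC.
Qed.

Section FractionField.
Context {R : realType} {n : nat}.
Variables (X : set 'rV[R]_n) (A : set ('rV[R]_n -> R)).
Hypotheses (hA : nash_subalgebra X A) (X0 : X !=set0).
Hypothesis dA : forall g1 g2, A g1 -> A g2 -> eq_on X (fun x => g1 x * g2 x) (fun=> 0) ->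
  eq_on X g1 (fun=> 0) \/ eq_on X g2 (fun=> 0).

Let D := {x : 'rV[R]_n | X x}.

(** Members of A are total functions of which only the values on X matter; passing to functions on
    the subtype [D] makes equality on X the equality of a ring. *)
Definition restrictions : {pred D -> R} :=
  fun h => `[< exists2 f, A f & forall x, h x = f (sval x) >].

Lemma restrictions_closed : GRing.subring_closed restrictions.
Proof.
have [_ eA cA aA mA] := hA; split.
- by apply/asboolP; exists (fun=> 1).
- move=> h1 h2 /asboolP[f1 A1 e1] /asboolP[f2 A2 e2]; apply/asboolP.
  exists (fun x => f1 x + (-1) * f2 x); first by apply: aA => //; apply: mA.
  by move=> x; rewrite mulN1r -e1 -e2.
- move=> h1 h2 /asboolP[f1 A1 e1] /asboolP[f2 A2 e2]; apply/asboolP.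
  exists (fun x => f1 x * f2 x); first exact: mA.
  by move=> x; rewrite -e1 -e2.
Qed.

HB.instance Definition _ := GRing.isSubringClosed.Build (D -> R) restrictions restrictions_closed.

Definition restriction_ring := {h : D -> R | h \in restrictions}.

HB.instance Definition _ := SubType.on restriction_ring.
HB.instance Definition _ := Choice.on restriction_ring.
HB.instance Definition _ :=
  GRing.SubChoice_isSubComPzRing.Build (D -> R) restrictions restriction_ring restrictions_closed.

Lemma restriction_ring1_neq0 : 1 != 0 :> restriction_ring.
Proof.
have [x Xx] := X0; apply/eqP => /(congr1 val) /(congr1 (@^~ (exist _ x Xx))) /eqP.
by rewrite [X in X == _]/= [X in _ == X]/= oner_eq0.
Qed.

HB.instance Definition _ := GRing.PzSemiRing_isNonZero.Build restriction_ring restriction_ring1_neq0.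

Let unit : {pred restriction_ring} := fun f => `[< exists g, g * f = 1 >].

Let inv (f : restriction_ring) : restriction_ring :=
  if pselect (exists g, g * f = 1) is left h then sval (cid h) else f.

Let mulVx : {in unit, left_inverse 1 inv *%R}.
Proof.
move=> f /asboolP h; rewrite /inv; case: pselect => // h'.
by case: (cid h').
Qed.

Let unitPl (x y : restriction_ring) : y * x = 1 -> unit x.
Proof. by move=> h; apply/asboolP; exists y. Qed.

Let inv_out : {in [predC unit], inv =1 id}.
Proof.
move=> f /negP h; rewrite /inv; case: pselect => // h'.
by exfalso; apply: h; apply/asboolP.
Qed.

HB.instance Definition _ := GRing.ComNzRing_hasMulInverse.Build restriction_ring mulVx unitPl inv_out.

Lemma restriction_ring_domain : GRing.integral_domain_axiom restriction_ring.
Proof.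
move=> f1 f2 e; have /asboolP[g1 A1 e1] := valP f1; have /asboolP[g2 A2 e2] := valP f2.
have [|h|h] := @dA g1 g2 A1 A2.
- move=> x Xx; have := congr1 (fun f => val f (exist _ x Xx)) e.
  by rewrite /= -(e1 (exist _ x Xx)) -(e2 (exist _ x Xx)).
- by apply/orP; left; apply/eqP/val_inj/funext => x; rewrite e1 h //; exact: (svalP x).
- by apply/orP; right; apply/eqP/val_inj/funext => x; rewrite e2 h //; exact: (svalP x).
Qed.

HB.instance Definition _ := GRing.ComUnitRing_isIntegral.Build restriction_ring restriction_ring_domain.

Lemma fraction_field_exists : exists (K : fieldType) (iota : ('rV[R]_n -> R) -> K), fraction_field_of X A iota.
Proof.
have [_ eA cA aA mA] := hA.
have rP g : A g -> (fun x : D => g (sval x)) \in restrictions by move=> Ag; apply/asboolP; exists g.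
pose res g : restriction_ring := if pselect (A g) is left h then Sub (fun x : D => g (sval x)) (rP g h) else 0.
have resE g x : A g -> val (res g) x = g (sval x).
  by move=> Ag; rewrite /res; case: pselect.
exists {fraction restriction_ring}, (fun g => FracField.tofrac (res g)); split.
- rewrite (_ : res _ = 1) ?rmorph1 //; apply/val_inj/funext => x; rewrite resE //; exact: cA.
- move=> g1 g2 A1 A2; rewrite -rmorphD; congr FracField.tofrac; apply/val_inj/funext => x.
  by rewrite resE; [rewrite /= -!resE|exact: aA].
- move=> g1 g2 A1 A2; rewrite -rmorphM; congr FracField.tofrac; apply/val_inj/funext => x.
  by rewrite resE; [rewrite /= -!resE|exact: mA].
- move=> g1 g2 A1 A2; split=> [/eqP|e].
    rewrite tofrac_eq => /eqP e x Xx; have := congr1 (fun f => val f (exist _ x Xx)) e.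
    by rewrite !resE.
  congr FracField.tofrac; apply/val_inj/funext => x; rewrite !resE // e //; exact: (svalP x).
move=> y; have [f1 [f2 [f20 ->]]] := fraction_quotient y.
have /asboolP[g1 A1 e1] := valP f1; have /asboolP[g2 A2 e2] := valP f2.
have E (f : restriction_ring) g : A g -> (forall x, val f x = g (sval x)) -> res g = f.
  by move=> Ag e; apply/val_inj/funext => x; rewrite resE // e.
by exists g1, g2; rewrite (E _ _ A1 e1) (E _ _ A2 e2); split=> //; rewrite tofrac_eq0.
Qed.

End FractionField.

Section Transcendence.
Context {R : realType}.

(** Evaluates one polynomial simultaneously at functions and at elements of K. The relation B is
    [iota f = v] in [iota_meval], and local representation by a quotient in [mmap_quotients0]. *)
Lemma meval_mmap_rel (T : Type) (K : comNzRingType) (emb : R -> K) k (B : (T -> R) -> K -> Prop)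
    (c : 'I_k -> T -> R) (z : 'I_k -> K) (P : mpoly k R) :
  (forall a, B (fun=> a) (emb a)) -> B (fun=> 0) 0 -> B (fun=> 1) 1 ->
  (forall f g u v, B f u -> B g v -> B (fun x => f x + g x) (u + v)) ->
  (forall f g u v, B f u -> B g v -> B (fun x => f x * g x) (u * v)) ->
  (forall j, B (c j) (z j)) -> B (fun x => meval (fun j => c j x) P) (mmap emb z P).
Proof.
move=> Bc B0 B1 BD BM hc; rewrite (_ : (fun x => _) = fun x => \sum_(m <- msupp P) mcoeff m P * \prod_i c i x ^+ m i);
  last by apply/funext => x; rewrite mevalE.
have hX i l : B (fun x => c i x ^+ l) (z i ^+ l).
  elim: l => [|l IH]; first by under eq_fun do rewrite expr0; rewrite expr0.
  by under eq_fun do rewrite exprS; rewrite exprS; apply: BM.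
have hP (m : multinom k) : B (fun x => \prod_i c i x ^+ m i) (mmap1 z m).
  rewrite /mmap1; elim: (index_enum _) => [|i r IH].
    by under eq_fun do rewrite big_nil; rewrite big_nil.
  by under eq_fun do rewrite big_cons; rewrite big_cons; apply: BM.
rewrite /mmap; elim: (msupp P : seq _) => [|m r IH].
  by under eq_fun do rewrite big_nil; rewrite big_nil.
by under eq_fun do rewrite big_cons; rewrite big_cons; apply: BD => //; apply: BM.
Qed.

Definition indep_on n (X : set 'rV[R]_n) k (c : 'I_k -> 'rV[R]_n -> R) : Prop :=
  forall P : mpoly k R, (forall x, X x -> meval (fun j => c j x) P = 0) -> P = 0.

Lemma gmaj_lipschitz n (a : 'rV[R]_n) (r M C : R) g : 0 <= M -> 0 <= C -> gmaj (ball a r) M C g ->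
  forall x y, ball a r x -> ball a r y -> `|g x - g y| <= n%:R * (M * C) * `|x - y|.
Proof.
move=> M0 C0 mg x y bx by_.
have cb t : 0 <= t <= 1 -> ball a r (y + t *: (x - y)) by exact: convex_ball.
have MC : 0 <= M * C by rewrite mulr_ge0.
have := @taylor_line R n g y (x - y) 1 (M * C) MC.
rewrite big_ord_recl big_ord0 addr0 expr1 divr1 (addrC y) subrK /dpow /= big_seq1 /hpow big_nil mul1r !divr1.
rewrite -[pds [::] g y]/(g y) => H; rewrite [leRHS](_ : _ = n%:R * `|x - y| * (M * C)); last lra.
apply: H => t tab w sw; first by case: (maj_pds w mg (cb t tab)).
by have [_] := maj_pds w mg (cb t tab); rewrite sw expr1 (_ : 1`! = 1)%N // mulr1.
Qed.

Lemma polytermV T : polyterm T -> polyterm (fun e : nat -> R => (T e)^-1).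
Proof. by move=> [t h]; exists (GRing.Inv t) => s /=; rewrite h. Qed.

Lemma divrB_diff (a a' u v : R) : u != 0 -> v != 0 ->
  a / u - a' / v = ((a - a') * v - a' * (u - v)) / (u * v).
Proof.
move=> u0 v0; have uv : u * v != 0 by rewrite mulf_neq0.
have e1 : a / u * (u * v) = a * v by rewrite mulrA divfK.
have e2 : a' / v * (u * v) = a' * u by rewrite [u * v]mulrC mulrA divfK.
apply: (mulIf uv); rewrite mulrBl e1 e2 divfK //; lra.
Qed.

(** On a ball where the denominators stay away from 0 the quotients are Lipschitz and
    semi-algebraic, so n + 1 of them in n variables satisfy a polynomial relation. *)
Lemma quotients_dependent n (X : set 'rV[R]_n) (a b : 'I_n.+1 -> 'rV[R]_n -> R) x0 : open X ->
  (forall j, nash_fun X (a j)) -> (forall j, nash_fun X (b j)) -> X x0 -> (forall j, b j x0 != 0) ->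
  exists rho (P : mpoly n.+1 R), [/\ 0 < rho, P != 0, ball x0 rho `<=` X,
    forall x j, ball x0 rho x -> b j x != 0 &
    forall x, ball x0 rho x -> meval (fun j => a j x / b j x) P = 0].
Proof.
move=> oX na nb Xx0 b0.
pose f (i : 'I_n.+1 * bool) := if i.2 then a i.1 else b i.1.
have nf i : nash_fun X (f i) by rewrite /f; case: i.2.
have [r1 [M [C [r10 M0 C0 sX mf]]]] := locally_maj_common oX (fun i => ((nash_locally_maj oX (f i)).1 (nf i)).1) Xx0.
have ma j := mf (j, true); have mb j := mf (j, false); rewrite /f /= in ma mb.
have cvb j : exists2 r : R, 0 < r & forall x, ball x0 r x -> `|b j x0| / 2 < `|b j x|.
  have db : differentiable (b j) x0 by case: (maj0 (mb j) (ballxx _ r10)).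
  have p : 0 < `|b j x0| / 2 by rewrite divr_gt0 // normr_gt0.
  have /cvgrPdist_lt /(_ _ p) /nbhs_ballP[r /= r0 h] := differentiable_continuous db.
  exists r => // x /h; have := ler_distD 0 (b j x0) (b j x); rewrite !subr0 sub0r normrN => _ h2.
  have := ler_normD (b j x0 - b j x) (b j x); rewrite subrK; lra.
pose r2 := \big[Num.min/r1]_j s2val (cid2 (cvb j)).
have r20 : 0 < r2 by rewrite /r2; apply: (big_ind (fun z => 0 < z)) => // [z w z0 w0|j _]; [rewrite lt_min z0|case: (cid2 _)].
have r2r1 : r2 <= r1 by apply: bigmin_le_id.
have r2j j : r2 <= s2val (cid2 (cvb j)) by apply: bigmin_le.
have sb : ball x0 r2 `<=` ball x0 r1 by apply: le_ball.
have bl j x : ball x0 r2 x -> `|b j x0| / 2 < `|b j x|.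
  move=> bx; have := r2j j; case: (cid2 _) => r r0 h /= rr; apply: h; exact: le_ball bx.
have bn j x : ball x0 r2 x -> b j x != 0.
  by move=> /(bl j) h; rewrite -normr_gt0; apply: le_lt_trans h; rewrite divr_ge0.
pose beta := \big[Num.min/1]_j (`|b j x0| / 2).
have beta0 : 0 < beta by rewrite /beta; apply: (big_ind (fun z => 0 < z)) => // [z w z0 w0|j _]; [rewrite lt_min z0|rewrite divr_gt0 // normr_gt0].
have bb j x : ball x0 r2 x -> beta <= `|b j x|.
  by move=> /(bl j)/ltW; apply: le_trans; apply: bigmin_le.
pose L := n%:R * (M * C); have L0 : 0 <= L by rewrite !mulr_ge0.
have sbal := semialgebraic_ball x0 r2.
have sX2 : ball x0 r2 `<=` X by apply: subset_trans sX.
have [|||P P0 hP] := @lipschitz_semialgebraic_dependent R n x0 r2 ((L * M + M * L) / beta ^+ 2) (fun j x => a j x / b j x) r20.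
- by rewrite divr_ge0 ?exprn_ge0 ?(ltW beta0) // addr_ge0 // mulr_ge0.
- move=> j x y bx by_.
  have [la lb] := (gmaj_lipschitz M0 C0 (ma j) (sb _ bx) (sb _ by_), gmaj_lipschitz M0 C0 (mb j) (sb _ bx) (sb _ by_)).
  rewrite -/L in la lb.
  have [_ a2] := maj0 (ma j) (sb _ by_); have [_ b2] := maj0 (mb j) (sb _ by_).
  rewrite expr0 !mulr1 in a2 b2.
  have E : a j x / b j x - a j y / b j y = ((a j x - a j y) * b j y - a j y * (b j x - b j y)) / (b j x * b j y).
    by apply: divrB_diff; exact: bn.
  rewrite E normrM normfV normrM -[leRHS]mulrA [_^-1 * _]mulrC mulrA; apply: ler_pM => //.
  - apply: le_trans (ler_normB _ _) _; rewrite !normrM.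
    have h1 := ler_pM (normr_ge0 _) (normr_ge0 _) la b2; have h2 := ler_pM (normr_ge0 _) (normr_ge0 _) a2 lb; lra.
  - rewrite lef_pV2 ?posrE ?exprn_gt0 // ?mulr_gt0 ?normr_gt0 ?bn // expr2; apply: ler_pM; rewrite ?(ltW beta0) //; exact: bb.
- move=> j; apply: (@semialgebraic_fun_op _ _ _ (fun u v => u / v)).
  + by move=> *; apply: polytermM => //; exact: polytermV.
  + by apply: semialgebraic_fun_sub sX2 _ => //; case: (na j).
  + by apply: semialgebraic_fun_sub sX2 _ => //; case: (nb j).
exists r2, P; split=> //; by move=> x j bx; exact: bn.
Qed.

Lemma minimal_relation_exists n d (X : set 'rV[R]_n) g (phi : 'I_d -> 'rV[R]_n -> R) Q :
  relation_on X g phi Q -> exists Q', minimal_relation X g phi Q'.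
Proof.
move=> rQ; pose p k := `[< exists2 Q, relation_on X g phi Q & msize Q = k >].
have ex : exists k, p k by exists (msize Q); apply/asboolP; exists Q.
case: (ex_minnP ex) => k /asboolP[Q' rQ' <-] h; exists Q'; split=> // Q2 rQ2.
by apply: h; apply/asboolP; exists Q2.
Qed.

(* If Q_T vanished identically, Q would by minimality not involve T. *)
Lemma minimal_relation_simple n d (X : set 'rV[R]_n) g (phi : 'I_d -> 'rV[R]_n -> R) Q :
  indep_on X phi -> minimal_relation X g phi Q ->
  exists2 x, X x & eval_rel (mderiv ord0 Q) g phi x != 0.
Proof.
move=> ip [[Q0 rQ] mQ]; apply: contrapT => H.
have dQ : mderiv ord0 Q = 0.
  apply/eqP; apply: contrapT => /negP d0; have := mQ (mderiv ord0 Q).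
  have -> : (msize Q <= msize (mderiv ord0 Q))%N = false.
    apply/negbTE; rewrite -ltnNge; apply: leq_ltn_trans (msize_deriv_le Q ord0) _.
    by rewrite ltn_predL lt0n msize_poly_eq0.
  move=> F; suff : false by []; apply: F; split=> // x Xx.
  by apply/eqP; apply: contrapT => /negP ne; apply: H; exists x.
have cst z z' (v : 'I_d -> R) : meval (fcons z v) Q = meval (fcons z' v) Q.
  have vE : v = (\row_i v i : 'rV[R]_d) 0 by apply/funext => i; rewrite mxE.
  suff W (u u' : R) : u <= u' -> meval (fcons u v) Q = meval (fcons u' v) Q.
    by have [/W|/ltW/W] := leP z z'.
  move=> uu; apply/eqP; rewrite eq_le; apply/andP; split; rewrite -subr_ge0 vE.
    by have := @meval_incr R d Q (\row_i v i) 0 u u'; rewrite mul0r; apply=> // t _; rewrite dQ meval0.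
  have := @meval_incr R d (- Q) (\row_i v i) 0 u u'; rewrite mul0r !mevalN opprK addrC; apply=> // t _.
  by rewrite mderivN dQ oppr0 meval0.
(* Substituting 0 for T turns Q into a relation among the phi alone, which independence forces to be
   zero. *)
pose q := [tuple fcons 0 (fun i : 'I_d => mpolyX R (mnm1 i)) j | j < d.+1].
have qE (v : 'I_d -> R) : (fun j => meval v (tnth q j)) = fcons 0 v.
  apply/funext => j; rewrite tnth_mktuple; case: (unliftP ord0 j) => [l ->|->].
    by rewrite !fconsS mevalXU.
  by rewrite !fcons0 meval0.
have : comp_mpoly q Q = 0.
  apply: ip => x Xx; rewrite comp_mpoly_meval qE (cst 0 (g x)); exact: rQ.
move=> Q'0; move: Q0 => /eqP; apply; apply: mpoly_eval0 => v.
have -> : v = fcons (v ord0) (fun i => v (lift ord0 i)).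
  by apply/funext => j; case: (unliftP ord0 j) => [l ->|->]; rewrite ?fconsS ?fcons0.
by rewrite (cst _ 0) -qE -comp_mpoly_meval Q'0 meval0.
Qed.

Section Fractions.
Context {n : nat}.
Variables (X : set 'rV[R]_n) (A : set ('rV[R]_n -> R)).
Hypotheses (oX : open X) (cX : connected X) (sX : semialgebraic X) (X0 : X !=set0).
Hypothesis hA : nash_subalgebra X A.
Variables (K : fieldType) (iota : ('rV[R]_n -> R) -> K).
Hypothesis hK : fraction_field_of X A iota.
Let emb c : K := iota (fun=> c).

Lemma subalgebra_locally_maj g : A g -> locally_maj X g.
Proof. by have [h _ _ _ _] := hA; move=> /h /(nash_locally_maj oX)[]. Qed.

Lemma iota_const0 : iota (fun=> 0) = 0.
Proof.
have [_ hD _ _ _] := hK; have [_ _ hc _ _] := hA.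
have := hD _ _ (hc 0) (hc 0); under [X in iota X = _]eq_fun do rewrite addr0.
by move=> /eqP; rewrite -subr_eq0 opprD addrA subrr sub0r oppr_eq0 => /eqP.
Qed.

Lemma iota_eq0 g : A g -> (iota g = 0 <-> eq_on X g (fun=> 0)).
Proof.
move=> Ag; have [_ _ _ hE _] := hK; have [_ _ hc _ _] := hA.
by rewrite -iota_const0; apply: hE.
Qed.

Lemma iota_meval k (c : 'I_k -> 'rV[R]_n -> R) P : (forall j, A (c j)) ->
  A (fun x => meval (fun j => c j x) P) /\
  iota (fun x => meval (fun j => c j x) P) = mmap emb (fun j => iota (c j)) P.
Proof.
move=> Ac; have [h1 hD hM hE hQ] := hK; have [_ _ hc aA mA] := hA.
apply: (@meval_mmap_rel _ _ emb k (fun f v => A f /\ iota f = v)) => //.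
- by split=> //; exact: iota_const0.
- by move=> f g u v [Af <-] [Ag <-]; split; [exact: aA|exact: hD].
- by move=> f g u v [Af <-] [Ag <-]; split; [exact: mA|exact: hM].
Qed.

Lemma alg_indep_on k (c : 'I_k -> 'rV[R]_n -> R) : (forall j, A (c j)) ->
  alg_indep emb (fun j => iota (c j)) <-> indep_on X c.
Proof.
move=> Ac; split=> h P hP; apply: h; have [AP e] := iota_meval P Ac.
  by rewrite -e; apply/(iota_eq0 AP).
by move: hP; rewrite -e => /(iota_eq0 AP).
Qed.

(** A relation that holds on one ball holds in K: after clearing denominators its numerator is
    analytic on the connected set X, and the identity theorem applies. *)
Lemma mmap_quotients0 k (a b : 'I_k -> 'rV[R]_n -> R) (P : mpoly k R) x0 (rho : R) :
  (forall j, A (a j)) -> (forall j, A (b j)) -> 0 < rho -> ball x0 rho `<=` X ->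
  (forall x j, ball x0 rho x -> b j x != 0) ->
  (forall x, ball x0 rho x -> meval (fun j => a j x / b j x) P = 0) ->
  mmap emb (fun j => iota (a j) / iota (b j)) P = 0.
Proof.
move=> Aa Ab r0 sB bn hP; have [h1 hD hM hE hQ] := hK; have [_ _ hc aA mA] := hA.
have Xx0 : X x0 by apply: sB; exact: ballxx.
have nz e : A e -> (forall x, ball x0 rho x -> e x != 0) -> iota e != 0.
  move=> Ae en; apply/eqP => /(iota_eq0 Ae) /(_ _ Xx0) /eqP.
  by rewrite (negbTE (en _ (ballxx _ r0))).
(* The function f on the ball and the element v of K are the same quotient h/e, with e having no
   zero on the ball. *)
pose B (f : 'rV[R]_n -> R) (v : K) := exists h e, [/\ A h, A e, forall x, ball x0 rho x -> e x != 0,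
   v * iota e = iota h & forall x, ball x0 rho x -> f x * e x = h x].
have : B (fun x => meval (fun j => a j x / b j x) P) (mmap emb (fun j => iota (a j) / iota (b j)) P).
  apply: (@meval_mmap_rel _ _ emb k B).
  - move=> c; exists (fun=> c), (fun=> 1); split=> //; rewrite ?h1 ?mulr1 // => x _; by rewrite ?mulr1 ?oner_neq0.
  - exists (fun=> 0), (fun=> 1); split=> //; rewrite ?h1 ?mulr1 ?iota_const0 // => x _; by rewrite ?mulr1 ?oner_neq0.
  - exists (fun=> 1), (fun=> 1); split=> //; rewrite ?h1 ?mulr1 // => x _; by rewrite ?mulr1 ?oner_neq0.
  - move=> f g u v [h [e [Ah Ae en E1 E2]]] [h' [e' [Ah' Ae' en' E1' E2']]].
    exists (fun x => h x * e' x + h' x * e x), (fun x => e x * e' x); split.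
    + by apply: aA; apply: mA.
    + exact: mA.
    + by move=> x bx; rewrite mulf_neq0 ?en ?en'.
    + rewrite hD ?hM //; [|exact: mA|exact: mA].
      by rewrite -E1 -E1' mulrDl mulrA [v * (_ * _)]mulrCA mulrC [in RHS]mulrC; congr (_ + _); rewrite mulrC -?mulrA // mulrCA.
    + by move=> x bx; rewrite -E2 // -E2' //; lra.
  - move=> f g u v [h [e [Ah Ae en E1 E2]]] [h' [e' [Ah' Ae' en' E1' E2']]].
    exists (fun x => h x * h' x), (fun x => e x * e' x); split.
    + exact: mA.
    + exact: mA.
    + by move=> x bx; rewrite mulf_neq0 ?en ?en'.
    + by rewrite !hM // -E1 -E1' mulrACA.
    + by move=> x bx; rewrite -E2 // -E2' // mulrACA.
  - move=> j; exists (a j), (b j); split=> //.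
    + by move=> x bx; apply: bn.
    + by rewrite divfK // nz // => x bx; apply: bn.
    + by move=> x bx; rewrite divfK // bn.
move=> [h [e [Ah Ae en E1 E2]]].
have h0 : iota h = 0.
  apply/(iota_eq0 Ah); apply: (identity_theorem oX cX (subalgebra_locally_maj Ah) Xx0).
  apply/nbhs_ballP; exists rho => // x bx /=.
  by rewrite -E2 // hP // mul0r.
by move: E1; rewrite h0 => /eqP; rewrite mulf_eq0 (negbTE (nz e Ae en)) orbF => /eqP.
Qed.

Lemma prod_nonzero (I : eqType) (s : seq I) (b : I -> 'rV[R]_n -> R) : (forall j, j \in s -> A (b j)) ->
  (forall j, j \in s -> exists2 x, X x & b j x != 0) ->
  A (fun x => \prod_(j <- s) b j x) /\ exists2 x, X x & \prod_(j <- s) b j x != 0.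
Proof.
have [_ _ hc _ mA] := hA; elim: s => [|j s IH] Ab bn.
  under eq_fun do rewrite big_nil; split; first exact: hc.
  by have [x Xx] := X0; exists x => //; rewrite big_nil oner_neq0.
have [l ls|l ls|As [x Xx px]] := IH; [by apply: Ab; rewrite inE ls orbT|by apply: bn; rewrite inE ls orbT|].
have Aj : A (b j) by apply: Ab; exact: mem_head.
split; first by under eq_fun do rewrite big_cons; apply: mA.
apply: contrapT => H; have E : eq_on X (fun x => b j x * \prod_(l <- s) b l x) (fun=> 0).
  move=> y Xy; apply/eqP; apply: contrapT => /negP h; apply: H; exists y => //.
  by rewrite big_cons.
have [h|h] := analytic_domain oX cX (subalgebra_locally_maj Aj) (subalgebra_locally_maj As) E.
  by have [y Xy] := bn j (mem_head j s); rewrite h ?eqxx.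
by move: px; rewrite h ?eqxx.
Qed.

Lemma common_nonzero k (b : 'I_k -> 'rV[R]_n -> R) : (forall j, A (b j)) ->
  (forall j, exists2 x, X x & b j x != 0) -> exists2 x, X x & forall j, b j x != 0.
Proof.
move=> Ab bn; have [_ [x Xx]] := prod_nonzero (fun j (_ : j \in enum 'I_k) => Ab j) (fun j _ => bn j).
rewrite prodf_seq_neq0 => /allP h; exists x => // j.
by apply: (implyP (h j _)) => //; rewrite mem_enum.
Qed.

(** Since products of nonzero analytic functions on connected X are nonzero, the denominators have a
    common point of non-vanishing, near which [quotients_dependent] gives the relation. *)
Lemma fractions_dependent (z : 'I_n.+1 -> K) : ~ alg_indep emb z.
Proof.
have [_ _ _ _ hQ] := hK; have [nA _ _ _ _] := hA.
have /choice[a] := fun j => hQ (z j).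
move=> /choice[b hab].
have Aa j : A (a j) by have [] := hab j.
have Ab j : A (b j) by have [] := hab j.
have bn j : iota (b j) != 0 by have [] := hab j.
have zE : z = fun j => iota (a j) / iota (b j) by apply/funext => j; have [] := hab j.
have [|x0 Xx0 b0] := common_nonzero Ab.
  move=> j; apply: contrapT => H; case/eqP: (bn j); apply/(iota_eq0 (Ab j)) => x Xx.
  by apply/eqP; apply: contrapT => /negP bx; apply: H; exists x.
have [rho [P [r0 P0 sB bx hP]]] := quotients_dependent oX (fun j => nA _ (Aa j)) (fun j => nA _ (Ab j)) Xx0 b0.
move=> /(_ P); rewrite zE (mmap_quotients0 Aa Ab r0 sB bx hP) => /(_ erefl) /eqP.
by rewrite (negbTE P0).
Qed.

Lemma fcons_iota g k (phi : 'I_k -> 'rV[R]_n -> R) :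
  fcons (iota g) (fun i => iota (phi i)) = fun j => iota (fcons g phi j).
Proof. by apply/funext => j; case: (unliftP ord0 j) => [l ->|->]; rewrite ?fconsS ?fcons0. Qed.

Lemma fcons_app g k (phi : 'I_k -> 'rV[R]_n -> R) x :
  (fun j => fcons g phi j x) = fcons (g x) (fun i => phi i x).
Proof. by apply/funext => j; case: (unliftP ord0 j) => [l ->|->]; rewrite ?fconsS ?fcons0. Qed.

Lemma dependent_relation g k (phi : 'I_k -> 'rV[R]_n -> R) : ~ indep_on X (fcons g phi) ->
  exists Q, relation_on X g phi Q.
Proof.
move=> H; apply: contrapT => N; apply: H => P hP; apply: contrapT => /eqP P0; apply: N.
by exists P; split=> // x Xx; rewrite /eval_rel -fcons_app; exact: hP.
Qed.

(* A quotient of two functions that are algebraic over Phi is, near a generic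
   point, a quotient of Nash functions of Phi. *)
Lemma quotient_dependent k (phi : 'I_k -> 'rV[R]_n -> R) : (forall i, A (phi i)) -> indep_on X phi ->
  (forall g, A g -> exists Q, relation_on X g phi Q) -> forall z, ~ alg_indep emb (fcons z (fun i => iota (phi i))).
Proof.
move=> Aphi ip rel z; have [h1 _ _ _ hQ] := hK; have [nA _ hc _ _] := hA.
have [a [b [Aa Ab bn zE]]] := hQ z.
have [Qa0 /minimal_relation_exists[Qa mQa]] := rel a Aa.
have [Qb0 /minimal_relation_exists[Qb mQb]] := rel b Ab.
have Ae g Q : A g -> A (eval_rel Q g phi).
  move=> Ag; have [|+ _] := @iota_meval k.+1 (fcons g phi) Q.
    by move=> j; case: (unliftP ord0 j) => [l ->|->]; rewrite ?fconsS ?fcons0.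
  by rewrite (_ : (fun x => _) = eval_rel Q g phi) //; apply/funext => x; rewrite fcons_app.
(* The generic point must avoid the zeros of the denominator and allow the implicit function theorem
   for both relations. *)
pose w (i : 'I_3) := if i == 0 :> nat then b else if i == 1%N :> nat then eval_rel (mderiv ord0 Qa) a phi else eval_rel (mderiv ord0 Qb) b phi.
have [||x0 Xx0 w0] := @common_nonzero 3 w.
- by move=> i; rewrite /w; case: ifP => _ //; case: ifP => _; exact: Ae.
- move=> i; rewrite /w; case: ifP => _; last by case: ifP => _; exact: minimal_relation_simple ip _.
  apply: contrapT => H; case/eqP: bn; apply/(iota_eq0 Ab) => x Xx.
  by apply/eqP; apply: contrapT => /negP bx; apply: H; exists x.
have := w0 (inord 0); have := w0 (inord 1); have := w0 (inord 2); rewrite /w !inordK //= => Qb1 Qa1 b0.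
have [[_ ra] _] := mQa; have [[_ rb] _] := mQb.
have {ra}Qa0' := ra _ Xx0; have {rb}Qb0' := rb _ Xx0; rewrite !eval_rel_Phi in Qa1 Qb1 Qa0' Qb0'.
have [wa [sa [psia [wa0 sa0 npa pa0 hpa]]]] := implicit_function Qa0' Qa1.
have [wb [sb [psib [wb0 sb0 npb pb0 hpb]]]] := implicit_function Qb0' Qb1.
set y0 := Phi phi x0 in pa0 hpa npa pb0 hpb npb.
pose V := ball y0 (Num.min sa sb).
have oV : open V by exact: ball_open_rV.
have sV : semialgebraic V by exact: semialgebraic_ball.
have Vy0 : V y0 by apply: ballxx; rewrite lt_min sa0.
have nsub g s : V `<=` ball y0 s -> nash_fun (ball y0 s) g -> nash_fun V g.
  by move=> sub; apply: nash_fun_sub => //; exact: ball_open_rV.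
have npa' := nsub _ _ (@ball_minl _ _ y0 sa sb) npa.
have npb' := nsub _ _ (@ball_minr _ _ y0 sa sb) npb.
(* These quotients are psia/psib and the k coordinates: k + 1 functions of k variables, whose
   relation pulls back along Phi to one between z and the phi. *)
pose num := fcons psia (fun i (y : 'rV[R]_k) => y 0 i).
pose den := fcons psib (fun (i : 'I_k) (y : 'rV[R]_k) => 1 : R).
have [||//||rho [P [r0 P0 sB dn hP]]] := @quotients_dependent k V num den y0 oV.
- by move=> j; rewrite /num; case: (unliftP ord0 j) => [l ->|->]; rewrite ?fconsS ?fcons0 //; exact: nash_coord.
- by move=> j; rewrite /den; case: (unliftP ord0 j) => [l ->|->]; rewrite ?fconsS ?fcons0 //; exact: nash_cst.
- by move=> j; rewrite /den; case: (unliftP ord0 j) => [l ->|->]; rewrite ?fconsS ?fcons0 ?oner_neq0 // pb0.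
have cPhi : {for x0, continuous (Phi phi)}.
  apply: differentiable_continuous; have [] := @row_differentiable R n k phi x0 => // i.
  by apply: (locally_maj_differentiable _ Xx0); exact: subalgebra_locally_maj.
have cg g : A g -> {for x0, continuous g}.
  by move=> Ag; apply: differentiable_continuous; apply: (locally_maj_differentiable _ Xx0); exact: subalgebra_locally_maj.
have [r [r00 sX' nPhi na nbx]] : exists r : R, [/\ 0 < r, ball x0 r `<=` X,
    forall x, ball x0 r x -> ball y0 rho (Phi phi x), forall x, ball x0 r x -> ball (a x0) wa (a x)
    & forall x, ball x0 r x -> ball (b x0) wb (b x) /\ b x != 0].
  have n1 : \forall x \near x0, ball y0 rho (Phi phi x) by apply: cPhi; exact: nbhsx_ballx.
  have n2 : \forall x \near x0, ball (a x0) wa (a x) by apply: (cg a Aa); exact: nbhsx_ballx.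
  have n3 : \forall x \near x0, ball (b x0) wb (b x) by apply: (cg b Ab); exact: nbhsx_ballx.
  have n4 : \forall x \near x0, b x != 0 by exact: (@cvgr_neq0 _ _ _ _ _ b (b x0) (cg b Ab) b0).
  have n5 : \forall x \near x0, X x by apply: open_nbhs_nbhs.
  have : \forall x \near x0, [/\ X x, ball y0 rho (Phi phi x), ball (a x0) wa (a x), ball (b x0) wb (b x) & b x != 0].
    by near=> x; split; near: x.
  by move=> /nbhs_ballP[r /= r00 h]; exists r; split=> // x /h[].
move=> /(_ P); have -> : fcons z (fun i => iota (phi i)) = fun j => iota (fcons a phi j) / iota (fcons b (fun=> fun=> 1) j).
  apply/funext => j; case: (unliftP ord0 j) => [l ->|->]; rewrite ?fconsS ?fcons0 //.
  by rewrite h1 divr1.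
rewrite (mmap_quotients0 _ _ r00 sX') => [/(_ erefl) /eqP|j|j|x j xr|x xr]; first by rewrite (negbTE P0).
- by case: (unliftP ord0 j) => [l ->|->]; rewrite ?fconsS ?fcons0.
- by case: (unliftP ord0 j) => [l ->|->]; rewrite ?fconsS ?fcons0.
- by case: (unliftP ord0 j) => [l ->|->]; rewrite ?fconsS ?fcons0 ?oner_neq0 //; case: (nbx x xr).
rewrite -(hP _ (nPhi x xr)); apply: meval_eq => j; rewrite /num /den.
have VPhi := sB _ (nPhi x xr).
case: (unliftP ord0 j) => [l ->|->]; rewrite ?fconsS ?fcons0 ?mxE //.
have [_ _ ua] := hpa _ (@ball_minl _ _ y0 sa sb _ VPhi).
have [_ _ ub] := hpb _ (@ball_minr _ _ y0 sa sb _ VPhi).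
have Xx := sX' _ xr; congr (_ / _).
  apply: ua; first exact: na.
  by rewrite -eval_rel_Phi; have [[_ r_] _] := mQa; apply: r_.
apply: ub; first by case: (nbx x xr).
by rewrite -eval_rel_Phi; have [[_ r_] _] := mQb; apply: r_.
Unshelve. all: by end_near.
Qed.

End Fractions.

End Transcendence.

Section TranscendenceBases.
Context {R : realType} {n : nat}.
Variables (X : set 'rV[R]_n) (A : set ('rV[R]_n -> R)).
Hypotheses (oX : open X) (cX : connected X) (sX : semialgebraic X) (X0 : X !=set0).
Hypothesis hA : nash_subalgebra X A.

Lemma subalgebra_fraction_field : exists (K : fieldType) (iota : ('rV[R]_n -> R) -> K), fraction_field_of X A iota.
Proof.
apply: fraction_field_exists => // g1 g2 A1 A2.
by apply: analytic_domain => //; exact: (subalgebra_locally_maj oX hA).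
Qed.

(** An independent family of n elements is maximal, since n + 1 fractions in n variables are always
    dependent. *)
Lemma indep_has_trdeg (g : 'I_n -> 'rV[R]_n -> R) : (forall i, A (g i)) -> indep_on X g -> has_trdeg X A n.
Proof.
move=> Ag ig; have [K [iota hK]] := subalgebra_fraction_field.
exists K, iota; split=> //; exists (fun i => iota (g i)); split; first exact/(alg_indep_on hA hK Ag).
by move=> z; apply: (fractions_dependent oX cX X0 hA hK).
Qed.

Lemma trans_basisP d (phi : 'I_d -> 'rV[R]_n -> R) : trans_basis X A phi ->
  [/\ forall i, A (phi i), indep_on X phi & forall g, A g -> exists Q, relation_on X g phi Q].
Proof.
move=> [Aphi [K [iota [hK [ip mx]]]]]; have ip' := (alg_indep_on hA hK Aphi).1 ip.
split=> // g Ag; apply: dependent_relation => ig; apply: (mx (iota g)).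
rewrite fcons_iota; apply/(alg_indep_on hA hK) => // j.
by case: (unliftP ord0 j) => [l ->|->]; rewrite ?fconsS ?fcons0.
Qed.

(** The family is taken maximal among independent families inside A; [quotient_dependent] transfers
    its maximality to the fraction field. *)
Lemma trans_basis_exists : exists d (phi : 'I_d -> 'rV[R]_n -> R), trans_basis X A phi.
Proof.
have [K [iota hK]] := subalgebra_fraction_field.
pose p d := exists2 phi : 'I_d -> 'rV[R]_n -> R, forall i, A (phi i) & indep_on X phi.
have p0 : p 0%N.
  exists (fun=> fun=> 0) => [[]//|P hP]; have [x Xx] := X0.
  apply: mpoly_eval0 => v; rewrite -(hP x Xx); apply: meval_eq; by case.
have pn : ~ p n.+1.
  move=> [phi Aphi ip]; apply: (fractions_dependent oX cX X0 hA hK (z := fun i => iota (phi i))).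
  exact/(alg_indep_on hA hK).
(* Size 0 is attained by an independent family and size n + 1 is not, so the property fails first
   somewhere in between. *)
have [d pd pd1] : exists2 d, p d & ~ p d.+1.
  apply: contrapT => H; apply: pn; elim: (n.+1) => // k pk.
  by apply: contrapT => pk1; apply: H; exists k.
have [phi Aphi ip] := pd; exists d, phi; split=> //; exists K, iota; split=> //; split.
  exact/(alg_indep_on hA hK).
apply: (quotient_dependent oX cX X0 hA hK Aphi ip) => g Ag.
apply: dependent_relation => ig; apply: pd1; exists (fcons g phi) => // j.
by case: (unliftP ord0 j) => [l ->|->]; rewrite ?fconsS ?fcons0.
Qed.

End TranscendenceBases.

Lemma indep_coord (R : realType) (n : nat) (X : set 'rV[R]_n) : open X -> X !=set0 ->
  indep_on X (fun i x => x 0 i).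
Proof.
move=> oX [x Xx] P hP; have [r r0 sB] := open_ball_sub oX Xx.
by apply: (mpoly_vanish r0) => y /sB/hP.
Qed.

(** * Admissible sets of inputs *)

Section InputWords.
Context {R : realType} {m : nat}.
Implicit Types (U : set 'rV[R]_m) (u v w : input R m) (a : 'rV[R]_m).

Lemma duration_nil : duration ([::] : input R m) = 0.
Proof. by rewrite /duration big_nil. Qed.

Lemma duration_cons a (s : R) u : duration ((a, s) :: u) = s + duration u.
Proof. by rewrite /duration big_cons. Qed.

Lemma duration_cat u v : duration (u ++ v) = duration u + duration v.
Proof. by rewrite /duration big_cat. Qed.

Lemma pc_inputs_cons U a (s : R) u : pc_inputs U ((a, s) :: u) <-> [/\ U a, 0 <= s & pc_inputs U u].
Proof.
split=> [h|[Ua s0 hu] b t].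
  have [Ua s0] := h a s (mem_head _ _); split=> // b t bt.
  by apply: h; rewrite inE bt orbT.
by rewrite inE => /orP[/eqP[-> ->]|/hu].
Qed.

Lemma pc_inputs_nil U : pc_inputs U [::].
Proof. by []. Qed.

Lemma pc_inputs_cat U u v : pc_inputs U (u ++ v) <-> pc_inputs U u /\ pc_inputs U v.
Proof.
split=> [h|[hu hv] b t]; last by rewrite mem_cat => /orP[/hu|/hv].
by split=> b t bt; apply: h; rewrite mem_cat bt ?orbT.
Qed.

Lemma duration_ge0 U u : pc_inputs U u -> 0 <= duration u.
Proof.
elim: u => [|[a s] u IH]; first by rewrite duration_nil.
by move=> /pc_inputs_cons[_ s0 /IH]; rewrite duration_cons; apply: addr_ge0.
Qed.

Lemma input_at_cat U u v (t : R) : pc_inputs U u -> 0 <= t ->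
  input_at (u ++ v) t = if t < duration u then input_at u t else input_at v (t - duration u).
Proof.
elim: u t => [|[a s] u IH] t /=; first by rewrite duration_nil subr0 => _ t0; rewrite ltNge t0.
move=> /pc_inputs_cons[_ s0 pu] t0; rewrite duration_cons; have du := duration_ge0 pu.
have [ts|st] := ltP t s; first by rewrite (lt_le_trans ts) // lerDl.
by rewrite IH ?subr_ge0 // ltrBlDl opprD addrA.
Qed.

Lemma input_at_None U u (t : R) : pc_inputs U u -> 0 <= t -> (input_at u t = None <-> duration u <= t).
Proof.
elim: u t => [|[a s] u IH] t /=; first by rewrite duration_nil => _ ->.
move=> /pc_inputs_cons[_ s0 pu] t0; rewrite duration_cons; have du := duration_ge0 pu.
have [ts|st] := ltP t s; last by rewrite IH ?subr_ge0 // lerBrDl.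
by split=> // h; have := le_lt_trans h ts; rewrite ltNge lerDl du.
Qed.

Lemma input_at_restrict U u (t r : R) : pc_inputs U u -> 0 <= t <= duration u -> 0 <= r ->
  input_at (Defs.restrict u t) r = if r < t then input_at u r else None.
Proof.
elim: u t r => [|[a s] u IH] t r /=.
  by rewrite duration_nil => _ /andP[t0 t1] r0; rewrite ltNge (le_trans t1 r0).
move=> /pc_inputs_cons[_ s0 pu]; rewrite duration_cons => /andP[t0 t1] r0.
have [ts|st] := leP t s => /=.
  by case: ltP => // rt; rewrite (lt_le_trans rt ts).
have [rs|sr] := ltP r s; first by rewrite (lt_trans rs st).
rewrite IH ?subr_ge0 // ?ltrD2r //.
by rewrite (ltW st) /= lerBlDl.
Qed.

Lemma same_input_duration U u v : pc_inputs U u -> pc_inputs U v -> same_input u v -> duration u = duration v.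
Proof.
move=> pu pv h; have du := duration_ge0 pu; have dv := duration_ge0 pv.
apply/eqP; rewrite eq_le; apply/andP; split.
  by apply/(input_at_None pu dv); rewrite h //; apply/(input_at_None pv dv).
by apply/(input_at_None pv du); rewrite -h //; apply/(input_at_None pu du).
Qed.

Lemma same_input_cat U u v w : pc_inputs U u -> same_input v w -> same_input (u ++ v) (u ++ w).
Proof.
move=> pu h t t0; rewrite !(input_at_cat _ pu t0); case: ltP => // ut.
by rewrite h // subr_ge0.
Qed.

Lemma same_input_restrict_cat U u v (t : R) : pc_inputs U u -> pc_inputs U v -> 0 <= t <= duration v ->
  same_input (Defs.restrict (u ++ v) (duration u + t)) (u ++ Defs.restrict v t).
Proof.
move=> pu pv /andP[t0 tv] r r0; have du := duration_ge0 pu.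
have puv : pc_inputs U (u ++ v) by apply/pc_inputs_cat.
rewrite (input_at_restrict puv) //; last by rewrite addr_ge0 //= duration_cat lerD2l.
rewrite !(input_at_cat _ pu r0); have [ru|ur] := ltP r (duration u).
  by rewrite (lt_le_trans ru) // lerDl.
by rewrite (input_at_restrict pv) ?t0 // ?subr_ge0 // ltrBlDl.
Qed.

Lemma pc_inputs_restrict U u (t : R) : pc_inputs U u -> 0 <= t -> pc_inputs U (Defs.restrict u t).
Proof.
elim: u t => [//|[a s] u IH] t /= /pc_inputs_cons[Ua s0 pu] t0.
case: leP => [ts|st]; first by apply/pc_inputs_cons.
by apply/pc_inputs_cons; split=> //; apply: IH; rewrite // subr_ge0 ltW.
Qed.

Lemma duration_restrict U u (t : R) : pc_inputs U u -> 0 <= t <= duration u -> duration (Defs.restrict u t) = t.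
Proof.
elim: u t => [|[a s] u IH] t /=; first by rewrite duration_nil => _ /andP[h1 h2]; apply/eqP; rewrite eq_le h1 h2.
move=> /pc_inputs_cons[Ua s0 pu]; rewrite duration_cons => /andP[t0 t1].
case: leP => [ts|st]; first by rewrite duration_cons duration_nil addr0.
rewrite duration_cons IH //; first by rewrite addrC subrK.
by rewrite subr_ge0 (ltW st) /= lerBlDl.
Qed.

Lemma wordE u : exists (al : 'I_(size u) -> 'rV[R]_m) (t : 'rV[R]_(size u)), word al t = u.
Proof.
exists (fun i => (tnth (in_tuple u) i).1), (\row_i (tnth (in_tuple u) i).2).
rewrite /word -[RHS](map_tnth_enum (in_tuple u)).
by apply: eq_map => i; rewrite mxE -surjective_pairing.
Qed.

Lemma size_word k (al : 'I_k -> 'rV[R]_m) (t : 'rV[R]_k) : size (word al t) = k.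
Proof. by rewrite size_map size_enum_ord. Qed.

Lemma duration_word k (al : 'I_k -> 'rV[R]_m) (t : 'rV[R]_k) : duration (word al t) = \sum_i t 0 i.
Proof. by rewrite /duration big_map big_enum. Qed.

Lemma pc_inputs_word U k (al : 'I_k -> 'rV[R]_m) (t : 'rV[R]_k) :
  pc_inputs U (word al t) <-> forall i, U (al i) /\ 0 <= t 0 i.
Proof.
split=> [h i|h a s /mapP[i _ [-> ->]]]; last exact: h.
by apply: h; apply/mapP; exists i; rewrite ?mem_enum.
Qed.

Definition cat_letters k l (al : 'I_k -> 'rV[R]_m) (be : 'I_l -> 'rV[R]_m) (i : 'I_(k + l)) :=
  match fintype.split i with inl j => al j | inr j => be j end.

Lemma word_cat k l (al : 'I_k -> 'rV[R]_m) (be : 'I_l -> 'rV[R]_m) (s : 'rV[R]_k) (t : 'rV[R]_l) :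
  word al s ++ word be t = word (cat_letters al be) (row_mx s t).
Proof.
have E : enum 'I_(k + l) = [seq lshift l i | i <- enum 'I_k] ++ [seq rshift k i | i <- enum 'I_l].
  apply: (inj_map val_inj); rewrite val_enum_ord map_cat iotaD; congr (_ ++ _).
    by rewrite -map_comp -val_enum_ord; apply: eq_map.
  by rewrite -map_comp add0n -[X in iota X]addn0 iotaDl -val_enum_ord -map_comp; apply: eq_map.
rewrite /word E map_cat; congr (_ ++ _); rewrite -map_comp; apply: eq_map => i /=.
  by rewrite /cat_letters row_mxEl (unsplitK (inl i : 'I_k + 'I_l)).
by rewrite /cat_letters row_mxEr (unsplitK (inr i : 'I_k + 'I_l)).
Qed.

End InputWords.

Section AdmissibleSets.
Context {R : realType} {m : nat} (U : set 'rV[R]_m).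
Implicit Types (Ut : set (input R m)) (u v : input R m).

(** The restriction of any member to time 0 denotes the same function of time as the empty word. *)
Lemma admissible_nil Ut : admissible U Ut -> Ut [::].
Proof.
move=> [[u Utu] pc sm [rs _ _]].
have pu := pc _ Utu; have du := duration_ge0 pu.
have d0 : (0 : R) <= 0 <= duration u by rewrite lexx.
have := rs u 0 Utu d0 => /sm; apply=> // t t0.
by rewrite (input_at_restrict pu d0 t0) ltNge t0.
Qed.

Lemma admissible_restrict_cat Ut u v (t : R) : admissible U Ut -> Ut (u ++ v) -> 0 <= t <= duration v ->
  Ut (u ++ Defs.restrict v t).
Proof.
move=> [_ pc sm [rs _ _]] Utu tv; have /pc_inputs_cat[pu pv] := pc _ Utu.
have du := duration_ge0 pu; move: (tv) => /andP[t0 t1].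
apply: (sm (Defs.restrict (u ++ v) (duration u + t))).
- by apply: rs => //; rewrite addr_ge0 //= duration_cat lerD2l.
- by apply/pc_inputs_cat; split=> //; apply: pc_inputs_restrict.
- exact: same_input_restrict_cat pu pv tv.
Qed.

Lemma admissible_enlarge Ut u k (al : 'I_k -> 'rV[R]_m) (t : 'rV[R]_k) : admissible U Ut ->
  Ut (u ++ word al t) -> exists2 delta : R, 0 < delta &
    forall t' : 'rV[R]_k, (forall i, 0 <= t' 0 i <= t 0 i + delta) -> Ut (u ++ word al t').
Proof.
move=> [_ pc _ [_ _ en]]; have [be [s <-]] := wordE u; rewrite word_cat => Utw.
have [del d0 h] := en _ _ _ Utw; exists del => // t' ht'.
rewrite word_cat; apply: h => i; rewrite -(splitK i).
case: (fintype.split i) => j /=; last by rewrite !row_mxEr.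
rewrite !row_mxEl; have /pc_inputs_word/(_ (lshift k j)) [_] := pc _ Utw.
by rewrite row_mxEl => s0; rewrite s0 lerDl ltW.
Qed.

Lemma admissible_shrink Ut u k (al : 'I_k -> 'rV[R]_m) (t t' : 'rV[R]_k) : admissible U Ut ->
  Ut (u ++ word al t) -> (forall i, 0 <= t' 0 i <= t 0 i) -> Ut (u ++ word al t').
Proof.
move=> aU Utw ht; have [del d0 h] := admissible_enlarge aU Utw.
apply: h => i; have /andP[-> h2] := ht i; apply: le_trans h2 _; by rewrite lerDl ltW.
Qed.

Lemma word_rcons1 u a (t : R) : rcons u (a, t) = u ++ word (fun=> a) (const_mx t : 'rV[R]_1).
Proof. by rewrite -cats1 /word enum_ordSl enum_ord0 /= mxE. Qed.

Lemma admissible_rcons_shrink Ut u a (t t' : R) : admissible U Ut -> Ut (rcons u (a, t)) -> 0 <= t' <= t ->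
  Ut (rcons u (a, t')).
Proof.
move=> aU; rewrite !word_rcons1 => h tt; apply: (admissible_shrink aU h) => i.
by rewrite !mxE.
Qed.

(** Letters are appended one at a time with some positive duration; afterwards all durations may be
    shortened independently. *)
Lemma admissible_extend Ut u k (al : 'I_k -> 'rV[R]_m) : admissible U Ut -> Ut u -> (forall i, U (al i)) ->
  exists2 s : 'rV[R]_k, forall i, 0 < s 0 i & forall t : 'rV[R]_k, (forall i, 0 <= t 0 i <= s 0 i) -> Ut (u ++ word al t).
Proof.
move=> aU; elim: k u al => [|k IH] u al Utu Ual.
  exists 0; first by case.
  by move=> t _; rewrite (_ : word al t = [::]) ?cats0 // /word enum_ord0.
have [_ pc _ [_ ex _]] := aU.
have [t0 t00 Ut0] := ex u (al ord0) Utu (Ual ord0).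
have [s s0 hs] := IH (rcons u (al ord0, t0)) (fun i => al (lift ord0 i)) Ut0 (fun i => Ual _).
have wE (t : 'rV[R]_k.+1) : word al t = (al ord0, t 0 ord0) :: word (fun i => al (lift ord0 i)) (\row_i t 0 (lift ord0 i)).
  by rewrite /word enum_ordSl /= -map_comp; congr cons; apply: eq_map => i /=; rewrite mxE.
pose s' : 'rV[R]_k.+1 := \row_i fcons t0 (s 0) i.
have Us : Ut (u ++ word al s').
  rewrite wE -cat_rcons mxE fcons0; apply: hs => i; rewrite !mxE fconsS (ltW (s0 i)) /=; exact: lexx.
exists s'.
  by move=> i; rewrite mxE; case: (unliftP ord0 i) => [j ->|->]; rewrite ?fconsS ?fcons0.
by move=> t ht; apply: (admissible_shrink aU Us).
Qed.

Lemma admissible_bigcup (C : set (set (input R m))) : (forall A, C A -> admissible U A) -> C !=set0 ->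
  admissible U [set u | exists2 A, C A & A u].
Proof.
move=> hC [A0 CA0]; split.
- by have [[u Au] _ _ _] := hC _ CA0; exists u, A0.
- by move=> u [A CA Au]; have [_ pc _ _] := hC A CA; apply: pc.
- by move=> u v [A CA Au] pv uv; exists A => //; have [_ _ sm _] := hC A CA; apply: sm uv.
split.
- by move=> u t [A CA Au] tu; exists A => //; have [_ _ _ [rs _ _]] := hC A CA; apply: rs.
- move=> u a [A CA Au] Ua; have [_ _ _ [_ ex _]] := hC A CA.
  by have [t t0 h] := ex u a Au Ua; exists t => //; exists A.
- move=> k al t [A CA Au]; have [_ _ _ [_ _ en]] := hC A CA.
  by have [del d0 h] := en k al t Au; exists del => // t' ht; exists A => //; apply: h.
Qed.

Lemma admissible_shifted Ut u : admissible U Ut -> Ut u -> admissible U (shifted_inputs Ut u).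
Proof.
move=> aU Utu; have [_ pc sm [rs ex en]] := aU; have pu := pc _ Utu; split.
- by exists [::]; split; [exact: admissible_nil|rewrite cats0].
- by move=> v [/pc].
- move=> v w [Uv Uuv] pw vw; split; first exact: sm vw.
  apply: sm Uuv _ (same_input_cat pu vw); exact/pc_inputs_cat.
split.
- move=> v t [Uv Uuv] tv; split; first exact: rs.
  exact: admissible_restrict_cat aU Uuv tv.
- move=> v a [Uv Uuv] Ua; have [t1 t10 h1] := ex v a Uv Ua; have [t2 t20 h2] := ex _ a Uuv Ua.
  exists (Num.min t1 t2); first by rewrite lt_min t10.
  have t0 : 0 <= Num.min t1 t2 by rewrite le_min !ltW.
  split; first by apply: admissible_rcons_shrink aU h1 _; rewrite t0 ge_min lexx.
  rewrite -rcons_cat; apply: admissible_rcons_shrink aU h2 _; by rewrite t0 ge_min lexx orbT.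
- move=> k al t [Uv Uuv]; have [d1 d10 h1] := en k al t Uv; have [d2 d20 h2] := admissible_enlarge aU Uuv.
  exists (Num.min d1 d2); first by rewrite lt_min d10.
  move=> t' ht; split; [apply: h1|apply: h2] => i; have /andP[-> h] := ht i; apply: le_trans h _;
    by rewrite lerD2l ge_min lexx ?orbT.
Qed.

End AdmissibleSets.

(** * Responses after a fixed initial input *)

Section ShiftedResponse.
Context {R : realType}.

Lemma gmaj_locally_maj n (a : 'rV[R]_n) (rho M C : R) G : 0 <= M -> 0 <= C -> gmaj (ball a rho) M C G -> locally_maj (ball a rho) G.
Proof.
move=> M0 C0 mG b bb; have [r r0 sub] := open_ball_sub (@ball_open_rV R n a rho) bb.
by exists r, M, C; split=> //; apply: maj_sub mG.
Qed.

Lemma analytic_on_germ n (S : set 'rV[R]_n) g : (forall a, S a -> exists (rho : R) G,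
    [/\ 0 < rho, locally_maj (ball a rho) G & forall x, S x -> ball a rho x -> g x = G x]) -> analytic_on S g.
Proof.
move=> h a Sa; have [rho [G [r0 mG gG]]] := h a Sa.
have oB : open (ball a rho) by exact: ball_open_rV.
have [rho1 r10 [c [sm cv]]] := (analytic_locally_maj G oB).2 mG a (ballxx _ r0).
exists (Num.min rho rho1); first by rewrite lt_min r0.
exists c; split=> [x /ball_minr/sm //|x Sx bx].
by rewrite gG //; [apply: cv|]; [exact: ball_minl bx|exact: ball_minr bx|exact: ball_minl bx].
Qed.

(** The local extension is composed with t -> (s, t), an affine map with constant partial
    derivatives, so [locally_maj_comp] applies with constant fields. *)
Lemma analytic_slice k l (S : set 'rV[R]_(k + l)) g (s : 'rV[R]_k) : analytic_on S g ->
  analytic_on [set t : 'rV[R]_l | S (row_mx s t)] (fun t => g (row_mx s t)).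
Proof.
move=> ag; apply: analytic_on_germ => a /= Sa.
have [rho [M [C [r0 M0 C0 [G [mG gG]]]]]] := analytic_on_local ag Sa.
have bE t : ball a rho t -> ball (row_mx s a) rho (row_mx s t).
  move=> /in_ball h; apply/in_ball; apply: norm_lt_coord => // i.
  rewrite !mxE; case: fintype.split => j; first by rewrite subrr normr0.
  by apply: le_lt_trans h; have := coord_le_norm (a - t) j; rewrite !mxE.
exists rho, (fun t => G (row_mx s t)); split=> //; last by move=> x Sx /bE; apply: gG.
have rE (y : 'rV[R]_l) : \row_j (row_mx s y) 0 j = row_mx s y by apply/rowP => j; rewrite !mxE.
have oB := @ball_open_rV R l a rho; have oB' := @ball_open_rV R (k + l) (row_mx s a) rho.
have := @locally_maj_comp R l (k + l) (ball a rho) (ball (row_mx s a) rho) (fun j y => row_mx s y 0 j)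
  (fun i => fun=> 'e_(rshift k i)) G oB oB'.
move=> H; apply: (locally_maj_eq_on _ (H _ (gmaj_locally_maj M0 C0 mG) _)) => [y _|i j|y by_]; first by rewrite rE.
  by apply: locally_maj_cst.
split=> [|j]; first by rewrite rE; exact: bE.
rewrite -(splitK j); case: (fintype.split j) => i /=.
  rewrite (_ : (fun y : 'rV[R]_l => _) = fun=> s 0 i); last by apply/funext => z; rewrite row_mxEl.
  split=> [|i']; first exact: differentiable_cst.
  by rewrite derive_cst mxE eq_lrshift andbF.
rewrite (_ : (fun y : 'rV[R]_l => _) = fun y => y 0 i); last by apply/funext => z; rewrite row_mxEr.
split=> [|i']; first exact: differentiable_coord.
by rewrite derive_coord !mxE eq_rshift.
Qed.

Lemma response_map_shifted m r (U : set 'rV[R]_m) (Ut : set (input R m)) (p : input R m -> 'rV[R]_r) u :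
  response_map U Ut p -> Ut u -> response_map U (shifted_inputs Ut u) (shifted_map p u).
Proof.
move=> [aU cp ap] Utu; have [_ pc _ _] := aU; split; first exact: admissible_shifted.
  by move=> v w [_ Uuv] [_ Uuw] vw; apply: cp => //; apply: same_input_cat vw; exact: pc.
move=> k al j k0 Ual; have [be [s uE]] := wordE u.
have Ube i : U (be i) by have := pc _ Utu; rewrite -uE => /pc_inputs_word/(_ i)[].
have h := @analytic_slice _ k _ _ s (ap _ (cat_letters be al) j _ _).
move=> a [_ Ua]; have [|||rho r0 [c [sm cv]]] := h _ _ a.
- by rewrite addn_gt0 k0 orbT.
- by move=> i; rewrite /cat_letters; case: fintype.split.
- by rewrite /= -word_cat uE.
exists rho => //; exists c; split=> // x [_ Ux] bx.
have := cv x; rewrite /= -word_cat uE => /(_ Ux bx).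
by rewrite /shifted_map; exact.
Qed.

End ShiftedResponse.

(** * Trajectories under piecewise-constant inputs *)

Section Steering.
Context {R : realType} {n m : nat}.
Implicit Types (X : set 'rV[R]_n) (F : 'rV[R]_m -> 'rV[R]_n -> 'rV[R]_n) (u v : input R m) (q : 'rV[R]_n).

(** A trajectory cut at its switching times, one flow line per letter: this form composes along
    words and allows the set X to be shrunk, so that arguments go by induction on the word. *)
Fixpoint steers X F u q q' : Prop :=
  if u is (a, s) :: u' then
    exists x : R -> 'rV[R]_n, [/\ flow_on X (F a) x 0 s, x 0 = q & steers X F u' (x s) q']
  else X q /\ q = q'.

Lemma steers_sub X Y F u q q' : X `<=` Y -> steers X F u q q' -> steers Y F u q q'.
Proof.
move=> XY; elim: u q => [|[a s] u IH] q /=; first by move=> [/XY].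
by move=> [x [[cx Xx dx] x0 /IH hu]]; exists x; split=> //; split=> // t /Xx/XY.
Qed.

Lemma steers_start U X F u q q' : pc_inputs U u -> steers X F u q q' -> X q.
Proof.
case: u => [_ []//|[a s] u] /pc_inputs_cons[_ s0 _] /= [x [[_ Xx _] <- _]].
by apply: Xx; rewrite lexx.
Qed.

Lemma steers_end X F u q q' : steers X F u q q' -> X q'.
Proof.
elim: u q => [q [Xq <-] //|[a s] u IH] q /= [x [_ _]].
exact: IH.
Qed.

Lemma steers_cat U X F u v q q' : pc_inputs U v -> steers X F (u ++ v) q q' <->
  exists2 q1, steers X F u q q1 & steers X F v q1 q'.
Proof.
move=> pv; elim: u q => [|[a s] u IH] q /=.
  split=> [h|[q1 [_ <-]] //]; exists q => //; split=> //; exact: steers_start pv h.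
split=> [[x [fx x0 /IH[q1 h1 h2]]]|[q1 [x [fx x0 h1]] h2]]; first by exists q1 => //; exists x.
by exists x; split=> //; apply/IH; exists q1.
Qed.

Lemma steers_zero X F u q : (forall a s, (a, s) \in u -> s = 0) -> X q -> steers X F u q q.
Proof.
elim: u => [//|[a s] u IH] h Xq /=; have s0 := h a s (mem_head _ _); subst s.
exists (fun=> q); split=> //; last by apply: IH => // b t bt; apply: (h b); rewrite inE bt orbT.
split=> // [|t /andP[t0 t1]]; first by apply: continuous_subspaceT => t; exact: cst_continuous.
by have := lt_trans t0 t1; rewrite ltxx.
Qed.

Lemma steers_unique U X F u q q1 q2 : open X -> (forall a, U a -> analytic_field X (F a)) -> pc_inputs U u ->
  steers X F u q q1 -> steers X F u q q2 -> q1 = q2.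
Proof.
move=> oX hF; elim: u q => [|[a s] u IH] q /=; first by move=> _ [_ <-] [_ <-].
move=> /pc_inputs_cons[Ua s0 pu] [x [fx x0 h1]] [y [fy y0 h2]].
have e : x s = y s.
  apply: (flow_unique oX (hF a Ua) fx fy (t0 := 0)); rewrite ?lexx ?s0 //.
  by rewrite x0.
by apply: IH pu h1 _; rewrite e.
Qed.

Lemma is_derive_shift (x : R -> 'rV[R]_n) (s t : R) (l : 'rV[R]_n) : is_derive (s + t) (1 : R) x l ->
  is_derive t (1 : R) (fun r => x (s + r)) l.
Proof.
move=> [d e].
have E : (fun r => x (s + r)) \o shift t = x \o shift (s + t).
  by apply/funext => h /=; rewrite addrCA.
split; first by move: d; rewrite /derivable E.
by move: e; rewrite /derive E.
Qed.

Lemma flow_on_eq X f (x y : R -> 'rV[R]_n) (a b : R) : (forall t, a <= t <= b -> x t = y t) ->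
  flow_on X f x a b -> flow_on X f y a b.
Proof.
move=> e [cx Xx dx]; split.
- move/within_continuousP : cx => cx; apply/within_continuousP => s sab eps e0.
  have [del d0 hd] := cx s sab _ e0; exists del => // r rab sr.
  by rewrite -!e; [exact: hd|move: rab; rewrite /= in_itv..|move: sab; rewrite /= in_itv].
- by move=> t tab; rewrite -e //; exact: Xx.
move=> t tab; have /andP[t1 t2] := tab; rewrite -e ?(ltW t1) ?(ltW t2) //.
apply: near_eq_is_derive (dx t tab).
near=> r; apply: e; apply/andP; split; apply: ltW; near: r.
  exact: lt_nbhsr.
exact: lt_nbhsl.
Unshelve. all: by end_near.
Qed.

Section Trajectories.
Context {r : nat}.
Variables (U : set 'rV[R]_m).
Implicit Types (S : system R n m r).

Definition restart S q : system R n m r := System (st_space S) (dyn S) (out S) q.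

Lemma trajectory_cons S a (s : R) u x : 0 <= s -> pc_inputs U u -> trajectory S ((a, s) :: u) x ->
  flow_on (st_space S) (dyn S a) x 0 s /\ trajectory (restart S (x s)) u (fun t => x (s + t)).
Proof.
move=> s0 pu [x0 cx Xx dx]; have du := duration_ge0 pu; rewrite duration_cons in cx Xx.
split.
  split.
  - apply: continuous_subspaceW cx => t /=; rewrite !in_itv /= => /andP[-> h] /=.
    by apply: le_trans h _; rewrite lerDl.
  - by move=> t /andP[t0 ts]; apply: Xx; rewrite t0 /=; apply: le_trans ts _; rewrite lerDl.
  - by move=> t tt; apply: (dx [::] a s u) => //; rewrite duration_nil add0r.
split=> /=.
- by rewrite addr0.
- move/within_continuousP : cx => cx; apply/within_continuousP => t tu eps e0.
  have [|del d0 hd] := cx (s + t) _ _ e0.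
    by move: tu; rewrite /= !in_itv /= => /andP[t0 t1]; rewrite addr_ge0 //= lerD2l.
  exists del => // q qu tq; apply: hd.
    by move: qu; rewrite /= !in_itv /= => /andP[t0 t1]; rewrite addr_ge0 //= lerD2l.
  by rewrite opprD addrACA subrr add0r.
- by move=> t /andP[t0 t1]; apply: Xx; rewrite addr_ge0 //= lerD2l.
move=> v b s' w uE t /andP[t1 t2]; apply: is_derive_shift.
apply: (dx ((a, s) :: v) b s' w); first by rewrite uE.
by rewrite duration_cons -addrA !ltrD2l t1.
Qed.

Lemma trajectory_steers S u x : pc_inputs U u -> trajectory S u x ->
  steers (st_space S) (dyn S) u (init S) (x (duration u)).
Proof.
elim: u S x => [|[a s] u IH] S x /=.
  by move=> _ [x0 _ Xx _]; rewrite duration_nil -x0; split=> //; apply: Xx; rewrite duration_nil lexx.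
move=> /pc_inputs_cons[Ua s0 pu] tx; have [fx tx'] := trajectory_cons s0 pu tx.
exists x; split=> //; first by case: tx.
by have := IH _ _ pu tx'; rewrite /= duration_cons.
Qed.

Lemma steers_trajectory S u q : pc_inputs U u -> steers (st_space S) (dyn S) u (init S) q ->
  exists2 x, trajectory S u x & x (duration u) = q.
Proof.
elim: u S => [|[a s] u IH] S /=.
  move=> _ [Xi <-]; exists (fun=> init S) => //; split=> //.
    by apply: continuous_subspaceT => t; exact: cst_continuous.
  by move=> v a s w; case: v.
move=> /pc_inputs_cons[Ua s0 pu] [y [[cy Xy dy] y0 hu]].
have du := duration_ge0 pu.
have [z [z0 cz Xz dz] zq] := IH (restart S (y s)) pu hu; rewrite /= in z0 cz Xz dz.
pose x t := if t <= s then y t else z (t - s).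
have xr t : s <= t -> x t = z (t - s).
  rewrite /x le_eqVlt => /orP[/eqP <-|st]; first by rewrite lexx subrr z0.
  by rewrite leNgt st.
have xl t : t <= s -> x t = y t by rewrite /x => ->.
exists x; last by rewrite duration_cons xr ?lerDl // addrC addKr.
split.
- by rewrite xl.
- rewrite duration_cons; move/within_continuousP : cy => cy; move/within_continuousP : cz => cz.
  apply/within_continuousP => t; rewrite /= in_itv /= => /andP[t0 t1] eps e0.
  have hl : t <= s -> exists2 del : R, 0 < del & forall r, 0 <= r <= s -> `|t - r| < del -> `|x t - x r| < eps.
    move=> ts; have [|del d0 hd] := cy t _ _ e0; first by rewrite /= in_itv /= t0.
    exists del => // rr qs tq; rewrite !xl //; last by case/andP: qs.
    by apply: hd => //; rewrite /= in_itv.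
  have hr : s <= t -> exists2 del : R, 0 < del & forall r, s <= r <= s + duration u -> `|t - r| < del -> `|x t - x r| < eps.
    move=> ts; have [|del d0 hd] := cz (t - s) _ _ e0.
      by rewrite /= in_itv /= subr_ge0 ts lerBlDl.
    exists del => // rr /andP[q1 q2] tq; rewrite !xr //.
    apply: hd; first by rewrite /= in_itv /= subr_ge0 q1 lerBlDl.
    by rewrite opprB addrA subrK.
  have [ts|st|ts] := ltgtP t s.
  + have [del d0 hd] := hl (ltW ts); exists (Num.min del (s - t)); first by rewrite lt_min d0 subr_gt0.
    move=> rr; rewrite in_itv /= lt_min => /andP[q0 q1] /andP[tq1 tq2]; apply: hd => //.
    by rewrite q0 /=; move: tq2; rewrite ltr_norml => /andP[]; lra.
  + have [del d0 hd] := hr (ltW st); exists (Num.min del (t - s)); first by rewrite lt_min d0 subr_gt0.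
    move=> rr; rewrite in_itv /= lt_min => /andP[q0 q1] /andP[tq1 tq2]; apply: hd => //.
    by rewrite q1 andbT; move: tq2; rewrite ltr_norml => /andP[]; lra.
  have [|d1 d10 h1] := hl; first by rewrite ts.
  have [|d2 d20 h2] := hr; first by rewrite ts.
  exists (Num.min d1 d2); first by rewrite lt_min d10.
  move=> rr; rewrite in_itv /= lt_min => /andP[q0 q1] /andP[tq1 tq2].
  by have [qs|/ltW sq] := leP rr s; [apply: h1; rewrite ?q0|apply: h2; rewrite ?sq].
- move=> t; rewrite duration_cons => /andP[t0 t1]; have [ts|/ltW st] := leP t s.
    by rewrite xl //; apply: Xy; rewrite t0.
  by rewrite xr //; apply: Xz; rewrite subr_ge0 st lerBlDl.
case=> [|c v] b s' w /= [].
  move=> <- <- _ t; rewrite duration_nil add0r => /andP[t0 ts]; rewrite xl ?ltW //.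
  apply: near_eq_is_derive (dy t _); last by rewrite t0.
  near=> rr; rewrite xl //; apply: ltW; near: rr; exact: lt_nbhsl.
move=> <- uE t; rewrite duration_cons => /andP[t0 t1].
have dv : 0 <= duration v by move: pu; rewrite uE => /pc_inputs_cat[/duration_ge0].
have st : s < t by apply: le_lt_trans t0; rewrite lerDl.
rewrite xr ?(ltW st) //.
have D : is_derive (- s + t) (1 : R) z (dyn S b (z (t - s))).
  rewrite [- s + t]addrC; apply: (dz _ _ _ _ uE); rewrite ltrBrDl t0 /= ltrBlDl addrA //.
apply: near_eq_is_derive (is_derive_shift D).
near=> rr; rewrite [- s + rr]addrC xr //; apply: ltW; near: rr; exact: lt_nbhsr.
Unshelve. all: by end_near.
Qed.

Lemma trajectory_unique S u x y : open (st_space S) -> (forall a, U a -> analytic_field (st_space S) (dyn S a)) ->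
  pc_inputs U u -> trajectory S u x -> trajectory S u y -> forall t, 0 <= t <= duration u -> y t = x t.
Proof.
move=> oX hF; elim: u S oX hF x y => [|[a s] u IH] S oX hF x y.
  move=> _ [x0 _ _ _] [y0 _ _ _] t; rewrite duration_nil => /andP[t0 t1].
  have -> : t = 0 by apply/eqP; rewrite eq_le t1.
  by rewrite x0 y0.
move=> /pc_inputs_cons[Ua s0 pu] tx ty.
have [fx tx'] := trajectory_cons s0 pu tx; have [fy ty'] := trajectory_cons s0 pu ty.
have [x0 _ _ _] := tx; have [y0 _ _ _] := ty.
have e t : 0 <= t <= s -> y t = x t.
  move=> ts; apply: (flow_unique oX (hF a Ua) fy fx (t0 := 0)); rewrite ?lexx ?s0 //.
  by rewrite x0.
rewrite -(e s) ?lexx ?s0 // in tx'.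
move=> t; rewrite duration_cons => /andP[t0 t1]; have [ts|/ltW st] := leP t s; first by apply: e; rewrite t0.
have := IH (restart S (y s)) oX hF _ _ pu tx' ty' (t - s); rewrite subrKC; apply.
by rewrite subr_ge0 st lerBlDl.
Qed.

(** Uniqueness is automatic for analytic fields, so the existence of a chain of flow lines is all
    that remains of the condition. *)
Lemma has_unique_trajectoryP S u : open (st_space S) -> (forall a, U a -> analytic_field (st_space S) (dyn S a)) ->
  pc_inputs U u -> (has_unique_trajectory S u <-> exists q, steers (st_space S) (dyn S) u (init S) q).
Proof.
move=> oX hF pu; split=> [[x tx _]|[q /(steers_trajectory pu)[x tx _]]].
  by exists (x (duration u)); exact: trajectory_steers.
by exists x => // y ty; exact: (trajectory_unique oX hF pu).
Qed.

Lemma final_stateP S u q : open (st_space S) -> (forall a, U a -> analytic_field (st_space S) (dyn S a)) ->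
  pc_inputs U u -> steers (st_space S) (dyn S) u (init S) q -> final_state S u = q.
Proof.
move=> oX hF pu sq; have [x tx _] := steers_trajectory pu sq.
have tg : trajectory S u (get (trajectory S u)) by apply: getPex; exists x.
exact: (steers_unique oX hF pu (trajectory_steers pu tg) sq).
Qed.

End Trajectories.

End Steering.

(** * Mixed time derivatives of responses *)

Lemma filter_forall_seq (T : Type) (I : eqType) (s : seq I) (F : set_system T) (P : I -> T -> Prop) : Filter F ->
  (forall i, i \in s -> F [set x | P i x]) -> F [set x | forall i, i \in s -> P i x].
Proof.
move=> FF; elim: s => [|j s IH] h; first exact: filterS filterT.
have h1 : F [set x | P j x] by apply: h; exact: mem_head.
have h2 : F [set x | forall i, i \in s -> P i x] by apply: IH => i si; apply: h; rewrite inE si orbT.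
by apply: filterS2 h1 h2 => x Pj Ps i; rewrite inE => /orP[/eqP ->|/Ps].
Qed.

Lemma filter_forall_fin (T : Type) (I : finType) (F : set_system T) (P : I -> T -> Prop) : Filter F ->
  (forall i, F [set x | P i x]) -> F [set x | forall i, P i x].
Proof.
move=> FF h; have := @filter_forall_seq T I (enum I) F P FF (fun i _ => h i).
by apply: filterS => x hx i; apply: hx; rewrite mem_enum.
Qed.

Section DerivativeFamilies.
Context {R : realType} {k : nat}.
Implicit Types (t : 'rV[R]_k) (l : 'I_k) (w : seq 'I_k).

(** Equality of derivatives inside extends by continuity to the endpoints, where it is used: the Lie
    derivatives are read off at duration 0. *)
Lemma cder_unique (a b : R) f f' g g' : a < b -> cder a b f f' -> cder a b g g' ->
  (forall t : R, a <= t <= b -> f t = g t) -> {within `[a, b], continuous f'} -> {within `[a, b], continuous g'} ->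
  forall t : R, a <= t <= b -> f' t = g' t.
Proof.
move=> ab [_ df] [_ dg] e cf cg.
have inner (t : R) : a < t < b -> f' t = g' t.
  move=> /andP[ta tb]; have [|_ <-] := df t; first by rewrite ta.
  have [|_ <-] := dg t; first by rewrite ta.
  apply: near_eq_derive; near=> s; apply: e; apply/andP; split; apply: ltW; near: s.
    exact: lt_nbhsr.
  exact: lt_nbhsl.
move=> t tab; apply/eqP; rewrite -subr_eq0; apply: contrapT => /negP ne.
have n0 : 0 < `|f' t - g' t| / 2 by rewrite divr_gt0 // normr_gt0.
move/within_continuousP : cf => cf; move/within_continuousP : cg => cg.
have tab' : t \in `[a, b] by rewrite in_itv.
have [d1 d10 h1] := cf t tab' _ n0; have [d2 d20 h2] := cg t tab' _ n0.
have [s sab [s1 s2]] : exists2 s, a < s < b & `|t - s| < d1 /\ `|t - s| < d2.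
  pose d := Num.min (Num.min d1 d2) (b - a).
  have d0 : 0 < d by rewrite !lt_min d10 d20 subr_gt0.
  have [l1 l2 l3] : [/\ d <= d1, d <= d2 & d <= b - a].
    by split; rewrite /d !ge_min lexx ?orbT.
  have /andP[ta tb] := tab; have [tm|mt] := leP t ((a + b) / 2).
    exists (t + d / 3); first by apply/andP; split; lra.
    by rewrite opprD addrA subrr sub0r normrN gtr0_norm ?divr_gt0 //; split; lra.
  exists (t - d / 3); first by apply/andP; split; lra.
  by rewrite opprB addrC subrK gtr0_norm ?divr_gt0 //; split; lra.
have sab' : s \in `[a, b] by rewrite in_itv /=; case/andP: sab => *; rewrite !ltW.
have := h1 s sab' s1; have := h2 s sab' s2; rewrite (inner s sab).
have := ler_distD (g' s) (f' t) (g' t); rewrite [`|g' s - g' t|]distrC; lra.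
Unshelve. all: by end_near.
Qed.

Definition upd_row t l (tau : R) : 'rV[R]_k := \row_i if i == l then tau else t 0 i.

Definition box (T : 'rV[R]_k) : set 'rV[R]_k := [set t | forall i, 0 <= t 0 i <= T 0 i].

Lemma upd_row_id t l : upd_row t l (t 0 l) = t.
Proof. by apply/rowP => i; rewrite mxE; case: eqP => [->|]. Qed.

Lemma upd_row_line t l (tau : R) : upd_row t l tau = upd_row t l 0 + tau *: 'e_l.
Proof.
apply/rowP => i; rewrite !mxE eqxx /=; case: eqP => _; rewrite ?mulr1 ?add0r //.
by rewrite mulr0 addr0.
Qed.

Lemma norm_upd_row t l (tau sig : R) : `|upd_row t l tau - upd_row t l sig| = `|tau - sig|.
Proof.
apply/eqP; rewrite eq_le; apply/andP; split.
  apply: norm_le_coord => // i; rewrite !mxE; case: eqP => // _.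
  by rewrite subrr normr0.
by have := coord_le_norm (upd_row t l tau - upd_row t l sig) l; rewrite !mxE eqxx.
Qed.

Lemma box_upd_row T t l (tau : R) : box T t -> 0 <= tau <= T 0 l -> box T (upd_row t l tau).
Proof. by move=> bt tl i; rewrite mxE; case: eqP => [->|_]. Qed.

(** Candidates for all mixed derivatives on the closed box, expressed along segments parallel to its
    edges and so without any function outside the box. *)
Definition deriv_family (T : 'rV[R]_k) (F : seq 'I_k -> 'rV[R]_k -> R) : Prop :=
  forall w l t, box T t -> cder 0 (T 0 l) (fun tau => F w (upd_row t l tau)) (fun tau => F (l :: w) (upd_row t l tau)).

Definition bounded_family (T : 'rV[R]_k) (F : seq 'I_k -> 'rV[R]_k -> R) : Prop :=
  forall t, box T t -> exists eps M C : R, [/\ 0 < eps, 0 <= M, 0 <= C &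
    forall w t', box T t' -> `|t' - t| < eps -> `|F w t'| <= M * C ^+ size w * (size w)`!%:R].

(* The box need not be a neighbourhood of its boundary points, but it is the
   closure of its interior, so the derivatives there do not depend on the local
   extension. *)
Lemma analytic_deriv_family (S : set 'rV[R]_k) g (T : 'rV[R]_k) : analytic_on S g -> box T `<=` S ->
  (forall i, 0 < T 0 i) -> exists F, [/\ deriv_family T F, bounded_family T F & forall t, box T t -> F [::] t = g t].
Proof.
move=> ag TS T0.
have loc a : exists x : R * R * R * ('rV[R]_k -> R), box T a ->
   [/\ 0 < x.1.1.1, 0 <= x.1.1.2 /\ 0 <= x.1.2, gmaj (ball a x.1.1.1) x.1.1.2 x.1.2 x.2 &
     forall y, S y -> ball a x.1.1.1 y -> g y = x.2 y].
  have [Ta|Ta] := pselect (box T a); last by exists (0, 0, 0, fun=> 0).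
  have [rho [M [C [r0 M0 C0 [G [mG gG]]]]]] := analytic_on_local ag (TS _ Ta).
  by exists (rho, M, C, G).
have [Z hZ] := choice loc; pose rho a := (Z a).1.1.1; pose G a := (Z a).2.
pose F w t := pds w (G t) t.
(* The extensions at a and at t both equal g on an open set inside the box that has t in its
   closure; their derivatives agree there, and by continuity at t. *)
have agree a t w : box T a -> box T t -> ball a (rho a) t -> pds w (G a) t = F w t.
  move=> Ta Tt bt; have [ra0 [Ma Ca] mGa gGa] := hZ a Ta; have [rt0 [Mt Ct] mGt gGt] := hZ t Tt.
  pose O := [set x : 'rV[R]_k | [/\ ball a (rho a) x, ball t (rho t) x & forall i, 0 < x 0 i < T 0 i]].
  have oO : open O.
    rewrite openE => x [bx1 bx2 bx3].
    have n1 : \forall y \near x, ball a (rho a) y by apply: open_nbhs_nbhs; split=> //; exact: ball_open_rV.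
    have n2 : \forall y \near x, ball t (rho t) y by apply: open_nbhs_nbhs; split=> //; exact: ball_open_rV.
    have n3 : nbhs x [set y : 'rV[R]_k | forall i, 0 < y 0 i < T 0 i].
      apply: filter_forall_fin => i; have /andP[p1 p2] := bx3 i.
      have c : {for x, continuous (fun y : 'rV[R]_k => y 0 i)} by apply: differentiable_continuous; exact: differentiable_coord.
      have m1 : nbhs x [set y : 'rV[R]_k | 0 < y 0 i] by exact: (c [set z | 0 < z] (lt_nbhsr p1)).
      have m2 : nbhs x [set y : 'rV[R]_k | y 0 i < T 0 i] by exact: (c [set z | z < T 0 i] (lt_nbhsl p2)).
      by apply: filterS2 m1 m2 => y y1 y2; rewrite /= y1.
    by rewrite /interior; near=> y; split; near: y.
  have eO : eq_on O (G a) (G t).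
    move=> x [bx1 bx2 bx3]; have Sx : S x by apply: TS => i; have /andP[h1 h2] := bx3 i; rewrite !ltW.
    exact: etrans (esym (gGa _ Sx bx1)) (gGt _ Sx bx2).
  have eD := pds_eq_on w oO eO.
  have btt : ball t (rho t) t by exact: ballxx.
  have [da _] := maj_pds w mGa bt; have [dt _] := maj_pds w mGt btt.
  have /cvgrPdist_lt ca := differentiable_continuous da; have /cvgrPdist_lt ct := differentiable_continuous dt.
  apply/eqP; rewrite /F -subr_eq0; apply: contrapT => /negP ne.
  have n0 : 0 < `|pds w (G a) t - pds w (G t) t| / 2 by rewrite divr_gt0 // normr_gt0.
  have /nbhs_ballP[d1 /= d10 h1] := ca _ n0; have /nbhs_ballP[d2 /= d20 h2] := ct _ n0.
  have rat : 0 < rho a - `|a - t| by rewrite subr_gt0; apply/in_ball.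
  pose c : 'rV[R]_k := 2^-1 *: T; pose d := Num.min (Num.min d1 d2) (Num.min (rho t) (rho a - `|a - t|)).
  have d0 : 0 < d by rewrite !lt_min d10 d20 rt0 rat.
  have [l1 l2 l3 l4] : [/\ d <= d1, d <= d2, d <= rho t & d <= rho a - `|a - t|].
    by split; rewrite /d !ge_min lexx ?orbT.
  pose s := Num.min 1 (d / (`|c - t| + 1)).
  have q0 : 0 < `|c - t| + 1 by rewrite ltr_wpDl.
  have s0 : 0 < s by rewrite lt_min ltr01 divr_gt0.
  have s1 : s <= 1 by rewrite ge_min lexx.
  have sd : s * `|c - t| < d.
    have : s <= d / (`|c - t| + 1) by rewrite ge_min lexx orbT.
    rewrite ler_pdivlMr // mulrDr mulr1; lra.
  (* A small step from t towards the centre T/2 leads into the interior of the box. *)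
  pose x := t + s *: (c - t).
  have xt : `|t - x| < d.
    by rewrite /x opprD addrA subrr sub0r normrN normrZ gtr0_norm.
  have Ox : O x.
    split.
    - apply/in_ball; apply: le_lt_trans (ler_distD t a x) _; lra.
    - by apply/in_ball; apply: lt_le_trans xt l3.
    move=> i; rewrite !mxE; have /andP[t0 tT] := Tt i; have Ti := T0 i.
    have -> : t 0 i + s * (2^-1 * T 0 i - t 0 i) = (1 - s) * t 0 i + s * (T 0 i / 2) by lra.
    have e1 : 0 <= (1 - s) * t 0 i by rewrite mulr_ge0 // subr_ge0.
    have e2 : 0 < s * (T 0 i / 2) by rewrite mulr_gt0 // divr_gt0.
    have e3 : (1 - s) * t 0 i <= (1 - s) * T 0 i by apply: ler_wpM2l => //; rewrite subr_ge0.
    by apply/andP; split; lra.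
  have k1 : `|pds w (G a) t - pds w (G a) x| < `|pds w (G a) t - pds w (G t) t| / 2.
    by apply: h1; apply/in_ball; apply: lt_le_trans xt l1.
  have k2 : `|pds w (G t) t - pds w (G t) x| < `|pds w (G a) t - pds w (G t) t| / 2.
    by apply: h2; apply/in_ball; apply: lt_le_trans xt l2.
  rewrite (eD _ Ox) in k1; have := ler_distD (pds w (G t) x) (pds w (G a) t) (pds w (G t) t).
  rewrite [`|pds w (G t) x - _|]distrC; lra.
exists F; split.
- move=> w l t Tt; have bx tau : 0 <= tau <= T 0 l -> box T (upd_row t l tau) by exact: box_upd_row.
  have near_ball tau sig : `|tau - sig| < rho (upd_row t l tau) -> ball (upd_row t l tau) (rho (upd_row t l tau)) (upd_row t l sig).
    by move=> h; apply/in_ball; rewrite norm_upd_row.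
  split.
    apply/within_continuousP => tau; rewrite /= in_itv /= => tl eps e0.
    set a := upd_row t l tau; have Ta : box T a by exact: bx.
    have [ra0 [Ma Ca] mGa _] := hZ a Ta.
    have [da _] := maj_pds w mGa (ballxx _ ra0).
    have /cvgrPdist_lt /(_ _ e0) /nbhs_ballP[d1 /= d10 h1] := differentiable_continuous da.
    exists (Num.min d1 (rho a)); first by rewrite lt_min d10.
    move=> sig; rewrite in_itv /= lt_min => sl /andP[b1 b2].
    have bb := near_ball tau sig b2; rewrite -(agree a _ w Ta (bx _ sl) bb).
    by apply: h1; apply/in_ball; rewrite norm_upd_row.
  move=> tau /andP[p1 p2]; have tl : 0 <= tau <= T 0 l by rewrite !ltW.
  set a := upd_row t l tau; have Ta : box T a by exact: bx.
  have [ra0 [Ma Ca] mGa _] := hZ a Ta.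
  have [da _] := maj_pds w mGa (ballxx _ ra0).
  have lE : upd_row t l 0 + tau *: 'e_l = a by rewrite -upd_row_line.
  have := @derive_along R k (fun s : R => upd_row t l 0 + s *: 'e_l) (pds w (G a)) tau 'e_l.
  rewrite /= lE => /(_ da (is_derive_line _ _ _)); apply: near_eq_is_derive.
  have n1 : \forall s \near tau, 0 < s by exact: lt_nbhsr.
  have n2 : \forall s \near tau, s < T 0 l by exact: lt_nbhsl.
  have n3 : \forall s \near tau, `|tau - s| < rho a by exact: nbhsx_ballx.
  near=> s; rewrite /= -upd_row_line; apply: agree => //.
    by apply: bx; apply/andP; split; apply: ltW; near: s.
  by apply: near_ball; near: s.
- move=> t Tt; have [r0 [M0 C0] mG _] := hZ t Tt.
  exists (rho t), (Z t).1.1.2, (Z t).1.2; split=> // w t' Tt' tt.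
  have bt : ball t (rho t) t' by apply/in_ball; rewrite distrC.
  by rewrite -(agree t t' w Tt Tt' bt); case: (maj_pds w mG bt).
move=> t Tt; rewrite /F /=; have [r0 _ _ gG] := hZ t Tt.
by rewrite gG //; [exact: TS|exact: ballxx].
Unshelve. all: by end_near.
Qed.

Section AlongFlows.
Context {n : nat}.
Variables (X : set 'rV[R]_n) (Fl : 'I_k -> 'rV[R]_n -> 'rV[R]_n) (H : 'rV[R]_n -> R).
Hypotheses (oX : open X) (aF : forall l, analytic_field X (Fl l)) (aH : locally_maj X H).
Variables (T : 'rV[R]_k) (E : 'rV[R]_k -> 'rV[R]_n) (F : seq 'I_k -> 'rV[R]_k -> R).
Hypothesis T0 : forall i, 0 < T 0 i.
Hypothesis flowE : forall t l, box T t -> (forall i : 'I_k, (l < i)%N -> t 0 i = 0) ->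
  flow_on X (Fl l) (fun tau => E (upd_row t l tau)) 0 (T 0 l).
Hypothesis dF : deriv_family T F.

Let L w := lies [seq Fl l | l <- w] H.

Let L_maj w : locally_maj X (L w).
Proof. by apply: locally_maj_lies => // f /List.in_map_iff[l [<- _]]. Qed.

Let L_cder w t l : box T t -> (forall i : 'I_k, (l < i)%N -> t 0 i = 0) ->
  cder 0 (T 0 l) (fun tau => L w (E (upd_row t l tau))) (fun tau => L (l :: w) (E (upd_row t l tau))).
Proof.
move=> Tt tl; apply: (flow_cder (flowE Tt tl)) => y Xy.
exact: locally_maj_differentiable (L_maj w) Xy.
Qed.

(** While the durations after l are zero, varying t_l moves the final state along [Fl l], so a
    derivative in t_l is a Lie derivative. Sorting w lets the later letters be differentiated first,
    with the earlier durations still free. *)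
Lemma descend : (forall t, box T t -> F [::] t = H (E t)) ->
  forall w t, sorted leq (map val w) -> box T t ->
  (forall l w', w = l :: w' -> forall i : 'I_k, (l < i)%N -> t 0 i = 0) -> F w t = L w (E t).
Proof.
move=> F0; elim=> [|l w IH] t sw Tt ht; first exact: F0.
have tl := ht l w erefl; have Tl : 0 <= t 0 l <= T 0 l by exact: Tt.
rewrite -(upd_row_id t l).
apply: (cder_unique (T0 l) (dF w l Tt) (L_cder w Tt tl)) Tl => [tau tauT||].
- apply: IH; first exact: path_sorted sw.
    exact: box_upd_row.
  move=> l' w' wE i li; rewrite mxE; move: sw; rewrite wE /= => /andP[ll _].
  case: eqP => [ii|_]; first by move: li; rewrite ii ltnNge ll.
  by apply: tl; apply: leq_ltn_trans li.
- by have [] := dF (l :: w) l Tt.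
- by have [] := L_cder (l :: w) Tt tl.
Qed.

(** Durations are switched on from the first letter to the last. At stage j the derivatives in the
    letters from j on are known when the durations from j on vanish; those in t_j at 0 then
    determine the function of t_j by [flow_agree]. *)
Lemma ascend : bounded_family T F ->
  (forall w, sorted leq (map val w) -> F w 0 = L w (E 0)) ->
  forall t, box T t -> F [::] t = H (E t).
Proof.
move=> bF h0; have T00 : box T 0 by move=> i; rewrite mxE lexx ltW.
suff C j : (j <= k)%N -> forall t w, box T t -> (forall i : 'I_k, (j <= i)%N -> t 0 i = 0) -> path leq j (map val w) ->
   F w t = L w (E t).
  move=> t Tt; apply: (C k) => // i; by rewrite leqNgt ltn_ord.
elim: j => [|j IH] jk t w Tt tj pw.
  have -> : t = 0 by apply/rowP => i; rewrite mxE tj.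
  by apply: h0; apply: path_sorted pw.
pose l := Ordinal jk; have tl (i : 'I_k) : (l < i)%N -> t 0 i = 0 by exact: tj.
have Tl : 0 <= t 0 l <= T 0 l by exact: Tt.
have lE i : lies (nseq i (Fl l)) (L w) = L (nseq i l ++ w).
  by rewrite /L map_cat map_nseq /lies foldr_cat.
rewrite -(upd_row_id t l).
have := @flow_agree R n X (Fl l) (fun tau => E (upd_row t l tau)) 0 (T 0 l) 0 (L w)
  (fun i tau => F (nseq i l ++ w) (upd_row t l tau)) oX (aF l) (L_maj w) (flowE Tt tl).
move=> /(_ _ _ _ _ 0%N _ Tl); apply.
- by rewrite lexx ltW.
- by move=> i; exact: dF.
- move=> tau tauT; have [eps [M [C [e0 M0 C0 hb]]]] := bF _ (box_upd_row Tt tauT).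
  (* With w fixed, (i + |w|)! <= 2^(i + |w|) i! |w|! separates the part that grows with i. *)
  exists eps, (M * C ^+ size w * 2 ^+ size w * (size w)`!%:R), (2 * C); split=> // s i sT ts.
  apply: le_trans (hb (nseq i l ++ w) _ (box_upd_row Tt sT) _) _; first by rewrite norm_upd_row.
  rewrite size_cat size_nseq.
  have f : (i + size w)`!%:R <= 2 ^+ (i + size w) * (i`!%:R * (size w)`!%:R) :> R.
    by rewrite -natrX -!natrM ler_nat fact_add_le.
  have z : 0 <= M * C ^+ (i + size w) by rewrite mulr_ge0 // exprn_ge0.
  apply: le_trans (ler_wpM2l z f) _; rewrite !exprD exprMn.
  rewrite le_eqVlt; apply/orP; left; apply/eqP; lra.
move=> i; rewrite lE; apply: IH (ltnW jk) _ _ _ _ _.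
- by apply: box_upd_row => //; rewrite lexx ltW.
- move=> i'; rewrite mxE; case: eqP => // /eqP ne ji; apply: tj.
  by rewrite ltn_neqAle ji andbT; apply: contraNneq ne => e; apply/eqP/val_inj.
rewrite map_cat map_nseq /=.
have {}pw : path leq j (map val w).
  by case: (w) pw => //= a w' /andP[/ltnW -> ->].
by elim: i => //= i ->; rewrite leqnn.
Qed.

End AlongFlows.

(** The flow line of letter l under the full duration [T 0 l] serves for all shorter ones: later
    letters of duration zero leave the state where it is, and uniqueness identifies E with the point
    at time tau. *)
Lemma steers_flow n m (X : set 'rV[R]_n) (U : set 'rV[R]_m) (f : 'rV[R]_m -> 'rV[R]_n -> 'rV[R]_n) (al : 'I_k -> 'rV[R]_m)
    (T : 'rV[R]_k) E q : open X -> (forall a, U a -> analytic_field X (f a)) -> (forall i, U (al i)) ->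
  (forall t, box T t -> steers X f (word al t) q (E t)) -> (forall i, 0 <= T 0 i) ->
  forall t l, box T t -> (forall i : 'I_k, (l < i)%N -> t 0 i = 0) ->
  flow_on X (f (al l)) (fun tau => E (upd_row t l tau)) 0 (T 0 l).
Proof.
move=> oX af Ual hE T0 t l Tt tl.
have eE : enum 'I_k = take l (enum 'I_k) ++ l :: drop l.+1 (enum 'I_k).
  rewrite -{1}(cat_take_drop l (enum 'I_k)) (drop_nth l) ?size_enum_ord //.
  by rewrite nth_ord_enum.
pose pre := [seq (al i, t 0 i) | i <- take l (enum 'I_k)].
pose post := [seq (al i, t 0 i) | i <- drop l.+1 (enum 'I_k)].
have wE tau : word al (upd_row t l tau) = pre ++ (al l, tau) :: post.
  rewrite /word eE map_cat /= mxE eqxx; congr (_ ++ (_ :: _)).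
    apply/eq_in_map => i /(index_ltn) ; rewrite index_enum_ord => il.
    by rewrite mxE; case: eqP => // ii; move: il; rewrite ii ltnn.
  apply/eq_in_map => i id; rewrite mxE; case: eqP => // ii.
  have := enum_uniq 'I_k; rewrite eE cat_uniq /= => /and3P[_ _ /andP[]].
  by move: id; rewrite ii => -> .
have z0 a s : (a, s) \in post -> s = 0.
  move=> /mapP[i id [_ ->]]; apply: tl.
  have := mem_drop id => _; have : val i \in drop l.+1 (iota 0 k).
    by rewrite -val_enum_ord -map_drop; apply/mapP; exists i.
  by rewrite drop_iota add0n mem_iota => /andP[].
have pw t' : box T t' -> pc_inputs U (word al t').
  by move=> bt; apply/pc_inputs_word => i; split=> //; have /andP[] := bt i.
have bT : box T (upd_row t l (T 0 l)) by apply: box_upd_row => //; rewrite lexx T0.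
have ppost : pc_inputs U post.
  by have := pw _ bT; rewrite wE => /pc_inputs_cat[_ /pc_inputs_cons[]].
have pcons tau : 0 <= tau -> pc_inputs U ((al l, tau) :: post) by move=> t0; apply/pc_inputs_cons.
have := hE _ bT; rewrite wE => /(steers_cat _ _ _ _ _ (pcons _ (T0 l)))[q1 s1 [y [fy y0 _]]].
have fy' := fy; apply: flow_on_eq fy => tau /andP[t0 t1].
have bt : box T (upd_row t l tau) by apply: box_upd_row => //; rewrite t0.
have := hE _ bt; apply: (steers_unique oX af (pw _ bt)).
rewrite wE; apply/(steers_cat _ _ _ _ _ (pcons _ t0)); exists q1 => //; exists y; split=> //.
  exact: flow_sub (lexx 0) t1 fy'.
apply: steers_zero z0 _; have [_ Xy _] := fy'; by apply: Xy; rewrite t0.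
Qed.

End DerivativeFamilies.

(** * States at which all iterated Lie derivatives of a function vanish *)

Section LieDerivativesAlongInputs.
Context {R : realType} {n m : nat}.
Variables (U : set 'rV[R]_m) (X : set 'rV[R]_n) (f : 'rV[R]_m -> 'rV[R]_n -> 'rV[R]_n) (H : 'rV[R]_n -> R).
Hypotheses (oX : open X) (af : forall a, U a -> analytic_field X (f a)) (aH : locally_maj X H).
Implicit Types (u : input R m) (q : 'rV[R]_n) (w : seq 'rV[R]_m).

Definition letters_in w : Prop := forall a, a \in w -> U a.

(** Unlike the vanishing of H, this property of a state is carried along every input, forwards and
    backwards ([flat_steers]). *)
Definition flat q : Prop := forall w, letters_in w -> lies [seq f a | a <- w] H q = 0.

Lemma lies_locally_maj w : letters_in w -> locally_maj X (lies [seq f a | a <- w] H).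
Proof.
move=> Uw; apply: locally_maj_lies => // F /List.in_map_iff[a [<- aw]]; apply: af.
by apply: Uw; elim: (w) aw => //= b w' IH [->|/IH]; rewrite inE ?eqxx // => ->; rewrite orbT.
Qed.

Lemma flat_flow a (s t0 : R) (x : R -> 'rV[R]_n) : U a -> flow_on X (f a) x 0 s -> 0 <= t0 <= s ->
  flat (x t0) -> forall t, 0 <= t <= s -> flat (x t).
Proof.
move=> Ua fx t0s fl t ts w Uw.
apply: (flow_vanish oX (af Ua) (lies_locally_maj Uw) fx t0s) => // j.
have -> : lies (nseq j (f a)) (lies [seq f a | a <- w] H) = lies [seq f a | a <- nseq j a ++ w] H.
  by rewrite map_cat map_nseq /lies foldr_cat.
apply: fl => b; rewrite mem_cat mem_nseq => /orP[/andP[_ /eqP ->]|/Uw] //.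
Qed.

Lemma flat_steers u q q' : pc_inputs U u -> steers X f u q q' -> (flat q <-> flat q').
Proof.
elim: u q => [q _ [_ ->] //|[a s] u IH] q /pc_inputs_cons[Ua s0 pu] [x [fx <- hu]].
rewrite -(IH _ pu hu); split=> fl; apply: (flat_flow Ua fx _ fl); by rewrite lexx s0.
Qed.

Lemma steers_choice k (al : 'I_k -> 'rV[R]_m) q (B : set 'rV[R]_k) (P : 'rV[R]_k -> 'rV[R]_n -> Prop) :
  (forall t, B t -> exists2 q', steers X f (word al t) q q' & P t q') ->
  exists E, forall t, B t -> steers X f (word al t) q (E t) /\ P t (E t).
Proof.
move=> h; have /choice[E hE] t : exists q', B t -> steers X f (word al t) q q' /\ P t q'.
  have [Bt|Bt] := pselect (B t); last by exists q.
  by have [q' h1 h2] := h t Bt; exists q'.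
by exists E.
Qed.

Lemma steers_word0 k (al : 'I_k -> 'rV[R]_m) q q' : (forall i, U (al i)) -> X q -> steers X f (word al 0) q q' -> q' = q.
Proof.
move=> Ual Xq; have p0 : pc_inputs U (word al 0) by apply/pc_inputs_word => i; rewrite mxE.
move=> /(steers_unique oX af p0)/(_ (steers_zero _ _ Xq)); apply=> // a s.
by move=> /mapP[i _ [_ ->]]; rewrite mxE.
Qed.

Lemma sorted_enum_ord k : sorted leq (map val (enum 'I_k)).
Proof. by rewrite val_enum_ord iota_sorted. Qed.

(** The Lie derivative along w at q is the mixed derivative, once in each duration, of the response
    to the input with the letters of w, taken at zero durations; [descend] is applied with the zero
    family. *)
Lemma small_vanish_flat q : X q ->
  (forall k (al : 'I_k -> 'rV[R]_m), (forall i, U (al i)) -> exists2 T : 'rV[R]_k, forall i, 0 < T 0 i &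
     forall t, box T t -> exists2 q', steers X f (word al t) q q' & H q' = 0) -> flat q.
Proof.
move=> Xq h w Uw; pose al := tnth (in_tuple w).
have Ual i : U (al i) by apply: Uw; exact: mem_tnth.
have [T T0 hT] := h _ al Ual; have [E hE] := steers_choice hT.
have flowE := steers_flow oX af Ual (fun t bt => (hE t bt).1) (fun i => ltW (T0 i)).
have dF : deriv_family T (fun _ _ => 0 : R).
  by move=> u l t _; apply: cderT => s; apply: is_derive_cst.
have b0 : box T 0 by move=> i; rewrite mxE lexx ltW.
have D : 0 = lies [seq f (al l) | l <- enum 'I_(size w)] H (E 0).
  apply: (@descend R _ n X (fun l => f (al l)) H oX (fun l => af (Ual l)) aH T E (fun _ _ => 0) T0 flowE dF _ (enum 'I_(size w)) 0 (sorted_enum_ord _) b0).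
    by move=> t bt; rewrite (hE t bt).2.
  by move=> l w' _ i _; rewrite mxE.
rewrite (steers_word0 Ual Xq (hE 0 b0).1) in D; rewrite [RHS]D (map_comp f al).
by congr (lies _ H q); congr map; rewrite -[LHS](map_tnth_enum (in_tuple w)).
Qed.

End LieDerivativesAlongInputs.

(** * Continuation of responses in the durations *)

Section Extension.
Context {R : realType} {n1 n2 m k : nat}.
Variables (U : set 'rV[R]_m) (al : 'I_k -> 'rV[R]_m).
Hypothesis Ual : forall i, U (al i).

Lemma deriv_family_sub (T T' : 'rV[R]_k) F : (forall i, T' 0 i <= T 0 i) -> deriv_family T F -> deriv_family T' F.
Proof.
move=> TT dF w l t bt; apply: (cder_sub (lexx 0) (TT l)); apply: dF => i.
by have /andP[-> h] := bt i; apply: le_trans h (TT i).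
Qed.

(* The mixed time derivatives of a response are iterated Lie derivatives along the
   flow, so agreement at the initial states spreads over the box by quasi-analyticity. *)
Lemma analytic_response_extends (X1 : set 'rV[R]_n1) f1 H1 q1 (X2 : set 'rV[R]_n2) f2 H2 q2
    (S : set 'rV[R]_k) P (T s : 'rV[R]_k) E1 E2 :
  open X1 -> (forall a, U a -> analytic_field X1 (f1 a)) -> locally_maj X1 H1 -> X1 q1 ->
  open X2 -> (forall a, U a -> analytic_field X2 (f2 a)) -> locally_maj X2 H2 -> X2 q2 ->
  analytic_on S P -> box T `<=` S -> (forall i, 0 < T 0 i) -> (forall i, 0 < s 0 i <= T 0 i) ->
  (forall t, box T t -> steers X2 f2 (word al t) q2 (E2 t)) ->
  (forall t, box s t -> steers X1 f1 (word al t) q1 (E1 t) /\ P t = H1 (E1 t)) ->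
  (forall w, letters_in U w -> lies [seq f1 a | a <- w] H1 q1 = lies [seq f2 a | a <- w] H2 q2) ->
  forall t, box T t -> P t = H2 (E2 t).
Proof.
move=> oX1 af1 aH1 Xq1 oX2 af2 aH2 Xq2 aP TS T0 sT h2 h1 hL.
have [F [dF bF F0]] := analytic_deriv_family aP TS T0.
have s0 i : 0 < s 0 i by have /andP[] := sT i.
have sT' i : s 0 i <= T 0 i by have /andP[] := sT i.
have sub t : box s t -> box T t by move=> bt i; have /andP[-> h] := bt i; apply: le_trans h (sT' i).
have flow1 := steers_flow oX1 af1 Ual (fun t bt => (h1 t bt).1) (fun i => ltW (s0 i)).
have flow2 := steers_flow oX2 af2 Ual h2 (fun i => ltW (T0 i)).
have bs0 : box s 0 by move=> i; rewrite mxE lexx ltW.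
move=> t bt; rewrite -F0 //.
apply: (ascend oX2 (fun l => af2 _ (Ual l)) aH2 T0 flow2 dF bF) bt => w sw.
rewrite (steers_word0 oX2 af2 Ual Xq2 (h2 _ (sub _ bs0))).
(* On the small box the response comes from the first system, so its mixed derivatives at 0 are Lie
   derivatives at q1. *)
rewrite (descend oX1 (fun l => af1 _ (Ual l)) aH1 s0 flow1 (deriv_family_sub sT' dF) _ sw bs0).
- rewrite (steers_word0 oX1 af1 Ual Xq1 (h1 _ bs0).1) !(map_comp _ al); apply: hL.
  by move=> a /mapP[i _ ->].
- by move=> t' bt'; rewrite F0 ?(h1 _ bt').2 //; exact: sub.
by move=> l w' _ i _; rewrite mxE.
Qed.

End Extension.

(** * Short inputs keep the state in a ball *)

Section Confinement.
Context {R : realType} {n m : nat}.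
Implicit Types (X : set 'rV[R]_n) (c q : 'rV[R]_n).

Lemma flow_speed X f (y : R -> 'rV[R]_n) (t M : R) : 0 <= t -> flow_on X f y 0 t ->
  (forall s, 0 < s < t -> `|f (y s)| <= M) -> `|y t - y 0| <= M * t.
Proof.
move=> t0 fy hM; have [teq|tn] := eqVneq t 0.
  by rewrite teq subrr normr0 mulr0.
have tp : 0 < t by rewrite lt_def tn.
have M0 : 0 <= M by apply: le_trans (normr_ge0 (f (y (t / 2)))) _; apply: hM; apply/andP; split; lra.
apply: norm_le_coord => [|i]; first by rewrite mulr_ge0.
have c1 := flow_cder (g := fun z : 'rV[R]_n => z 0 i) fy (fun z _ => differentiable_coord z 0 i).
have c2 : cder 0 t (fun s => y s 0 i - y 0 0 i) (fun s => lie f (fun z : 'rV[R]_n => z 0 i) (y s)).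
  apply: cder_eq (cderD c1 (cderT _ _ (fun s => is_derive_cst (- y 0 0 i) s 1))) => // s _; by rewrite addr0.
have h : `|y t 0 i - y 0 0 i| <= M * t ^+ 1 / 1`!%:R.
  apply: (cder_bound c2); rewrite ?subrr ?t0 ?lexx // => s st; rewrite expr0 divr1 mulr1 /lie derive_coord.
  by apply: le_trans (coord_le_norm _ i) _; exact: hM.
by move: h; rewrite !mxE expr1 divr1.
Qed.

(** As long as the flow is in the ball its speed is at most M, hence it is at a definite distance
    from the boundary. Having stayed in the ball up to time t is therefore a locally constant
    property of t. *)
Lemma flow_stays X f c (y : R -> 'rV[R]_n) (s M rho : R) : 0 <= s -> 0 <= M -> flow_on X f y 0 s ->
  (forall x, ball c rho x -> `|f x| <= M) -> `|c - y 0| + M * s < rho ->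
  forall t, 0 <= t <= s -> `|c - y t| <= `|c - y 0| + M * t.
Proof.
move=> s0 M0 fy hM hr.
have bound t : 0 <= t <= s -> (forall r, 0 <= r <= t -> ball c rho (y r)) -> `|c - y t| <= `|c - y 0| + M * t.
  move=> /andP[t0 ts] h; have := flow_speed t0 (flow_sub (lexx 0) ts fy) (M := M).
  rewrite distrC => sp; have := ler_distD (y 0) c (y t) => tr; apply: le_trans tr _; rewrite lerD2l; apply: sp.
  by move=> r /andP[r0 rt]; apply: hM; apply: h; rewrite !ltW.
pose P (t : R) := forall r : R, 0 <= r <= t -> ball c rho (y r).
suff HP t : 0 <= t <= s -> P t by move=> t ts; apply: bound => //; exact: HP.
move=> ts; have [cy _ _] := fy; move/within_continuousP : cy => cy.
have loc (x : R) : `[0, s]%classic x -> exists2 B, nbhs x B & forall p q : R, `[0, s]%classic p -> `[0, s]%classic q -> B p -> B q -> P p -> P q.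
  rewrite /= in_itv /= => xs.
  have xs' : x \in `[0, s] by rewrite in_itv.
  pose rho' := `|c - y 0| + M * s.
  have [bx|nbx] := ltP `|c - y x| rho.
    have e0 : 0 < rho - `|c - y x| by rewrite subr_gt0.
    have [del d0 hd] := cy x xs' _ e0; exists (ball x del); first exact: nbhsx_ballx.
    move=> p q; rewrite /= !in_itv /= => ps qs xp xq Pp r /andP[r0 rq].
    have [rp|pr] := leP r p; first by apply: Pp; rewrite r0.
    have rs : r \in `[0, s] by rewrite in_itv /= r0; case/andP: qs => _ qs; exact: le_trans rq qs.
    have xr : `|x - r| < del.
      move: xp xq; rewrite /ball /= !ltr_norml => /andP[? ?] /andP[? ?]; apply/andP; split; lra.
    have := hd r rs xr => h; apply/in_ball; apply: le_lt_trans (ler_distD (y x) c (y r)) _; lra.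
  have e0 : 0 < rho - rho' by rewrite subr_gt0.
  have [del d0 hd] := cy x xs' _ e0; exists (ball x del); first exact: nbhsx_ballx.
  move=> p q; rewrite /= !in_itv /= => ps qs xp xq Pp; exfalso.
  have ps' : p \in `[0, s] by rewrite in_itv.
  have := hd p ps' xp => h; have b := bound p ps Pp.
  have pM : M * p <= M * s by apply: ler_wpM2l => //; case/andP: ps.
  have := ler_distD (y p) c (y x); rewrite [`|y p - _|]distrC; rewrite /rho' in h; lra.
have s0' : `[0, s]%classic 0 by rewrite /= in_itv /= lexx s0.
have ts' : `[0, s]%classic t by rewrite /= in_itv.
have P0 : P 0.
  move=> r /andP[r0 r1]; have -> : r = 0 by apply/eqP; rewrite eq_le r1.
  by apply/in_ball; apply: le_lt_trans hr; rewrite lerDl mulr_ge0.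
refine (@connected_locally_constant _ _ P (@segment_connected R 0 s) loc 0 t s0' ts' P0).
Qed.

Lemma steers_stays (U : set 'rV[R]_m) X f c (u : input R m) q q' (M rho : R) : 0 <= M -> pc_inputs U u ->
  (forall a x, U a -> ball c rho x -> `|f a x| <= M) -> `|c - q| + M * duration u < rho ->
  steers X f u q q' -> steers (X `&` ball c rho) f u q q'.
Proof.
move=> M0 + hM; elim: u q => [|[a s] u IH] q /=.
  by rewrite duration_nil mulr0 addr0 => _ qr [Xq <-]; split=> //; split=> //; apply/in_ball.
move=> /pc_inputs_cons[Ua s0 pu]; rewrite duration_cons mulrDr => hr [x [fx x0 hu]].
have du := duration_ge0 pu; have Mu : 0 <= M * duration u by rewrite mulr_ge0.
have hr' : `|c - x 0| + M * s < rho by rewrite x0; lra.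
have st := flow_stays s0 M0 fx (fun y => hM a y Ua) hr'.
exists x; split=> //; last first.
  have s1 : 0 <= s <= s by rewrite s0 lexx.
  by apply: IH => //; have := st s s1; rewrite x0; lra.
have [cx Xx dx] := fx; split=> // t ts; split; first exact: Xx.
apply/in_ball; apply: le_lt_trans (st t ts) _; apply: le_lt_trans hr'.
by rewrite lerD2l ler_wpM2l //; case/andP: ts.
Qed.

End Confinement.

(** * Transport of trajectories and Lie derivatives by Phi *)

Section Conjugation.
Context {R : realType} {n d m : nat}.
Variables (U : set 'rV[R]_m) (N : set 'rV[R]_n) (V : set 'rV[R]_d) (f : 'rV[R]_m -> 'rV[R]_n -> 'rV[R]_n)
  (fV : 'rV[R]_m -> 'rV[R]_d -> 'rV[R]_d) (phi : 'I_d -> 'rV[R]_n -> R).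
Hypotheses (oN : open N) (NV : forall x, N x -> V (Phi phi x)) (dphi : forall x i, N x -> differentiable (phi i) x).
Hypothesis conj : forall a x i, U a -> N x -> lie (f a) (phi i) x = fV a (Phi phi x) 0 i.

Lemma lies_conj k w : open V -> (forall a, U a -> analytic_field V (fV a)) -> locally_maj V k -> letters_in U w ->
  eq_on N (lies [seq f a | a <- w] (fun x => k (Phi phi x))) (fun x => lies [seq fV a | a <- w] k (Phi phi x)).
Proof.
move=> oV aV mk; elim: w => [//|a w IH] Uaw x Nx.
have Uw : letters_in U w by move=> b bw; apply: Uaw; rewrite inE bw orbT.
have Ua : U a by apply: Uaw; exact: mem_head.
rewrite /= (lie_eq_on _ oN (IH Uw) Nx) /lie.
have dk := locally_maj_differentiable (lies_locally_maj oV aV mk Uw) (NV Nx).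
rewrite (derive_comp (fun i => dphi i Nx) dk).2; congr ('D_ _ _ _).
by apply/rowP => i; rewrite mxE; exact: conj.
Qed.

Lemma steers_conj (u : input R m) q q' : pc_inputs U u -> steers N f u q q' -> steers V fV u (Phi phi q) (Phi phi q').
Proof.
elim: u q => [|[a s] u IH] q /=; first by move=> _ [Nq <-]; split=> //; exact: NV.
move=> /pc_inputs_cons[Ua s0 pu] [x [[cx Nx dx] <- hu]].
exists (fun t => Phi phi (x t)); split=> //; last exact: IH.
split.
- move/within_continuousP : cx => cx; apply/within_continuousP => t ts eps e0.
  have Nt : N (x t) by apply: Nx; move: ts; rewrite /= in_itv.
  have [dP _] := row_differentiable (fun i => dphi i Nt).
  have /cvgrPdist_lt /(_ _ e0) /nbhs_ballP[d1 /= d10 h1] := differentiable_continuous dP.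
  have [del d0 hd] := cx t ts _ d10; exists del => // r rs tr.
  by apply: h1; apply/in_ball; exact: hd.
- by move=> t ts; apply: NV; exact: Nx.
move=> t ts; have Nt : N (x t) by apply: Nx; case/andP: ts => *; rewrite !ltW.
have D i : is_derive t (1 : R) (fun t => phi i (x t)) (fV a (Phi phi (x t)) 0 i).
  by rewrite -conj //; apply: (derive_along (dphi i Nt) (dx t ts)).
have E i : (fun t => Phi phi (x t) 0 i) = (fun t => phi i (x t)) by apply/funext => r; rewrite mxE.
have dm : derivable (fun t => Phi phi (x t)) t 1.
  by apply/derivable_mxP => j i; rewrite (ord1 j) E; case: (D i).
apply: DeriveDef => //; rewrite derive_mx //; apply/rowP => i; rewrite mxE E.
by case: (D i).
Qed.

End Conjugation.

(** * Inputs of a Nash system *)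

Section SystemInputs.
Context {R : realType} {n m r : nat}.
Variables (U : set 'rV[R]_m) (S : system R n m r).

Lemma system_inputs_admissible u : system_inputs U S u -> admissible U (system_inputs U S).
Proof.
move=> [A0 [aA0 hA0 A0u]].
have -> : system_inputs U S = [set u | exists2 A, admissible U A /\ A `<=` has_unique_trajectory S & A u].
  by apply/seteqP; split=> v [A]; [move=> [? ? ?]; exists A|move=> [? ?] ?; exists A].
by apply: admissible_bigcup => [A []//|]; exists A0.
Qed.

Hypothesis nS : nash_system U S.

Lemma nash_system_fields : open (st_space S) /\ forall a, U a -> analytic_field (st_space S) (dyn S a).
Proof.
by have [oX _ _ [nf _ _]] := nS; split=> // a Ua; apply: nash_map_analytic => //; exact: nf.
Qed.

Lemma system_inputs_steers u : system_inputs U S u ->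
  pc_inputs U u /\ steers (st_space S) (dyn S) u (init S) (final_state S u).
Proof.
move=> [A [[_ pc _ _] hA Au]]; have [oX aF] := nash_system_fields.
have pu := pc _ Au; split=> //; have [q sq] := (has_unique_trajectoryP oX aF pu).1 (hA _ Au).
by rewrite (final_stateP oX aF pu sq).
Qed.

Lemma system_inputs_sub (A : set (input R m)) : admissible U A ->
  (forall u, A u -> exists q, steers (st_space S) (dyn S) u (init S) q) -> A `<=` system_inputs U S.
Proof.
move=> aA hA u Au; exists A; split=> // v Av; have [oX aF] := nash_system_fields.
by have [_ pc _ _] := aA; apply/(has_unique_trajectoryP oX aF (pc _ Av)); exact: hA.
Qed.

Lemma system_inputs_restart u v : system_inputs U S (u ++ v) ->
  steers (st_space S) (dyn S) v (final_state S u) (final_state S (u ++ v)).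
Proof.
move=> su; have [puv st] := system_inputs_steers su; have [pu pv] := (pc_inputs_cat _ _ _).1 puv.
have [oX aF] := nash_system_fields.
have [q1 h1 h2] := (steers_cat _ _ _ _ _ pv).1 st.
by rewrite (final_stateP oX aF pu h1).
Qed.

End SystemInputs.

Lemma mpoly_factor0 (R : realType) d (B : mpoly d.+1 R) : (forall v, meval (fcons 0 v) B = 0) ->
  exists B', B = mpolyX R (mnm1 ord0) * B'.
Proof.
move=> h; pose z (m : multinom d.+1) := m ord0 == 0%N.
pose Q1 := \sum_(m <- msupp B | z m) mcoeff m B *: mpolyX R m.
pose B' := \sum_(m <- msupp B | ~~ z m) mcoeff m B *: mpolyX R (mnm_sub m (mnm1 ord0)).
have E : B = Q1 + mpolyX R (mnm1 ord0) * B'.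
  rewrite {1}[B]mpolyE (bigID z) /=; congr (_ + _); rewrite mulr_sumr; apply: eq_bigr => m mz.
  rewrite -scalerAr -mpolyXD; congr (_ *: mpolyX _ _); apply/mnmP => i; rewrite mnmDE mnmBE mnm1E.
  by case: eqVneq => [<-|_] /=; rewrite ?subn0 // subnKC // lt0n.
have Q10 : Q1 = 0.
  apply: mpoly_eval0 => v; have -> : meval v Q1 = meval (fcons 0 (fun i => v (lift ord0 i))) Q1.
    rewrite /Q1 !raddf_sum; apply: eq_bigr => m /eqP mz; rewrite /= !mevalZ !mevalX; congr (_ * _).
    by apply: eq_bigr => i _; case: (unliftP ord0 i) => [j ->|->]; rewrite ?fconsS // mz !expr0.
  have := h (fun i => v (lift ord0 i)); rewrite {1}E mevalD mevalM mevalXU fcons0 mul0r addr0 //.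
by exists B'; rewrite {1}E Q10 add0r.
Qed.

Lemma comp_fcons0 (R : realType) d (B : mpoly d.+1 R) : exists B0 : mpoly d R, forall v, meval v B0 = meval (fcons 0 v) B.
Proof.
exists (comp_mpoly [tuple fcons 0 (fun i : 'I_d => mpolyX R (mnm1 i)) j | j < d.+1] B) => v.
rewrite comp_mpoly_meval; apply: meval_eq => j; rewrite tnth_mktuple.
by case: (unliftP ord0 j) => [l ->|->]; rewrite ?fconsS ?fcons0 ?mevalXU ?meval0.
Qed.

Section FiniteIntersections.
Context {T : Type}.
Variable P : set T -> Prop.
Hypotheses (PT : P setT) (PI : forall A B, P A -> P B -> P (A `&` B)).

Lemma bigcap_seq_closed (I : choiceType) (s : seq I) (F : I -> set T) : (forall i, i \in s -> P (F i)) ->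
  P (\bigcap_(i in [set` s]) F i).
Proof.
elim: s => [|j s IH] h; first by rewrite set_nil bigcap_set0.
have -> : \bigcap_(i in [set` j :: s]) F i = F j `&` \bigcap_(i in [set` s]) F i.
  apply/seteqP; split=> [x hx|x [xj xs] i]; last by rewrite /= inE => /orP[/eqP ->|/xs].
  by split=> [|i si]; apply: hx; rewrite /= inE ?eqxx // si orbT.
apply: PI; first by apply: h; exact: mem_head.
by apply: IH => i si; apply: h; rewrite inE si orbT.
Qed.

Lemma bigcap_fin_closed (I : finType) (F : I -> set T) : (forall i, P (F i)) -> P (\bigcap_i F i).
Proof.
move=> h; have := @bigcap_seq_closed I (enum I) F (fun i _ => h i).
rewrite (_ : [set` enum I] = setT) //; apply/seteqP; split=> // i _ /=; exact: mem_enum.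
Qed.

End FiniteIntersections.

Section SmallInputs.
Context {R : realType} {m : nat}.
Variables (U : set 'rV[R]_m).

Lemma admissible_small_box (A : set (input R m)) u k (al : 'I_k -> 'rV[R]_m) (eps : R) : admissible U A -> A u ->
  (forall i, U (al i)) -> 0 < eps -> exists2 T : 'rV[R]_k, forall i, 0 < T 0 i &
  forall t, box T t -> A (u ++ word al t) /\ duration (word al t) < eps.
Proof.
move=> aA Au Ual e0; have [s s0 hs] := admissible_extend aA Au Ual.
have k0 : 0 < k.+1%:R :> R by rewrite ltr0n.
(* Dividing by k + 1 rather than k makes the total duration strictly smaller than eps and covers k =
   0. *)
exists (\row_i Num.min (s 0 i) (eps / k.+1%:R)) => [i|t bt].
  by rewrite mxE lt_min s0 divr_gt0.
split; first by apply: hs => i; have := bt i; rewrite mxE le_min => /and3P[-> ->].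
rewrite duration_word; apply: le_lt_trans (_ : \sum_(i < k) eps / k.+1%:R < _).
  by apply: ler_sum => i _; have := bt i; rewrite mxE le_min => /and3P[_ _].
rewrite sumr_const card_ord -[_ *+ _]mulr_natl mulrCA -[ltRHS]mulr1 ltr_pM2l //.
by rewrite ltr_pdivrMr // mul1r ltr_nat.
Qed.

Lemma box_minl k (T1 T2 : 'rV[R]_k) : box (\row_i Num.min (T1 0 i) (T2 0 i)) `<=` box T1.
Proof. by move=> t bt i; have := bt i; rewrite mxE le_min => /and3P[-> ->]. Qed.

Lemma box_minr k (T1 T2 : 'rV[R]_k) : box (\row_i Num.min (T1 0 i) (T2 0 i)) `<=` box T2.
Proof. by move=> t bt i; have := bt i; rewrite mxE le_min => /and3P[-> _]. Qed.

End SmallInputs.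

Section NonvanishingInput.
Context {R : realType} {n m r : nat}.
Variables (U : set 'rV[R]_m) (Ut : set (input R m)) (S : system R n m r).
Hypotheses (nS : nash_system U S) (aUt : admissible U Ut) (rS : sa_reachable U S).

(** If G vanished after all short inputs common to S and [Ut], the initial state would be flat for
    G; flatness follows every input of S, so G would vanish on the reachable set. *)
Lemma small_input_nonvanishing G (eps : R) : nash_fun (st_space S) G -> ~ eq_on (st_space S) G (fun=> 0) -> 0 < eps ->
  exists u, [/\ system_inputs U S u, Ut u, duration u < eps & G (final_state S u) != 0].
Proof.
move=> nG G0 e0; apply: contrapT => H; apply: G0; apply: rS => // x [u su <-].
have [oX aF] := nash_system_fields nS; have [_ _ _ [_ _ Xi]] := nS.
have aS := system_inputs_admissible su.
have aG := ((nash_locally_maj oX G).1 nG).1.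
have fl : flat U (dyn S) G (init S).
  apply: (small_vanish_flat oX aF aG Xi) => k al Ual.
  have [T1 T10 h1] := admissible_small_box aS (admissible_nil aS) Ual e0.
  have [T2 T20 h2] := admissible_small_box aUt (admissible_nil aUt) Ual e0.
  exists (\row_i Num.min (T1 0 i) (T2 0 i)) => [i|t bt]; first by rewrite mxE lt_min T10 T20.
  have [sw dw] := h1 _ (box_minl bt); have [Uw _] := h2 _ (box_minr bt).
  exists (final_state S (word al t)); first by have [] := system_inputs_steers nS sw.
  by apply/eqP; apply: contrapT => /negP ne; apply: H; exists (word al t).
have [pu st] := system_inputs_steers nS su.
by have /(_ [::]) := (flat_steers oX aF aG pu st).1 fl; apply.
Qed.

End NonvanishingInput.

(** * The reduced system *)

Section Reduction.
Context {R : realType} {n m r d : nat}.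
Variables (U : set 'rV[R]_m) (S : system R n m r) (phi : 'I_d -> 'rV[R]_n -> R).
Hypotheses (fU : finite_set U) (nS : nash_system U S).
Let X := st_space S.
Hypotheses (Aphi : forall i, A_obs U S (phi i)) (ip : indep_on X phi).
Variables (Q : 'rV[R]_m -> 'I_d -> mpoly d.+1 R) (P : 'I_r -> mpoly d.+1 R) (xbar : 'rV[R]_n).
Variables (If : 'rV[R]_m -> 'I_d -> implicit_fun R d) (Ih : 'I_r -> implicit_fun R d).
Hypotheses (Xx : X xbar) (h2 : step2 U S phi Q P) (h4 : step4 U S phi Q P xbar If Ih).
Hypothesis cV : connected (step5 U If Ih).
Let SV := step6 U phi If Ih xbar.
Let V := step5 U If Ih.

Let oX : open X. Proof. by case: nS. Qed.
Let cX : connected X. Proof. by case: nS. Qed.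
Let sX : semialgebraic X. Proof. by case: nS. Qed.
Let aF a : U a -> analytic_field X (dyn S a). Proof. exact: (nash_system_fields nS).2. Qed.
Let nphi i : nash_fun X (phi i). Proof. exact: (A_obs_nash nS). Qed.
Let mphi i : locally_maj X (phi i). Proof. exact: ((nash_locally_maj oX _).1 (nphi i)).1. Qed.

(** Finiteness of U makes V a finite intersection; used for openness and for semi-algebraicity. *)
Lemma step5_closed (C : set 'rV[R]_d -> Prop) : C setT -> (forall A B, C A -> C B -> C (A `&` B)) ->
  (forall a i, U a -> C (imV (If a i))) -> (forall j, C (imV (Ih j))) -> C V.
Proof.
move=> CT CI hf hh; have /finite_seqP[s Us] := fU; apply: (CI); last exact: (bigcap_fin_closed CT CI).
rewrite Us; apply: (bigcap_seq_closed CT CI) => a as_; apply: (bigcap_fin_closed CT CI) => i.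
by apply: hf; rewrite Us.
Qed.

Let oV : open V.
Proof.
apply: step5_closed => [|A B|a i Ua|j]; [exact: openT|exact: openI|..].
  by have [_ [] //] := h4.1 a i Ua.
by have [_ [] //] := h4.2 j.
Qed.

Let sV : semialgebraic V.
Proof.
apply: step5_closed => [|A B|a i Ua|j]; [exact: semialgebraic_setT|exact: semialgebraic_setI|..].
  by have [_ [] //] := h4.1 a i Ua.
by have [_ [] //] := h4.2 j.
Qed.

Let Vx : V (Phi phi xbar).
Proof.
split=> [a Ua i _|j _]; first by have [_ _ _ []] := h4.1 a i Ua.
by have [_ _ _ []] := h4.2 j.
Qed.

Lemma reduced_nash_system : nash_system U SV.
Proof.
split=> //; split=> // [a Ua i|j].
  rewrite (_ : (fun y => _) = impsi (If a i)); last by apply/funext => y; rewrite mxE.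
  have [_ [oI _ _] [nI _] _ _] := h4.1 a i Ua.
  by apply: nash_fun_sub nI => // y [Vy _]; exact: Vy.
rewrite (_ : (fun y => _) = impsi (Ih j)); last by apply/funext => y; rewrite mxE.
have [_ [oI _ _] [nI _] _ _] := h4.2 j.
by apply: nash_fun_sub nI => // y [_ Vy]; exact: Vy.
Qed.

Let aFV a : U a -> analytic_field V (dyn SV a).
Proof. exact: (nash_system_fields reduced_nash_system).2. Qed.

Let cphi : {for xbar, continuous (Phi phi)}.
Proof.
by apply: differentiable_continuous; apply: (row_differentiable _).1 => i; exact: locally_maj_differentiable (mphi i) Xx.
Qed.

Lemma solves_relation_near g q I : locally_maj X g -> relation_on X g phi q -> solves_relation X g phi q xbar I ->
  nbhs xbar [set x | g x = impsi I (Phi phi x)].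
Proof.
move=> mg [_ rq] [[oW _ _] [oI _ _] _ [Wx Ix _] hI].
have cg : {for xbar, continuous g}.
  by apply: differentiable_continuous; exact: locally_maj_differentiable mg Xx.
have n1 : nbhs xbar [set x | imW I (g x)] by apply: cg; exact: open_nbhs_nbhs.
have n2 : nbhs xbar [set x | imV I (Phi phi x)] by apply: cphi; exact: open_nbhs_nbhs.
have n3 : nbhs xbar X by exact: open_nbhs_nbhs.
apply: filterS3 n1 n2 n3 => x Wgx Ipx Xx'.
by apply/(hI x Xx' Wgx Ipx); exact: rq.
Qed.

(** Near xbar the minimal relations hold and all values lie in the neighbourhoods of Step 4, so the
    equivalences there turn into equations for psi. [T0] is a duration too short for S to leave
    N. *)
Lemma local_conjugation : exists (N : set 'rV[R]_n) (T0 : R), [/\ open N, N xbar, N `<=` X, 0 < T0 &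
  [/\ forall x, N x -> V (Phi phi x),
      forall a x i, U a -> N x -> lie (dyn S a) (phi i) x = dyn SV a (Phi phi x) 0 i,
      forall x j, N x -> out S x 0 j = out SV (Phi phi x) 0 j &
      forall v q, pc_inputs U v -> duration v < T0 -> steers X (dyn S) v xbar q -> steers N (dyn S) v xbar q]].
Proof.
have /finite_seqP[s Us] := fU; have [_ _ _ [nf nh _]] := nS.
have n1 : nbhs xbar X by exact: open_nbhs_nbhs.
have n2 : nbhs xbar [set x | V (Phi phi x)] by apply: cphi; exact: open_nbhs_nbhs.
have n3 : nbhs xbar [set x | forall a, a \in s -> forall i, lie (dyn S a) (phi i) x = dyn SV a (Phi phi x) 0 i].
  apply: filter_forall_seq => a as_; have Ua : U a by rewrite Us.
  apply: filter_forall_fin => i; have [h21 _] := h2.1 a i Ua.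
  have H := solves_relation_near (locally_maj_lie oX (aF Ua) (mphi i)) h21 (h4.1 a i Ua).
  by apply: filterS H => x /= ->; rewrite mxE.
have n4 : nbhs xbar [set x | forall j, out S x 0 j = out SV (Phi phi x) 0 j].
  apply: filter_forall_fin => j; have [h22 _] := h2.2 j.
  have H := solves_relation_near (((nash_locally_maj oX _).1 (nh j)).1) h22 (h4.2 j).
  by apply: filterS H => x /= hx; rewrite mxE -hx.
(* The sum exceeds the speed at xbar under each letter by at least 1, so it bounds all speeds near
   xbar. *)
pose M := \sum_(a <- s) (`|dyn S a xbar| + 1).
have Ma a : a \in s -> `|dyn S a xbar| + 1 <= M.
  move=> as_; rewrite /M (big_rem a as_) /= lerDl; apply: sumr_ge0 => b _.
  by rewrite addr_ge0.
have M0 : 0 <= M by apply: sumr_ge0 => b _; rewrite addr_ge0.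
have n5 : nbhs xbar [set x | forall a, a \in s -> `|dyn S a x| <= M].
  apply: filter_forall_seq => a as_; have Ua : U a by rewrite Us.
  have := (row_differentiable (fun j => locally_maj_differentiable (aF Ua j) Xx)).1.
  rewrite (_ : (fun y => _) = dyn S a) => [|]; last by apply/funext => y; apply/rowP => j; rewrite mxE.
  move=> /differentiable_continuous/cvgrPdist_lt/(_ _ ltr01); apply: filterS => x h.
  apply: le_trans (Ma a as_); have := ler_normD (dyn S a x - dyn S a xbar) (dyn S a xbar).
  rewrite subrK distrC; rewrite /= in h; lra.
have : nbhs xbar [set x | [/\ X x, V (Phi phi x), forall a, a \in s -> forall i, lie (dyn S a) (phi i) x = dyn SV a (Phi phi x) 0 i,
    forall j, out S x 0 j = out SV (Phi phi x) 0 j & forall a, a \in s -> `|dyn S a x| <= M]].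
  by near=> x; split; near: x.
move=> /nbhs_ballP[rho /= r0 hb].
have M1 : 0 < M + 1 by rewrite ltr_wpDl.
(* At speed at most M an input shorter than this cannot leave the ball; the added 1 covers M = 0. *)
exists (ball xbar rho), (rho / (M + 1)); split; [exact: ball_open_rV|exact: ballxx|by move=> x /hb[]|by rewrite divr_gt0|].
have aU a : U a -> a \in s by rewrite {1}Us.
split=> [x /hb[] //|a x i /aU as_ /hb[_ _ h _ _]|x j /hb[_ _ _ h _]|v q pv dv sv]; [exact: h|exact: h|].
apply: (steers_sub (@subIsetr _ X _)); apply: (steers_stays M0 pv _ _ sv) => [a x /aU as_ /hb[_ _ _ _ h]|]; first exact: h.
rewrite subrr normr0 add0r; have dv0 := duration_ge0 pv.
move: dv; rewrite ltr_pdivlMr //; lra.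
Unshelve. all: by end_near.
Qed.

Lemma lies_out_match j w : letters_in U w ->
  lies [seq dyn S a | a <- w] (out_comp S j) xbar = lies [seq dyn SV a | a <- w] (out_comp SV j) (Phi phi xbar).
Proof.
move=> Uw; have [N [T0 [oN Nx NX _ [NV cj co _]]]] := local_conjugation.
have e : eq_on N (out_comp S j) (fun x => out_comp SV j (Phi phi x)) by move=> x Nx'; exact: co.
rewrite (lies_eq_on _ oN e Nx).
have mo : locally_maj V (out_comp SV j).
  by have [_ _ _ [_ nh _]] := reduced_nash_system; exact: (((nash_locally_maj oV _).1 (nh j)).1).
by apply: (lies_conj oN NV _ cj oV aFV mo Uw) => // x i Nx'; apply: locally_maj_differentiable (mphi i) _; exact: NX.
Qed.

Lemma reduced_out_near : \forall x \near xbar, out SV (Phi phi x) = out S x.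
Proof.
have [N [T0 [oN Nx NX _ [NV cj co _]]]] := local_conjugation.
apply: near_open oN Nx _ => x Nx'; apply/rowP => j; by rewrite co.
Qed.

Section ShiftedInput.
Variable u : input R m.
Hypotheses (su : system_inputs U S u) (xE : xbar = final_state S u).

(** The short v for which S follows uv form an admissible set, and images under Phi provide their
    trajectories; being the largest such set, [system_inputs] of the reduced system contains
    them. *)
Lemma reduced_small_inputs : exists2 T0 : R, 0 < T0 & forall v, pc_inputs U v -> duration v < T0 ->
  system_inputs U S (u ++ v) -> system_inputs U SV v /\ final_state SV v = Phi phi (final_state S (u ++ v)).
Proof.
have [N [T0 [oN Nx NX T00 [NV cj co hs]]]] := local_conjugation.
have aS := system_inputs_admissible su; have [_ pc sm [rs ex en]] := aS; have pu := pc _ su.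
pose A := [set v : input R m | [/\ pc_inputs U v, duration v < T0 & system_inputs U S (u ++ v)]].
have hA v : A v -> steers V (dyn SV) v (Phi phi xbar) (Phi phi (final_state S (u ++ v))).
  move=> [pv dv sv]; have := system_inputs_restart nS sv; rewrite -xE => /(hs _ _ pv dv).
  apply: (steers_conj NV _ cj pv) => x i Nx'.
  by apply: locally_maj_differentiable (mphi i) _; exact: NX.
exists T0 => // v pv dv sv; have Av : A v by [].
split; last by have [oV' aFV'] := nash_system_fields reduced_nash_system; exact: (final_stateP oV' aFV' pv (hA v Av)).
suff aA : admissible U A.
  apply: (system_inputs_sub reduced_nash_system aA _ Av) => w Aw.
  by exists (Phi phi (final_state S (u ++ w))); exact: hA.
split.
- by exists [::]; split=> //; rewrite ?duration_nil ?cats0.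
- by move=> w [].
- move=> w w' [pw dw sw] pw' ww; split=> //; first by rewrite -(same_input_duration pw pw' ww).
  by apply: sm sw _ (same_input_cat pu ww); exact/pc_inputs_cat.
split.
- move=> w t [pw dw sw] tw; have /andP[t0 t1] := tw; split.
  + exact: pc_inputs_restrict.
  + by rewrite (duration_restrict pw) //; exact: le_lt_trans dw.
  + exact: (admissible_restrict_cat aS sw tw).
- move=> w a [pw dw sw] Ua; have [t1 t10 h1] := ex _ a sw Ua.
  have e0 : 0 < (T0 - duration w) / 2 by rewrite divr_gt0 // subr_gt0.
  exists (Num.min t1 ((T0 - duration w) / 2)); first by rewrite lt_min t10.
  have t0 : 0 <= Num.min t1 ((T0 - duration w) / 2) by rewrite le_min !ltW.
  split.
  + by rewrite -cats1; apply/pc_inputs_cat; split=> //; apply/pc_inputs_cons.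
  + rewrite -cats1 duration_cat duration_cons duration_nil addr0.
    have : Num.min t1 ((T0 - duration w) / 2) <= (T0 - duration w) / 2 by rewrite ge_min lexx orbT.
    lra.
  + rewrite -rcons_cat; apply: (admissible_rcons_shrink aS h1).
    by rewrite t0 ge_min lexx.
move=> k al t [pw dw sw]; have [d1 d10 h1] := admissible_enlarge aS sw.
have k0 : 0 < k.+1%:R :> R by rewrite ltr0n.
have e0 : 0 < T0 - duration (word al t) by rewrite subr_gt0.
exists (Num.min d1 ((T0 - duration (word al t)) / k.+1%:R)); first by rewrite lt_min d10 divr_gt0.
move=> t' ht; split.
- apply/pc_inputs_word => i; have /pc_inputs_word/(_ i)[Ui _] := pw; by have /andP[] := ht i.
- rewrite duration_word; apply: le_lt_trans (_ : \sum_i (t 0 i + (T0 - duration (word al t)) / k.+1%:R) < _).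
    by apply: ler_sum => i _; have /andP[_ /le_trans] := ht i; apply; rewrite lerD2l ge_min lexx orbT.
  rewrite big_split /= -(duration_word al) sumr_const card_ord -[_ *+ _]mulr_natl -ltrBrDl.
  rewrite mulrCA -[ltRHS]mulr1 ltr_pM2l // ltr_pdivrMr // mul1r ltr_nat //.
by apply: h1 => i; have /andP[-> /le_trans] := ht i; apply; rewrite lerD2l ge_min lexx.
Qed.

(** S need not follow uv, so the equality is first obtained for small durations of the letters of v
    and then continued over a box up to the actual durations. *)
Lemma reduced_realization (Ut : set (input R m)) (p : input R m -> 'rV[R]_r) : response_map U Ut p ->
  (forall v, Ut v -> system_inputs U S v -> p v = out S (final_state S v)) -> Ut u ->
  local_nash_realization U (shifted_inputs Ut u) (shifted_map p u) SV.
Proof.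
move=> rp hp Utu; have rp' := response_map_shifted rp Utu.
split=> //; first exact: reduced_nash_system.
move=> v; have [al0 [t0 <-]] := wordE v; move: (size v) al0 t0 => k al t Utv sv.
(* Response maps are analytic in k durations only for k > 0; for the empty word the claim is the
   agreement of the outputs at xbar. *)
apply/rowP => j; have [k0|k0] := posnP k.
  have w0 : word al t = [::] by apply/size0nil; rewrite size_word.
  rewrite w0 /shifted_map cats0 hp // -xE.
  have <- := nbhs_singleton reduced_out_near.
  rewrite (_ : final_state SV [::] = Phi phi xbar) //.
  have [oV' aFV'] := nash_system_fields reduced_nash_system; exact: (final_stateP oV' aFV' (pc_inputs_nil U)).
have aSV := system_inputs_admissible sv.
have [aUt' _ aP] := rp'; have [_ pcU _ _] := aUt'.
have pw := pcU _ Utv; have Ual i : U (al i) by have /pc_inputs_word/(_ i)[] := pw.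
have tpos i : 0 <= t 0 i by have /pc_inputs_word/(_ i)[] := pw.
have [_ _ _ [_ _ en1]] := aSV; have [_ _ _ [_ _ en2]] := aUt'.
have [d1 d10 hd1] := en1 k al t sv; have [d2 d20 hd2] := en2 k al t Utv.
(* The enlargement gives the box positive sides even where a duration of v is 0. *)
pose dd := Num.min d1 d2; have dd0 : 0 < dd by rewrite lt_min d10.
pose T : 'rV[R]_k := \row_i (t 0 i + dd).
have T0 i : 0 < T 0 i by rewrite mxE ltr_wpDl.
have bT1 s : box T s -> system_inputs U SV (word al s).
  move=> bs; apply: hd1 => i; have := bs i; rewrite mxE => /andP[-> /le_trans]; apply.
  by rewrite lerD2l ge_min lexx.
have bT2 s : box T s -> shifted_inputs Ut u (word al s).
  move=> bs; apply: hd2 => i; have := bs i; rewrite mxE => /andP[-> /le_trans]; apply.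
  by rewrite lerD2l ge_min lexx orbT.
have aS := system_inputs_admissible su.
(* On this box S follows u and then the letters of v, so there the shifted response is an output of
   S; the bound 1 on the duration is arbitrary. *)
have [s1 s10 hs1] := admissible_small_box aS su Ual ltr01.
pose s : 'rV[R]_k := \row_i Num.min (s1 0 i) (T 0 i).
have bt : box T t by move=> i; rewrite mxE tpos lerDl ltW.
have [_ _ _ [_ nh _]] := nS; have [_ _ _ [_ nhV _]] := reduced_nash_system.
apply: (@analytic_response_extends R n d m k U al Ual X (dyn S) (out_comp S j) xbar V (dyn SV) (out_comp SV j) (Phi phi xbar)
  _ (fun s => shifted_map p u (word al s) 0 j) T s (fun s => final_state S (u ++ word al s)) (fun s => final_state SV (word al s))
  oX aF (((nash_locally_maj oX _).1 (nh j)).1) Xx oV aFV (((nash_locally_maj oV _).1 (nhV j)).1) Vx (aP k al j k0 Ual) bT2 T0) bt => [i|s' bs|s' bs|w Uw].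
- by rewrite mxE lt_min s10 T0 ge_min lexx orbT.
- by have [] := system_inputs_steers reduced_nash_system (bT1 _ bs).
- have [sw _] := hs1 _ (box_minl bs); have [_ Uw] := bT2 _ (box_minr bs); split.
    by have := system_inputs_restart nS sw; rewrite -xE.
  by rewrite /shifted_map hp.
exact: lies_out_match.
Qed.

Lemma reduced_reachable : sa_reachable U S -> sa_reachable U SV.
Proof.
move=> rS g ng hg; apply: contrapT => gn0.
have nA := nash_fun_subalgebra oV sV.
have V0 : V !=set0 by exists (Phi phi xbar).
have [K [iota hK]] := subalgebra_fraction_field oV cV V0 nA.
pose co (i : 'I_d) (y : 'rV[R]_d) := y 0 i.
have [B0 /minimal_relation_exists[B [[Bn0 rB] mB]]] : exists B, relation_on V g co B.
  apply: dependent_relation => ig; apply: (fractions_dependent oV cV V0 nA hK (z := fun j => iota (fcons g co j))).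
  apply/(alg_indep_on nA hK) => // j.
  by case: (unliftP ord0 j) => [l ->|->]; rewrite ?fconsS ?fcons0 //; exact: nash_coord.
have [B00 hB0] := comp_fcons0 B.
pose H x := meval (fun i => phi i x) B00.
have nH : nash_fun X H.
  by apply: meval_closed => //; [exact: nash_cst|exact: nashD|exact: nashM].
have mH := ((nash_locally_maj oX H).1 nH).1.
have [T0 T00 hT0] := reduced_small_inputs; have aS := system_inputs_admissible su.
have Bg y : V y -> g y = 0 -> meval (fcons 0 (y 0)) B = 0.
  by move=> Vy gy; have := rB y Vy; rewrite /eval_rel gy.
have fl : flat U (dyn S) H xbar.
  apply: (small_vanish_flat oX aF mH Xx) => k al Ual.
  have [T TT hT] := admissible_small_box aS su Ual T00.
  exists T => // t bt; have [sw dw] := hT t bt.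
  have [_ pc _ _] := aS; have /pc_inputs_cat[_ pw] := pc _ sw.
  exists (final_state S (u ++ word al t)); first by have := system_inputs_restart nS sw; rewrite -xE.
  have [sVw fE] := hT0 _ pw dw sw.
  have Vq : V (Phi phi (final_state S (u ++ word al t))).
    rewrite -fE; have [_] := system_inputs_steers reduced_nash_system sVw; exact: steers_end.
  have g0 : g (Phi phi (final_state S (u ++ word al t))) = 0 by apply: hg; exists (word al t).
  rewrite /H hB0; apply: etrans (Bg _ Vq g0); apply: meval_eq => j.
  by case: (unliftP ord0 j) => [l ->|->]; rewrite ?fconsS ?fcons0 ?mxE.
have H0 : eq_on X H (fun=> 0).
  apply: rS => // x [v sv <-].
  have [pu st] := system_inputs_steers nS su; rewrite -xE in st.
  have [pv stv] := system_inputs_steers nS sv.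
  have fl0 := (flat_steers oX aF mH pu st).2 fl.
  by have /(_ [::]) := (flat_steers oX aF mH pv stv).1 fl0; apply.
have B000 : B00 = 0 by apply: ip => x Xx'; exact: H0.
have [B' BE] := mpoly_factor0 (fun v => etrans (esym (hB0 v)) (etrans (congr1 (meval v) B000) (meval0 v))).
have B'0 : B' != 0 by apply: contraNneq Bn0 => B'0; rewrite BE B'0 mulr0.
have mg := ((nash_locally_maj oV g).1 ng).1.
have nB' : nash_fun V (eval_rel B' g co).
  rewrite (_ : eval_rel B' g co = fun y => meval (fun j => fcons g co j y) B'); last first.
    by apply/funext => y; rewrite fcons_app.
  apply: meval_closed; [exact: nash_cst|exact: nashD|exact: nashM|move=> j].
  by case: (unliftP ord0 j) => [l ->|->]; rewrite ?fconsS ?fcons0 //; exact: nash_coord.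
(* V is connected, so one factor vanishes identically; it cannot be the second, a relation of
   smaller degree than B. *)
have E : eq_on V (fun y => g y * eval_rel B' g co y) (fun=> 0).
  by move=> y Vy; rewrite -(rB y Vy) BE /eval_rel mevalM mevalXU fcons0.
have [//|h] := analytic_domain oV cV mg ((nash_locally_maj oV _).1 nB').1 E.
have := mB B' (conj B'0 h); rewrite BE msizeM //; last by rewrite -msize_poly_eq0 msizeX.
by rewrite msizeX mdeg1 add2n /= ltnn.
Qed.

End ShiftedInput.

(** The Nash functions that equal, on the conjugation neighbourhood, an observable of the reduced
    system composed with Phi form an algebra closed under Lie derivatives and containing the
    outputs; minimality of [A_obs] concludes. *)
Lemma observable_near g : A_obs U S g -> exists2 k, A_obs U SV k & \forall x \near xbar, g x = k (Phi phi x).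
Proof.
move=> Ag; have [N [T0 [oN Nx NX _ [NV cj co _]]]] := local_conjugation.
have [[hA1 hA2 hA3 hA4 hA5] hA6] := A_obs_closed reduced_nash_system.
pose B := [set g | nash_fun X g /\ exists2 k, A_obs U SV k & eq_on N g (fun x => k (Phi phi x))].
suff [_ [k Ak e]] : B g by exists k => //; apply: near_open oN Nx _.
apply: Ag; split; last first.
  move=> _ [j ->]; have [_ _ _ [_ nh _]] := nS; split; first exact: nh.
  by exists (out_comp SV j); [exact: A_obs_out|move=> x; exact: co].
split; last first.
  move=> a g' Ua [ng [k Ak e]]; have [_ _ _ [nf _ _]] := nS; split; first by apply: nash_lie => //; exact: nf.
  exists (lie (dyn SV a) k); first exact: hA6.
  have mk : locally_maj V k by exact: ((nash_locally_maj oV k).1 (hA1 _ Ak)).1.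
  have Ua' : letters_in U [:: a] by move=> b; rewrite inE => /eqP ->.
  move=> x Nx'; rewrite (lie_eq_on _ oN e Nx').
  by apply: (lies_conj oN NV _ cj oV aFV mk Ua') => // y i Ny; apply: locally_maj_differentiable (mphi i) _; exact: NX.
split.
- by move=> g' [].
- move=> g1 g2 [n1 [k Ak e1]] e; split; first exact: nash_eq_on e.
  by exists k => // x Nx'; rewrite -e1 // e //; exact: NX.
- by move=> c; split; [exact: nash_cst|exists (fun=> c)].
- move=> g1 g2 [n1 [k1 Ak1 e1]] [n2 [k2 Ak2 e2]]; split; first exact: nashD.
  by exists (fun y => k1 y + k2 y); [exact: hA4|move=> x Nx'; rewrite e1 // e2].
- move=> g1 g2 [n1 [k1 Ak1 e1]] [n2 [k2 Ak2 e2]]; split; first exact: nashM.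
  by exists (fun y => k1 y * k2 y); [exact: hA5|move=> x Nx'; rewrite e1 // e2].
Qed.

Lemma reduced_observable : sa_observable U SV.
Proof.
have V0 : V !=set0 by exists (Phi phi xbar).
have [k hk] := choice (fun i => let: ex_intro2 k h1 h2 := observable_near (Aphi i) in ex_intro _ k (conj h1 h2)).
exists d; split.
  apply: (@indep_has_trdeg _ _ V _ oV cV V0 (A_obs_closed reduced_nash_system).1 k) => [i|p hp]; first by have [] := hk i.
  have nV : nbhs xbar [set x | V (Phi phi x)] by apply: cphi; exact: open_nbhs_nbhs.
  have n1 : nbhs xbar [set x | forall i, phi i x = k i (Phi phi x)].
    by apply: filter_forall_fin => i; have [] := hk i.
  (* A relation among the k i on V is one among the phi i near xbar, hence on all of the connected
     set X. *)
  have mp : locally_maj X (fun x => meval (fun i => phi i x) p) by exact: locally_maj_meval.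
  apply: ip; apply: (identity_theorem oX cX mp Xx).
  apply: filterS2 nV n1 => x Vx' e; rewrite -(hp _ Vx'); apply: meval_eq => i; exact: e.
apply: (@indep_has_trdeg _ _ V _ oV cV V0 (nash_fun_subalgebra oV sV) (fun i y => y 0 i)) => [i|]; first exact: nash_coord.
exact: indep_coord.
Qed.

End Reduction.

(** * The steps of the procedure *)

Section ProcedureSteps.
Context {R : realType} {n m r d : nat}.
Variables (U : set 'rV[R]_m) (S : system R n m r) (phi : 'I_d -> 'rV[R]_n -> R).
Hypotheses (fU : finite_set U) (nS : nash_system U S).
Let X := st_space S.
Hypotheses (Aphi : forall i, A_obs U S (phi i)) (ip : indep_on X phi).

Let oX : open X. Proof. by case: nS. Qed.
Let cX : connected X. Proof. by case: nS. Qed.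
Let X0 : X !=set0. Proof. by have [_ _ _ [_ _ ?]] := nS; exists (init S). Qed.

Lemma step2_exists : (forall g, A_obs U S g -> exists Q, relation_on X g phi Q) ->
  exists Q P, step2 U S phi Q P.
Proof.
move=> rel.
have hQ (z : 'rV[R]_m * 'I_d) : exists Q, U z.1 -> minimal_relation X (lie (dyn S z.1) (phi z.2)) phi Q.
  have [Uz|nUz] := pselect (U z.1); last by exists 0.
  have [Q0 /minimal_relation_exists[Q hQ]] := rel _ (A_obs_lie nS Uz (Aphi z.2)).
  by exists Q.
have hP j : exists P, minimal_relation X (out_comp S j) phi P.
  by have [P0 /minimal_relation_exists[P hP]] := rel _ (@A_obs_out _ _ _ _ U S j); exists P.
have [Q {}hQ] := choice hQ; have [P {}hP] := choice hP.
by exists (fun a i => Q (a, i)), P; split=> // a i; exact: (hQ (a, i)).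
Qed.

Variables (Q : 'rV[R]_m -> 'I_d -> mpoly d.+1 R) (P : 'I_r -> mpoly d.+1 R).
Hypothesis h2 : step2 U S phi Q P.

Lemma eval_rel_observable B g : A_obs U S g -> A_obs U S (eval_rel B g phi).
Proof.
move=> Ag; have [[_ _ hc hD hM] _] := A_obs_closed nS.
rewrite (_ : eval_rel B g phi = fun x => meval (fun j => fcons g phi j x) B); last first.
  by apply/funext => x; rewrite fcons_app.
by apply: meval_closed => // j; case: (unliftP ord0 j) => [l ->|->]; rewrite ?fconsS ?fcons0.
Qed.

Lemma observable_neq0_near g x : A_obs U S g -> X x -> g x != 0 -> \forall y \near x, g y != 0.
Proof.
move=> Ag Xx; have mg := ((nash_locally_maj oX g).1 (A_obs_nash nS Ag)).1.
have cg : {for x, continuous g}.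
  by apply: differentiable_continuous; exact: locally_maj_differentiable mg Xx.
exact: cvgr_neq0 cg.
Qed.

(** The finitely many functions that must not vanish are each nonzero by minimality; their product
    is a nonzero observable, and one short input at which it is nonzero serves all of them. *)
Lemma step3_exists (Ut : set (input R m)) (eps : R) : admissible U Ut -> sa_reachable U S -> 0 < eps ->
  exists u, step3 U Ut S phi eps Q P u.
Proof.
move=> aUt rS e0; have /finite_seqP[s Us] := fU.
pose b (z : ('rV[R]_m * 'I_d) + 'I_r) : 'rV[R]_n -> R := match z with
  | inl (a, i) => eval_rel (mderiv ord0 (Q a i)) (lie (dyn S a) (phi i)) phi
  | inr j => eval_rel (mderiv ord0 (P j)) (out_comp S j) phi
  end.
pose l : seq (('rV[R]_m * 'I_d) + 'I_r) := [seq inl (a, i) | a <- s, i <- enum 'I_d] ++ [seq inr j | j <- enum 'I_r].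
have lP z : z \in l -> if z is inl (a, i) then U a else True.
  rewrite mem_cat => /orP[/allpairsP[[a i] [/= as_ _ ->]]|/mapP[j _ ->]] //.
  by rewrite Us.
have Ab z : z \in l -> A_obs U S (b z).
  case: z => [[a i] /lP Ua|j _]; apply: eval_rel_observable; first exact: A_obs_lie.
  exact: A_obs_out.
have [|AG [x0 Xx0 G0]] := prod_nonzero oX cX X0 (A_obs_closed nS).1 Ab.
  case=> [[a i] /lP Ua|j _]; first exact: (minimal_relation_simple ip (h2.1 a i Ua)).
  exact: (minimal_relation_simple ip (h2.2 j)).
have [|u [su Utu du]] := small_input_nonvanishing nS aUt rS (A_obs_nash nS AG) _ e0.
  by move=> /(_ _ Xx0)/eqP; apply/negP.
rewrite prodf_seq_neq0 => /allP h.
have Xu : X (final_state S u) by have [_ /steers_end] := system_inputs_steers nS su.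
have near_b z : z \in l -> \forall x \near final_state S u, b z x != 0.
  by move=> zl; apply: observable_neq0_near => //; [exact: Ab|exact: (implyP (h z zl))].
exists u; split=> // [a i Ua|j].
  apply: (near_b (inl (a, i))); rewrite mem_cat; apply/orP; left.
  by apply/allpairsP; exists (a, i); split=> //=; [rewrite Us in Ua|rewrite mem_enum].
by apply: (near_b (inr j)); rewrite mem_cat; apply/orP; right; apply/mapP; exists j => //; rewrite mem_enum.
Qed.

(** The implicit function theorem provides balls around Phi(xbar), whose intersection is convex.
    Letters outside U receive an empty default. *)
Lemma step4_exists (Ut : set (input R m)) (eps : R) u : step3 U Ut S phi eps Q P u ->
  exists If Ih, step4 U S phi Q P (final_state S u) If Ih /\ connected (step5 U If Ih).
Proof.
move=> [su _ _ nQ nP]; have [_ /steers_end Xu] := system_inputs_steers nS su.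
have hf (z : 'rV[R]_m * 'I_d) : exists I : implicit_fun R d, U z.1 ->
    solves_relation X (lie (dyn S z.1) (phi z.2)) phi (Q z.1 z.2) (final_state S u) I /\ convex_set (imV I).
  have [Uz|nUz] := pselect (U z.1); last by exists (ImplicitFun set0 set0 (fun=> 0)).
  have [I hI] := solves_relation_exists Xu (h2.1 _ z.2 Uz).1 (nbhs_singleton (nQ _ z.2 Uz)).
  by exists I.
have hh j := solves_relation_exists Xu (h2.2 j).1 (nbhs_singleton (nP j)).
have [If {}hf] := choice hf; have [Ih {}hh] := choice hh.
exists (fun a i => If (a, i)), Ih; split.
  by split=> [a i Ua|j]; [have [] := hf (a, i) Ua|have [] := hh j].
apply: convex_connected => x y t [x1 x2] [y1 y2] t01; split=> [a Ua i _|j _].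
  by have [_] := hf (a, i) Ua; apply=> //; [exact: x1|exact: y1].
by have [_] := hh j; apply=> //; [exact: x2|exact: y2].
Qed.

End ProcedureSteps.

(** Correctness of a procedure with choices: at each step a choice exists, and the conclusion holds
    for every choice. A Nash system needs a connected state space, and intersections of connected
    sets may be disconnected, so connectedness of V is part of the choice in Step 4. *)
Theorem theoremV2 (R : realType) (n m r : nat) (U : set 'rV[R]_m)
    (Ut : set (input R m)) (p : input R m -> 'rV[R]_r) (S : system R n m r)
    (eps : R) :
  finite_set U ->
  response_map U Ut p ->
  has_negative_extension U Ut p ->
  local_nash_realization U Ut p S ->
  sa_reachable U S ->
  0 < eps ->
  (exists (d : nat) (phi : 'I_d -> 'rV[R]_n -> R), step1 U S phi) /\
  forall (d : nat) (phi : 'I_d -> 'rV[R]_n -> R), step1 U S phi ->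
  (exists (Q : 'rV[R]_m -> 'I_d -> mpoly d.+1 R) (P : 'I_r -> mpoly d.+1 R),
     step2 U S phi Q P) /\
  forall (Q : 'rV[R]_m -> 'I_d -> mpoly d.+1 R) (P : 'I_r -> mpoly d.+1 R),
    step2 U S phi Q P ->
  (exists u : input R m, step3 U Ut S phi eps Q P u) /\
  forall u : input R m, step3 U Ut S phi eps Q P u ->
  (exists (If : 'rV[R]_m -> 'I_d -> implicit_fun R d)
          (Ih : 'I_r -> implicit_fun R d),
     step4 U S phi Q P (final_state S u) If Ih /\
     connected (step5 U If Ih)) /\
  forall (If : 'rV[R]_m -> 'I_d -> implicit_fun R d)
         (Ih : 'I_r -> implicit_fun R d),
    step4 U S phi Q P (final_state S u) If Ih ->
    connected (step5 U If Ih) ->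
    let SV := step6 U phi If Ih (final_state S u) in
    [/\ local_nash_realization U (shifted_inputs Ut u) (shifted_map p u) SV,
        sa_reachable U SV,
        sa_observable U SV &
        \forall x \near final_state S u, out SV (Phi phi x) = out S x].
Proof.
move=> fU rp _ [_ nS real] rS e0; have [oX cX sX [_ _ Xi]] := nS.
have X0 : st_space S !=set0 by exists (init S).
have hA := (A_obs_closed nS).1.
split; first exact: trans_basis_exists.
move=> d phi /(trans_basisP hA)[Aphi ip rel]; split; first exact: step2_exists.
move=> Q P h2; split; first by have [aUt _ _] := rp; exact: step3_exists.
move=> u h3; split; first exact: step4_exists h3.
move=> If Ih h4 cV SV; have [su Utu _ _ _] := h3.
have [_ /steers_end Xu] := system_inputs_steers nS su.
split.
- exact: (reduced_realization fU nS Aphi Xu h2 h4 cV su erefl rp real Utu).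
- exact: (reduced_reachable fU nS Aphi ip Xu h2 h4 cV su erefl rS).
- exact: (reduced_observable fU nS Aphi ip Xu h2 h4 cV).
- exact: (reduced_out_near fU nS Aphi Xu h2 h4).
Qed.
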